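(* Let $(W,S)$ be a finite Coxeter system and $\mathcal K\subseteq 2^S$ a simplicial complex. For every $D\subseteq S$, let $w_D$ be the longest element of $W_D$. Then, for every $j$, $\widetilde H_j(\mathcal K_D;\mathbb Z)$ occurs as a direct summand of $$H_{2\ell(w_D)+j+1}(\mathcal B_{\mathcal K}(W);\mathbb Z).$$ Consequently $H_*(\mathcal B_{\mathcal K}(W);\mathbb Z)$ is torsion free if and only if every induced subcomplex $\mathcal K_D$ ($D\subseteq S$) has torsion-free reduced integral homology. If, in addition, $(W,S)$ is the Weyl system of a compact, connected, simply connected semisimple Lie group $G$ and $\mathcal K$ has vertex set exactly $S$, then $X_{\mathcal K}(G)$ is contractible if and only if $\mathcal K=2^S$.
   Context: $\ell$ is the Coxeter length; $W_D$ is the subgroup generated by $D$; $W^I=\{w\in W:\ell(ws)>\ell(w)\ \forall s\in I\}$. A simplicial complex $\mathcal K\subseteq2^S$ contains $\varnothing$ and is closed under subsets (elements of $S$ need not be vertices; it has vertex set exactly $S$ if $\{s\}\in\mathcal K$ for all $s\in S$). $\mathcal K_D=\{I\in\mathcal K:I\subseteq D\}$. Reduced homology is augmented: $\widetilde H_{-1}(\{\varnothing\};\mathbb Z)=\mathbb Z$. Parabolic bar complex $\mathcal B_{\mathcal K}(W)$: the free $\mathbb Z$-complex with basis $[w;I_0<\cdots<I_q]$, where $I_0<\cdots<I_q$ is a strict chain of faces of $\mathcal K$ (the empty face allowed) and $w\in W^{I_0}$, in degree $2\ell(w)+q$, with differential $$\partial[w;I_0<\cdots<I_q]=\epsilon\,[w;I_1<\cdots<I_q]+\sum_{j=1}^q(-1)^j[w;I_0<\cdots<\widehat{I_j}<\cdots<I_q],$$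 where $\epsilon=1$ if $w\in W^{I_1}$ and $\epsilon=0$ otherwise (and $\partial[w;I_0]=0$). In the Lie case, with maximal torus $T$ and simple reflections $S$, $G_I$ ($I\subseteq S$) is the connected maximal-rank subgroup generated by $T$ and the rank-one root subgroups indexed by $I$ (so $G_I=G\cap P_I$ for the standard parabolic $P_I$ of the complexification), and $X_{\mathcal K}(G)=\operatorname{hocolim}_{I\in\mathcal K}G/G_I$ is the Bousfield--Kan homotopy colimit of the projections $G/G_I\to G/G_J$ ($I\subseteq J$) over the face poset of $\mathcal K$ (including $\varnothing$). *)

(* Defs.v *)
From HB Require Import structures.
From Stdlib Require Import Relation_Operators.
From mathcomp Require Import all_boot all_order all_fingroup all_algebra.
From mathcomp Require Import ring_quotient.
From mathcomp Require Import all_classical all_reals all_analysis.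
From mathcomp Require Import complex.

Set Implicit Arguments.
Unset Strict Implicit.
Unset Printing Implicit Defensive.

Import Order.TTheory GRing.Theory Num.Theory.
Import numFieldNormedType.Exports.

Section BasedComplex.
Local Open Scope ring_scope.

(** A bounded complex of finitely generated free abelian groups with a
    homogeneous basis; [bd b c] is the coefficient of [c] in the boundary
    of [b]. *)
Record based_complex := BasedComplex {
  bgen : finType;
  deg : bgen -> int;
  bd : bgen -> bgen -> int }.

Variable C : based_complex.
Local Notation chain := {ffun bgen C -> int}.

Definition homogeneous (n : int) (x : chain) : bool :=
  [forall b, (x b != 0) ==> (deg b == n)].

Definition boundary (x : chain) : chain :=
  [ffun c => \sum_(b : bgen C) x b * bd b c].

Definition is_cycle (n : int) : {pred chain} :=
  fun x => homogeneous n x && (boundary x == 0).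

Lemma boundaryB x y : boundary (x - y) = boundary x - boundary y.
Proof.
apply/ffunP => c; rewrite !ffunE -sumrB.
by apply: eq_bigr => b _; rewrite !ffunE mulrBl.
Qed.

Lemma boundary0 : boundary 0 = 0.
Proof. by rewrite -{1}(subrr 0) boundaryB subrr. Qed.

Lemma homogeneous0 n : homogeneous n 0.
Proof. by apply/forallP => b; rewrite ffunE eqxx. Qed.

Lemma homogeneousB n x y :
  homogeneous n x -> homogeneous n y -> homogeneous n (x - y).
Proof.
move=> /forallP hx /forallP hy; apply/forallP => b; apply/implyP.
rewrite !ffunE; apply: contraNT => nb.
have := hx b; have := hy b; rewrite (negbTE nb) !implybF !negbK.
by move=> /eqP-> /eqP->; rewrite subr0.
Qed.

Fact is_cycle_zmod_closed n : zmod_closed (is_cycle n).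
Proof.
split; first by rewrite unfold_in /is_cycle homogeneous0 boundary0 eqxx.
move=> x y /andP[hx /eqP dx] /andP[hy /eqP dy].
by rewrite unfold_in /is_cycle homogeneousB// boundaryB dx dy subrr eqxx.
Qed.
HB.instance Definition _ n :=
  GRing.isZmodClosed.Build chain (is_cycle n) (is_cycle_zmod_closed n).

Record cycles (n : int) :=
  Cycle { cycle_val : chain; cycleP : cycle_val \in is_cycle n }.
HB.instance Definition _ n := [isSub for @cycle_val n].
HB.instance Definition _ n := [Choice of cycles n by <:].
HB.instance Definition _ n := [SubChoice_isSubZmodule of cycles n by <:].

Definition is_boundary (n : int) : {pred cycles n} := fun z =>
  `[< exists2 x : chain, homogeneous (n + 1) x & val z = boundary x >].

Fact is_boundary_zmod_closed n : zmod_closed (@is_boundary n).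
Proof.
split; first by apply/asboolP; exists 0; rewrite ?homogeneous0 ?boundary0.
move=> x y /asboolP[x' hx ex] /asboolP[y' hy ey]; apply/asboolP.
by exists (x' - y'); rewrite ?homogeneousB// boundaryB -ex -ey.
Qed.
HB.instance Definition _ n :=
  GRing.isZmodClosed.Build (cycles n) (@is_boundary n)
    (is_boundary_zmod_closed n).

Definition homology (n : int) : zmodType :=
  Quotient.quot (@is_boundary n : zmodClosed (cycles n)).

End BasedComplex.

Definition direct_summand (A B : zmodType) : Prop :=
  exists (C : zmodType) (f : {additive (A * C)%type -> B}), bijective f.

Definition torsion_free (A : zmodType) : Prop :=
  forall (x : A) (n : nat), (0 < n)%N -> (x *+ n = 0)%R -> x = 0%R.

Section SimplicialComplex.
Local Open Scope ring_scope.
Variable T : finType.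

Definition simplicial_complex (S : {set T}) (K : {set {set T}}) : Prop :=
  [/\ finset.set0 \in K, K \subset finset.powerset S &
      forall I J : {set T}, I \in K -> J \subset I -> J \in K].

Definition induced_subcomplex (K : {set {set T}}) (D : {set T}) :
    {set {set T}} :=
  [set I in K | I \subset D].

(** Position of the vertex [v] in the face [I], for the enumeration order of
    the ambient type. *)
Definition vertex_pos (I : {set T}) (v : T) : nat :=
  #|[set u in I | (enum_rank u < enum_rank v)%N]|.

(** The augmented ordered simplicial chain complex: the empty face spans
    degree [-1]. *)
Definition augmented_complex (K : {set {set T}}) : based_complex :=
  @BasedComplex {I : {set T} | I \in K}
    (fun I => #|val I|%:Z - 1)
    (fun I J => \sum_(v in val I | val J == val I :\ v)
                  (-1) ^+ vertex_pos (val I) v).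

Definition reduced_homology (K : {set {set T}}) (j : int) : zmodType :=
  homology (augmented_complex K) j.

End SimplicialComplex.

Section Coxeter.
Local Open Scope group_scope.
Variables (W : finGroupType) (S : {set W}).

(** [S] is a generating set of involutions, and the relations
    [(s t)^m(s,t) = 1], with [m(s,t)] the order of [s t], present [W]. *)
Definition coxeter_system : Prop :=
  [/\ <<S>> = [set: W],
      {in S, forall s, #[s] = 2} &
      forall (H : groupType) (f : W -> H),
        {in S &, forall s t, (f s * f t) ^+ #[s * t] = 1} ->
        exists2 g : W -> H, {morph g : x y / x * y} & {in S, g =1 f}].

(** The least [n] such that [w] is a product of [n] elements of [S]; since [S]
    generates the finite group [W], such an [n] exists below [#|W|]. *)
Definition len (w : W) : nat :=
  find (fun n => w \in S ^+ n) (iota 0 #|W|).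

Definition longest_in (D : {set W}) (w : W) : Prop :=
  w \in <<D>> /\ {in <<D>>, forall v, (len v <= len w)%N}.

Definition min_reps (I : {set W}) : {set W} :=
  [set w | [forall s in I, (len w < len (w * s))%N]].

(** A nonempty strict chain [I_0 < ... < I_q] of faces is the set
    [{I_0, ..., I_q}], which has [q + 1] elements; [I_0] is the intersection
    of its members. *)
Definition is_face_chain (K c : {set {set W}}) : bool :=
  [&& c != finset.set0, c \subset K &
      [forall I in c, forall J in c, (I \subset J) || (J \subset I)]].

Definition chain_bot (c : {set {set W}}) : {set W} :=
  (\bigcap_(I in c) I)%SET.

(** Index [j] of [I = I_j] in the chain [c]. *)
Definition chain_pos (c : {set {set W}}) (I : {set W}) : nat :=
  #|[set J in c | J \proper I]|.

Definition bar_gen (K : {set {set W}}) : pred (W * {set {set W}}) :=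
  fun x => is_face_chain K x.2 && (x.1 \in min_reps (chain_bot x.2)).

(** The coefficient of [y = [v; d]] in the boundary of [x = [w; c]]: a face
    operator drops one element of [c].  The factor [epsilon] is implicit, as
    [[w; I_1 < ... < I_q]] is a basis element only if [w] is in [W^(I_1)], and
    so is the vanishing of the boundary when [q = 0], as [d] is nonempty. *)
Definition bar_complex (K : {set {set W}}) : based_complex :=
  @BasedComplex {x : W * {set {set W}} | bar_gen K x}
    (fun x => ((2 * len (val x).1)%N%:Z + #|(val x).2|%:Z - 1)%R)
    (fun x y =>
      \sum_(I in (val x).2 |
              ((val y).1 == (val x).1) && ((val y).2 == (val x).2 :\ I)%SET)
        (-1) ^+ chain_pos (val x).2 I)%R.

End Coxeter.

Section Topology.
Local Open Scope classical_set_scope.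
Local Open Scope ring_scope.
Variable R : realType.

Definition contractible (X : topologicalType) : Prop :=
  exists (x0 : X) (h : X * R -> X),
    [/\ {within [set: X] `*` `[0, 1], continuous h},
        forall x, h (x, 0) = x &
        forall x, h (x, 1) = x0].

Definition path_connected (X : topologicalType) : Prop :=
  forall x y : X, exists2 p : R -> X,
    {within `[0, 1], continuous p} & p 0 = x /\ p 1 = y.

Definition simply_connected (X : topologicalType) : Prop :=
  path_connected X /\
  forall p : R -> X, {within `[0, 1], continuous p} -> p 0 = p 1 ->
    exists h : R * R -> X,
      [/\ {within `[0, 1] `*` `[0, 1], continuous h},
          forall t, h (t, 0) = p t,
          forall t, h (t, 1) = p 0 &
          forall u, h (0, u) = p 0 /\ h (1, u) = p 0].

End Topology.

Section SmoothMaps.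
Local Open Scope classical_set_scope.
Local Open Scope ring_scope.
Variable R : realType.

Fixpoint class_C (k m n : nat) (U : set 'rV[R]_m) (f : 'rV[R]_m -> 'rV[R]_n)
    : Prop :=
  (forall x, U x -> {for x, continuous f}) /\
  if k isn't k'.+1 then True else
    forall i : 'I_m, (forall x, U x -> derivable f x (delta_mx 0 i)) /\
      class_C k' U (fun x => 'D_(delta_mx 0 i) f x).

Definition smooth (m n : nat) (U : set 'rV[R]_m) (f : 'rV[R]_m -> 'rV[R]_n)
    : Prop :=
  open U /\ forall k, class_C k U f.

End SmoothMaps.

HB.structure Definition GroupTop := {G of monoid.Group G & Topological G}.

Section LieGroups.
Local Open Scope classical_set_scope.
Local Open Scope ring_scope.
Variable R : realType.

(** A smooth atlas is indexed by the points of the group, the chart of index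
    [x] being defined around [x]; [coord x] and [param x] are the mutually
    inverse coordinate map and parametrization. *)
Record lie_group := LieGroup {
  carrier :> GroupTop.type;
  dim : nat;
  dom : carrier -> set carrier;
  coord : carrier -> carrier -> 'rV[R]_dim;
  param : carrier -> 'rV[R]_dim -> carrier;
  lie_hausdorff : hausdorff_space carrier;
  lie_second_countable : @second_countable carrier;
  dom_open : forall x, open (dom x);
  dom_center : forall x, dom x x;
  coord_open : forall x, open (coord x @` dom x);
  coordK : forall x, {in dom x, cancel (coord x) (param x)};
  coord_continuous : forall x, {within dom x, continuous (coord x)};
  param_continuous : forall x,
    {within coord x @` dom x, continuous (param x)};
  transition_smooth : forall x y,
    smooth [set u | (coord x @` dom x) u /\ dom y (param x u)]
      (fun u => coord y (param x u));
  mul_smooth : forall x y z,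
    smooth [set u : 'rV[R]_(dim + dim) |
             [/\ (coord x @` dom x) (lsubmx u), (coord y @` dom y) (rsubmx u) &
                 dom z (param x (lsubmx u) * param y (rsubmx u))%g]]
      (fun u => coord z (param x (lsubmx u) * param y (rsubmx u))%g);
  inv_smooth : forall x y,
    smooth [set u | (coord x @` dom x) u /\ dom y (param x u)^-1%g]
      (fun u => coord y (param x u)^-1%g) }.

Variable G : lie_group.

(** The Lie algebra is the tangent space at [1], read in the chart at [1];
    the bracket is the derivative of [Ad] at [1]. *)
Definition Ad (g : G) (v : 'rV[R]_(dim G)) : 'rV[R]_(dim G) :=
  'D_v (fun x => coord 1%g (g * param 1%g x * g^-1)%g : 'rV[R]_(dim G))
    (coord 1%g (1%g : G)).

Definition bracket (u v : 'rV[R]_(dim G)) : 'rV[R]_(dim G) :=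
  'D_u (fun x => Ad (param 1%g x) v) (coord 1%g (1%g : G)).

(** The Lie algebra has no nonzero abelian ideal; the ideal is given as the
    row space of a matrix. *)
Definition semisimple : Prop :=
  forall A : 'M[R]_(dim G),
    (forall u v : 'rV[R]_(dim G), (v <= A)%MS -> (bracket u v <= A)%MS) ->
    (forall u v : 'rV[R]_(dim G), (u <= A)%MS -> (v <= A)%MS ->
       bracket u v = 0) ->
    A = 0.

Definition is_subgroup (H : set G) : Prop :=
  [/\ H 1%g, forall x y, H x -> H y -> H (x * y)%g &
      forall x, H x -> H x^-1%g].

Definition gen (A : set G) : set G := smallest is_subgroup A.

(** A torus: an isomorphic image of [R^k / Z^k]. *)
Definition is_torus (T : set G) : Prop :=
  exists (k : nat) (f : 'rV[R]_k -> G),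
    [/\ continuous f,
        {morph f : x y / x + y >-> (x * y)%g},
        forall x, f x = 1%g <-> forall i, x 0 i \is a Num.int &
        f @` [set: 'rV[R]_k] = T].

Definition maximal_torus (T : set G) : Prop :=
  is_torus T /\ forall T', is_torus T' -> T `<=` T' -> T' = T.

(** A root: a nontrivial unitary character [a] of [T] which is a weight of the
    complexified adjoint representation, with weight vector [u + i v]. *)
Definition is_root (T : set G) (a : G -> R[i]) : Prop :=
  [/\ {within T, continuous (fun t => (complex.Re (a t), complex.Im (a t)))},
      forall t, T t -> `|a t| = 1,
      forall t t', T t -> T t' -> a (t * t')%g = a t * a t',
      exists2 t, T t & a t != 1 &
      exists u v : 'rV[R]_(dim G), (u, v) != (0, 0) /\
        forall t, T t ->
          Ad t u = complex.Re (a t) *: u - complex.Im (a t) *: v /\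
          Ad t v = complex.Im (a t) *: u + complex.Re (a t) *: v].

(** A base of the root system, indexed by [S], in multiplicative notation:
    every root is a combination of the family with coefficients all
    nonnegative or all nonpositive, and the family is independent. *)
Definition is_base (T : set G) (I : finType) (S : {set I})
    (a : I -> G -> R[i]) : Prop :=
  [/\ forall s, s \in S -> is_root T (a s),
      forall b, is_root T b -> exists n : I -> nat,
        (forall t, T t -> b t = \prod_(s in S) a s t ^+ n s) \/
        (forall t, T t -> b t = \prod_(s in S) a s t ^- n s) &
      forall n : I -> int,
        (forall t, T t -> \prod_(s in S) a s t ^ n s = 1) ->
        forall s, s \in S -> n s = 0].

(** The centralizer in [G] of the kernel of [a] in [T]. *)
Definition root_centralizer (T : set G) (a : G -> R[i]) : set G :=
  [set g | forall t, T t -> a t = 1 -> commute g t].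

(** The rank-one subgroup of a root, as the derived group of the centralizer
    of its kernel. *)
Definition root_subgroup (T : set G) (a : G -> R[i]) : set G :=
  gen [set [~ x, y]%g | x in root_centralizer T a &
                        y in root_centralizer T a].

Definition normalizer (T : set G) : set G :=
  [set g | forall t, T t <-> T (t ^ g)%g].

(** [(W, S)] is the Weyl system of [G] for the maximal torus [T] and the base
    [a]: the map [r], choosing representatives, induces an isomorphism from
    [W] onto [N(T) / T] sending [s] in [S] to the reflection in the root
    [a s], which is the nontrivial class of [N(T) / T] represented in the
    centralizer of the kernel of [a s]. *)
Definition is_weyl_system (W : finGroupType) (S : {set W}) (T : set G)
    (a : W -> G -> R[i]) (r : W -> G) : Prop :=
  [/\ maximal_torus T, is_base T S a,
      [/\ forall w, normalizer T (r w),
          forall v w, T ((r v * r w)^-1 * r (v * w))%g,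
          forall w, T (r w) -> w = 1%g &
          forall g, normalizer T g -> exists w, T ((r w)^-1 * g)%g] &
      forall s, s \in S -> root_centralizer T (a s) (r s)].

(** [G_I], generated as an abstract group. *)
Definition standard_subgroup (W : finType) (T : set G)
    (a : W -> G -> R[i]) (I : {set W}) : set G :=
  gen (T `|` \bigcup_(s in [set s | s \in I]) root_subgroup T (a s)).

Lemma gen_is_subgroup (A : set G) : is_subgroup (gen A).
Proof.
split; first by move=> H [[]].
- by move=> x y hx hy H HA; have [[_ hM _] _] := HA; apply: hM; [exact: hx|exact: hy].
- by move=> x hx H HA; have [[_ _ hV] _] := HA; apply: hV; exact: hx.
Qed.

Lemma standard_is_subgroup (W : finType) (T : set G) (a : W -> G -> R[i])
  (I : {set W}) : is_subgroup (standard_subgroup T a I).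
Proof. exact: gen_is_subgroup. Qed.

End LieGroups.

Section CosetSpace.
Local Open Scope classical_set_scope.
Local Open Scope quotient_scope.
Variables (R : realType) (G : lie_group R) (H : set G).
Hypothesis subH : is_subgroup H.

Definition coset_rel of is_subgroup H : rel G :=
  fun x y => `[< H (x^-1 * y)%g >].

Fact coset_rel_equiv : equiv_class_of (coset_rel subH).
Proof.
have [H1 HM HV] := subH.
split => [x|x y|y x z].
- by apply/asboolP; rewrite mulVg.
- by apply/asboolP/asboolP => /HV; rewrite invgM invgK.
- move=> /asboolP h1 /asboolP h2; apply/asboolP.
  by have := HM _ _ h1 h2; rewrite -mulgA mulKVg.
Qed.
Canonical coset_equiv := EquivRelPack coset_rel_equiv.

Definition coset_space : topologicalType :=
  quotient_topology {eq_quot coset_equiv}.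

End CosetSpace.

(** The projection [g H |-> g H'], for [H] contained in [H']. *)
Definition coset_proj (R : realType) (G : lie_group R) (H H' : set G)
    (subH : is_subgroup H) (subH' : is_subgroup H')
    (x : coset_space subH) : coset_space subH' :=
  (\pi_({eq_quot coset_equiv subH'}) (generic_quotient.repr
    (x : {eq_quot coset_equiv subH})))%qT.

Section Hocolim.
Local Open Scope classical_set_scope.
Local Open Scope ring_scope.
Local Open Scope quotient_scope.
Variables (R : realType) (P : finType) (le : rel P).
(** A diagram of spaces on the poset [(P, le)]; [f i j] is only used when
    [le i j]. *)
Variables (X : P -> topologicalType) (f : forall i j, X i -> X j).

(** The geometric realization of the nerve of the poset [i \ P] of elements
    above [i], in barycentric coordinates. *)
Definition nerve_above (i : P) : set {ptws P -> R} :=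
  [set l | [/\ forall j, 0 <= l j, \sum_j l j = 1,
               forall j, l j != 0 -> le i j &
               forall j k, l j != 0 -> l k != 0 -> le j k || le k j]].

(** The Bousfield-Kan formula: the coend of [X i] and [|N (i \ P)|]. *)
Definition hocolim_piece (i : P) : topologicalType :=
  (X i * set_type (nerve_above i))%type.

Definition hocolim_pre : topologicalType := {i : P & hocolim_piece i}.

Inductive hocolim_step : hocolim_pre -> hocolim_pre -> Prop :=
  HocolimStep i j (x : X i) (l : nerve_above i) (m : nerve_above j) :
    le i j -> set_val l = set_val m ->
    hocolim_step (existT hocolim_piece i (x, l))
                 (existT hocolim_piece j (f j x, m)).

Definition hocolim_rel (p q : hocolim_pre) : bool :=
  `[< clos_refl_sym_trans _ hocolim_step p q >].

Fact hocolim_rel_equiv : equiv_class_of hocolim_rel.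
Proof.
split => [p|p q|q p r].
- by apply/asboolP; apply: rst_refl.
- by apply/asboolP/asboolP => h; apply: rst_sym.
- by move=> /asboolP h1 /asboolP h2; apply/asboolP; apply: rst_trans h1 h2.
Qed.
Canonical hocolim_equiv := EquivRelPack hocolim_rel_equiv.

Definition hocolim : topologicalType :=
  quotient_topology {eq_quot hocolim_equiv}.

End Hocolim.

Section ParabolicHocolim.
Variables (R : realType) (G : lie_group R) (W : finType) (T : set G).
Variables (a : W -> G -> R[i]) (K : {set {set W}}).

Definition faces : finType := {I : {set W} | I \in K}.

Definition flag_space (I : faces) : topologicalType :=
  coset_space (standard_is_subgroup T a (val I)).

Definition flag_proj (I J : faces) : flag_space I -> flag_space J :=
  coset_proj (standard_is_subgroup T a (val J)).

Definition parabolic_hocolim : topologicalType :=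
  @hocolim R faces (fun I J => val I \subset val J) flag_space flag_proj.

End ParabolicHocolim.

(* Main.v *)
(* Part one: the chains of [K] starting from [w] are compared with the induced complex on the descent
   set of [w]; acyclic carriers split the latter off the bar complex, and the composites sum to the
   identity up to homotopy. As [w_D] has descent set [D], this gives both homological claims.

   Part two: a contraction pushes everything to the face [S], since [G_S] is dense. Conversely the
   homotopy colimit maps to vectors [(l_J, l_J Ad(g) rho_J)], with the same contractibility on
   indistinguishability classes; iterated Smith theory for the 2-power torsion of [T] makes the
   [T]-fixed points, which are the [W]-translates of a chamber, acyclic over [F_2]. If [D] is a minimal
   nonface, the cochain recording the walls labelled by [D] is a cocycle there, yet summing it over
   [W_D] contradicts Sperner's lemma on the chamber. *)
From HB Require Import structures.
Require Import Defs.
From mathcomp Require Import all_boot all_order all_fingroup all_algebra boolp.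
From mathcomp Require Import ring lra zify.

Set Implicit Arguments.
Unset Strict Implicit.
Unset Printing Implicit Defensive.

Import Order.TTheory GRing.Theory Num.Theory.

(** * Coxeter groups and the bar complex *)

Section Coxeter.
Local Open Scope group_scope.
Variables (W : finGroupType) (S : {set W}).

(** Several obstacles shape the second half. A Lie group is given by a smooth atlas alone, so the
    exponential map, the bracket and an invariant inner product are built from strict derivatives of
    chart expressions: the exponential as the limit of the powers [2^k] of [psi (v / 2^k)], the
    product as a fixed point in a convex set of forms. The subgroups [G_I] are generated abstractly
    and only their closures are identified, as the stabilisers of the vectors [rhoJ]; a continuous
    map to a Hausdorff space does not see the difference. Cohomology is of Alexander-Spanier type:
    cochains are arbitrary functions tested on small tuples, so extension by zero and noncontinuous
    retractions are harmless. Involutions suffice because a vector fixed by [exp (v / 2^m)] with [m]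
    large is fixed by the whole one-parameter group. Minimality of the nonface makes each face of
    the chamber cut out by a proper subset of [D] contractible, and modulo 2 the translates by [v]
    and [v c] cancel on the wall of [c]. *)

Definition wprod (l : seq W) : W := \prod_(x <- l) x.

Lemma wprod_cons x l : wprod (x :: l) = x * wprod l.
Proof. by rewrite /wprod big_cons. Qed.

Lemma wprod_cat l1 l2 : wprod (l1 ++ l2) = wprod l1 * wprod l2.
Proof. by rewrite /wprod big_cat. Qed.

Lemma wprod_nil : wprod [::] = 1.
Proof. by rewrite /wprod big_nil. Qed.

Lemma wprod1 x : wprod [:: x] = x.
Proof. by rewrite /wprod big_seq1. Qed.

Lemma mem_expgs_word (n : nat) w :
  reflect (exists l, [/\ size l = n, {subset l <= S} & wprod l = w]) (w \in S ^+ n).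
Proof.
apply: (iffP idP).
  elim: n w => [|n IH] w.
    by rewrite expg0 => /set1P ->; exists [::]; rewrite wprod_nil.
  rewrite expgS => /mulsgP[x y xS /IH[l [sl lS <-]] ->]; exists (x :: l).
  rewrite /= sl wprod_cons; split=> // z; rewrite inE => /orP[/eqP -> //|]; exact: lS.
move=> [l [<- lS <-]]; elim: l lS => [|x l IH] lS; first by rewrite wprod_nil.
rewrite /= expgS wprod_cons; apply: mem_mulg; first by apply: lS; rewrite mem_head.
by apply: IH => z zl; apply: lS; rewrite inE zl orbT.
Qed.

Hypothesis genS : <<S>> = [set: W].

Lemma gen_word (D : {set W}) w : w \in <<D>> -> exists2 l, {subset l <= D} & wprod l = w.
Proof.
move=> /gen_prodgP[n [c cD ->]]; exists [seq c i | i <- index_enum 'I_n].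
  by move=> x /mapP[i _ ->].
by rewrite /wprod big_map.
Qed.

Lemma len_ex w : exists l, [/\ {subset l <= S}, wprod l = w, size l = len S w &
  forall l', {subset l' <= S} -> wprod l' = w -> (len S w <= size l')%N].
Proof.
have wS : w \in <<S>> by rewrite genS.
have [l0 l0S l0w] := gen_word wS.
have ex : exists n, w \in S ^+ n by exists (size l0); apply/mem_expgs_word; exists l0.
case: (ex_minnP ex) => n wn nmin.
have /mem_expgs_word[l [sl lS lw]] := wn.
(* Equal products of two prefixes would let the letters between them be cut out. So the [n + 1]
   prefixes of a shortest word are distinct elements, and [n] lies in the range searched by
   [len]. *)
have inj : injective (fun i : 'I_n.+1 => wprod (take i l)).
  have H i j : (i < j)%N -> (j <= n)%N -> wprod (take i l) = wprod (take j l) -> False.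
    move=> ij jn e; have : w \in S ^+ (i + (n - j)).
      apply/mem_expgs_word; exists (take i l ++ drop j l); split.
      - by rewrite size_cat size_drop size_takel sl// (leq_trans (ltnW ij)).
      - by move=> x; rewrite mem_cat => /orP[/mem_take|/mem_drop]; exact: lS.
      - by rewrite wprod_cat e -wprod_cat cat_take_drop.
    by move=> /nmin; lia.
  move=> i j /= e; apply/val_inj => /=; case: (ltngtP i j) => // h.
    by case: (H i j h (ltn_ord j) e).
  by case: (H j i h (ltn_ord i) (esym e)).
have nW : (n < #|W|)%N by rewrite -{1}(card_ord n.+1) -(card_imset _ inj) max_card.
have -> : len S w = n.
  rewrite /len; set p := fun n => _.
  have hp : has p (iota 0 #|W|) by apply/hasP; exists n; rewrite ?mem_iota.
  have lt : (find p (iota 0 #|W|) < #|W|)%N by move: hp; rewrite has_find size_iota.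
  have := nth_find 0%N hp; rewrite nth_iota// add0n => /nmin h1.
  apply/eqP; rewrite eqn_leq h1 andbT leqNgt; apply/negP => h2.
  by have := before_find 0%N h2; rewrite nth_iota// /p wn.
exists l; split=> // l' lS' lw'; apply: nmin; apply/mem_expgs_word; by exists l'.
Qed.

Lemma len_le l : {subset l <= S} -> (len S (wprod l) <= size l)%N.
Proof. by move=> lS; have [l' [_ _ _ h]] := len_ex (wprod l); exact: h. Qed.

Lemma len_word w : exists l, [/\ {subset l <= S}, wprod l = w & size l = len S w].
Proof. by have [l []] := len_ex w; exists l. Qed.

Hypothesis invS : {in S, forall s, #[s] = 2}.

Lemma ss1 s : s \in S -> s * s = 1.
Proof. by move=> /invS h; have := expg_order s; rewrite h. Qed.

Lemma sV s : s \in S -> s^-1 = s.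
Proof. by move=> /ss1 h; apply: (mulgI s); rewrite mulgV. Qed.

Lemma S_neq1 s : s \in S -> s != 1.
Proof. by move=> /invS h; apply/eqP => s1; move: h; rewrite s1 order1. Qed.

Lemma wprod_rev l : {subset l <= S} -> wprod (rev l) = (wprod l)^-1.
Proof.
elim: l => [|x l IH] lS; first by rewrite wprod_nil invg1.
have lS' : {subset l <= S} by move=> z zl; apply: lS; rewrite inE zl orbT.
by rewrite rev_cons -cats1 wprod_cat wprod1 IH// wprod_cons invMg (sV (lS _ (mem_head _ _))).
Qed.

Lemma len_inv w : len S w^-1 = len S w.
Proof.
have H x : (len S x^-1 <= len S x)%N.
  have [l [lS <- <-]] := len_word x; rewrite -wprod_rev// -(size_rev l).
  by apply: len_le => z; rewrite mem_rev; exact: lS.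
by apply/eqP; rewrite eqn_leq H -{1}(invgK w) H.
Qed.

Lemma len_mulr w s : s \in S -> (len S (w * s) <= (len S w).+1)%N.
Proof.
move=> sS; have [l [lS <- <-]] := len_word w.
have := @len_le (rcons l s); rewrite size_rcons -cats1 wprod_cat wprod1; apply.
by move=> z; rewrite mem_cat mem_seq1 => /orP[/lS|/eqP ->].
Qed.

Lemma len1 : len S 1 = 0%N.
Proof. by apply/eqP; rewrite -leqn0 -wprod_nil; apply: (@len_le [::]). Qed.

Lemma len0_eq1 w : len S w = 0%N -> w = 1.
Proof. by move=> h; have [l [_ lw]] := len_word w; rewrite h => /size0nil l0; rewrite -lw l0 wprod_nil. Qed.

Lemma len_mulr_ge w s : s \in S -> (len S w <= (len S (w * s)).+1)%N.
Proof. by move=> sS; have := len_mulr (w * s) sS; rewrite -mulgA ss1// mulg1. Qed.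

Hypothesis presS : forall (H : groupType) (f : W -> H),
  {in S &, forall s t, (f s * f t) ^+ #[s * t] = 1} ->
  exists2 g : W -> H, {morph g : x y / x * y} & {in S, g =1 f}.

Lemma morph1 (H : groupType) (g : W -> H) : {morph g : x y / x * y} -> g 1 = 1.
Proof. by move=> gM; apply: (mulgI (g 1)); rewrite -gM !mulg1. Qed.

(** The presentation yields a sign character: all generators go to one transposition of [bool], and
    the relations hold because its square is trivial. It records the parity of the length. *)
Lemma len_mulr_neq w s : s \in S -> len S (w * s) != len S w.
Proof.
move=> sS; pose H : groupType := {perm bool}; pose c : {perm bool} := tperm true false.
have cc : c * c = 1 by exact: tperm2.
have [|g gM gS] := @presS H (fun=> c); first by move=> x y _ _; rewrite cc expg1n.
have c1 : c != 1 by apply/eqP => /permP/(_ true); rewrite tpermL perm1.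
have gw x : g x = c ^+ (len S x).
  have [l [lS <- <-]] := len_word x; elim: l lS => [|y l IH] lS.
    by rewrite wprod_nil morph1.
  rewrite wprod_cons gM gS ?lS ?mem_head// IH ?expgS// => z zl.
  by apply: lS; rewrite inE zl orbT.
apply/eqP => e; have := gM w s; rewrite (gw (w * s)) (gw w) e gS// => h.
by move/eqP : c1; apply; apply: (mulgI (c ^+ len S w)); rewrite mulg1.
Qed.

Lemma len_mulr_cases w s : s \in S ->
  len S (w * s) = (len S w).+1 \/ len S w = (len S (w * s)).+1.
Proof.
move=> sS; have := len_mulr w sS; have := len_mulr_ge w sS; have := len_mulr_neq w sS.
by move/eqP; move: (len S (w * s)) (len S w) => a b; lia.
Qed.

(* Each generator [s] acts on [W * bool] by [x |-> x^s], flipping the sign at [x = s]; the sign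
   cocycle of [w] counts the reflections of any word for [w]. *)
Definition refl_fun (s : W) (p : W * bool) : W * bool :=
  if s \in S then (p.1 ^ s, p.2 (+) (p.1 == s)) else p.

Lemma refl_funK s : cancel (refl_fun s) (refl_fun s).
Proof.
move=> [x b]; rewrite /refl_fun; case: (boolP (s \in S)) => sS //=.
rewrite -conjgM ss1// conjg1; congr (_, _).
have ssE : s ^ s = s by rewrite conjgE mulKg.
by rewrite -[X in _ ^ s == X]ssE (inj_eq (conjg_inj s)) -addbA addbb addbF.
Qed.

Definition refl_perm s : {perm W * bool} := perm (can_inj (refl_funK s)).

Lemma refl_permE s x b : s \in S -> refl_perm s (x, b) = (x ^ s, b (+) (x == s)).
Proof. by move=> sS; rewrite permE /refl_fun sS. Qed.

(** The signs flipped along the word [s t s t ...] sit at the reflections [(s t)^i s]; the two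
    letters of round [k] account for the exponents [2 k] and [2 k + 1]. *)
Lemma refl_pair_pow s t k x b : s \in S -> t \in S ->
  ((refl_perm s * refl_perm t) ^+ k) (x, b) =
  (x ^ ((s * t) ^+ k), b (+) odd (\sum_(i < 2 * k) nat_of_bool (x == (s * t) ^+ i * s)%g)%N).
Proof.
move=> sS tS; elim: k => [|k IH].
  by rewrite perm1 big_ord0 conjg1 addbF.
rewrite expgSr permM IH permM !refl_permE// -(conjgM x).
have -> : (x ^ ((s * t) ^+ k * s)) ^ t = x ^ ((s * t) ^+ k.+1) by rewrite expgSr -conjgM mulgA.
congr (_, _).
set y := s * t.
have sy i : y ^+ i * s = s * y^-1 ^+ i.
  elim: i => [|i IHi]; first by rewrite mulg1 mul1g.
  rewrite expgS -mulgA IHi expgS mulgA [in RHS]mulgA; congr (_ * _).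
  by rewrite invMg !sV// mulgA.
have cj (g u : W) : (x ^ g == u) = (x == u ^ g^-1) by rewrite (can2_eq (conjgK g) (conjgKV g)).
have e1 : s ^ (y ^+ k)^-1 = y ^+ (2 * k) * s.
  by rewrite conjgE invgK -expVgn -sy mulgA -expgnDr mul2n addnn.
have e2 : t ^ (y ^+ k * s)^-1 = y ^+ (2 * k).+1 * s.
  rewrite conjgE invgK invMg sV// -expVgn !mulgA -[_ * s * t]mulgA -expgSr -mulgA -sy mulgA.
  by rewrite -expgnDr mul2n addSn addnn.
rewrite mulnS addnC addn2 !big_ord_recr /= !oddD !oddb -!addbA !cj e1 e2.
by congr (_ (+) (_ (+) (_ (+) _))).
Qed.

(** Over a full period the list of reflections [(s t)^i s] is run through twice, since
    [(s t)^m = 1]; every sign is flipped an even number of times. *)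
Lemma refl_rel : {in S &, forall s t, (refl_perm s * refl_perm t) ^+ #[s * t] = 1}.
Proof.
move=> s t sS tS; apply/permP => -[x b]; rewrite refl_pair_pow// perm1.
rewrite expg_order conjg1; congr (_, _); set m := #[_].
rewrite mul2n -addnn big_split_ord /= oddD.
rewrite (_ : \sum_(i < m) nat_of_bool (x == (s * t) ^+ (m + i) * s)%g =
    \sum_(i < m) nat_of_bool (x == (s * t) ^+ i * s)%g)%N.
  by rewrite addbb addbF.
by apply: eq_bigr => i _; rewrite expgnDr expg_order mul1g.
Qed.

Definition cocycle_ex := presS refl_rel.

(** The sign cocycle depends only on the group element, so the number of letters with
    [s ^ prefix = letter] has the same parity for all words of one element. When [s] shortens the
    element this parity is odd, and a counted letter cancels against [s]. *)
Lemma exchange_left l s : {subset l <= S} -> s \in S -> (len S (s * wprod l) < len S (wprod l))%N ->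
  exists2 i, (i < size l)%N & s * wprod l = wprod (take i l ++ drop i.+1 l).
Proof.
move=> lS sS lt; have [g gM gS] := cocycle_ex.
have gw l' x b : {subset l' <= S} ->
    g (wprod l') (x, b) = (x ^ wprod l', b (+) odd (\sum_(i < size l') nat_of_bool (x ^ wprod (take i l') == nth 1 l' i)%g)%N).
  elim/last_ind: l' => [|l' y IH] lS0.
    by rewrite wprod_nil (morph1 gM) perm1 conjg1 big_ord0 addbF.
  have yS : y \in S by apply: lS0; rewrite mem_rcons mem_head.
  have lS' : {subset l' <= S} by move=> z zl; apply: lS0; rewrite mem_rcons inE zl orbT.
  rewrite size_rcons big_ord_recr /= -cats1 wprod_cat wprod1 gM permM IH// gS// refl_permE//.
  rewrite -conjgM take_size_cat// nth_cat ltnn subnn oddD oddb addbA; congr (_, _ (+) odd _ (+) _).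
  by apply: eq_bigr => i _; rewrite takel_cat 1?ltnW// nth_cat ltn_ord.
(* The equation [s ^ prefix = letter] says that [s * prefix] is the prefix followed by the letter,
   so an [s] in front deletes that letter. *)
have del l' : {subset l' <= S} -> odd (\sum_(i < size l') nat_of_bool (s ^ wprod (take i l') == nth 1 l' i)%g)%N ->
    exists2 i, (i < size l')%N & s * wprod l' = wprod (take i l' ++ drop i.+1 l').
  move=> lS' h; have [i hi] : exists i : 'I_(size l'), s ^ wprod (take i l') == nth 1 l' i.
    apply/existsP; apply: contraLR h; rewrite negb_exists => /forallP h.
    by rewrite big1// => i _; rewrite (negbTE (h i)).
  exists i => //; move/eqP: hi; rewrite conjgE => hi.
  rewrite -{1}(cat_take_drop i l') wprod_cat (drop_nth 1 (ltn_ord i)) wprod_cons -hi.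
  rewrite wprod_cat; move: (wprod (take i l')) (wprod (drop i.+1 l')) => A B.
  have -> : s * (A * (A^-1 * (s * A) * B)) = s * s * (A * B) by rewrite !mulgA mulgK.
  by rewrite (ss1 sS) mul1g.
(* The same element is [s] followed by a shortest word for [s * wprod l]. That shortest word cannot
   count [s] an odd number of times: deleting a letter would make [wprod l] shorter than
   [s * wprod l]. *)
have : odd (\sum_(i < size l) nat_of_bool (s ^ wprod (take i l) == nth 1 l i)%g)%N.
  have [l' [lS' l'w sl']] := len_word (s * wprod l).
  have := gw l s false lS; have E : wprod l = s * wprod l' by rewrite l'w mulgA ss1// mul1g.
  have e1 : s ^ s = s by rewrite conjgE mulKg.
  rewrite {1}E gM permM (gS _ sS) refl_permE// eqxx e1 gw//= => -[_].
  case: (boolP (odd (\sum_(i < size l') _))) => [/(del _ lS')[i il' e]|_ <- //].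
  exfalso; have : (len S (wprod l) < len S (s * wprod l))%N.
    rewrite -sl' E e; apply: leq_ltn_trans (len_le _) _.
      by move=> z; rewrite mem_cat => /orP[/mem_take|/mem_drop]; exact: lS'.
    by rewrite size_cat size_takel ?size_drop -?addSn ?subnKC // ltnW.
  by move=> lt2; move: lt; rewrite ltnNge ltnW.
exact: del.
Qed.

Lemma exchange_right l s : {subset l <= S} -> s \in S -> (len S (wprod l * s) < len S (wprod l))%N ->
  exists2 l', subseq l' l & size l' = (size l).-1 /\ wprod l' = wprod l * s.
Proof.
move=> lS sS lt; have lrS : {subset rev l <= S} by move=> z; rewrite mem_rev; exact: lS.
have [|i il e] := exchange_left lrS sS.
  by rewrite wprod_rev// -{1}(sV sS) -invMg !len_inv.
rewrite size_rev in il; set l0 := _ ++ _ in e.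
have l0S : {subset l0 <= S} by move=> z; rewrite mem_cat => /orP[/mem_take|/mem_drop]; exact: lrS.
exists (rev l0).
  rewrite -[l]revK subseq_rev -(cat_take_drop i (rev l)); apply: cat_subseq => //.
  by rewrite [drop i _](drop_nth 1) ?size_rev// subseq_cons.
split; first by rewrite size_rev size_cat size_takel ?size_drop size_rev; lia.
by rewrite wprod_rev// -e wprod_rev// invMg invgK sV.
Qed.

(** Letters are appended one at a time. When the length drops, exchange removes a letter from the
    reduced word already built, so no letter outside [D] ever enters. *)
Lemma parabolic_word (D : {set W}) w : D \subset S -> w \in <<D>> ->
  exists l, [/\ {subset l <= D}, wprod l = w & size l = len S w].
Proof.
move=> DS wD.
have [l lD <-] := gen_word wD.
clear wD w; have [k] := ubnP (size l); elim: k l lD => // k IH l lD.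
case/lastP: l lD => [|l s] lD; rewrite ?size_rcons ltnS => lk.
  by exists [::]; rewrite wprod_nil len1.
have sD : s \in D by apply: lD; rewrite mem_rcons mem_head.
have lD' : {subset l <= D} by move=> z zl; apply: lD; rewrite mem_rcons inE zl orbT.
have [l1 [l1D l1w l1s]] := IH l lD' lk; rewrite -cats1 wprod_cat wprod1 -l1w.
have sS := subsetP DS s sD.
have l1S : {subset l1 <= S} by move=> z /l1D; exact: (subsetP DS).
have l1s' : size l1 = len S (wprod l1) by rewrite l1w.
case: (len_mulr_cases (wprod l1) sS) => h.
  exists (rcons l1 s); rewrite -cats1 wprod_cat wprod1 size_cat l1s' addn1; split=> //.
  by move=> z; rewrite mem_cat mem_seq1 => /orP[/l1D|/eqP ->].
have [|l2 l2l [l2s l2w]] := exchange_right l1S sS; first by rewrite h.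
exists l2; rewrite l2s l1s' h; split=> //.
by move=> z zl; apply: l1D; exact: (mem_subseq l2l).
Qed.

Lemma parabolic_gen (D : {set W}) s : D \subset S -> s \in S -> s \in <<D>> -> s \in D.
Proof.
move=> DS sS /(parabolic_word DS)[l [lD lw ls]].
have s1 : len S s = 1%N.
  apply/eqP; rewrite eqn_leq; apply/andP; split.
    by have := len_mulr 1 sS; rewrite mul1g len1.
  by rewrite lt0n; apply: contra (S_neq1 sS) => /eqP/len0_eq1 ->.
rewrite s1 in ls; case: l lD lw ls => [|x [|]]//= lD; rewrite wprod1 => <- _.
by apply: lD; rewrite mem_head.
Qed.

Definition Des (w : W) : {set W} := [set s in S | (len S (w * s) < len S w)%N].

(** Maximality and parity make every element of [D] a descent. A descent [s] outside [D] would, by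
    exchange in a reduced word over [D], make [w * s] and then [s] itself an element of [<<D>>]. *)
Lemma longest_Des (D : {set W}) w : D \subset S -> longest_in S D w -> Des w = D.
Proof.
move=> DS [wD wmax]; apply/setP => s; rewrite inE; case: (boolP (s \in S)) => sS /=; last first.
  by apply/esym/negbTE; apply: contra sS; exact: (subsetP DS).
case: (boolP (s \in D)) => sD.
  rewrite ltn_neqAle len_mulr_neq//=; apply: wmax; rewrite groupM//; exact: mem_gen.
apply/negbTE; apply: contra sD => lt.
have [l [lD lw ls]] := parabolic_word DS wD.
have lS : {subset l <= S} by move=> z /lD; exact: (subsetP DS).
rewrite -lw in lt; have [l' l'l [_ l'w]] := exchange_right lS sS lt.
apply: (parabolic_gen DS sS); have -> : s = w^-1 * wprod l' by rewrite l'w lw mulKg.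
rewrite groupM ?groupV// /wprod big_seq; apply: group_prod => x xl.
by apply: mem_gen; apply: lD; exact: (mem_subseq l'l).
Qed.

(** In this form the condition on [I] refers to one set attached to [w], so the part of the bar
    complex at [w] depends on [K] and [Des w] only. *)
Lemma min_repsE (I : {set W}) w : I \subset S -> (w \in min_reps S I) = [disjoint I & Des w].
Proof.
move=> IS; rewrite inE; apply/forall_inP/pred0P => [h s|h s sI] /=.
  apply/negbTE/negP => /andP[sI]; rewrite inE => /andP[_]; rewrite ltnNge.
  by rewrite ltnW// h.
have sS := subsetP IS s sI; have := h s; rewrite /= sI inE sS /= => /negbT.
by rewrite -leqNgt leq_eqVlt eq_sym (negbTE (len_mulr_neq w sS)).
Qed.

End Coxeter.

Local Open Scope ring_scope.

(** * Chains, acyclic carriers and homology of based complexes *)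

Section BasedComplexes.
Local Notation chain C := {ffun bgen C -> int}.

Definition is_complex (C : based_complex) : Prop :=
  (forall b c : bgen C, bd b c != 0 -> deg b = deg c + 1) /\
  forall b e : bgen C, \sum_c bd b c * bd c e = 0.

Definition delta (C : based_complex) (b : bgen C) : chain C := [ffun c => (c == b)%:R].

Section Extension.
Variables C C' : based_complex.

(** The linear extension of a map given on the basis. All chain maps and homotopies below are
    families of chains indexed by basis elements. *)
Definition ext (h : bgen C -> chain C') (x : chain C) : chain C' := [ffun c => \sum_b x b * h b c].

Lemma extD h x y : ext h (x + y) = ext h x + ext h y.
Proof. by apply/ffunP => c; rewrite !ffunE -big_split; apply: eq_bigr => b _; rewrite ffunE mulrDl. Qed.

Lemma extB h x y : ext h (x - y) = ext h x - ext h y.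
Proof. by apply/ffunP => c; rewrite !ffunE -sumrB; apply: eq_bigr => b _; rewrite !ffunE mulrBl. Qed.

Lemma ext0 h : ext h 0 = 0.
Proof. by apply/ffunP => c; rewrite !ffunE big1// => b _; rewrite ffunE mul0r. Qed.

Lemma ext_delta h b : ext h (delta b) = h b.
Proof.
apply/ffunP => c; rewrite ffunE (bigD1 b)//= ffunE eqxx mul1r big1 ?addr0// => b' ne.
by rewrite ffunE (negbTE ne) mul0r.
Qed.

Lemma eq_ext h h' (x : chain C) : (forall b, x b != 0 -> h b = h' b) -> ext h x = ext h' x.
Proof.
move=> e; apply/ffunP => c; rewrite !ffunE; apply: eq_bigr => b _.
by have [->|/e ->] := eqVneq (x b) 0; rewrite ?mul0r.
Qed.

Lemma ext_homogeneous h (n k m : int) x : (forall b, homogeneous (deg b + k) (h b)) ->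
  homogeneous n x -> m = n + k -> homogeneous m (ext h x).
Proof.
move=> hh /forallP hx ->; apply/forallP => c; apply/implyP; rewrite ffunE; apply: contraNT => ne.
rewrite big1// => b _; have := hx b; have /forallP/(_ c) := hh b.
case: (eqVneq (x b) 0) => [->|_ /= + /eqP bn]; first by rewrite mul0r.
by rewrite bn (negbTE ne) implybF negbK => /eqP ->; rewrite mulr0.
Qed.

Lemma ext_support h x c : ext h x c != 0 -> exists b, x b != 0 /\ h b c != 0.
Proof.
rewrite ffunE => ne; apply: contrapT => no; move: ne; rewrite big1 ?eqxx// => b _.
have [->|xb] := eqVneq (x b) 0; first by rewrite mul0r.
have [->|hb] := eqVneq (h b c) 0; first by rewrite mulr0.
by case: no; exists b.
Qed.

End Extension.

Lemma ext_ext (C C' C'' : based_complex) (h : bgen C' -> chain C'') (g : bgen C -> chain C') x :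
  ext h (ext g x) = ext (fun b => ext h (g b)) x.
Proof.
apply/ffunP => c; rewrite !ffunE.
under eq_bigr => b _ do rewrite ffunE mulr_suml.
rewrite exchange_big; apply: eq_bigr => b _; rewrite ffunE mulr_sumr.
by apply: eq_bigr => b' _; rewrite mulrA.
Qed.

Lemma ext_id (C : based_complex) (x : chain C) : ext (@delta C) x = x.
Proof.
apply/ffunP => c; rewrite ffunE (bigD1 c)//= ffunE eqxx mulr1 big1 ?addr0// => b ne.
by rewrite ffunE eq_sym (negbTE ne) mulr0.
Qed.

Section Boundary.
Variable C : based_complex.
Implicit Types (x y : chain C).

Lemma boundary_ext x : boundary x = ext (fun b => boundary (delta b)) x.
Proof.
apply/ffunP => c; rewrite !ffunE; apply: eq_bigr => b _; rewrite ffunE; congr (_ * _).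
rewrite (bigD1 b)//= ffunE eqxx mul1r big1 ?addr0// => b' ne; by rewrite ffunE (negbTE ne) mul0r.
Qed.

Lemma boundary_delta (b : bgen C) : boundary (delta b) = [ffun c : bgen C => bd b c].
Proof.
apply/ffunP => c; rewrite !ffunE (bigD1 b)//= ffunE eqxx mul1r big1 ?addr0// => b' ne.
by rewrite ffunE (negbTE ne) mul0r.
Qed.

Lemma boundaryD x y : boundary (x + y) = boundary x + boundary y.
Proof. by rewrite boundary_ext extD -!boundary_ext. Qed.

Lemma boundaryN x : boundary (- x) = - boundary x.
Proof. by rewrite -[- x]add0r boundaryB boundary0 sub0r. Qed.

Lemma boundary_sub_ext (C' : based_complex) (h : bgen C' -> chain C) (x : chain C') :
  boundary (ext h x) = ext (fun b => boundary (h b)) x.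
Proof.
by rewrite boundary_ext ext_ext; apply: eq_ext => b _; rewrite -boundary_ext.
Qed.

Hypothesis cC : is_complex C.

Lemma boundary_boundary x : boundary (boundary x) = 0.
Proof.
rewrite [boundary x]boundary_ext boundary_sub_ext; apply/ffunP => e; rewrite !ffunE big1// => b _.
rewrite boundary_delta ffunE; case: cC => _ h.
by under eq_bigr => c _ do rewrite ffunE; rewrite h mulr0.
Qed.

End Boundary.

Lemma homogeneous_delta (C : based_complex) (b : bgen C) n : deg b = n -> homogeneous n (delta b).
Proof.
by move=> <-; apply/forallP => c; apply/implyP; rewrite ffunE; have [->|ne] := eqVneq c b.
Qed.

Lemma homogeneousD (C : based_complex) n (x y : chain C) :
  homogeneous n x -> homogeneous n y -> homogeneous n (x + y).
Proof. by move=> hx hy; rewrite -[y]opprK homogeneousB// -[- y]add0r homogeneousB// homogeneous0. Qed.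

Definition supp (C : based_complex) (A : pred (bgen C)) (x : chain C) := forall c, x c != 0 -> A c.

(* Acyclic carriers: [h] is a chain map for [U = 0] and [s = 1], a chain homotopy for [s = -1]. *)
Section Carrier.
Variables (C C' : based_complex) (k s : int).
Variables (carr : bgen C -> pred (bgen C')) (Init : pred (bgen C)).
Variables (h0 U : bgen C -> chain C').
Hypotheses (cC : is_complex C) (cC' : is_complex C').
Hypothesis deg_lb : forall b : bgen C, -1 <= deg b.
Hypothesis carr_bd : forall b c, bd b c != 0 -> forall e, carr c e -> carr b e.
Hypothesis Init_bd : forall b c, bd b c != 0 -> Init b -> Init c.
Hypothesis Udeg : forall b, homogeneous (deg b + k - 1) (U b).
Hypothesis Ucarr : forall b, supp (carr b) (U b).
Hypothesis Ubd : forall b, boundary (U b) = - (ext U (boundary (delta b)) *~ s).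
Hypothesis h0P : forall b, Init b -> [/\ homogeneous (deg b + k) (h0 b), supp (carr b) (h0 b) &
  boundary (h0 b) = U b + ext h0 (boundary (delta b)) *~ s].
Hypothesis acyc : forall b y, ~~ Init b -> homogeneous (deg b + k - 1) y -> supp (carr b) y ->
  boundary y = 0 -> exists2 x, homogeneous (deg b + k) x & supp (carr b) x /\ boundary x = y.

Let okb (h : bgen C -> chain C') b := [/\ homogeneous (deg b + k) (h b), supp (carr b) (h b) &
  boundary (h b) = U b + ext h (boundary (delta b)) *~ s].

Let ext_bdE (h h' : bgen C -> chain C') b : (forall c, deg c + 1 = deg b -> h c = h' c) ->
  ext h (boundary (delta b)) = ext h' (boundary (delta b)).
Proof.
move=> e; apply: eq_ext => c; rewrite boundary_delta ffunE => ne; apply: e.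
by case: cC => hd _; rewrite (hd _ _ ne).
Qed.

Let boundaryMz (C0 : based_complex) (x : chain C0) (z : int) : boundary (x *~ z) = boundary x *~ z.
Proof.
rewrite !boundary_ext; apply/ffunP => c; rewrite ffunMzE !ffunE mulrz_suml; apply: eq_bigr => b _.
by rewrite ffunMzE mulrzAl.
Qed.

(** Induction on the degree, which starts at [-1]. The step from [j] to [j + 1] alters [h] only in
    degree [j - 1] and outside [Init], so identities in lower degrees survive. *)
Let step (j : nat) : exists h, (forall b, deg b < j%:Z - 1 -> okb h b) /\ forall b, Init b -> h b = h0 b.
Proof.
elim: j => [|j [h [hP hI]]].
  by exists h0; split=> // b; rewrite ltNge deg_lb.
have ex b : exists x, ~~ Init b -> deg b = j%:Z - 1 -> [/\ homogeneous (deg b + k) x, supp (carr b) x &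
    boundary x = U b + ext h (boundary (delta b)) *~ s].
  case: (boolP (Init b)) => nI; first by exists 0.
  case: (eqVneq (deg b) (j%:Z - 1)) => [db|ne]; last by exists 0 => _ e; rewrite e eqxx in ne.
  have below c : bd b c != 0 -> okb h c.
    by move=> ne; apply: hP; case: cC => hd _; rewrite -db (hd _ _ ne) ltrDl.
  have [|||x hx [sx dx]] := acyc (y := U b + ext h (boundary (delta b)) *~ s) nI.
  - apply: homogeneousD; first exact: Udeg.
    apply/forallP => c; apply/implyP; rewrite ffunMzE => ne.
    have {}ne : ext h (boundary (delta b)) c != 0 by apply: contraNneq ne => ->; rewrite mul0rz.
    have [e [be he]] := ext_support ne; rewrite boundary_delta ffunE in be.
    have [/forallP/(_ c) /implyP/(_ he) /eqP -> _ _] := below e be.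
    by case: cC => hd _; rewrite (hd _ _ be); apply/eqP; ring.
  - move=> c; rewrite ffunE ffunMzE => ne.
    have [U0|/Ucarr //] := eqVneq (U b c) 0; rewrite U0 add0r in ne.
    have {}ne : ext h (boundary (delta b)) c != 0 by apply: contraNneq ne => ->; rewrite mul0rz.
    have [e [be he]] := ext_support ne; rewrite boundary_delta ffunE in be.
    by have [_ sc _] := below e be; apply: carr_bd be _ _; exact: sc.
  (* The chain to be filled is a cycle: by the identity already known one degree lower, the boundary
     of its second term is [ext U] of the boundary, up to the factor [s], and this cancels the
     boundary of [U b]. *)
  - rewrite boundaryD boundaryMz boundary_sub_ext Ubd.
    rewrite (_ : ext (fun c => boundary (h c)) _ = ext U (boundary (delta b))) ?addNr//.
    rewrite (@eq_ext _ _ _ (fun c => U c + ext h (boundary (delta c)) *~ s)); last first.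
      by move=> c; rewrite boundary_delta ffunE => /below[].
    transitivity (ext U (boundary (delta b)) + ext h (boundary (boundary (delta b))) *~ s).
      rewrite [boundary (boundary _)]boundary_ext ext_ext; apply/ffunP => c.
      rewrite !ffunE ffunMzE ffunE mulrz_suml -big_split /=; apply: eq_bigr => e _.
      by rewrite [(U e + _) c]ffunE ffunMzE mulrDr mulrzAr.
    by rewrite boundary_boundary// ext0 mul0rz addr0.
  - by exists x => _ _.
have [x xP] := choice ex.
exists (fun b => if (deg b == j%:Z - 1) && ~~ Init b then x b else h b); split; last first.
  by move=> b Ib; rewrite Ib andbF; exact: hI.
move=> b lt; have same c : deg c + 1 = deg b -> (if (deg c == j%:Z - 1) && ~~ Init c then x c else h c) = h c.
  by move=> dc; case: eqP => // e; lia.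
case: (boolP (Init b)) => Ib.
  have [h1 h2 h3] := h0P Ib; rewrite /okb Ib andbF hI//; split=> //; rewrite h3; congr (_ + _ *~ _).
  apply: eq_ext => c; rewrite boundary_delta ffunE => ne; have Ic := Init_bd ne Ib.
  by rewrite Ic andbF hI.
rewrite /okb (ext_bdE same) Ib andbT; case: eqP => [db|ne]; first exact: xP.
by apply: hP; lia.
Qed.

Lemma carrier_extend : exists h, (forall b, okb h b) /\ forall b, Init b -> h b = h0 b.
Proof.
have [j hj] : exists j : nat, forall b : bgen C, deg b < j%:Z - 1.
  exists (\sum_(b : bgen C) `|deg b|).+2%N => b.
  have : (`|deg b| <= \sum_(b : bgen C) `|deg b|)%N by rewrite (bigD1 b)//= leq_addr.
  by move: (\sum_ _ _)%N => N; lia.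
by have [h [hP hI]] := step j; exists h; split=> // b; exact: hP.
Qed.

End Carrier.

Lemma ext_eq0 (C C' : based_complex) (h : bgen C -> chain C') (x : chain C) :
  (forall b, x b != 0 -> h b = 0) -> ext h x = 0.
Proof.
move=> h0; apply/ffunP => c; rewrite [LHS]ffunE [RHS]ffunE big1// => b _.
by have [->|/h0 ->] := eqVneq (x b) 0; rewrite ?mul0r// ffunE mulr0.
Qed.

Lemma ext_pair (C C' : based_complex) (h : bgen C -> chain C') (b c : bgen C) :
  h b = h c -> ext h (delta c - delta b) = 0.
Proof. by move=> e; rewrite extB !ext_delta e subrr. Qed.

Lemma ext_sub_delta (C : based_complex) (U : bgen C -> chain C) x : ext (fun b => U b - delta b) x = ext U x - x.
Proof.
rewrite -[X in _ = _ - X]ext_id; apply/ffunP => c; rewrite !ffunE -sumrB; apply: eq_bigr => b _.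
by rewrite -mulrBr; rewrite !ffunE.
Qed.

(** The hypothesis reads [d h + h d = U], and [h d] vanishes on cycles. *)
Lemma homotopy_cycle (C C' : based_complex) (h U : bgen C -> chain C') (x : chain C) :
  (forall b, boundary (h b) = U b + ext h (boundary (delta b)) *~ (-1)) -> boundary x = 0 ->
  ext U x = boundary (ext h x).
Proof.
move=> hP dx; have e0 : ext h (boundary x) = 0 by rewrite dx ext0.
rewrite boundary_sub_ext -[LHS]subr0 -e0 [boundary x]boundary_ext ext_ext.
apply/ffunP => c; rewrite !ffunE -sumrB; apply: eq_bigr => b _; rewrite hP -mulrBr.
by rewrite [(U b + _) c]ffunE [(- ext _ _) c]ffunE.
Qed.

Section Homology.
Variables (C : based_complex) (n : int).

Definition hcls (z : cycles C n) : homology C n := \pi%qT z.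

Lemma hclsP z z' : hcls z = hcls z' <->
  exists2 x : chain C, homogeneous (n + 1) x & val z - val z' = boundary x.
Proof.
split=> [h|h].
  have : z - z' \in (@is_boundary C n : zmodClosed (cycles C n)).
    by rewrite Quotient.idealrBE; apply/eqP.
  by move=> /asboolP.
apply/eqP; have : z - z' \in (@is_boundary C n : zmodClosed (cycles C n)) by apply/asboolP.
by rewrite Quotient.idealrBE.
Qed.

Lemma hcls_rep (h : homology C n) : exists z, hcls z = h.
Proof. by exists (generic_quotient.repr h); exact: generic_quotient.reprK. Qed.

Lemma hclsD z z' : hcls (z + z') = hcls z + hcls z'.
Proof. by rewrite piE. Qed.

Lemma hcls0 : hcls 0 = 0.
Proof. by rewrite piE. Qed.

Lemma cycle_boundary (z : cycles C n) : boundary (val z) = 0.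
Proof. by have := valP z; rewrite unfold_in => /andP[_ /eqP]. Qed.

Lemma cycle_homogeneous (z : cycles C n) : homogeneous n (val z).
Proof. by have := valP z; rewrite unfold_in => /andP[]. Qed.

Lemma mem_cycle (x : chain C) : homogeneous n x -> boundary x = 0 -> x \in is_cycle n.
Proof. by move=> hx dx; rewrite unfold_in hx dx eqxx. Qed.

End Homology.

Section Retract.
Variables (A B : zmodType) (p : {additive B -> A}).

Definition ker_pred : {pred B} := fun b => p b == 0.

Fact ker_zmod_closed : zmod_closed ker_pred.
Proof.
split; first by rewrite unfold_in raddf0.
by move=> x y /eqP hx /eqP hy; rewrite unfold_in raddfB hx hy subrr.
Qed.
HB.instance Definition _ := GRing.isZmodClosed.Build B ker_pred ker_zmod_closed.

Record kernel := Kernel { kernel_val : B; kernelP : kernel_val \in ker_pred }.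
HB.instance Definition _ := [isSub for kernel_val].
HB.instance Definition _ := [Choice of kernel by <:].
HB.instance Definition _ := [SubChoice_isSubZmodule of kernel by <:].

Variable i : {additive A -> B}.
Hypothesis ip : cancel i p.

Definition retract_map (x : (A * kernel)%type) : B := i x.1 + val x.2.

Fact retract_map_additive : additive retract_map.
Proof.
by move=> [a k] [a' k']; rewrite /retract_map raddfB opprD addrACA.
Qed.
HB.instance Definition _ := GRing.isZmodMorphism.Build (A * kernel)%type B retract_map retract_map_additive.

(** Subtracting [i (p b)] projects [B] onto the kernel of [p]. The kernel is packed as a group of
    its own because [direct_summand] asks for a complement of type [zmodType]. *)
Lemma retract_direct_summand : direct_summand A B.
Proof.
exists kernel, retract_map.
have kp b : b - i (p b) \in ker_pred by rewrite unfold_in raddfB ip subrr.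
exists (fun b => (p b, Kernel (kp b))) => [[a k]|b]; last first.
  by change (i (p b) + (b - i (p b)) = b); rewrite addrC subrK.
have kv : p (val k) = 0 by apply/eqP; exact: kernelP.
have pa : p (retract_map (a, k)) = a by rewrite raddfD kv addr0.
congr (_, _) => //; apply: val_inj => /=; by rewrite pa addrC addKr.
Qed.

End Retract.

Section HomologyMap.
Variables (C C' : based_complex) (n m k : int) (f : bgen C -> chain C').
Hypothesis mn : m = n + k.
Hypothesis fdeg : forall b, homogeneous (deg b + k) (f b).
Hypothesis fbd : forall b, boundary (f b) = ext f (boundary (delta b)).

Lemma ext_chain_map x : boundary (ext f x) = ext f (boundary x).
Proof.
by rewrite boundary_sub_ext [boundary x]boundary_ext ext_ext; apply: eq_ext => b _.
Qed.

Fact hmap_cycle (z : cycles C n) : ext f (val z) \in is_cycle m.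
Proof.
apply: mem_cycle; first exact: ext_homogeneous fdeg (cycle_homogeneous z) mn.
by rewrite ext_chain_map cycle_boundary ext0.
Qed.

Definition cmap (z : cycles C n) : cycles C' m := Cycle (hmap_cycle z).
Definition hmap (h : homology C n) : homology C' m := hcls (cmap (generic_quotient.repr h)).

Lemma hmap_hcls z : hmap (hcls z) = hcls (cmap z).
Proof.
have : hcls (generic_quotient.repr (hcls z)) = hcls z by exact: generic_quotient.reprK.
move=> /hclsP[x hx e]; apply/hclsP; exists (ext f x).
  by apply: ext_homogeneous fdeg hx _; rewrite mn; ring.
by rewrite ext_chain_map -e extB.
Qed.

Fact hmap_additive : additive hmap.
Proof.
move=> h h'; have [z <-] := hcls_rep h; have [z' <-] := hcls_rep h'.
have e : hcls z - hcls z' = hcls (z - z') by apply/esym/eqP; rewrite eq_sym subr_eq -hclsD subrK.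
rewrite e !hmap_hcls; apply/esym/eqP; rewrite subr_eq -hclsD; apply/eqP; congr hcls.
by apply: val_inj; rewrite /= -extD; rewrite subrK.
Qed.
HB.instance Definition _ := GRing.isZmodMorphism.Build (homology C n) (homology C' m) hmap hmap_additive.

End HomologyMap.

Lemma homology_summand (C C' : based_complex) (k : int) (f : bgen C -> chain C') (g : bgen C' -> chain C) :
  (forall b, homogeneous (deg b + k) (f b)) -> (forall b, boundary (f b) = ext f (boundary (delta b))) ->
  (forall b, homogeneous (deg b - k) (g b)) -> (forall b, boundary (g b) = ext g (boundary (delta b))) ->
  (forall n x, homogeneous n x -> boundary x = 0 ->
     exists2 y, homogeneous (n + 1) y & ext g (ext f x) - x = boundary y) ->
  forall n m, m = n + k -> direct_summand (homology C n) (homology C' m).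
Proof.
move=> fd fb gd gb gf n m mn; have nm : n = m + - k by rewrite mn addrK.
apply: (@retract_direct_summand _ _ (hmap nm gd gb) (hmap mn fd fb)) => h.
have [z <-] := hcls_rep h; rewrite /= !hmap_hcls; apply/hclsP => /=.
exact: gf (cycle_homogeneous z) (cycle_boundary z).
Qed.

End BasedComplexes.

(** * Complexes spanned by labelled finite sets *)

Section SetComplex.
Variables (C : based_complex) (L : eqType) (X : finType).
Variables (lb : bgen C -> L) (st : bgen C -> {set X}) (lt : rel X) (f : L -> int).
Local Notation chain := {ffun bgen C -> int}.
Let pos (c : {set X}) (I : X) := #|[set J in c | lt J I]|.
Hypothesis st_inj : forall b c, lb b = lb c -> st b = st c -> b = c.
Hypothesis bdE : forall b c,
  bd b c = \sum_(I in st b | (lb c == lb b) && (st c == st b :\ I)) (-1) ^+ pos (st b) I.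
Hypothesis degE : forall b, deg b = f (lb b) + #|st b|%:Z.
Hypothesis tot : forall b I J, I \in st b -> J \in st b -> I != J -> lt I J = ~~ lt J I.
Hypothesis irr : forall I, lt I I = false.
Hypothesis conv : forall b e (c : {set X}), lb b = lb e -> st e \subset c -> c \subset st b ->
  exists g, lb g = lb b /\ st g = c.

Lemma bd_face b c I : I \in st b -> lb c = lb b -> st c = (st b :\ I) ->
  bd b c = (-1) ^+ pos (st b) I.
Proof.
move=> Ib lc sc; rewrite bdE lc eqxx sc (bigD1 I) /=; last by rewrite Ib eqxx.
rewrite big1 ?addr0// => J /andP[/andP[Jb /eqP e] JI]; exfalso.
have : J \in (st b :\ J) by rewrite -e !inE JI.
by rewrite !inE eqxx.
Qed.

Lemma bd_neq0 b c : bd b c != 0 -> exists2 I, I \in st b & lb c = lb b /\ st c = (st b :\ I).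
Proof.
rewrite bdE => ne; apply: contrapT => no; move: ne; rewrite big1 ?eqxx// => I /andP[Ib /andP[/eqP h1 /eqP h2]].
by case: no; exists I.
Qed.

Lemma bd_eq0 b c : (forall I, I \in st b -> lb c = lb b -> st c <> (st b :\ I)) -> bd b c = 0.
Proof. by move=> h; apply/eqP; apply: contraT => /bd_neq0[I Ib [lc sc]]; case: (h I Ib lc sc). Qed.

Let pos_del (c : {set X}) I J : pos c J = (((I \in c) && lt I J) + pos (c :\ I) J)%N.
Proof.
rewrite /pos (cardsD1 I) inE; congr (_ + #|pred_of_set _|)%N.
by apply/setP => k; rewrite !inE andbA.
Qed.

(** Simplices and chains of faces both have a boundary that deletes elements with the sign of their
    position. Deleting [I] and [J] in the two orders gives opposite signs, since the removal of the
    smaller one shifts the position of the larger. [conv] guarantees that both intermediate sets are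
    generators. *)
Lemma set_complex : is_complex C.
Proof.
split=> [b c /bd_neq0[I Ib [lc sc]]|b e].
  by rewrite !degE lc sc (cardsD1 I (st b)) Ib addnC PoszD addrA.
case: (pselect (exists c, bd b c * bd c e != 0)) => [[c0]|no]; last first.
  by rewrite big1// => c _; apply/eqP; apply: contraT => h; case: no; exists c.
rewrite mulf_eq0 negb_or => /andP[/bd_neq0[I Ib [l0 s0]] /bd_neq0[J Jc [l1 s1]]].
rewrite s0 !inE in Jc; have /andP[JI Jb] := Jc.
have IJ : I != J by rewrite eq_sym.
have le : lb e = lb b by rewrite l1.
have se : st e = (st b :\ J :\ I).
  by rewrite s1 s0; apply/setP => k; rewrite !inE andbCA.
have [c1 [l2 s2]] : exists g, lb g = lb b /\ st g = (st b :\ J).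
  apply: (conv (esym le)); last by rewrite subD1set.
  by rewrite se subD1set.
have c10 : c1 != c0.
  apply/eqP => ec; have : J \in st c1 by rewrite ec s0 !inE.
  by rewrite s2 !inE eqxx.
rewrite (bigD1 c0)//= (bigD1 c1)//= big1 ?addr0; last first.
  move=> c /andP[cc0 cc1]; apply/eqP; apply: contraT; rewrite mulf_eq0 negb_or.
  move=> /andP[/bd_neq0[I' I'b [l3 s3]] /bd_neq0[J' J'c [l4 s4]]].
  have I'e : I' \notin st e by rewrite s4 s3 !inE eqxx andbF.
  move: I'e; rewrite se !inE I'b andbT negb_and !negbK => /orP[/eqP eI|/eqP eI].
    by move: cc0; rewrite (st_inj (b := c) (c := c0)) ?eqxx ?s3 ?eI// l0.
  by move: cc1; rewrite (st_inj (b := c) (c := c1)) ?eqxx ?l3 ?s3 ?eI.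
have Ic1 : I \in st c1 by rewrite s2 !inE IJ.
have Jc0 : J \in st c0 by rewrite s0 !inE.
rewrite (bd_face Ib l0 s0) (bd_face Jc0 l1 s1) (bd_face Jb l2 s2).
rewrite (@bd_face c1 e I)//; [|by rewrite le l2|by rewrite s2 se].
rewrite s0 s2 (pos_del (st b) J I) (pos_del (st b) I J) Ib Jb /=.
rewrite (tot Ib Jb IJ); case: (lt J I) => /=; rewrite exprS; ring.
Qed.

(* Joining with an apex [m] above all other elements contracts the chains supported under [U]. *)
Variables (m : X) (U : {set X}) (w : L) (d : int).
Hypothesis mlt : forall J, J \in U -> J != m -> lt J m /\ lt m J = false.
Let Q c := [/\ lb c = w, st c \subset U & deg c = d].
Hypothesis add_apex : forall c, Q c -> m \notin st c -> exists g, lb g = lb c /\ st g = (m |: st c).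
Hypothesis del_apex : forall c, Q c -> m \in st c -> exists g, lb g = lb c /\ st g = (st c :\ m).
Hypothesis del_under_apex : forall c I e, Q c -> m \notin st c -> I \in st c -> lb e = lb c ->
  st e = (m |: (st c :\ I)) -> exists g, lb g = lb c /\ st g = (st c :\ I).

Let kc (c : bgen C) : chain :=
  [ffun e => if [&& lb e == lb c, m \notin st c & st e == (m |: st c)] then (-1) ^+ #|st c| else 0].

Let kcE c e : lb e = lb c -> m \notin st c -> st e = (m |: st c) -> kc c e = (-1) ^+ #|st c|.
Proof. by move=> h1 h2 h3; rewrite ffunE h1 h2 h3 !eqxx. Qed.

Let kc_neq0 c e : kc c e != 0 -> [/\ lb e = lb c, m \notin st c & st e = (m |: st c)].
Proof. by rewrite ffunE; case: ifP => [/and3P[/eqP -> -> /eqP ->]|]. Qed.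

Let sum1 (F : bgen C -> int) g0 : (forall g, F g != 0 -> g = g0) -> \sum_g F g = F g0.
Proof.
move=> h; rewrite (bigD1 g0)//= big1 ?addr0// => g ne; apply/eqP; apply: contraT => /h e.
by rewrite e eqxx in ne.
Qed.

Let sum0 (F : bgen C -> int) : (forall g, F g != 0 -> False) -> \sum_g F g = 0.
Proof. by move=> h; rewrite big1// => g _; apply/eqP; apply: contraT => /h. Qed.

Let pos_apex (c : {set X}) : c \subset U -> m \notin c -> pos (m |: c) m = #|c|.
Proof.
move=> /subsetP cU mc; congr #|pred_of_set _|; apply/setP => J; rewrite !inE.
case: (eqVneq J m) => [->|Jm] /=; first by rewrite (negbTE mc).
by case: (boolP (J \in c)) => // /cU /mlt /(_ Jm) [-> _].
Qed.

Let pos_under (c : {set X}) I : c \subset U -> m \notin c -> I \in c -> pos (m |: c) I = pos c I.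
Proof.
move=> /subsetP cU mc Ic; congr #|pred_of_set _|; apply/setP => J; rewrite !inE.
case: (eqVneq J m) => [->|//] /=; have Im : I != m by apply: contraNneq mc => <-.
by have [_ ->] := mlt (cU I Ic) Im; rewrite andbF.
Qed.

Let apexD1 (c : {set X}) I : I != m -> (m |: c) :\ I = m |: (c :\ I).
Proof. by move=> Im; apply/setP => J; rewrite !inE; case: (eqVneq J m) => [->|] //=; rewrite eq_sym Im. Qed.

(** The apex comes last, so adding it and deleting it carry the same sign [(-1) ^+ #|st c|]. A
    deletion below the apex lowers the cardinality by one, which gives the opposite sign in the
    other composite, and these terms cancel; [del_under_apex] supplies the partner of each. *)
Let cone_id c e : Q c -> \sum_g kc c g * bd g e + \sum_g bd c g * kc g e = (e == c)%:R.
Proof.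
move=> Qc; have [lc cU _] := Qc; case: (boolP (m \in st c)) => mc; last first.
  have [g [lg sg]] := add_apex Qc mc.
  have mg : m \in st g by rewrite sg setU11.
  have gm : st g :\ m = st c by rewrite sg setU1K.
  rewrite (sum1 (g0 := g)) => [|g']; last first.
    by rewrite mulf_eq0 negb_or => /andP[/kc_neq0[h1 _ h3] _]; apply: st_inj; rewrite ?lg ?sg.
  rewrite (kcE lg mc sg); have [->|ec] := eqVneq e c.
    rewrite (bd_face mg (esym lg) (esym gm)) sg pos_apex// -exprD addnn -signr_odd odd_double expr0.
    rewrite sum0 ?addr0// => g'; rewrite mulf_eq0 negb_or => /andP[_ /kc_neq0[_ _ h]].
    by move: mc; rewrite h setU11.
  have [be|be] := eqVneq (bd g e) 0.
    rewrite be mulr0 sum0// => g'; rewrite mulf_eq0 negb_or => /andP[/bd_neq0[I Ic [l1 s1]] /kc_neq0[l2 mg' s2]].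
    have Im : I != m by apply: contraNneq mc => <-.
    have Ig : I \in st g by rewrite sg inE Ic orbT.
    have le : lb e = lb g by rewrite l2 lg.
    have se : st e = st g :\ I by rewrite s2 s1 sg apexD1.
    by have /eqP := bd_face Ig le se; rewrite be eq_sym signr_eq0.
  have [I Ig [l1 s1]] := bd_neq0 be.
  have Im : I != m.
    by apply: contra ec => /eqP eI; apply/eqP; apply: st_inj; rewrite ?l1// s1 eI.
  have Ic : I \in st c by move: Ig; rewrite sg !inE (negbTE Im).
  have s1' : st e = m |: (st c :\ I) by rewrite s1 sg apexD1.
  have le : lb e = lb c by rewrite l1.
  have [g' [l2 s2]] := del_under_apex Qc mc Ic le s1'.
  have mg' : m \notin st g' by rewrite s2 inE negb_and mc orbT.
  rewrite (sum1 (g0 := g')) => [|g'']; last first.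
    rewrite mulf_eq0 negb_or => /andP[/bd_neq0[I' I'c [l3 s3]] /kc_neq0[l4 mg'' s4]].
    apply: st_inj; first by rewrite l3.
    by rewrite -(setU1K mg'') -s4 s1' setU1K// -s2.
  rewrite (bd_face Ig l1 s1) sg pos_under// (bd_face Ic l2 s2) (kcE _ mg'); [|by rewrite le l2|by rewrite s2].
  have -> : #|st c| = #|st g'|.+1 by rewrite (cardsD1 I) Ic s2.
  rewrite exprS mulr0n; ring.
rewrite sum0 ?add0r => [|g]; last by rewrite mulf_eq0 negb_or => /andP[/kc_neq0[_ h _] _]; rewrite mc in h.
have [g0 [l0 s0]] := del_apex Qc mc.
have mg0 : m \notin st g0 by rewrite s0 !inE eqxx.
rewrite (sum1 (g0 := g0)) => [|g]; last first.
  rewrite mulf_eq0 negb_or => /andP[/bd_neq0[I Ic [l1 s1]] /kc_neq0[l2 mg s2]].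
  have eI : I = m by apply/eqP; apply: contraNT mg => Im; rewrite s1 !inE mc andbT eq_sym.
  by apply: st_inj; rewrite ?l0// s1 eI.
have pm : pos (st c) m = #|st g0|.
  by rewrite -{1}(setD1K mc) -s0 pos_apex// s0; exact: subset_trans (subD1set _ _) cU.
rewrite (bd_face mc l0 s0) pm; have [->|ec] := eqVneq e c.
  by rewrite kcE ?l0// s0 ?setD1K// -exprD addnn -signr_odd odd_double.
have [->|/kc_neq0[l1 _ s1]] := eqVneq (kc g0 e) 0; first by rewrite mulr0.
by move: ec; rewrite (st_inj (b := e) (c := c)) ?eqxx ?l1 ?l0// s1 s0 setD1K.
Qed.

Lemma cone_acyclic y : homogeneous d y -> supp (fun c => (lb c == w) && (st c \subset U)) y ->
  boundary y = 0 ->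
  exists2 x, homogeneous (d + 1) x & supp (fun c => (lb c == w) && (st c \subset m |: U)) x /\ boundary x = y.
Proof.
move=> /forallP hy sy dy; have Qy c : y c != 0 -> Q c.
  move=> yc; have /andP[/eqP h1 h2] := sy c yc.
  by split=> //; have := hy c; rewrite yc => /eqP.
exists (ext kc y).
  apply/forallP => e; apply/implyP => /ext_support[c [yc /kc_neq0[l1 mc s1]]].
  have [lc cU <-] := Qy c yc.
  by rewrite !degE l1 s1 cardsU1 mc add1n -addn1 PoszD addrA.
split.
  move=> e /ext_support[c [yc /kc_neq0[l1 mc s1]]]; have [lc cU _] := Qy c yc.
  by rewrite l1 lc eqxx s1 setUS.
have e : ext kc (boundary y) = 0 by rewrite dy ext0.
rewrite -[LHS]addr0 -e -[RHS]ext_id boundary_sub_ext [boundary y]boundary_ext ext_ext.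
apply/ffunP => b; rewrite !ffunE -big_split; apply: eq_bigr => c _ /=.
have [->|yc] := eqVneq (y c) 0; first by rewrite !mul0r.
rewrite -mulrDr; congr (_ * _); rewrite [RHS]ffunE -(cone_id b (Qy c yc)) !ffunE; congr (_ + _).
by apply: eq_bigr => g _; rewrite boundary_delta [in LHS]ffunE.
Qed.

End SetComplex.

(** * The augmented simplicial complex *)

Section FaceComplex.
Variables (T : finType) (K : {set {set T}}).
Hypothesis downK : forall I J : {set T}, I \in K -> J \subset I -> J \in K.
Local Notation A := (augmented_complex K).

Definition fc (b : bgen A) : {set T} := val (b : {I : {set T} | I \in K}).
Let vlt (u v : T) := (enum_rank u < enum_rank v)%N.
Let fdim (x : unit) : int := -1.
Let flab (b : bgen A) := tt.

Lemma fc_inj : injective fc. Proof. exact: val_inj. Qed.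

Lemma fc_mem b : fc b \in K. Proof. exact: valP (b : {I : {set T} | I \in K}). Qed.

Lemma fc_exists (I : {set T}) : I \in K -> exists b, fc b = I.
Proof. by move=> IK; exists (exist _ I IK). Qed.

Lemma deg_fc b : deg b = #|fc b|%:Z - 1. Proof. by []. Qed.

Let inj : forall b c, flab b = flab c -> fc b = fc c -> b = c.
Proof. by move=> b c _ /fc_inj. Qed.

Let bdE : forall b c : bgen A, bd b c = \sum_(I in fc b | (flab c == flab b) && (fc c == fc b :\ I))
  (-1) ^+ #|[set J in fc b | vlt J I]|.
Proof. by []. Qed.

Let degE : forall b : bgen A, deg b = fdim (flab b) + #|fc b|%:Z.
Proof. by move=> b. Qed.

Let irr I : vlt I I = false. Proof. by rewrite /vlt ltnn. Qed.

Lemma augmented_is_complex : is_complex A.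
Proof.
apply: (set_complex inj bdE degE) => [b I J _ _ ne|b e c _ _ cb].
  rewrite /vlt -leqNgt ltn_neqAle; case: eqVneq => // e.
  by move: ne; rewrite (enum_rank_inj (ord_inj e)) eqxx.
by have [g <-] := fc_exists (downK (fc_mem b) cb); exists g.
Qed.

Lemma fc_bd b c : bd b c != 0 -> fc c \subset fc b.
Proof. by move=> /(bd_neq0 bdE)[I _ [_ ->]]; exact: subD1set. Qed.

Lemma simplex_acyclic (U : {set T}) d y : U \in K -> U != set0 -> homogeneous d y ->
  supp (fun b => fc b \subset U) y -> boundary y = 0 ->
  exists2 x, homogeneous (d + 1) x & supp (fun b => fc b \subset U) x /\ boundary x = y.
Proof.
move=> UK /set0Pn[u0 u0U] hy sy dy.
(* The cone operator puts its apex last, so the apex is the vertex of [U] of highest rank. *)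
pose m := [arg max_(u > u0 in U) enum_rank u]%N.
have [mU mmax] : m \in U /\ forall u, u \in U -> (enum_rank u <= enum_rank m)%N.
  by rewrite /m; case: arg_maxnP.
have mlt J : J \in U -> J != m -> vlt J m /\ vlt m J = false.
  move=> JU ne; have le := mmax J JU; split; last by rewrite /vlt ltnNge le.
  by rewrite /vlt ltn_neqAle le andbT; apply: contra ne => /eqP/ord_inj/enum_rank_inj ->.
have mUE : (m |: U) = U by apply/setUidPr; rewrite sub1set.
have ex (c : {set T}) : c \subset U -> exists g : bgen A, flab g = tt /\ fc g = c.
  by move=> cU; have [g <-] := fc_exists (downK UK cU); exists g.
have [|||x hx [sx dx]] := @cone_acyclic _ _ _ flab _ _ _ inj bdE degE irr m U tt d mlt _ _ _ y hy sy dy.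
- by move=> c [_ cU _] _; apply: ex; rewrite -mUE setUS.
- by move=> c [_ cU _] _; apply: ex; apply: subset_trans cU; exact: subD1set.
- by move=> c I e [_ cU _] _ _ _ _; apply: ex; apply: subset_trans cU; exact: subD1set.
by exists x => //; split=> // c /sx; rewrite mUE.
Qed.

End FaceComplex.

(** * The parabolic bar complex and its splitting *)

Section BarComplex.
Variables (W : finGroupType) (S : {set W}) (K : {set {set W}}).
Hypotheses (coxS : coxeter_system S) (cplxK : simplicial_complex S K).
Local Notation B := (bar_complex S K).
Local Notation A D := (augmented_complex (induced_subcomplex K D)).
Local Notation chain C := {ffun bgen C -> int}.

Local Notation gens := {x : W * {set {set W}} | bar_gen S K x}.
Definition bw (b : bgen B) : W := (val (b : gens)).1.
Definition bc (b : bgen B) : {set {set W}} := (val (b : gens)).2.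
Let plt (I J : {set W}) := I \proper J.
Let bdim (w : W) : int := (2 * len S w)%N%:Z - 1.

Lemma bar_inj b c : bw b = bw c -> bc b = bc c -> b = c.
Proof.
move=> h1 h2; apply: val_inj; move: h1 h2; rewrite /bw /bc.
by case: (val (b : gens)) (val (c : gens)) => [? ?] [? ?] /= -> ->.
Qed.

Let bdE : forall b c : bgen B, bd b c = \sum_(I in bc b | (bw c == bw b) && (bc c == bc b :\ I))
  (-1) ^+ #|[set J in bc b | plt J I]|.
Proof. by []. Qed.

Lemma deg_bar (b : bgen B) : deg b = (2 * len S (bw b))%N%:Z + #|bc b|%:Z - 1.
Proof. by []. Qed.

Let degE : forall b : bgen B, deg b = bdim (bw b) + #|bc b|%:Z.
Proof. by move=> b; rewrite addrAC. Qed.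

Let irr I : plt I I = false. Proof. exact: properxx. Qed.

Let faceS (I : {set W}) : I \in K -> I \subset S.
Proof. by case: cplxK => _ /subsetP h _ /h; rewrite powersetE. Qed.

Lemma is_face_chainP (c : {set {set W}}) : reflect
  [/\ c != set0, c \subset K & {in c &, forall I J : {set W}, (I \subset J) || (J \subset I)}]
  (is_face_chain K c).
Proof.
apply: (iffP and3P) => -[h1 h2 h3]; split=> //.
  by move=> I J Ic Jc; have /forall_inP/(_ J Jc) := forall_inP h3 I Ic.
by apply/forall_inP => I Ic; apply/forall_inP => J Jc; exact: h3.
Qed.

Lemma chain_top (c : {set {set W}}) : is_face_chain K c -> cover c \in c.
Proof.
move=> /is_face_chainP[/set0Pn[I0 I0c] _ tot].
have [m mc mmax] : exists2 m, m \in c & forall J, J \in c -> (#|J| <= #|m|)%N.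
  by case: (@arg_maxnP _ I0 (mem c) (fun J : {set W} => #|J|) I0c) => m mc mmax; exists m.
suff -> : cover c = m by [].
apply/eqP; rewrite eqEsubset (bigcup_sup m)// andbT; apply/bigcupsP => J Jc.
have /orP[//|mJ] := tot J m Jc mc.
by have /eqP -> : m == J by rewrite eqEcard mJ mmax.
Qed.

Lemma cover_mono (c c' : {set {set W}}) : c' \subset c -> cover c' \subset cover c.
Proof.
move=> /subsetP h; apply/bigcupsP => J /h Jc; exact: (bigcup_sup J).
Qed.

Lemma chain_bot_anti (c c' : {set {set W}}) : c' \subset c -> chain_bot c \subset chain_bot c'.
Proof.
move=> /subsetP h; apply/bigcapsP => J /h Jc; exact: bigcap_inf.
Qed.

Lemma sub_chain (c c' : {set {set W}}) : is_face_chain K c -> c' \subset c -> c' != set0 ->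
  is_face_chain K c'.
Proof.
move=> /is_face_chainP[_ cK tot] s n0; apply/is_face_chainP; split=> //.
  exact: subset_trans s cK.
by move=> I J Ic Jc; apply: tot; exact: (subsetP s).
Qed.

Lemma sub_powerset_cover (c : {set {set W}}) : c \subset powerset (cover c).
Proof. by apply/subsetP => J Jc; rewrite powersetE; exact: (bigcup_sup J). Qed.

Lemma cover_sub (c : {set {set W}}) (U : {set W}) : c \subset powerset U -> cover c \subset U.
Proof. by move=> /subsetP h; apply/bigcupsP => J /h; rewrite powersetE. Qed.

Lemma chain_add (c : {set {set W}}) (U : {set W}) : U \in K -> c \subset powerset U ->
  c == set0 \/ is_face_chain K c -> is_face_chain K (U |: c).
Proof.
move=> UK /subsetP cU h.
have [cK tot] : c \subset K /\ {in c &, forall I J : {set W}, (I \subset J) || (J \subset I)}.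
  case: h => [/eqP ->|/is_face_chainP[]//]; rewrite sub0set; split=> // I J; by rewrite inE.
apply/is_face_chainP; split; first by apply/set0Pn; exists U; rewrite setU11.
  by rewrite subUset sub1set UK.
move=> I J /setU1P[->|Ic] /setU1P[->|Jc]; rewrite ?subxx//; last exact: tot.
  by apply/orP; right; have := cU J Jc; rewrite powersetE.
by apply/orP; left; have := cU I Ic; rewrite powersetE.
Qed.

Lemma chain_bot_sub (c : {set {set W}}) I : I \in c -> chain_bot c \subset I.
Proof. exact: bigcap_inf. Qed.

Let chain_botS (c : {set {set W}}) : is_face_chain K c -> chain_bot c \subset S.
Proof.
move=> /is_face_chainP[/set0Pn[I Ic] /subsetP cK _].
exact: subset_trans (chain_bot_sub Ic) (faceS (cK I Ic)).
Qed.

Lemma bar_chain (b : bgen B) : is_face_chain K (bc b).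
Proof. by have /andP[] := valP (b : gens). Qed.

Lemma bc_card_gt0 (b : bgen B) : (0 < #|bc b|)%N.
Proof. by rewrite card_gt0; have /is_face_chainP[] := bar_chain b. Qed.

Lemma cover_bc (b : bgen B) : cover (bc b) \in K.
Proof. have /is_face_chainP[_ /subsetP h _] := bar_chain b; exact: h (chain_top (bar_chain b)). Qed.

Lemma bar_bot (b : bgen B) : [disjoint chain_bot (bc b) & Des S (bw b)].
Proof.
have [genS _ presS] := coxS.
have /andP[h1 h2] := valP (b : gens).
by rewrite -(min_repsE genS presS)// chain_botS.
Qed.

Lemma bar_exists (w : W) (c : {set {set W}}) : is_face_chain K c -> [disjoint chain_bot c & Des S w] ->
  exists b, bw b = w /\ bc b = c.
Proof.
have [genS _ presS] := coxS; move=> hc hd; have bg : bar_gen S K (w, c).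
  by rewrite /bar_gen hc (min_repsE genS presS)// chain_botS.
by exists (exist _ (w, c) bg).
Qed.

Lemma bar_sub_exists (b : bgen B) (c : {set {set W}}) (I : {set W}) : I \in c -> [disjoint I & Des S (bw b)] ->
  c \subset bc b -> exists g, bw g = bw b /\ bc g = c.
Proof.
move=> Ic dI cb; apply: bar_exists.
  by apply: sub_chain (bar_chain b) cb _; apply/set0Pn; exists I.
exact: disjointWl (chain_bot_sub Ic) dI.
Qed.

Lemma bar_is_complex : is_complex B.
Proof.
apply: (set_complex bar_inj bdE degE) => [b I J Ib Jb ne|b e c be ec cb].
  have /is_face_chainP[_ _ tot] := bar_chain b.
  rewrite /plt !properEneq ne eq_sym ne; case/orP: (tot I J Ib Jb) => h; rewrite h /=.
    by apply/esym/negP => h'; case/eqP: ne; apply/eqP; rewrite eqEsubset h.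
  by apply/negbTE/negP => h'; case/eqP: ne; apply/eqP; rewrite eqEsubset h'.
have /is_face_chainP[/set0Pn[I Ie] _ _] := bar_chain e; apply: bar_exists.
  by apply: sub_chain (bar_chain b) cb _; apply/set0Pn; exists I; exact: (subsetP ec).
by rewrite be; exact: disjointWl (chain_bot_anti ec) (bar_bot e).
Qed.

Lemma bc_bd b c : bd b c != 0 -> bw c = bw b /\ bc c \subset bc b.
Proof. by move=> /(bd_neq0 bdE)[I _ [-> ->]]; split=> //; exact: subD1set. Qed.

(* Deleting the apex can leave a nongenerator only when the empty chain remains. *)
Lemma bar_acyclic (w : W) (U : {set W}) d y : U \in K ->
  ~~ [disjoint U & Des S w] \/ (2 * len S w)%N%:Z < d -> homogeneous d y ->
  supp (fun b => (bw b == w) && (bc b \subset powerset U)) y -> boundary y = 0 ->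
  exists2 x, homogeneous (d + 1) x &
    supp (fun b => (bw b == w) && (bc b \subset powerset U)) x /\ boundary x = y.
Proof.
move=> UK hU hy sy dy.
have UU : U \in powerset U by rewrite powersetE.
have mlt J : J \in powerset U -> J != U -> plt J U /\ plt U J = false.
  rewrite powersetE => JU ne; split; first by rewrite /plt properEneq ne.
  by apply/negbTE; rewrite negb_and JU orbT.
have mUE : (U |: powerset U) = powerset U.
  by apply/setUidPr; rewrite sub1set.
have del (b : bgen B) (c : {set {set W}}) : bw b = w -> bc b = (U |: c) -> c \subset powerset U ->
    ~~ [disjoint U & Des S w] \/ c != set0 -> exists g, bw g = w /\ bc g = c.
  move=> bbw bcE cU h.
  have c0 : c != set0.
    case: h => // h; apply: contra h => /eqP c0; have := bar_bot b.
    by rewrite bcE c0 setU0 /chain_bot big_set1 bbw.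
  apply: bar_exists; first by apply: sub_chain (bar_chain b) _ c0; rewrite bcE subsetUr.
  have := bar_bot b; rewrite bbw; apply: disjointWl; rewrite bcE; apply/bigcapsP => J /setU1P[->|Jc].
    have /set0Pn[I Ic] := c0; apply: subset_trans (chain_bot_sub Ic) _.
    by have := subsetP cU I Ic; rewrite powersetE.
  exact: chain_bot_sub.
have big (c : bgen B) I : bw c = w -> deg c = d -> I \in bc c ->
    ~~ [disjoint U & Des S w] \/ (bc c :\ I) != set0.
  move=> lc dc Ic; case: hU => [|hd]; [by left|right]; rewrite -card_gt0.
  move: hd; rewrite -dc deg_bar lc (cardsD1 I (bc c)) Ic.
  by move: (#|_|)%N (len _ _) => u v; lia.
have [|||x hx [sx dx]] :=
    @cone_acyclic _ _ _ bw _ _ _ bar_inj bdE degE irr U (powerset U) w d mlt _ _ _ y hy sy dy.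
- move=> c [lc cU _] _; apply: bar_exists.
    by apply: chain_add => //; right; exact: bar_chain.
  by apply: disjointWl (chain_bot_anti _) (bar_bot c); exact: subsetUr.
- move=> c [lc cU dc] Uc; rewrite lc; apply: (del c) => //; first by rewrite setD1K.
    by apply: subset_trans cU; exact: subD1set.
  exact: big.
- move=> c I e [lc cU dc] Uc Ic le se; rewrite lc; apply: (del e) => //; first by rewrite le.
    by apply: subset_trans cU; exact: subD1set.
  exact: big.
by exists x => //; split=> // c /sx; rewrite mUE.
Qed.

Lemma bar_pair (b b0 b1 : bgen B) (I J : {set W}) : I \proper J -> bc b = [set I; J] ->
  bw b0 = bw b -> bc b0 = [set I] -> bw b1 = bw b -> bc b1 = [set J] ->
  boundary (delta b) = delta b1 - delta b0.
Proof.
move=> IJ bcb l0 s0 l1 s1; have ne : I != J by move: IJ; rewrite properEneq => /andP[].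
have Ib : I \in bc b by rewrite bcb !inE eqxx.
have Jb : J \in bc b by rewrite bcb !inE eqxx orbT.
have bI : (bc b :\ I) = [set J].
  by apply/setP => k; rewrite bcb !inE; case: (eqVneq k I) => [->|] //=; rewrite (negbTE ne).
have bJ : (bc b :\ J) = [set I].
  apply/setP => k; rewrite bcb !inE; case: (eqVneq k J) => [->|] //=; last by rewrite orbF.
  by rewrite eq_sym (negbTE ne).
have pI : #|[set k in bc b | plt k I]| = 0%N.
  apply/eqP; rewrite cards_eq0; apply/eqP/setP => k; rewrite bcb !inE.
  case: (eqVneq k I) => [->|_] /=; first exact: irr.
  case: (eqVneq k J) => [->|//] /=; apply/negbTE; rewrite negb_and negbK.
  by rewrite (proper_sub IJ) orbT.
have pJ : #|[set k in bc b | plt k J]| = 1%N.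
  apply/eqP/cards1P; exists I; apply/setP => k; rewrite bcb !inE.
  case: (eqVneq k I) => [->|_] //=; case: (eqVneq k J) => [->|//] /=; exact: irr.
apply/ffunP => c; rewrite boundary_delta !ffunE.
have [->|c1] := eqVneq c b1.
  have -> : (b1 == b0) = false.
    apply/eqP => e; have : I \in bc b1 by rewrite e s0 inE.
    by rewrite s1 inE (negbTE ne).
  by rewrite (bd_face bdE Ib l1 _) ?bI// pI.
have [->|c0] := eqVneq c b0; first by rewrite (bd_face bdE Jb l0 _) ?bJ// pJ.
rewrite subr0; apply: (bd_eq0 bdE) => k; rewrite bcb !inE => /orP[/eqP ->|/eqP ->] lc sc.
  by move: c1; rewrite (@bar_inj c b1) ?eqxx ?l1// s1 -bI bcb.
by move: c0; rewrite (@bar_inj c b0) ?eqxx ?l0// s0 -bJ bcb.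
Qed.

Lemma induced_down D (I J : {set W}) : I \in induced_subcomplex K D -> J \subset I -> J \in induced_subcomplex K D.
Proof.
case: cplxK => _ _ down; rewrite !inE => /andP[IK ID] JI.
by rewrite (down I J IK JI) (subset_trans JI ID).
Qed.

Let cA D : is_complex (A D) := augmented_is_complex (@induced_down D).
Let cB : is_complex B := bar_is_complex.

Let degA D (b : bgen (A D)) : -1 <= deg b.
Proof. by rewrite deg_fc; lia. Qed.

Let degB (b : bgen B) : -1 <= deg b.
Proof. by rewrite deg_bar; lia. Qed.

Lemma empty_simplex D : exists e : bgen (A D), fc e = set0.
Proof. by apply: fc_exists; case: cplxK => K0 _ _; rewrite inE K0 sub0set. Qed.

Lemma boundary_empty D (b : bgen (A D)) : fc b = set0 -> boundary (delta b) = 0.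
Proof.
move=> b0; apply/ffunP => c; rewrite boundary_delta !ffunE; apply/eqP; apply: contraT => ne.
by case: (cA D) => /(_ b c ne) + _; rewrite !deg_fc b0 cards0; lia.
Qed.

Lemma boundary_vertex (b : bgen B) : #|bc b| = 1%N -> boundary (delta b) = 0.
Proof.
move=> b1; apply/ffunP => c; rewrite boundary_delta !ffunE; apply/eqP; apply: contraT => ne.
have [lc _] := bc_bd ne; have := bc_card_gt0 c.
by case: cB => /(_ b c ne) + _; rewrite !deg_bar lc; lia.
Qed.

Lemma empty_chain (w : W) : exists e : bgen B, bw e = w /\ bc e = [set set0].
Proof.
case: cplxK => K0 _ _; apply: bar_exists.
  apply/is_face_chainP; split; first by apply/set0Pn; exists set0; rewrite inE.
    by rewrite sub1set.
  by move=> I J; rewrite inE => /eqP -> _; rewrite sub0set.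
by rewrite /chain_bot big_set1; apply/pred0P => s; rewrite !inE.
Qed.

(** The empty face has degree [-1] and the one-element chain at [w] formed by the empty face has
    degree [2 * len S w]; the difference is the shift. *)
Definition bar_shift (w : W) : int := (2 * len S w)%N%:Z + 1.

Definition is_inclusion w (f : bgen (A (Des S w)) -> chain B) :=
  (forall b, [/\ homogeneous (deg b + bar_shift w) (f b),
    supp (fun e => (bw e == w) && (bc e \subset powerset (fc b))) (f b) &
    boundary (f b) = ext f (boundary (delta b))]) /\
  forall b e, fc b = set0 -> bw e = w -> bc e = [set set0] -> f b = delta e.

(** A form of barycentric subdivision. A nonempty face inside the descent set meets it, so the
    chains of its subsets are an acyclic carrier; all of them start at the empty set. Only the empty
    face needs a value given by hand. *)
Lemma bar_inclusion w : exists f, @is_inclusion w f.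
Proof.
have [e0 [le se]] := empty_chain w.
pose carr (b : bgen (A (Des S w))) (e : bgen B) := (bw e == w) && (bc e \subset powerset (fc b)).
have [|||||||f [fP fI]] := @carrier_extend (A (Des S w)) B (bar_shift w) 1 carr
  (fun b => fc b == set0) (fun=> delta e0) (fun=> 0) (cA _) (@degA _).
- move=> b c ne e /andP[h1 h2]; rewrite /carr h1 (subset_trans h2)//.
  by rewrite powersetS (fc_bd ne).
- by move=> b c ne /eqP b0; have := fc_bd ne; rewrite b0 subset0.
- by move=> b; exact: homogeneous0.
- by move=> b c; rewrite ffunE.
- by move=> b; rewrite boundary0 (ext_eq0 (fun _ _ => erefl)) oppr0.
- move=> b /eqP b0; split.
  + by apply: homogeneous_delta; rewrite deg_bar deg_fc b0 le se cards1 cards0.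
  + move=> e; rewrite ffunE; have [->|] := eqVneq e e0; last by rewrite eqxx.
    by move=> _; rewrite /carr le se eqxx sub1set powersetE sub0set.
  + by rewrite boundary_empty// ext0 addr0 boundary_vertex// se cards1.
- move=> b y b0 hy sy dy; have := valP (b : {I : {set W} | I \in induced_subcomplex K (Des S w)}).
  rewrite -/(fc b) inE => /andP[bK bD].
  have [|x hx [sx dx]] := bar_acyclic bK _ hy sy dy.
  + left; apply: contra b0 => /pred0P h; rewrite -subset0; apply/subsetP => s sb.
    by have := h s; rewrite /= sb (subsetP bD s sb).
  + by exists x => //; move: hx; rewrite subrK.
exists f; split.
  by move=> b; have [h1 h2 h3] := fP b; rewrite h3 add0r.
move=> b e b0 lb sb; have -> : e = e0 by apply: bar_inj; [rewrite lb le | rewrite sb se].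
by apply: fI; rewrite b0.
Qed.

Definition is_retraction w (g : bgen B -> chain (A (Des S w))) := [/\
  forall b, [/\ homogeneous (deg b - bar_shift w) (g b),
    supp (fun e => fc e \subset cover (bc b)) (g b) &
    boundary (g b) = ext g (boundary (delta b))],
  forall b, bw b != w -> g b = 0 &
  forall b e, bw b = w -> #|bc b| = 1%N -> [disjoint cover (bc b) & Des S w] -> fc e = set0 ->
    g b = delta e].

(** A chain with top face [I] is carried by the simplex [I :&: Des S w], which is acyclic as soon as
    it is nonempty. *)
Lemma bar_retraction w : exists g, @is_retraction w g.
Proof.
have [e0 e00] := empty_simplex (Des S w).
pose carr (b : bgen B) (e : bgen (A (Des S w))) := fc e \subset cover (bc b).
(* When the top face contains no descent the carrier is just the empty face, so the values are
   prescribed: one-element chains go to the empty face, longer chains to zero. *)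
pose g0 (b : bgen B) : chain (A (Des S w)) := if (bw b == w) && (#|bc b| == 1%N) then delta e0 else 0.
have [|||||||g [gP gI]] := @carrier_extend B (A (Des S w)) (- bar_shift w) 1 carr
  (fun b => (bw b != w) || [disjoint cover (bc b) & Des S w]) g0 (fun=> 0) cB degB.
- by move=> b c ne e /subset_trans; apply; apply: cover_mono; have [] := bc_bd ne.
- move=> b c ne; have [-> sc] := bc_bd ne; case/orP => [->//|h]; apply/orP; right.
  exact: disjointWl (cover_mono sc) h.
- by move=> b; exact: homogeneous0.
- by move=> b c; rewrite ffunE.
- by move=> b; rewrite boundary0 (ext_eq0 (fun _ _ => erefl)) oppr0.
- move=> b hb; split.
  + rewrite /g0; case: ifP => [/andP[/eqP lb /eqP b1]|_]; last exact: homogeneous0.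
    by apply: homogeneous_delta; rewrite deg_bar deg_fc lb e00 cards0 /bar_shift; lia.
  + move=> e; rewrite /g0; case: ifP => _; rewrite ffunE ?eqxx//.
    by have [-> _|] := eqVneq e e0; rewrite ?eqxx// /carr e00 sub0set.
  rewrite add0r mulr1z (_ : boundary (g0 b) = 0); last first.
    by rewrite /g0; case: ifP => _; rewrite ?boundary0// boundary_empty.
  apply/esym; have [lb|nb] := eqVneq (bw b) w; last first.
    by apply: ext_eq0 => c; rewrite boundary_delta ffunE => /bc_bd[lc _]; rewrite /g0 lc (negbTE nb).
  rewrite lb eqxx /= in hb; have [b1|b1] := eqVneq #|bc b| 1%N; first by rewrite boundary_vertex// ext0.
  (* Chains with more than two elements have no one-element faces, so all terms vanish. For two
     elements both faces have the same prescribed value and occur with opposite signs. *)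
  have [/eqP/cards2P[I [J [IJ bE]]]|b2] := eqVneq #|bc b| 2%N; last first.
    apply: ext_eq0 => c; rewrite boundary_delta ffunE => ne; rewrite /g0.
    case: ifP => // /andP[_ /eqP c1]; have [lc _] := bc_bd ne.
    by case: cB => /(_ b c ne) + _; rewrite !deg_bar lc; lia.
  have vtx I' : I' \in bc b -> exists g : bgen B, bw g = bw b /\ bc g = [set I'].
    move=> I'b; apply: (bar_sub_exists (I := I')); rewrite ?sub1set ?inE//.
    by rewrite lb; apply: disjointWl hb; exact: (bigcup_sup I').
  have [bI [lI sI]] : exists g : bgen B, bw g = bw b /\ bc g = [set I] by apply: vtx; rewrite bE !inE eqxx.
  have [bJ [lJ sJ]] : exists g : bgen B, bw g = bw b /\ bc g = [set J] by apply: vtx; rewrite bE !inE eqxx orbT.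
  have e c : bw c = bw b -> #|bc c| = 1%N -> g0 c = delta e0 by move=> lc c1; rewrite /g0 lc lb c1 eqxx.
  have eI : g0 bI = delta e0 by apply: e; [exact: lI | rewrite sI cards1].
  have eJ : g0 bJ = delta e0 by apply: e; [exact: lJ | rewrite sJ cards1].
  have /is_face_chainP[_ _ /(_ I J)] := bar_chain b; rewrite bE !inE !eqxx orbT => /(_ isT isT) /orP[h|h].
    rewrite (@bar_pair b bI bJ I J)//; last by rewrite properEneq IJ.
    exact: (ext_pair (etrans eI (esym eJ))).
  rewrite (@bar_pair b bJ bI J I)//; [|by rewrite properEneq eq_sym IJ|by rewrite setUC].
  exact: (ext_pair (etrans eJ (esym eI))).
- move=> b y; rewrite negb_or negbK => /andP[/eqP lb nd] hy sy dy.
  have hU : (cover (bc b) :&: Des S w) \in induced_subcomplex K (Des S w).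
    rewrite inE subsetIr andbT; case: cplxK => _ _ down; apply: down (subsetIl _ _).
    have /is_face_chainP[_ /subsetP h _] := bar_chain b; exact: h (chain_top (bar_chain b)).
  have [||x hx [sx dx]] := @simplex_acyclic _ _ (@induced_down _) _ _ y hU _ hy _ dy.
  + apply: contra nd => /eqP h; apply/pred0P => s; have /setP/(_ s) := h.
    by rewrite !inE.
  + move=> e /sy h; rewrite subsetI [_ \subset _]h; have := valP (e : {I : {set W} | I \in induced_subcomplex K (Des S w)}).
    by rewrite inE => /andP[].
  exists x; first by move: hx; rewrite subrK.
  by split=> // e /sx; rewrite subsetI => /andP[].
exists g; split.
- by move=> b; have [h1 h2 h3] := gP b; rewrite h3 add0r.
- by move=> b nb; rewrite gI /g0 (negbTE nb).
- move=> b e lb b1 db ee; rewrite gI; last by rewrite db orbT.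
  by rewrite /g0 lb b1 eqxx; congr delta; apply: fc_inj; rewrite ee.
Qed.

Let inc w : bgen (A (Des S w)) -> chain B := sval (cid (bar_inclusion w)).
Let ret w : bgen B -> chain (A (Des S w)) := sval (cid (bar_retraction w)).

Let incS w : is_inclusion (@inc w) := svalP (cid (bar_inclusion w)).
Let retS w : is_retraction (ret w) := svalP (cid (bar_retraction w)).
Let incP w b := (incS w).1 b.
Let retP w b := let: And3 h _ _ := retS w in h b.

Let inc_chain w x : boundary (ext (@inc w) x) = ext (@inc w) (boundary x).
Proof. by apply: ext_chain_map => b; have [] := incP b. Qed.

Let ret_chain w x : boundary (ext (ret w) x) = ext (ret w) (boundary x).
Proof. by apply: ext_chain_map => b; have [] := retP w b. Qed.

Lemma retraction_inclusion (w : W) : exists h : bgen (A (Des S w)) -> chain (A (Des S w)),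
  forall b, homogeneous (deg b + 1) (h b) /\
    boundary (h b) = ext (ret w) (inc b) - delta b + ext h (boundary (delta b)) *~ (-1).
Proof.
pose U (b : bgen (A (Des S w))) := ext (ret w) (inc b) - delta b.
have [||||||||h [hP _]] := @carrier_extend (A (Des S w)) (A (Des S w)) 1 (-1)
  (fun b e => fc e \subset fc b) (fun b => fc b == set0) (fun=> 0) U (cA _).
- by move=> b; rewrite deg_fc; lia.
- by move=> b c ne e h; apply: subset_trans h (fc_bd ne).
- by move=> b c ne /eqP b0; have := fc_bd ne; rewrite b0 subset0.
- move=> b; rewrite addrK; apply: homogeneousB; last exact: homogeneous_delta.
  have [hi _ _] := incP b; apply: ext_homogeneous (fun e => let: And3 h _ _ := retP w e in h) hi _.
  by rewrite addrK.
- move=> b e; rewrite !ffunE => ne; have [->|eb] := eqVneq e b; first exact: subxx.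
  move: ne; rewrite (negbTE eb) subr0 => ne.
  have [c [cb ec]] : exists c, inc b c != 0 /\ ret w c e != 0 by apply: ext_support; rewrite ffunE.
  have [_ /(_ c cb)/andP[_ cs] _] := incP b; have [_ /(_ e ec) es _] := retP w c.
  exact: subset_trans es (cover_sub cs).
- move=> b; rewrite mulrN1z opprK boundaryB ret_chain ext_sub_delta; have [_ _ ->] := incP b.
  by rewrite ext_ext.
- move=> b /eqP b0; split; first exact: homogeneous0.
    by move=> e; rewrite ffunE.
  rewrite boundary0 (boundary_empty b0) ext0 mul0rz addr0 /U.
  have [[_ _ r0] [e [le se]]] := (retS w, empty_chain w).
  rewrite ((incS w).2 _ _ b0 le se) ext_delta (r0 _ _ le _ _ b0) ?subrr// se ?cards1//.
  by rewrite cover1; apply/pred0P => s; rewrite !inE.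
- move=> b y b0 hy sy dy.
  have [x hx [sx dx]] := simplex_acyclic (@induced_down _) (fc_mem b) b0 hy sy dy.
  by exists x => //; move: hx; rewrite addrK.
by exists h => b; have [] := hP b.
Qed.

(** As [ret w] vanishes on chains at another group element, this is the sum over [w] of the
    composites of [ret w] and [inc w]. *)
Let proj (b : bgen B) : chain B := ext (@inc (bw b)) (ret (bw b) b).

Let proj_bd b : boundary (proj b) = ext proj (boundary (delta b)).
Proof.
rewrite /proj inc_chain; have [_ _ ->] := retP (bw b) b; rewrite ext_ext; apply: eq_ext => c.
by rewrite boundary_delta ffunE => /bc_bd[-> _].
Qed.

(** The chains of subsets of the top face are a carrier that is acyclic above its lowest degree
    [2 * len S w]; only the one-element chains need a homotopy given by hand. *)
Lemma inclusion_retraction : exists h : bgen B -> chain B,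
  forall b, homogeneous (deg b + 1) (h b) /\
    boundary (h b) = proj b - delta b + ext h (boundary (delta b)) *~ (-1).
Proof.
pose carr (b e : bgen B) := (bw e == bw b) && (bc e \subset powerset (cover (bc b))).
(* In the lowest degree the carrier of a one-element chain [I] is not acyclic. There [proj] gives
   the chain formed by the empty face, and the edge from the empty face to [I] joins it to the given
   one. *)
have edge (b : bgen B) : exists x : chain B, #|bc b| = 1%N ->
    [/\ homogeneous (deg b + 1) x, supp (carr b) x & boundary x = proj b - delta b].
  have [b1|/eqP nb] := eqVneq #|bc b| 1%N; last by exists 0 => /nb.
  have /eqP/cards1P[I bI] := b1.
  have cI : cover (bc b) = I by rewrite bI cover1.
  have dI : [disjoint I & Des S (bw b)].
    by have := bar_bot b; rewrite bI /chain_bot big_set1.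
  have IK : I \in K by rewrite -cI cover_bc.
  have [s s0] := empty_simplex (Des S (bw b)).
  have [e0 [le se]] := empty_chain (bw b).
  have pE : proj b = delta e0.
    by have [_ _ r0] := retS (bw b); rewrite /proj (r0 _ _ erefl b1 _ s0) ?cI// ext_delta ((incS _).2 _ _ s0 le se).
  have [I0|I0] := eqVneq I set0.
    have eb : e0 = b by apply: bar_inj; [exact: le | rewrite se bI I0].
    exists 0 => _; split; first exact: homogeneous0.
      by move=> c; rewrite ffunE.
    by rewrite boundary0 pE eb subrr.
  have pI : set0 \proper I by rewrite properEneq eq_sym I0 sub0set.
  have cc : is_face_chain K [set set0; I].
    apply/is_face_chainP; split; first by apply/set0Pn; exists I; rewrite !inE eqxx orbT.
      by case: cplxK => K0 _ _; rewrite subUset !sub1set K0.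
    by move=> J J'; rewrite !inE => /orP[]/eqP -> /orP[]/eqP ->; rewrite ?subxx ?sub0set ?orbT.
  have [g [lg sg]] : exists g : bgen B, bw g = bw b /\ bc g = [set set0; I].
    apply: (bar_exists cc); apply: disjointWl (chain_bot_sub _) dI.
    by rewrite !inE eqxx orbT.
  have g2 : #|bc g| = 2%N by rewrite sg cards2 eq_sym I0.
  exists (- delta g) => _; split.
  - rewrite -[- _]add0r; apply: homogeneousB; first exact: homogeneous0.
    by apply: homogeneous_delta; rewrite !deg_bar lg; lia.
  - move=> c; rewrite !ffunE; have [->|] := eqVneq c g; last by rewrite eqxx.
    move=> _; rewrite /carr lg eqxx sg cI subUset !sub1set !powersetE.
    by rewrite sub0set subxx.
  - by rewrite boundaryN pE (bar_pair pI sg _ se _ bI) ?le// opprB.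
have [h0 h0P] := choice edge.
have [||||||||h [hP _]] := @carrier_extend B B 1 (-1) carr (fun b => #|bc b| == 1%N) h0
  (fun b => proj b - delta b) cB.
- by move=> b; rewrite deg_bar; lia.
- move=> b c ne e /andP[h1 h2]; have [lc sc] := bc_bd ne; rewrite /carr -lc h1.
  by apply: subset_trans h2 _; rewrite powersetS cover_mono.
- move=> b c ne /eqP b1; have [lc _] := bc_bd ne; have := bc_card_gt0 c.
  by case: cB => /(_ b c ne) + _; rewrite !deg_bar lc; lia.
- move=> b; rewrite addrK; apply: homogeneousB; last exact: homogeneous_delta.
  have [hr _ _] := retP (bw b) b.
  by apply: ext_homogeneous (fun e => let: And3 h _ _ := incP e in h) hr _; rewrite subrK.
- move=> b e; rewrite !ffunE => ne; have [->|eb] := eqVneq e b.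
    by rewrite /carr eqxx sub_powerset_cover.
  move: ne; rewrite (negbTE eb) subr0 => ne.
  have [c [cb ec]] : exists c, ret (bw b) b c != 0 /\ inc c e != 0 by apply: ext_support; rewrite ffunE.
  have [_ /(_ c cb) cs _] := retP (bw b) b; have [_ /(_ e ec)/andP[le es] _] := incP c.
  by rewrite /carr le; apply: subset_trans es _; rewrite powersetS.
- by move=> b; rewrite opprK boundaryB proj_bd ext_sub_delta.
- move=> b /eqP b1; have [h1 h2 h3] := h0P b b1; split=> //.
  by rewrite (boundary_vertex b1) ext0 mul0rz addr0.
- move=> b y b1 hy sy dy.
  have [|x hx [sx dx]] := bar_acyclic (cover_bc b) _ hy sy dy.
    right; rewrite addrK deg_bar; move: b1 (bc_card_gt0 b).
    by move: (len _ _) => L; lia.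
  by exists x => //; move: hx; rewrite addrK.
by exists h => b; have [] := hP b.
Qed.

Lemma reduced_homology_summand (D : {set W}) (wD : W) (j : int) : D \subset S -> longest_in S D wD ->
  direct_summand (reduced_homology (induced_subcomplex K D) j)
    (homology B ((2 * len S wD)%N%:Z + j + 1)).
Proof.
have [genS invS presS] := coxS; move=> DS hD; have <- := longest_Des genS invS presS DS hD.
apply: (@homology_summand _ _ (bar_shift wD) (@inc wD) (ret wD)).
- by move=> b; have [] := incP b.
- by move=> b; have [] := incP b.
- by move=> b; have [] := retP wD b.
- by move=> b; have [] := retP wD b.
- move=> n x hx dx; have [h hP] := retraction_inclusion wD; exists (ext h x).
    exact: ext_homogeneous (fun b => (hP b).1) hx _.
  rewrite ext_ext -(homotopy_cycle (fun b => (hP b).2) dx); exact/esym/ext_sub_delta.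
- by rewrite addrA; lia.
Qed.

Lemma longest_exists (D : {set W}) : exists w, longest_in S D w.
Proof.
exists [arg max_(w > (1 : W)%g in <<D>>%g) len S w]; case: arg_maxnP => [|w wD wmax]; first exact: group1.
by split=> // v vD.
Qed.

Lemma bar_torsion_free : (forall n, torsion_free (homology B n)) <->
  (forall D : {set W}, D \subset S -> forall j, torsion_free (reduced_homology (induced_subcomplex K D) j)).
Proof.
split=> [tf D DS j x m m0 xm|tf n x m m0 xm].
  have [wD hD] := longest_exists D.
  have [C [f [g fg gf]]] := reduced_homology_summand j DS hD.
  have : f (x, 0) = 0.
    apply: (tf _ _ m) => //; rewrite -raddfMn (_ : (x, 0) *+ m = 0) ?raddf0//.
    have -> k : (x, 0 : C) *+ k = (x *+ k, 0).
      by elim: k => // k IH; rewrite !mulrS IH; congr (_, _); rewrite addr0.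
    by rewrite xm.
  by move=> /(congr1 g); rewrite fg -(raddf0 f) fg => -[].
have DesS w : Des S w \subset S by apply/subsetP => s; rewrite inE => /andP[].
have [z zx] := hcls_rep x; have hz := cycle_homogeneous z; have dz := cycle_boundary z.
(* Each retraction sends a torsion class to a torsion class of some reduced homology group, hence to
   zero. *)
have bound w : exists u : chain (A (Des S w)), homogeneous (n - bar_shift w + 1) u /\
    ext (ret w) (val z) = boundary u.
  pose rw := hmap (erefl (n - bar_shift w)) (fun b => let: And3 h _ _ := retP w b in h)
    (fun b => let: And3 _ _ h := retP w b in h).
  have : rw x = 0.
    by apply: (tf _ (DesS w) _ _ m m0); rewrite -raddfMn xm raddf0.
  rewrite -zx /rw hmap_hcls -hcls0 => /hclsP[u hu e]; exists u; split=> //.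
  by move: e; rewrite subr0.
have [u uP] : exists u : forall w, chain (A (Des S w)), forall w, homogeneous (n - bar_shift w + 1) (u w) /\
    ext (ret w) (val z) = boundary (u w).
  by exists (fun w => sval (cid (bound w))) => w; exact: svalP (cid (bound w)).
have [h hP] := inclusion_retraction.
have hE := homotopy_cycle (fun b => (hP b).2) dz; rewrite ext_sub_delta in hE.
(* The bounding chains of the retractions, pushed back by the inclusions and summed over [w], bound
   the image of the cycle under [proj], which is homotopic to the identity. *)
have pE : ext proj (val z) = boundary (\sum_w ext (@inc w) (u w)).
  have bsum (F : W -> chain B) : boundary (\sum_w F w) = \sum_w boundary (F w).
    by elim/big_rec2: _ => [|w y y' _ <-]; [exact: boundary0 | exact: boundaryD].
  rewrite bsum; under [RHS]eq_bigr => w _ do rewrite inc_chain -(uP w).2 ext_ext.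
  apply/ffunP => c; rewrite sum_ffunE ffunE.
  under [RHS]eq_bigr => w _ do rewrite ffunE.
  rewrite exchange_big; apply: eq_bigr => b _; rewrite (bigD1 (bw b))//= big1 ?addr0// => w wb.
  by have [_ r0 _] := retS w; rewrite r0 1?eq_sym// ext0 ffunE mulr0.
rewrite -zx -hcls0; apply/hclsP; exists (\sum_w ext (@inc w) (u w) - ext h (val z)).
  apply: homogeneousB; last by apply: ext_homogeneous (fun b => (hP b).1) hz _.
  elim/big_rec: _ => [|w y _ hy]; first exact: homogeneous0.
  apply: homogeneousD hy; have [hu _] := uP w.
  by apply: ext_homogeneous (fun e => let: And3 h _ _ := incP e in h) hu _; rewrite addrAC subrK.
by rewrite subr0 boundaryB -pE -hE opprB addrC subrK.
Qed.

End BarComplex.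

From mathcomp Require Import all_classical all_reals all_analysis complex.

Import Order.TTheory GRing.Theory Num.Theory numFieldNormedType.Exports.

Local Open Scope classical_set_scope.
Local Open Scope ring_scope.

(** * Calculus and Smith theory *)

Section Calculus.
Variable R : realType.

Lemma half_gt0 (e : R) : 0 < e -> 0 < e / 2.
Proof. by move=> e0; rewrite divr_gt0. Qed.

Lemma mx_norm_le m n (A : 'M[R]_(m, n)) e :
  0 <= e -> (forall i j, `|A i j| <= e) -> `|A| <= e.
Proof.
move=> e0 h; rewrite [leLHS]/Num.Def.normr/= mx_normrE.
by apply: bigmax_le => // -[i j] _.
Qed.

Lemma mx_norm_ge m n (A : 'M[R]_(m, n)) i j : `|A i j| <= `|A|.
Proof.
rewrite [leRHS]/Num.Def.normr/= mx_normrE.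
exact: (le_bigmax _ (fun k : 'I_m * 'I_n => `|A k.1 k.2|) (i, j)).
Qed.

Lemma mulmx_norm_le m n p (A : 'M[R]_(m, n)) (B : 'M[R]_(n, p)) :
  `|A *m B| <= n%:R * (`|A| * `|B|).
Proof.
apply: mx_norm_le => [|i j]; first by rewrite ?ler0n.
rewrite mxE (le_trans (ler_norm_sum _ _ _))//.
have -> : n%:R * (`|A| * `|B|) = \sum_(k < n) (`|A| * `|B|).
  by rewrite sumr_const card_ord mulr_natl.
by apply: ler_sum => k _; rewrite normrM ler_pM ?mx_norm_ge.
Qed.

Definition dirD m n (f : 'rV[R]_m -> 'rV[R]_n) (k : 'I_m) (x : 'rV[R]_m) :=
  'D_(delta_mx 0 k) f x.

Definition jac m n (f : 'rV[R]_m -> 'rV[R]_n) (x : 'rV[R]_m) : 'M[R]_(m, n) :=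
  \matrix_(k, j) dirD f k x 0 j.

Lemma MVT_abs (f df : R -> R) (t w : R) :
  (forall s, `|s| <= `|t| -> 0 <= s * t -> is_derive s 1 f (df s)) ->
  (forall s, `|s| <= `|t| -> 0 <= s * t -> `|df s| <= w) ->
  `|f t - f 0| <= w * `|t|.
Proof.
move=> fdf dfw.
have fc a b : (forall s, s \in `[a, b] -> `|s| <= `|t| /\ 0 <= s * t) ->
    {within `[a, b], continuous f}.
  move=> h; apply: derivable_within_continuous => x /h[x1 x2].
  by have [] := fdf _ x1 x2.
have [t0|t0] := leP 0 t.
  have H s : s \in `[0, t] -> `|s| <= `|t| /\ 0 <= s * t.
    rewrite in_itv/= => /andP[s0 st]; rewrite !ger0_norm//.
    by rewrite mulr_ge0.
  have [|c /H[c1 c2] ->] := @MVT_segment R f df 0 t t0 _ (fc _ _ H).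
    by move=> x /subset_itv_oo_cc /H[x1 x2]; exact: fdf.
  by rewrite subr0 normrM ler_wpM2r// dfw.
have H s : s \in `[t, 0] -> `|s| <= `|t| /\ 0 <= s * t.
  rewrite in_itv/= => /andP[s0 st]; rewrite !ler0_norm ?(ltW t0)// lerN2 s0.
  by rewrite mulr_le0 ?(ltW t0).
have [|c /H[c1 c2] e] := @MVT_segment R f df t 0 (ltW t0) _ (fc _ _ H).
  by move=> x /subset_itv_oo_cc /H[x1 x2]; exact: fdf.
by rewrite distrC e sub0r normrM normrN ler_wpM2r// dfw.
Qed.

Lemma dirD_coord m n (f : 'rV[R]_m -> 'rV[R]_n) k x (s : R) j :
  derivable f (x + s *: delta_mx 0 k) (delta_mx 0 k) ->
  is_derive s (1 : R) (fun t => f (x + t *: delta_mx 0 k) 0 j)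
    (dirD f k (x + s *: delta_mx 0 k) 0 j).
Proof.
move=> df; set d := delta_mx 0 k in df *.
have E : forall t, (fun h : R => h^-1 *: ((f \o shift (x + t *: d)) (h *: d) - f (x + t *: d)))
    = (fun h => h^-1 *: (((fun t : R => f (x + t *: d)) \o shift t) (h *: (1:R)) - f (x + t *: d))).
  move=> t; apply/funext => h /=.
  by rewrite [h *: 1]mulr1 scalerDl addrCA.
have d1 : derivable (fun t : R => f (x + t *: d)) s 1.
  by move: df; rewrite /derivable E.
have dj : derivable (fun t : R => f (x + t *: d) 0 j) s 1.
  exact: ((derivable_mxP _ _ _).1 d1).
apply: DeriveDef => //.
have -> : dirD f k (x + s *: d) = 'D_1 (fun t : R => f (x + t *: d)) s.
  by rewrite /dirD /derive E.
by rewrite derive_mx// mxE.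
Qed.

Lemma dir_increment m n (f : 'rV[R]_m -> 'rV[R]_n) k z (t w : R) (L : 'rV[R]_n) :
  (forall s, `|s| <= `|t| -> 0 <= s * t ->
     derivable f (z + s *: delta_mx 0 k) (delta_mx 0 k)) ->
  (forall s, `|s| <= `|t| -> 0 <= s * t ->
     `|dirD f k (z + s *: delta_mx 0 k) - L| <= w) ->
  `|f (z + t *: delta_mx 0 k) - f z - t *: L| <= w * `|t|.
Proof.
move=> fd fw.
have w0 : 0 <= w by rewrite (le_trans _ (fw 0 _ _)) ?normr0 ?mul0r.
apply: mx_norm_le => [|i j]; first by rewrite mulr_ge0.
rewrite ord1 !mxE.
pose g s := f (z + s *: delta_mx 0 k) 0 j - s * L 0 j.
have gd s : `|s| <= `|t| -> 0 <= s * t ->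
    is_derive s (1 : R) g (dirD f k (z + s *: delta_mx 0 k) 0 j - L 0 j).
  move=> s1 s2; have H := dirD_coord j (fd _ s1 s2).
  have H2 : is_derive s (1 : R) (fun s => s * L 0 j) (L 0 j).
    have -> : (fun s => s * L 0 j) = (L 0 j *: (id : R -> R)).
      by apply/funext => u; rewrite mulrC.
    by apply: is_derive_eq; rewrite /GRing.scale/= mulr1.
  exact: is_deriveB.
have := MVT_abs gd (w := w).
rewrite /g scale0r addr0 mul0r subr0 => H.
rewrite addrAC; apply: H => s st s0.
apply: le_trans (fw s st s0).
by have := mx_norm_ge (dirD f k (z + s *: delta_mx 0 k) - L) 0 j; rewrite !mxE.
Qed.

(** Derivatives are known along the axes only, so the path from [y] to [x] changes one coordinate at
    a time. It stays in the ball because balls of the maximum norm are boxes. *)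
Lemma box_increment m n (f : 'rV[R]_m -> 'rV[R]_n) x0 (r w : R) (L : 'M[R]_(m, n)) :
  (forall z k, `|z - x0| < r -> derivable f z (delta_mx 0 k)) ->
  (forall z k, `|z - x0| < r -> `|dirD f k z - row k L| <= w) ->
  forall x y, `|x - x0| < r -> `|y - x0| < r ->
    `|f x - f y - (x - y) *m L| <= m%:R * (w * `|x - y|).
Proof.
move=> fd fw x y xr yr.
pose z (k : nat) : 'rV[R]_m := \row_i (if (i < k)%N then x 0 i else y 0 i).
have z0 : z 0%N = y by apply/rowP => i; rewrite mxE.
have zm : z m = x by apply/rowP => i; rewrite mxE ltn_ord.
have zS (k : 'I_m) : z k.+1 = z k + (x - y) 0 k *: delta_mx 0 k.
  apply/rowP => i; rewrite !mxE eqxx/= ltnS leq_eqVlt.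
  have [->|ik] := eqVneq i k; first by rewrite eqxx ltnn/= mulr1 addrC subrK.
  by rewrite (negbTE (ik : val i != val k)) mulr0 addr0.
have zr (k : 'I_m) s : `|s| <= `|(x - y) 0 k| ->
    0 <= s * (x - y) 0 k -> `|z k + s *: delta_mx 0 k - x0| < r.
  move=> sk sp; apply: (@le_lt_trans _ _ (Num.max `|x - x0| `|y - x0|)); last first.
    by rewrite gt_max xr.
  apply: mx_norm_le => [|i j]; first by rewrite le_max normr_ge0.
  rewrite ord1 le_max !mxE eqxx/=.
  have [->|jk] := eqVneq j k; last first.
    rewrite mulr0 addr0; case: ifP => _.
      by rewrite (le_trans _ (mx_norm_ge (x - x0) 0 j)) ?mxE.
    by rewrite orbC (le_trans _ (mx_norm_ge (y - x0) 0 j)) ?mxE.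
  rewrite ltnn mulr1.
  have hx := mx_norm_ge (x - x0) 0 k; have hy := mx_norm_ge (y - x0) 0 k.
  move: sk sp hx hy; rewrite !mxE.
  move: (x 0 k) (y 0 k) (x0 0 k) => a b c sk sp hx hy.
  suff: `|b + s - c| <= Num.max `|a - c| `|b - c|.
    rewrite le_max => /orP[h|h]; first by rewrite (le_trans h hx).
    by rewrite (le_trans h hy) orbT.
  rewrite le_max.
  have [ab|ab] := leP 0 (a - b).
    have s0 : 0 <= s.
      have [ab0|ab0] := ltP 0 (a - b); first by rewrite -(pmulr_lge0 _ ab0).
      have ab1 : a - b = 0 by lra.
      by move: sk; rewrite ab1 normr0 normr_le0 => /eqP->.
    move: sk; rewrite (ger0_norm s0) (ger0_norm ab) => sk.
    have [bc|bc] := leP 0 (b + s - c).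
      apply/orP; rewrite (ger0_norm bc) (le_trans _ (ler_norm _)); lra.
    apply/orP; right; rewrite (ltr0_norm bc).
    have := ler_norm (- (b - c)); rewrite normrN; lra.
  have s0 : s <= 0 by rewrite -(nmulr_lge0 _ ab).
  move: sk; rewrite (ler0_norm s0) (ltr0_norm ab) => sk.
  have [bc|bc] := leP 0 (b + s - c).
    apply/orP; right; rewrite (ger0_norm bc) (le_trans _ (ler_norm _)); lra.
  apply/orP; left; rewrite (ltr0_norm bc).
  have := ler_norm (- (a - c)); rewrite normrN; lra.
have -> : f x - f y - (x - y) *m L =
    \sum_(k < m) (f (z k.+1) - f (z k) - (x - y) 0 k *: row k L).
  rewrite sumrB -(big_mkord xpredT (fun k => f (z k.+1) - f (z k))).
  rewrite telescope_sumr// zm z0; congr (_ - _).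
  apply/rowP => j; rewrite mxE summxE; apply: eq_bigr => k _.
  by rewrite !mxE.
rewrite (le_trans (ler_norm_sum _ _ _))//.
have -> : m%:R * (w * `|x - y|) = \sum_(k < m) (w * `|x - y|).
  by rewrite sumr_const card_ord mulr_natl.
apply: ler_sum => k _; rewrite zS.
have w0 : 0 <= w by rewrite (le_trans _ (fw x k xr)).
apply: le_trans (dir_increment (w := w) _ _) _.
- by move=> s s1 s2; exact/fd/zr.
- by move=> s s1 s2; exact/fw/zr.
- by rewrite ler_wpM2l// mx_norm_ge.
Qed.

Lemma box_increment_c m n (f : 'rV[R]_m -> 'rV[R]_n) x0 (r w : R) :
  (forall z k, `|z - x0| < r -> derivable f z (delta_mx 0 k)) ->
  (forall z k, `|z - x0| < r -> `|dirD f k z - dirD f k x0| <= w) ->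
  forall x y, `|x - x0| < r -> `|y - x0| < r ->
    `|f x - f y - (x - y) *m jac f x0| <= m%:R * (w * `|x - y|).
Proof.
move=> fd fw; apply: box_increment => // z k /fw h.
apply: le_trans (h k); rewrite le_eqVlt; apply/orP; left; apply/eqP; congr (`| _ |).
by congr (_ - _); apply/rowP => j; rewrite !mxE.
Qed.

(** Strict differentiability. The two-point form bounds the Lipschitz constant of the remainder,
    which is what the contraction argument behind local surjectivity needs; it also composes without
    any continuity of the derivative. *)
Definition strict_diff m n (f : 'rV[R]_m -> 'rV[R]_n) x0 (L : 'M[R]_(m, n)) :=
  forall e, 0 < e -> exists2 r, 0 < r & forall x y,
    `|x - x0| < r -> `|y - x0| < r -> `|f x - f y - (x - y) *m L| <= e * `|x - y|.

Lemma open_ball_rV m (U : set 'rV[R]_m) x : open U -> U x ->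
  exists2 r, 0 < r & forall y, `|y - x| < r -> U y.
Proof.
move=> oU Ux; have /nbhs_ballP[r r0 rU] : nbhs x U by exact: open_nbhs_nbhs.
by exists r => // y yr; apply: rU; rewrite -ball_normE/= distrC.
Qed.

Lemma continuous_rVP m n (f : 'rV[R]_m -> 'rV[R]_n) x : {for x, continuous f} ->
  forall e, 0 < e -> exists2 r, 0 < r & forall y, `|y - x| < r -> `|f y - f x| < e.
Proof.
move=> /cvgrPdist_lt fc e /fc/nbhs_ballP[r/= r0 rf]; exists r => // y yr.
by rewrite distrC; apply: rf; rewrite -ball_normE/= distrC.
Qed.

Lemma small_family (I : finType) (P : I -> R -> Prop) :
  (forall i, exists2 r, 0 < r & forall s, s <= r -> P i s) ->
  exists2 r, 0 < r & forall i, P i r.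
Proof.
move=> /(_ _)/cid2 h; pose r := \big[Num.min/1]_i (s2val (h i)).
exists r; first by apply: lt_bigmin => // i _; exact: (s2valP (h i)).
by move=> i; apply: (s2valP' (h i)); apply: bigmin_le_cond.
Qed.

Lemma class_C1_strict m n (f : 'rV[R]_m -> 'rV[R]_n) k (U : set 'rV[R]_m) x0 :
  open U -> class_C k.+1 U f -> U x0 -> strict_diff f x0 (jac f x0).
Proof.
move=> oU [fc fd] Ux0 e e0; have [r1 r10 r1U] := open_ball_rV oU Ux0.
pose w := e / m.+1%:R; have w0 : 0 < w by rewrite divr_gt0.
have [r2 r20 h2] : exists2 r, 0 < r & forall k : 'I_m, forall z,
    `|z - x0| < r -> `|dirD f k z - dirD f k x0| < w.
  apply: (@small_family _ (fun k r => forall z, `|z - x0| < r ->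
     `|dirD f k z - dirD f k x0| < w)) => i.
  have [_ ] := fd i; case: k fd => [|k] fd [/(_ _ Ux0) c _];
    by have [r r0 h] := continuous_rVP c w0; exists r => // s sr z /lt_le_trans/(_ sr)/h.
exists (Num.min r1 r2); first by rewrite lt_min r10.
move=> x y; rewrite !lt_min => /andP[x1 x2] /andP[y1 y2].
have := @box_increment_c m n f x0 (Num.min r1 r2) w _ _ x y.
rewrite !lt_min x1 x2 y1 y2 => H; apply: le_trans (H _ _ isT isT) _.
- by move=> z i; rewrite lt_min => /andP[/r1U/((fd i).1)].
- by move=> z i; rewrite lt_min => /andP[_ /h2 h]; exact/ltW/h.
- rewrite mulrA ler_wpM2r// mulrCA ler_piMr ?(ltW e0)//.
  by rewrite ler_pdivrMr// mul1r ler_nat.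
Qed.

Lemma strict_diff_cont m n (f : 'rV[R]_m -> 'rV[R]_n) x0 L : strict_diff f x0 L ->
  exists2 r, 0 < r & exists2 C, 0 < C & forall x y,
    `|x - x0| < r -> `|y - x0| < r -> `|f x - f y| <= C * `|x - y|.
Proof.
move=> /(_ 1 ltr01)[r r0 h]; exists r => //; exists (1 + m%:R * `|L|).
  by rewrite ltr_pwDl.
move=> x y xr yr; have := h x y xr yr; rewrite mul1r => H.
have -> : f x - f y = (f x - f y - (x - y) *m L) + (x - y) *m L by rewrite subrK.
rewrite (le_trans (ler_normD _ _))// mulrDl mul1r lerD//.
by rewrite (le_trans (mulmx_norm_le _ _))// -mulrA [`|x - y| * _]mulrC.
Qed.

(** The Lipschitz constant of the remainder is proportional to the radius; this rate makes the
    iteration defining the exponential converge. *)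
Definition quad_diff m n (f : 'rV[R]_m -> 'rV[R]_n) x0 (L : 'M[R]_(m, n)) :=
  exists2 C, 0 < C & exists2 r0, 0 < r0 & forall r, r <= r0 -> forall x y,
    `|x - x0| < r -> `|y - x0| < r ->
    `|f x - f y - (x - y) *m L| <= C * r * `|x - y|.

Lemma class_C2_quadratic m n (f : 'rV[R]_m -> 'rV[R]_n) (U : set 'rV[R]_m) x0 :
  open U -> class_C 2 U f -> U x0 -> quad_diff f x0 (jac f x0).
Proof.
move=> oU [fc fd] Ux0; have [r1 r10 r1U] := open_ball_rV oU Ux0.
pose lip (i : 'I_m) r C := forall x, `|x - x0| < r -> `|dirD f i x - dirD f i x0| <= C * `|x - x0|.
have [r2 r20 h2] : exists2 r, 0 < r & forall i, exists C, 0 < C /\ lip i r C.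
  apply: (@small_family _ (fun i r => exists C, 0 < C /\ lip i r C)) => i.
  have [_ c1] : _ /\ class_C 1 U (dirD f i) := fd i.
  have [r r0 [C C0 H]] := strict_diff_cont (class_C1_strict oU c1 Ux0).
  exists r => // s sr; exists C; split => // x xs; apply: H; last by rewrite subrr normr0.
  exact: lt_le_trans xs sr.
have [C C0 h3] : exists2 C, 0 < C & forall i, lip i r2 C.
  have [K /all_and2[kK kP]] := choice h2.
  exists (1 + \sum_i K i).
    by rewrite ltr_pwDl// sumr_ge0// => i _; exact/ltW.
  move=> i x xr; apply: le_trans (kP i x xr) _; apply: ler_wpM2r; first exact: normr_ge0.
  rewrite (bigD1 i) //= addrCA lerDl addr_ge0 // sumr_ge0 // => j _.
  exact/ltW.
exists (m.+1%:R * C); first by rewrite mulr_gt0.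
exists (Num.min r1 r2); first by rewrite lt_min r10.
move=> r; rewrite le_min => /andP[rr1 rr2] x y xr yr.
have rp : 0 < r by rewrite (le_lt_trans _ xr).
have H := @box_increment_c m n f x0 r (C * r) _ _ x y xr yr.
apply: le_trans (H _ _) _.
- by move=> z i zr; apply: (fd i).1; apply/r1U/(lt_le_trans zr).
- move=> z i zr; apply: le_trans (h3 i z (lt_le_trans zr rr2)) _.
  by rewrite ler_pM2l// ltW.
- rewrite !mulrA ler_wpM2r// ler_wpM2r ?(ltW rp)// ler_wpM2r ?(ltW C0)//.
  by rewrite ler_nat.
Qed.
End Calculus.

Section VectorConvergence.
Variable R : realType.

Lemma floor_bounds (x : R) : (Num.floor x)%:~R <= x < (Num.floor x)%:~R + 1.
Proof. by have := floor_itv x; rewrite intrD. Qed.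

Lemma nbhs_dist_lt (N : normedModType R) (v : N) e : 0 < e -> \forall u \near v, `|v - u| < e.
Proof. by move=> e0; have /cvgrPdist_lt := @cvg_id _ (nbhs v); apply. Qed.

Lemma ball_lipschitz_continuous p (N : normedModType R) (f : 'rV[R]_p -> N) (C s : R) (x0 : 'rV[R]_p) :
  0 < s -> (forall x, `|x - x0| < s -> `|f x - f x0| <= C * `|x - x0|) -> f @ x0 --> f x0.
Proof.
have F : Filter (nbhs x0) by exact: nbhs_filter.
move=> s0 h; apply/(@cvgrPdist_le R N 'rV[R]_p (nbhs x0) F f (f x0)) => e e0.
pose d := Num.min s (e / (`|C| + 1)); have d0 : 0 < d by rewrite lt_min s0 divr_gt0.
apply: (@filterS _ (nbhs x0) F _ _ _ (@nbhs_dist_lt 'rV[R]_p x0 d d0)) => x.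
rewrite lt_min distrC => /andP[xs xe].
rewrite distrC (le_trans (h x xs)); rewrite ltr_pdivlMr// in xe.
have : C * `|x - x0| <= `|C| * `|x - x0| by rewrite ler_wpM2r// ler_norm.
rewrite mulrDr in xe; have := normr_ge0 (x - x0); lra.
Qed.

Lemma cvg_sum_real (T : topologicalType) (I : Type) (s : seq I) (f : I -> T -> R) (t : T) :
  (forall i, {for t, continuous (f i)}) -> {for t, continuous (fun x => \sum_(i <- s) f i x)}.
Proof.
move=> h; elim: s => [|i s IH].
  rewrite (_ : (fun x => _) = fun=> 0); first exact: cvg_cst.
  by apply/funext => x; rewrite big_nil.
rewrite (_ : (fun x => _) = fun x => f i x + \sum_(k <- s) f k x).
  by apply: (@cvgD R R^o); [exact: h|exact: IH].
by apply/funext => x; rewrite big_cons.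
Qed.

Lemma cvg_coord (T : topologicalType) m (f : T -> 'rV[R]_m) t :
  (forall i, {for t, continuous (fun x => f x 0 i)}) -> {for t, continuous f}.
Proof.
move=> h; apply/cvgrPdist_le => e e0.
have : \forall x \near t, forall i, `|f t 0 i - f x 0 i| <= e.
  by apply: filter_forall => i; have /cvgrPdist_le := h i; exact.
apply: filterS => x hx; apply: mx_norm_le => [|i j]; first exact: ltW.
by rewrite ord1 !mxE.
Qed.
End VectorConvergence.

Section StrictDiff.
Variable R : realType.

Lemma strict_diff_comp m n p (f : 'rV[R]_m -> 'rV[R]_n) (g : 'rV[R]_n -> 'rV[R]_p)
    x0 L M : strict_diff f x0 L -> strict_diff g (f x0) M ->
  strict_diff (g \o f) x0 (L *m M).
Proof.
move=> sf sg e e0.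
have [r1 r10 [C C0 fC]] := strict_diff_cont sf.
pose K := C + n%:R * `|M|; have K0 : 0 < K by rewrite ltr_wpDr.
have [r2 r20 h2] := sg (e / (2 * C)) (divr_gt0 e0 (mulr_gt0 (ltr0Sn _ 1) C0)).
have [r3 r30 h3] := sf (e / (2 * K)) (divr_gt0 e0 (mulr_gt0 (ltr0Sn _ 1) K0)).
exists (Num.min (Num.min r1 r3) (r2 / C)); first by rewrite !lt_min r10 r30 divr_gt0.
move=> x y; rewrite !lt_min => /andP[/andP[x1 x3] x2] /andP[/andP[y1 y3] y2].
have fx z : `|z - x0| < r1 -> `|z - x0| < r2 / C -> `|f z - f x0| < r2.
  move=> z1 z2; rewrite (le_lt_trans (fC _ _ z1 _)) ?subrr ?normr0//.
  by rewrite mulrC -ltr_pdivlMr.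
have -> : (g \o f) x - (g \o f) y - (x - y) *m (L *m M) =
    (g (f x) - g (f y) - (f x - f y) *m M) + (f x - f y - (x - y) *m L) *m M.
  by rewrite (mulmxBl (f x - f y)) mulmxA addrA subrK.
rewrite (le_trans (ler_normD _ _))// [e in leRHS]splitr mulrDl lerD//.
  rewrite (le_trans (h2 _ _ (fx _ x1 x2) (fx _ y1 y2)))//.
  apply: le_trans (_ : e / (2 * C) * (C * `|x - y|) <= _).
    by rewrite ler_wpM2l ?fC// divr_ge0 ?(ltW e0)// mulr_ge0 ?(ltW C0).
  by rewrite le_eqVlt; apply/orP; left; apply/eqP; field; rewrite gt_eqF.
rewrite (le_trans (mulmx_norm_le _ _))//.
apply: le_trans (_ : n%:R * (e / (2 * K) * `|x - y| * `|M|) <= _).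
  by rewrite ler_wpM2l// ler_wpM2r// h3.
have -> : n%:R * (e / (2 * K) * `|x - y| * `|M|) = e / 2 * `|x - y| * (n%:R * `|M| / K).
  by field; rewrite gt_eqF.
rewrite ler_piMr ?mulr_ge0 ?(ltW e0)//.
by rewrite ler_pdivrMr// mul1r lerDr ltW.
Qed.

Lemma strict_diff_near m n (f g : 'rV[R]_m -> 'rV[R]_n) x0 L r : 0 < r ->
  (forall x, `|x - x0| < r -> f x = g x) -> strict_diff f x0 L -> strict_diff g x0 L.
Proof.
move=> r0 fg sf e /sf[s s0 h]; exists (Num.min r s); first by rewrite lt_min r0.
by move=> x y; rewrite !lt_min => /andP[x1 x2] /andP[y1 y2]; rewrite -!fg// h.
Qed.

Lemma strict_diff_affine m n (L : 'M[R]_(m, n)) a x0 :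
  strict_diff (fun x => x *m L + a) x0 L.
Proof.
move=> e e0; exists 1 => // x y _ _.
by rewrite opprD addrACA subrr addr0 mulmxBl subrr normr0 mulr_ge0// ltW.
Qed.

Lemma mx_small_eq0 m n (M : 'M[R]_(m, n)) :
  (forall e, 0 < e -> exists2 r, 0 < r & forall h : 'rV[R]_m, `|h| < r ->
     `|h *m M| <= e * `|h|) -> M = 0.
Proof.
move=> H; apply/row_matrixP => i; rewrite row0; apply/eqP; rewrite -normr_le0.
apply/ler_addgt0Pr => e e0; rewrite add0r; have [r r0 h] := H e e0.
pose d : 'rV[R]_m := delta_mx 0 i.
have dn : `|d| <= 1.
  by apply: mx_norm_le => // a b; rewrite mxE; case: (_ && _); rewrite ?normr1 ?normr0.
have := h ((r / 2) *: d).
rewrite -scalemxAl -rowE !normrZ !gtr0_norm ?divr_gt0// => H1.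
have /H1 : r / 2 * `|d| < r.
  by rewrite (@le_lt_trans _ _ (r / 2)) ?ler_piMr; lra.
rewrite mulrCA ler_pM2l ?divr_gt0// => /le_trans; apply.
by rewrite ler_piMr// ltW.
Qed.

Lemma strict_diff_uniq m n (f : 'rV[R]_m -> 'rV[R]_n) x0 L M :
  strict_diff f x0 L -> strict_diff f x0 M -> L = M.
Proof.
move=> sL sM; apply/eqP; rewrite -subr_eq0; apply/eqP/mx_small_eq0 => e e0.
have [r1 r10 h1] := sL (e / 2) (half_gt0 e0).
have [r2 r20 h2] := sM (e / 2) (half_gt0 e0).
exists (Num.min r1 r2); first by rewrite lt_min r10.
move=> h; rewrite lt_min => /andP[hr1 hr2].
have := h1 (h + x0) x0; have := h2 (h + x0) x0.
rewrite addrK subrr normr0 => /(_ hr2 r20) H2 /(_ hr1 r10) H1.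
have -> : h *m (L - M) = (f (h + x0) - f x0 - h *m M) - (f (h + x0) - f x0 - h *m L).
  by set X := f _ - _; rewrite mulmxBr opprD opprK addrACA subrr add0r addrC.
by rewrite (le_trans (ler_normB _ _))// (splitr e) mulrDl lerD.
Qed.

Lemma strict_diff_derive m n (f : 'rV[R]_m -> 'rV[R]_n) x0 L v :
  strict_diff f x0 L -> is_derive x0 v f (v *m L).
Proof.
move=> sf.
suff H : (fun h : R => h^-1 *: ((f \o shift x0) (h *: v) - f x0)) @ 0^' --> v *m L.
  by apply: DeriveDef; [apply/cvg_ex; exists (v *m L)|exact/cvg_lim].
apply/cvgrPdist_le => e e0.
pose K := `|v| + 1; have K0 : 0 < K by rewrite ltr_wpDl.
have [r r0 h] := sf (e / K) (divr_gt0 e0 K0).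
near=> t => /=.
have t0 : t != 0 by near: t; exact: nbhs_dnbhs_neq.
have tr : `|t *: v + x0 - x0| < r.
  rewrite addrK normrZ (@le_lt_trans _ _ (`|t| * K))//.
    by rewrite ler_wpM2l// lerDl.
  rewrite -ltr_pdivlMr//; near: t; apply: dnbhs0_lt; exact: divr_gt0.
have := h (t *: v + x0) x0 tr; rewrite subrr normr0 addrK => /(_ r0).
rewrite distrC -scalemxAl => H.
have -> : v *m L - t^-1 *: (f (t *: v + x0) - f x0) =
   t^-1 *: (t *: (v *m L) - (f (t *: v + x0) - f x0)).
  by rewrite [in RHS]scalerBr scalerA mulVf// scale1r.
rewrite normrZ normfV ler_pdivrMl ?normr_gt0// (le_trans H)// normrZ mulrCA ler_wpM2l//.
by rewrite -mulrA ler_piMr ?(ltW e0)// mulrC ler_pdivrMr// mul1r lerDl.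
Unshelve. all: by end_near. Qed.

Lemma row_mx_norm m n1 n2 (A : 'M[R]_(m, n1)) (B : 'M[R]_(m, n2)) :
  `|row_mx A B| = Num.max `|A| `|B|.
Proof.
apply/eqP; rewrite eq_le; apply/andP; split.
  apply: mx_norm_le => [|i j]; first by rewrite le_max normr_ge0.
  rewrite mxE le_max; case: splitP => k _; first by rewrite mx_norm_ge.
  by rewrite mx_norm_ge orbT.
rewrite ge_max; apply/andP; split; apply: mx_norm_le => // i j.
  by rewrite -(row_mxEl A B) mx_norm_ge.
by rewrite -(row_mxEr A B) mx_norm_ge.
Qed.

Lemma cvg_row_mx (T : Type) (F : set_system T) {FF : Filter F} n1 n2
    (f : T -> 'rV[R]_n1) (g : T -> 'rV[R]_n2) (a : 'rV[R]_n1) (b : 'rV[R]_n2) :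
  f @ F --> a -> g @ F --> b -> (fun t => row_mx (f t) (g t)) @ F --> row_mx a b.
Proof.
move=> /cvgrPdist_lt fa /cvgrPdist_lt gb; apply/cvgrPdist_lt => e e0.
near=> t; rewrite opp_row_mx add_row_mx row_mx_norm gt_max.
by apply/andP; split; near: t; [exact: fa|exact: gb].
Unshelve. all: by end_near. Qed.
End StrictDiff.

Section QuadDiff.
Variable R : realType.

Lemma addrKK (Z : zmodType) (x y z : Z) : x + z - (y + z) = x - y.
Proof. by rewrite opprD addrACA subrr addr0. Qed.

Lemma quad_diff_strict m n (f : 'rV[R]_m -> 'rV[R]_n) x0 L :
  quad_diff f x0 L -> strict_diff f x0 L.
Proof.
move=> [C C0 [r0 r00 h]] e e0; exists (Num.min r0 (e / C)).
  by rewrite lt_min r00 divr_gt0.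
move=> x y xr yr; apply: le_trans (h _ _ x y xr yr) _; first by rewrite ge_min lexx.
rewrite ler_wpM2r// mulrC -ler_pdivlMr//.
by rewrite ge_min lexx orbT.
Qed.

Lemma quad_diff_shift m n (f g : 'rV[R]_m -> 'rV[R]_n) x0 L b :
  (forall x, g x = f (x + x0) + b) -> quad_diff f x0 L -> quad_diff g 0 L.
Proof.
move=> gf [C C0 [r0 r00 h]]; exists C => //; exists r0 => // r rr x y.
rewrite !subr0 => xr yr; have := h r rr (x + x0) (y + x0).
by rewrite !addrK !gf !addrKK => /(_ xr yr).
Qed.

Lemma strict_diffD m n (f g : 'rV[R]_m -> 'rV[R]_n) x0 L M :
  strict_diff f x0 L -> strict_diff g x0 M ->
  strict_diff (fun x => f x + g x) x0 (L + M).
Proof.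
move=> sf sg e e0.
have [r1 r10 h1] := sf (e / 2) (half_gt0 e0).
have [r2 r20 h2] := sg (e / 2) (half_gt0 e0).
exists (Num.min r1 r2); first by rewrite lt_min r10.
move=> x y; rewrite !lt_min => /andP[x1 x2] /andP[y1 y2].
have -> : f x + g x - (f y + g y) - (x - y) *m (L + M) =
   (f x - f y - (x - y) *m L) + (g x - g y - (x - y) *m M).
  by rewrite mulmxDr !opprD [RHS]addrACA; congr (_ + _); rewrite addrACA.
by rewrite (le_trans (ler_normD _ _))// (splitr e) mulrDl lerD// ?h1 ?h2.
Qed.

Lemma strict_diffZ m n (f : 'rV[R]_m -> 'rV[R]_n) x0 L a :
  strict_diff f x0 L -> strict_diff (fun x => a *: f x) x0 (a *: L).
Proof.
move=> sf; have := strict_diff_comp sf (strict_diff_affine a%:M 0 (f x0)).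
rewrite mul_mx_scalar => H e /H[r r0 h]; exists r => // x y xr yr.
by have := h x y xr yr; rewrite /= !addr0 !mul_mx_scalar.
Qed.

Lemma strict_diff_cst m n (a : 'rV[R]_n) (x0 : 'rV[R]_m) : strict_diff (fun=> a) x0 0.
Proof.
by move=> e e0; exists 1 => // x y _ _; rewrite subrr mulmx0 subrr normr0 mulr_ge0// ltW.
Qed.

Lemma strict_diff_sum (I : Type) (s : seq I) m n (f : I -> 'rV[R]_m -> 'rV[R]_n) x0 L :
  (forall i, strict_diff (f i) x0 (L i)) ->
  strict_diff (fun x => \sum_(i <- s) f i x) x0 (\sum_(i <- s) L i).
Proof.
move=> h; elim: s => [|i s IH].
  rewrite big_nil; have -> : (fun x => \sum_(i <- [::]) f i x) = fun=> 0.
    by apply/funext => x; rewrite big_nil.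
  exact: strict_diff_cst.
rewrite big_cons; have -> : (fun x => \sum_(i <- i :: s) f i x) =
    fun x => f i x + \sum_(i <- s) f i x by apply/funext => x; rewrite big_cons.
exact: strict_diffD.
Qed.
End QuadDiff.

Section GeometricLimit.
Variable R : realType.

Lemma geometric_small (q A e : R) : 0 <= q < 1 -> 0 <= A -> 0 < e ->
  exists K, forall k, (K <= k)%N -> A * q ^+ k < e.
Proof.
move=> /andP[q0 q1] A0 e0.
have c : (fun k => A * q ^+ k) @ \oo --> 0.
  rewrite -(mulr0 A); apply: cvgM; first exact: cvg_cst.
  by apply: cvg_expr; rewrite ger0_norm.
move/cvgrPdist_lt : c => /(_ e e0)[K _ h]; exists K => k Kk.
have := h k Kk; rewrite sub0r normrN ger0_norm//.
by rewrite mulr_ge0// exprn_ge0.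
Qed.

Lemma geometric_cauchy_rV n (x : nat -> 'rV[R]_n) (A q : R) : 0 <= q < 1 -> 0 <= A ->
  (forall k, `|x k.+1 - x k| <= A * q ^+ k) ->
  exists l, forall e, 0 < e -> exists K, forall k, (K <= k)%N -> `|x k - l| <= e.
Proof.
move=> q01 A0 h; have /andP[q0 q1] := q01.
have tel k m : (k <= m)%N -> `|x m - x k| <= A / (1 - q) * q ^+ k.
  move=> km; have -> : A / (1 - q) * q ^+ k = A * q ^+ k / (1 - q) by rewrite mulrAC.
  rewrite ler_pdivlMr ?subr_gt0//.
  have {km} : `|x m - x k| * (1 - q) <= A * (q ^+ k - q ^+ m).
    rewrite -(subnKC km); elim: (m - k)%N => [|i IH].
      by rewrite addn0 !subrr normr0 mul0r mulr0.
    rewrite addnS.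
    have t : `|x (k + i).+1 - x k| <= A * q ^+ (k + i) + `|x (k + i)%N - x k|.
      have -> : x (k + i).+1 - x k = (x (k + i).+1 - x (k + i)%N) + (x (k + i)%N - x k).
        by rewrite addrA subrK.
      by rewrite (le_trans (ler_normD _ _))// lerD2r.
    have t2 : `|x (k + i).+1 - x k| * (1 - q) <=
        (A * q ^+ (k + i) + `|x (k + i)%N - x k|) * (1 - q).
      by rewrite ler_wpM2r// subr_ge0 ltW.
    rewrite exprS; move: IH t2; rewrite mulrDl.
    move: (`|x (k + i)%N - x k| * (1 - q)) (q ^+ (k + i)) => a b; lra.
  move=> /le_trans; apply; rewrite ler_wpM2l// gerBl exprn_ge0//.
pose l : 'rV[R]_n := \row_j limn (fun k => x k 0 j).
have AA : 0 <= A / (1 - q) by rewrite divr_ge0// subr_ge0 ltW.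
have cj j : cvgn (fun k => x k 0 j).
  apply/cauchy_cvgP/cauchy_ballP => e e0; near_simpl.
  have [K hK] := geometric_small q01 AA (divr_gt0 e0 (ltr0Sn R 2)).
  exists ([set k | (K <= k)%N], [set k | (K <= k)%N]).
    by split; exists K.
  move=> [a b] /= [Ka Kb].
  have near m : (K <= m)%N -> `|x m 0 j - x K 0 j| < e / 3.
    move=> Km; apply: le_lt_trans (hK K (leqnn _)); apply: le_trans (tel K m Km).
    by have := mx_norm_ge (x m - x K) 0 j; rewrite !mxE.
  rewrite -ball_normE /=; have na := near a Ka; have nb := near b Kb.
  have t := ler_normD (x a 0 j - x K 0 j) (x K 0 j - x b 0 j).
  rewrite addrA subrK [`|x K 0 j - _|]distrC in t; lra.
exists l => e e0; have [K hK] := geometric_small q01 AA e0.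
exists K => k Kk; apply: mx_norm_le => [|i j]; first exact: ltW.
rewrite ord1 !mxE; apply/ler_addgt0Pr => d d0.
have /cvgrPdist_lt/(_ d d0)[M _ hM] := cj j.
pose m := maxn M k.
have h1 : `|limn (fun k => x k 0 j) - x m 0 j| < d by apply: hM; rewrite /= leq_maxl.
have h2 : `|x m 0 j - x k 0 j| <= e.
  apply: le_trans (ltW (hK k Kk)); apply: le_trans (tel k m (leq_maxr _ _)).
  by have := mx_norm_ge (x m - x k) 0 j; rewrite !mxE.
have t := ler_normD (x k 0 j - x m 0 j) (x m 0 j - limn (fun k => x k 0 j)).
rewrite addrA subrK [X in _ <= X + _]distrC [X in _ <= _ + X]distrC in t; lra.
Unshelve. all: by end_near. Qed.

End GeometricLimit.

Lemma cvg_unshift (T : topologicalType) (f : nat -> T) (l : T) m :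
  ((fun k => f (k + m)%N) @ \oo --> l -> f @ \oo --> l)%classic.
Proof.
move=> h P /h[K _ hK]; exists (K + m)%N => // k /= Kk.
rewrite -(subnK (leq_trans (leq_addl K m) Kk)); apply: hK => /=.
by rewrite leq_subRL ?(leq_trans (leq_addl K m))// addnC.
Qed.

(** * Fixed vectors of compact groups in invariant convex sets *)

Section InvariantVector.
Variable R : realType.

(** The norm of matrices is the maximum norm, which is not strictly convex; the Euclidean square
    satisfies the parallelogram identity used below. *)
Definition sqnorm m (x : 'rV[R]_m) : R := \sum_i x 0 i ^+ 2.

Lemma sqnorm_ge m (x : 'rV[R]_m) : `|x| ^+ 2 <= sqnorm x.
Proof.
have s0 : 0 <= sqnorm x by rewrite sumr_ge0// => i _; rewrite sqr_ge0.
rewrite -[leRHS]sqr_sqrtr// ler_sqr ?nnegrE ?sqrtr_ge0//.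
apply: mx_norm_le => [|i j]; rewrite ?sqrtr_ge0// ord1.
rewrite -ler_sqr ?nnegrE ?sqrtr_ge0// sqr_sqrtr// -normrX ger0_norm ?sqr_ge0//.
by rewrite /sqnorm (bigD1 j)//= lerDl sumr_ge0// => k _; rewrite sqr_ge0.
Qed.

Lemma sqnorm_ge0 m (x : 'rV[R]_m) : 0 <= sqnorm x.
Proof. exact: le_trans (sqr_ge0 _) (sqnorm_ge x). Qed.

Lemma sqnorm_eq0 m (x : 'rV[R]_m) : sqnorm x <= 0 -> x = 0.
Proof.
move=> /(le_trans (sqnorm_ge x)) h; apply/eqP; rewrite -normr_eq0 -sqrf_eq0.
by rewrite eq_le h sqr_ge0.
Qed.

Lemma sqnorm_diff m (x y : 'rV[R]_m) :
  `|sqnorm x - sqnorm y| <= m%:R * (`|x - y| * (`|x| + `|y|)).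
Proof.
rewrite -sumrB (le_trans (ler_norm_sum _ _ _))//.
apply: le_trans (_ : \sum_(i < m) (`|x - y| * (`|x| + `|y|)) <= _); last first.
  by rewrite sumr_const card_ord mulr_natl.
apply: ler_sum => i _; rewrite subr_sqr normrM ler_pM//.
  by have := mx_norm_ge (x - y) 0 i; rewrite !mxE.
by rewrite (le_trans (ler_normD _ _))// lerD// mx_norm_ge.
Qed.

Lemma sqnorm_mid m (x y : 'rV[R]_m) :
  sqnorm (2^-1 *: (x + y)) = (sqnorm x + sqnorm y) / 2 - sqnorm (x - y) / 4.
Proof.
rewrite /sqnorm -big_split/= !mulr_suml -sumrB; apply: eq_bigr => i _.
by rewrite !mxE; field.
Qed.

Lemma sqnorm_cts m : continuous (@sqnorm m).
Proof.
move=> x; apply: (@ball_lipschitz_continuous R _ R^o _ (m%:R * (2 * `|x| + 1)) 1) => // y yx.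
apply: le_trans (sqnorm_diff y x) _.
rewrite -mulrA ler_wpM2l// mulrC ler_wpM2r//.
have := ler_normD (y - x) x; rewrite subrK; lra.
Qed.

Lemma evt_max_all (T : topologicalType) (f : T -> R) (t0 : T) :
  compact [set: T] -> continuous f -> exists c, forall t, f t <= f c.
Proof.
move=> cT cf; have [||c _ h] := @compact_EVT_max T R f [set: T] _ cT.
- by exists t0.
- by apply: continuous_subspaceT.
- by exists c => t; apply: h; rewrite inE.
Qed.

Variables (G : GroupTop.type) (m : nat) (T : G -> 'rV[R]_m -> 'rV[R]_m).
Hypotheses (cG : compact [set: G]).
Hypothesis TD : forall g x y, T g (x + y) = T g x + T g y.
Hypothesis TZ : forall g c x, T g (c *: x) = c *: T g x.
Hypothesis TM : forall g h, exists k, forall x, T g (T h x) = T k x.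
Hypothesis T1 : forall x, T 1%g x = x.
Hypothesis TV : forall g x, T g x = 0 -> x = 0.
Hypothesis Tc : forall x, continuous (fun g => T g x).
Variable b : R.
Hypothesis b0 : 0 <= b.
Hypothesis Tb : forall g x, `|T g x| <= b * `|x|.

Let TB g x y : T g (x - y) = T g x - T g y.
Proof. by rewrite -scaleN1r TD TZ scaleN1r. Qed.

Let am (x : 'rV[R]_m) : {g : G | forall k, sqnorm (T k x) <= sqnorm (T g x)}.
Proof.
apply: cid; apply: (evt_max_all 1%g cG) => g.
by apply: (@continuous_comp G 'rV[R]_m R (T^~ x) (@sqnorm m)); [exact: Tc|exact: sqnorm_cts].
Qed.

Let f (x : 'rV[R]_m) : R := sqnorm (T (sval (am x)) x).
Let fP x k : sqnorm (T k x) <= f x. Proof. exact: (svalP (am x)). Qed.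

Let f_diff x y : f x <= f y + m%:R * (b * `|x - y| * (b * (`|x| + `|y|))).
Proof.
rewrite {1}/f; set g := sval _.
have := sqnorm_diff (T g x) (T g y); rewrite -TB => h.
have := fP y g; have := ler_norm (sqnorm (T g x) - sqnorm (T g y)).
have : m%:R * (`|T g (x - y)| * (`|T g x| + `|T g y|)) <=
    m%:R * (b * `|x - y| * (b * (`|x| + `|y|))).
  by rewrite ler_wpM2l// ler_pM ?addr_ge0// mulrDr lerD.
lra.
Qed.

Let f_cts : continuous f.
Proof.
move=> x; apply: (@ball_lipschitz_continuous R _ R^o _ (m%:R * (b * (b * (2 * `|x| + 1)))) 1) => // y yx.
have h1 := f_diff y x; have h2 := f_diff x y.
rewrite distrC [`|x| + _]addrC in h2.
have : m%:R * (b * `|y - x| * (b * (`|y| + `|x|))) <=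
    m%:R * (b * (b * (2 * `|x| + 1))) * `|y - x|.
  have -> : m%:R * (b * (b * (2 * `|x| + 1))) * `|y - x| =
      m%:R * (b * `|y - x| * (b * (2 * `|x| + 1))) by ring.
  rewrite ler_wpM2l// ler_wpM2l ?mulr_ge0// ler_wpM2l//.
  have := ler_normD (y - x) x; rewrite subrK; lra.
by rewrite ler_norml; lra.
Qed.

(* The functional [sup_g |g x|^2] is invariant and strictly convex: its minimiser on [C] is unique,
   hence fixed. *)
Lemma invariant_vector (C : set 'rV[R]_m) : closed C -> C !=set0 ->
  (forall x y, C x -> C y -> C (2^-1 *: (x + y))) -> (forall g x, C x -> C (T g x)) ->
  exists2 x, C x & forall g, T g x = x.
Proof.
move=> cC [x0 Cx0] Cm CT.
have fge x : `|x| ^+ 2 <= f x by apply: le_trans (fP x 1%g); rewrite T1; exact: sqnorm_ge.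
pose M := 1 + f x0; pose B : set 'rV[R]_m := C `&` [set x | `|x| <= M].
have big x : M < `|x| -> f x0 < f x.
  move=> Mx; apply: lt_le_trans (fge x); have f0 : 0 <= f x0 := le_trans (sqr_ge0 _) (fge x0).
  have x1 : 1 <= `|x| by move: Mx; rewrite /M; lra.
  have : `|x| <= `|x| ^+ 2 by rewrite ler_peMl.
  move: Mx; rewrite /M; lra.
have cB : compact B.
  apply: bounded_closed_compact.
    by exists M; split; [exact: num_real|move=> r Mr x [_ /= xM]; lra].
  apply: closedI => //.
  have -> : [set x : 'rV[R]_m | `|x| <= M] = (fun x : 'rV[R]_m => `|x|) @^-1` [set y | y <= M] by [].
  by apply: closed_comp; [move=> x _; exact: norm_continuous|exact: closed_le].
have Bx0 : B x0.
  split=> //=; case: (leP `|x0| M) => // /big; lra.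
have [||x /set_mem[Cx _] xmin] := @compact_EVT_min _ R f B _ cB.
- by exists x0.
- exact: continuous_subspaceT.
have min y : C y -> f x <= f y.
  move=> Cy; case: (leP `|y| M) => [yM|/big /ltW]; first by apply: xmin; rewrite inE.
  by apply: le_trans; apply: xmin; rewrite inE.
exists x => // g; set y := T g x.
have fy : f y <= f x.
  by rewrite {1}/f; have [k ->] := TM (sval (am (T g x))) g.
have := min _ (Cm _ _ Cx (CT g _ Cx)); rewrite -/y {2}/f; set k := sval _.
rewrite TZ TD sqnorm_mid -TB => h.
have h1 := fP x k; have h2 := fP y k; have := @sqnorm_ge0 m (T k (x - y)) => h3.
have : T k (x - y) = 0 by apply: sqnorm_eq0; lra.
by move=> /TV/eqP; rewrite subr_eq0 => /eqP.
Qed.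
End InvariantVector.

(** * Subspaces as predicates and inner products *)

Section Subspaces.
Variables (R : realType) (n : nat).
Local Notation V := 'rV[R]_n.

Definition is_subspace (P : V -> Prop) :=
  [/\ P 0, (forall u v, P u -> P v -> P (u + v)) & forall c u, P u -> P (c *: u)].

Lemma subspaceB P u v : is_subspace P -> P u -> P v -> P (u - v).
Proof. by move=> [_ PD PZ] Pu Pv; apply: PD => //; rewrite -scaleN1r; exact: PZ. Qed.

(** A matrix with rows in [P] is enlarged by a vector of [P] outside its row space as long as there
    is one; the rank grows each time, so this ends after at most [n] steps. *)
Lemma subspace_mx (P : V -> Prop) : is_subspace P ->
  exists M : 'M[R]_n, forall v, P v <-> (v <= M)%MS.
Proof.
move=> [P0 PD PZ].
have Pmul m (M : 'M[R]_(m, n)) : (forall i, P (row i M)) -> forall v : V, (v <= M)%MS -> P v.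
  move=> h v /submxP[D ->]; rewrite mulmx_sum_row.
  by elim/big_ind: _ => [//|x y Px Py|i _]; [exact: PD|exact/PZ/h].
suff H k : (k <= n)%N -> exists M : 'M[R]_n, (forall i, P (row i M)) /\
    ((k <= \rank M)%N \/ forall v, P v -> (v <= M)%MS).
  have [M [h1 h2]] := H n (leqnn _); exists M => v; split; last exact: Pmul.
  case: h2 => [|h]; last exact: h.
  by move=> rM Pv; apply: submx_full; rewrite /row_full eqn_leq rank_leq_col.
elim: k => [|k IH] kn; first by exists 0; split; [move=> i; rewrite row0|left].
have [M [h1 [h2|h2]]] := IH (ltnW kn); last by exists M; split=> //; right.
case: (pselect (forall v, P v -> (v <= M)%MS)) => [h|]; first by exists M; split=> //; right.
move=> /existsNP[v /not_implyP[Pv vM]].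
exists <<col_mx M v>>%MS; split.
  have h3 i : P (row i (col_mx M v)).
    case: (split_ordP i) => j ->; first by rewrite rowKu.
    by rewrite rowKd row_id.
  move=> i; apply: (Pmul _ _ h3); apply: submx_trans (row_sub _ _) _.
  by rewrite genmxE.
left; rewrite mxrank_gen; apply: leq_ltn_trans h2 _.
rewrite ltn_neqAle; apply/andP; split; last by apply: mxrankS; rewrite -addsmxE addsmxSl.
apply/negP => /eqP e; apply: vM.
have : (M == col_mx M v)%MS by rewrite -(mxrank_leqif_eq _) ?e// -addsmxE addsmxSl.
by move=> /eqmxP ->; rewrite -addsmxE addsmxSr.
Qed.

Variable Q : 'M[R]_n.
Hypothesis Qs : Q^T = Q.
Definition ip (u v : V) : R := (u *m Q *m v^T) 0 0.
Hypothesis Qp : forall v, v != 0 -> 0 < ip v v.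

Lemma ipC u v : ip u v = ip v u.
Proof.
have E : (v *m Q *m u^T)^T = u *m Q *m v^T by rewrite !trmx_mul trmxK Qs mulmxA.
by rewrite /ip -E [LHS]mxE.
Qed.

Lemma ipDl u v w : ip (u + v) w = ip u w + ip v w.
Proof. by rewrite /ip !mulmxDl mxE. Qed.

Lemma ipZl c u w : ip (c *: u) w = c * ip u w.
Proof. by rewrite /ip -!scalemxAl mxE. Qed.

Lemma ipDr u v w : ip w (u + v) = ip w u + ip w v.
Proof. by rewrite /ip linearD/= mulmxDr mxE. Qed.

Lemma ipZr c u w : ip w (c *: u) = c * ip w u.
Proof. by rewrite /ip linearZ/= -scalemxAr mxE. Qed.

Lemma ipNl u w : ip (- u) w = - ip u w.
Proof. by rewrite -scaleN1r ipZl mulN1r. Qed.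

Lemma ipNr u w : ip w (- u) = - ip w u.
Proof. by rewrite -scaleN1r ipZr mulN1r. Qed.

Lemma ip0l w : ip 0 w = 0.
Proof. by rewrite -(scale0r 0) ipZl mul0r. Qed.

Lemma ip0r w : ip w 0 = 0.
Proof. by rewrite -(scale0r 0) ipZr mul0r. Qed.

Lemma ip_eq0 v : ip v v = 0 -> v = 0.
Proof. by move=> h; apply/eqP; apply: contraT => /Qp; rewrite h ltxx. Qed.

Lemma ip_bound : exists2 K, 0 <= K & forall u v, `|ip u v| <= K * (`|u| * `|v|).
Proof.
exists (n%:R * (n%:R * `|Q|)); first by rewrite mulr_ge0.
move=> u v; apply: le_trans (mx_norm_ge _ _ _) _; apply: le_trans (mulmx_norm_le _ _) _.
rewrite -mulrA ler_wpM2l//.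
have h1 := mulmx_norm_le u Q; have h2 : `|v^T| <= `|v|.
  by apply: mx_norm_le => // i j; rewrite mxE mx_norm_ge.
have -> : n%:R * `|Q| * (`|u| * `|v|) = n%:R * (`|u| * `|Q|) * `|v| by ring.
by rewrite ler_pM.
Qed.

(** The kernel of [Q *m M^T] is the orthogonal complement. Positivity makes it meet the row space of
    [M] trivially, and the ranks then add up to [n]. *)
Lemma orth_decomp P : is_subspace P -> forall v, exists a b,
  [/\ P a, (forall w, P w -> ip w b = 0) & v = a + b].
Proof.
move=> sP v; have [M hM] := subspace_mx sP.
pose N := kermx (Q *m M^T).
have orth (b : V) : (b <= N)%MS -> forall w, P w -> ip w b = 0.
  rewrite sub_kermx => /eqP bN w /hM/submxP[D ->].
  by rewrite ipC /ip trmx_mul mulmxA -(mulmxA b) bN mul0mx mxE.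
have d0 : (M :&: N)%MS = 0.
  apply/eqP; rewrite -submx0; apply/rV_subP => w; rewrite sub_capmx => /andP[/hM Pw /orth h].
  by rewrite (ip_eq0 (h _ Pw)) sub0mx.
have full : row_full (M + N)%MS.
  rewrite /row_full eqn_leq rank_leq_col/=.
  have := mxrank_sum_cap M N; rewrite d0 mxrank0 addn0 => ->.
  rewrite mxrank_ker -leq_subLR -{1}(subnK (rank_leq_row (Q *m M^T))) addnC.
  rewrite leq_subLR leq_add2r; apply: leq_trans (mxrankM_maxr _ _) _.
  by rewrite mxrank_tr.
have /sub_addsmxP[[a b] /= ->] := submx_full v full.
exists (a *m M), (b *m N); split => //; first by apply/hM; exact: submxMl.
by apply: orth; exact: submxMl.
Qed.

End Subspaces.

(** * Trigonometric estimates and the circle *)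

Section TrigSmall.
Variable R : realType.

Lemma deriv_small (f df : R -> R) (e : R) :
  (forall x : R, is_derive x (1 : R) f (df x)) -> {for 0, continuous df} ->
  df 0 = 0 -> 0 < e -> exists2 d, 0 < d & forall h, `|h| < d -> `|f h - f 0| <= e * `|h|.
Proof.
move=> fd dc df0 e0; move/cvgrPdist_lt : dc => /(_ e e0)/nbhs_ballP[d /= d0 hd].
exists d => // h hh; apply: (MVT_abs (df := df)) => // s sh _; apply: ltW.
have := hd s; rewrite df0 sub0r normrN; apply.
by rewrite -ball_normE /= sub0r normrN (le_lt_trans sh).
Qed.

Lemma trig_small (e : R) : 0 < e -> exists2 d, 0 < d & forall h, `|h| < d ->
  `|cos h - 1| <= e * `|h| /\ `|sin h - h| <= e * `|h|.
Proof.
move=> e0.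
have [||d1 d10 h1] := @deriv_small cos (fun x => - sin x) e _ _ _ e0.
- by apply: (@cvgN R R^o); exact: continuous_sin.
- by rewrite sin0 oppr0.
have [||d2 d20 h2] := @deriv_small (fun x => sin x - x) (fun x => cos x - 1) e _ _ _ e0.
- by apply: (@cvgB R R^o); [exact: continuous_cos|exact: cvg_cst].
- by rewrite cos0 subrr.
exists (Num.min d1 d2) => [|h]; first by rewrite lt_min d10.
rewrite lt_min => /andP[/h1 + /h2]; rewrite cos0 sin0 !subr0; by split.
Qed.

End TrigSmall.

Lemma sub_split3 (Z : zmodType) (x u y : Z) : (x = u + (y + (x - u - y)))%R.
Proof. by rewrite -[(x - u - y)%R]addrA -opprD addrA addrC subrK. Qed.

Section Expi.
Local Open Scope complex_scope.
Variable R : realType.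

Definition expi (x : R) : R[i] := cos x +i* sin x.

Lemma expi0 : expi 0 = 1.
Proof. by rewrite /expi cos0 sin0. Qed.

Lemma expiD x y : expi (x + y) = expi x * expi y.
Proof.
apply/eqP; rewrite eq_complex /= cosD sinD; apply/andP; split; apply/eqP => //.
by rewrite addrC.
Qed.

Lemma expiX x (m : nat) : expi (m%:R * x) = expi x ^+ m.
Proof.
elim: m => [|m IH]; first by rewrite mul0r expi0.
by rewrite -natr1 mulrDl mul1r expiD IH exprSr.
Qed.

Lemma expi_neq0 x : expi x != 0.
Proof.
apply/eqP => h; have := expiD x (- x); rewrite h mul0r subrr expi0 => /eqP.
by rewrite oner_eq0.
Qed.

Lemma expiN x : expi (- x) = (expi x)^-1.
Proof.
by apply: (mulfI (expi_neq0 x)); rewrite -expiD subrr expi0 mulfV// expi_neq0.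
Qed.

Lemma expiZ x (m : int) : expi (m%:~R * x) = expi x ^ m.
Proof.
case: m => m; first by rewrite expiX.
by rewrite mulNr expiN expiX.
Qed.

Lemma expi_norm x : `|expi x| = 1.
Proof.
by rewrite normc_def cos2Dsin2 sqrtr1.
Qed.

Lemma expi_pi : expi pi = -1.
Proof. by rewrite /expi cospi sinpi; apply/eqP; rewrite eq_complex /= oppr0 !eqxx. Qed.

Lemma expi_2pi (m : int) : expi (m%:~R * (pi *+ 2)) = 1.
Proof. by rewrite expiZ expiD expi_pi mulrNN mul1r exp1rz. Qed.

(** After removing a multiple of [2 pi], half of a nonzero remainder lies strictly between [0] and
    [pi], where the sine is positive; the double angle formula then excludes cosine [1]. *)
Lemma expi_eq1 x : expi x = 1 -> exists m : int, x = m%:~R * (pi *+ 2).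
Proof.
move=> h; have p2 : 0 < pi *+ 2 :> R by rewrite pmulrn_lgt0// pi_gt0.
pose m := Num.floor (x / (pi *+ 2)); exists m.
have /andP[] := floor_bounds (x / (pi *+ 2)); rewrite -/m ler_pdivlMr// ltr_pdivrMr// mulrDl mul1r.
move=> h1 h2; pose y := x - m%:~R * (pi *+ 2).
have y1 : expi y = 1 by rewrite expiD expiN expi_2pi invr1 mulr1.
apply/eqP; rewrite -subr_eq0 -/y; apply/eqP; apply: contrapT => /eqP y0.
have y0' : 0 < y by rewrite lt_neqAle eq_sym y0 subr_ge0.
have yp : y / 2 < pi by rewrite /y; lra.
have s0 : 0 < sin (y / 2) by apply: sin_gt0_pi; rewrite divr_gt0.
have : cos y = 1 by move: y1 => [].
rewrite (splitr y) cosD -!expr2 => e; have := cos2Dsin2 (y / 2).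
by have : 0 < sin (y / 2) ^+ 2 by [rewrite exprn_gt0]; lra.
Qed.

End Expi.

Lemma cvg_nat_eq (A : topologicalType) (f g : nat -> A) (l : A) : (forall k, f k = g k) ->
  (g @ \oo --> l -> f @ \oo --> l)%classic.
Proof. by move=> /funext ->. Qed.

(** * Alexander-Spanier cochains modulo 2 *)

Section Cochains.
Variable T : choiceType.
Implicit Types (f g : seq T -> bool) (s : seq T).

(** Alexander-Spanier cochains with coefficients in [F_2] of all degrees at
    once: a tuple of length [k] is a simplex of degree [k - 1]. *)
Fixpoint cob f s : bool :=
  if s is x :: s' then f s' (+) cob (fun t => f (x :: t)) s' else false.

Lemma eq_in_cob f g s : (forall t, {subset t <= s} -> f t = g t) -> cob f s = cob g s.
Proof.
elim: s f g => //= x s IH f g fg; congr (_ (+) _).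
  by apply: fg => y ys; rewrite inE ys orbT.
apply: IH => t ts; apply: fg => y; rewrite !inE => /orP[->//|/ts->].
by rewrite orbT.
Qed.

Lemma cobD f g s : cob (fun t => f t (+) g t) s = cob f s (+) cob g s.
Proof. by elim: s f g => //= x s IH f g; rewrite IH addbACA. Qed.

Lemma cob_false s : cob (fun=> false) s = false.
Proof. by elim: s. Qed.

Lemma cob_and b f s : cob (fun t => b && f t) s = b && cob f s.
Proof.
by case: b; rewrite ?cob_false.
Qed.

Lemma cob_cob f s : cob (cob f) s = false.
Proof.
elim: s f => //= x s IH f.
rewrite cobD IH addbF addbb //.
Qed.

End Cochains.

Section CochainMap.
Variables (T U : choiceType).

Lemma cob_map (h : T -> U) f s : cob (fun t => f (map h t)) s = cob f (map h s).
Proof. by elim: s f => //= x s IH f; rewrite (IH (fun t => f (h x :: t))). Qed.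

(** The prism operator: the sum over all cuts of the tuple, with [a] applied up to the cut, [b] from
    the cut on, and the vertex at the cut used twice. Modulo 2 no signs appear. *)
Fixpoint prism (a b : T -> U) (f : seq U -> bool) (s : seq T) : bool :=
  if s is x :: s' then
    f (a x :: b x :: map b s') (+) prism a b (fun t => f (a x :: t)) s'
  else false.

Lemma prismD a b f g s :
  prism a b (fun t => f t (+) g t) s = prism a b f s (+) prism a b g s.
Proof. by elim: s f g => //= x s IH f g; rewrite IH addbACA. Qed.

Lemma prism_homotopy a b f s :
  cob (prism a b f) s (+) prism a b (cob f) s = f (map a s) (+) f (map b s).
Proof.
elim: s f => [|x s IH] f /=; first by rewrite addbb.
rewrite (cobD (fun t => f (a x :: b x :: map b t))) prismD.
rewrite (cob_map b (fun t => f (a x :: b x :: t))).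
have := IH (fun t => f (a x :: t)).
move: (cob (prism _ _ _) s) (prism _ _ _ s) => p q.
case: (f (map b s)); case: (cob _ (map b s)); case: p; case: q;
  case: (prism a b f s); case: (f (b x :: map b s)); case: (f (a x :: map a s));
  case: (f (a x :: map b s)) => //=.
Qed.

Lemma prism_eq0 a b f s :
  (forall t, {subset t <= map a s ++ map b s} -> f t = false) -> prism a b f s = false.
Proof.
elim: s f => //= x s IH f f0; rewrite f0 ?IH// => t ts.
  apply: f0 => y; rewrite !inE => /orP[->//|/ts].
  by rewrite !mem_cat inE => /orP[->|->]; rewrite ?orbT.
move: ts; rewrite !inE mem_cat inE => /or3P[->//|->|->]; by rewrite ?orbT.
Qed.

End CochainMap.

Section Acyclic.
Variables (R : realType) (N : nat).
Local Notation V := 'rV[R]_N.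
Implicit Types (X : set V) (s : seq V).

Definition small X (e : R) s :=
  (forall x, x \in s -> X x) /\ (forall x y, x \in s -> y \in s -> `|x - y| < e).

(** Cochains count only as germs along the diagonal, so every identity between them is asserted for
    tuples of small diameter. *)
Definition near_diag X (P : seq V -> Prop) :=
  exists2 e, 0 < e & forall s, small X e s -> P s.

(** Reduced [F_2]-cohomology vanishes, the empty tuple having degree [-1]. *)
Definition acyclic X := forall f, near_diag X (fun s => cob f s = false) ->
  exists g, near_diag X (fun s => f s = cob g s).

Lemma small_le X e e' s : e <= e' -> small X e s -> small X e' s.
Proof. by move=> ee [h1 h2]; split => // x y xs ys; exact: lt_le_trans (h2 _ _ xs ys) ee. Qed.

Lemma small_sub X e s t : {subset t <= s} -> small X e s -> small X e t.
Proof. by move=> ts [h1 h2]; split=> [x /ts/h1|x y /ts xs /ts ys]//; exact: h2. Qed.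

Lemma contractible_acyclic X (h : V -> R -> V) x0 : X x0 ->
  (forall x t, X x -> 0 <= t <= 1 -> X (h x t)) ->
  (forall e, 0 < e -> exists2 d, 0 < d & forall x y t u, X x -> X y ->
     0 <= t <= 1 -> 0 <= u <= 1 -> `|x - y| < d -> `|t - u| < d ->
     `|h x t - h y u| < e) ->
  (forall x, X x -> h x 0 = x) -> (forall x, X x -> h x 1 = x0) -> acyclic X.
Proof.
move=> Xx0 hX hu h0 h1 f [e e0 fe].
have [d d0 hd] := hu e e0.
have [M Md] : exists M : nat, (M.+1)%:R^-1 < d.
  have := near_infty_natSinv_lt (PosNum d0); case=> M _ /(_ M (leqnn M)) /= H.
  by exists M.
pose tt (i : nat) : R := i%:R / M.+1%:R.
have tt01 i : (i <= M.+1)%N -> 0 <= tt i <= 1.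
  by move=> iM; rewrite divr_ge0//= ler_pdivrMr// mul1r ler_nat.
pose hh i x := h x (tt i).
(* Consecutive times are so close that the prism between them uses only small tuples, on which
   [cob f] vanishes; the prisms of all the steps add up to a primitive of the difference. *)
have step i : (i <= M.+1)%N -> exists g, forall s, small X d s ->
    f s (+) f (map (hh i) s) = cob g s.
  elim: i => [|i IH] iM.
    exists (fun=> false) => s [Xs _]; rewrite cob_false.
    have -> : map (hh 0%N) s = s; last by rewrite addbb.
    by rewrite -[RHS]map_id; apply/eq_in_map => x /Xs xX; rewrite /hh /tt mul0r h0.
  have [g gP] := IH (ltnW iM).
  exists (fun s => g s (+) prism (hh i) (hh i.+1) f s) => s sd.
  rewrite cobD -gP//.
  have := prism_homotopy (hh i) (hh i.+1) f s.
  rewrite [prism _ _ (cob f) s]prism_eq0 ?addbF => [->|t ts].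
    by rewrite addbA -(addbA (f s)) addbb addbF.
  apply: fe; have [Xs ds] := sd.
  have mem y : y \in t -> exists2 x, x \in s & y = hh i x \/ y = hh i.+1 x.
    by move=> /ts; rewrite mem_cat => /orP[] /mapP[x xs ->]; exists x; auto.
  split=> [y /mem[x xs [->|->]]|y z /mem[x xs yx] /mem[x' xs' zx]].
  - by apply: hX; [exact: Xs|exact/tt01/ltnW].
  - by apply: hX; [exact: Xs|exact: tt01].
  have di : `|tt i - tt i.+1| < d /\ `|tt i.+1 - tt i| < d.
    rewrite distrC; suff : `|tt i.+1 - tt i| < d by [].
    by rewrite -mulrBl -natrB// subSnn mul1r ger0_norm.
  have [Xx Xx'] := (Xs _ xs, Xs _ xs'); have dx := ds _ _ xs xs'.
  have [ti tS] := (tt01 _ (ltnW iM), tt01 _ iM).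
  by case: yx zx => -> [] ->; apply: hd => //; rewrite ?subrr ?normr0; case: di.
have [g gP] := step M.+1 (leqnn _).
(* At the end of the homotopy all vertices are [x0]. Adding [x0] once more in front exhibits [f] on
   the constant tuple as a coboundary. *)
pose k s := f (x0 :: map (fun=> x0) s).
exists (fun s => g s (+) k s), (Num.min d e); first by rewrite lt_min d0.
move=> s sde; have sd : small X d s by apply: small_le sde; rewrite ge_min lexx.
rewrite cobD -gP//.
have -> : map (hh M.+1) s = map (fun=> x0) s.
  by have [Xs _] := sd; apply/eq_in_map => x /Xs xX; rewrite /hh /tt divff// h1.
have : cob f (x0 :: map (fun=> x0) s) = false.
  apply: fe; split=> [y|y z]; rewrite !inE.
    by case/orP => [/eqP->//|/mapP[? _ ->]].
  have P (w : V) : (w == x0) || (w \in [seq x0 | _ <- s]) -> w = x0.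
    by case/orP => [/eqP|/mapP[? _ ->]].
  by move=> /P-> /P->; rewrite subrr normr0.
rewrite /= -(cob_map (fun=> x0) (fun t => f (x0 :: t))) /k.
by move: (f _) (f s) (cob _ s) => [] [] [].
Qed.

End Acyclic.

(** Smith theory: the complex of invariant cochains vanishing near the fixed
    set is acyclic, because cup product with the class of the double cover
    [X \ F -> (X \ F) / tau] is both injective, as [X] is acyclic, and
    nilpotent, as the cover is classified by the odd map [x - tau x]. *)
Section Smith.
Variables (R : realType) (N : nat).
Local Notation V := 'rV[R]_N.
Variables (X : set V) (tau : V -> V) (L : R).
Hypothesis tX : forall x, X x -> X (tau x).
Hypothesis tK : forall x, X x -> tau (tau x) = x.
Hypothesis L1 : 1 <= L.
Hypothesis tL : forall x y, X x -> X y -> `|tau x - tau y| <= L * `|x - y|.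
Hypothesis retr : forall e, 0 < e -> exists2 h, 0 < h & forall x, X x ->
  `|x - tau x| < h -> exists y, [/\ X y, tau y = y & `|x - y| < e].
Hypothesis acX : acyclic X.

Let F : set V := [set x | X x /\ tau x = x].
Let q (j : 'I_N) (x : V) := (x - tau x) 0 j.
Let nearq (j : nat) e (s : seq V) :=
  forall x, x \in s -> forall i : 'I_N, (i < j)%N -> `|q i x| < e.
(** A filtration between two extremes: [evj 0] refers to all small tuples of [X], [evj N] to small
    tuples near the fixed set. Each intermediate index imposes smallness of one more coordinate of
    the odd map [x - tau x]. *)
Let evj j (P : seq V -> Prop) :=
  exists2 e, 0 < e & forall s, small X e s -> nearq j e s -> P s.

Let nearq_le j e e' s : e <= e' -> nearq j e s -> nearq j e' s.
Proof. by move=> ee h x xs i ij; exact: lt_le_trans (h x xs i ij) ee. Qed.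

Let nearq_sub j e s t : {subset t <= s} -> nearq j e s -> nearq j e t.
Proof. by move=> ts h x /ts; exact: h. Qed.

Let evjI j P Q : evj j P -> evj j Q -> evj j (fun s => P s /\ Q s).
Proof.
move=> [a a0 ha] [b b0 hb]; exists (Num.min a b); first by rewrite lt_min a0.
move=> s ss sn; split.
  by apply: ha; [apply: small_le ss|apply: nearq_le sn]; rewrite ge_min lexx.
by apply: hb; [apply: small_le ss|apply: nearq_le sn]; rewrite ge_min lexx orbT.
Qed.

Let evj_imp j (P Q : seq V -> Prop) : (forall s, (forall x, x \in s -> X x) -> P s -> Q s) ->
  evj j P -> evj j Q.
Proof. by move=> PQ [a a0 ha]; exists a => // s ss sn; apply: PQ (ha s ss sn); case: ss. Qed.

Let evj_le i j P : (i <= j)%N -> evj i P -> evj j P.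
Proof.
move=> ij [a a0 ha]; exists a => // s ss sn; apply: ha => // x xs k ki.
by apply: sn => //; exact: leq_trans ki ij.
Qed.

Let evj0P P : evj 0 P <-> near_diag X P.
Proof.
by split=> -[a a0 ha]; exists a => // s ss; [apply: ha|move=> _; exact: ha].
Qed.

Let qtau j x : X x -> q j (tau x) = - q j x.
Proof. by move=> Xx; rewrite /q tK// !mxE opprB. Qed.

Let qlip j x y : X x -> X y -> `|q j x - q j y| <= (1 + L) * `|x - y|.
Proof.
move=> Xx Xy; have -> : q j x - q j y = ((x - y) - (tau x - tau y)) 0 j.
  by rewrite /q !mxE; ring.
rewrite (le_trans (mx_norm_ge _ _ _))// (le_trans (ler_normB _ _))//.
by rewrite mulrDl mul1r lerD// tL.
Qed.

Let L0 : 0 < L. Proof. exact: lt_le_trans L1. Qed.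

Let small_tau e s : small X e s -> small X (L * e) (map tau s).
Proof.
move=> [h1 h2]; split=> [x /mapP[y ys ->]|x y /mapP[a sa ->] /mapP[b sb ->]].
  exact/tX/h1.
by rewrite (le_lt_trans (tL (h1 _ sa) (h1 _ sb)))// ltr_pM2l// h2.
Qed.

Let evj_tau j P : evj j P -> evj j (fun s => P (map tau s)).
Proof.
move=> [a a0 ha]; have aL : a / L <= a by rewrite ler_pdivrMr// ler_peMr// ltW.
exists (a / L); first by rewrite divr_gt0.
move=> s ss sn; apply: ha.
  by have := small_tau ss; rewrite mulrC divfK// gt_eqF.
have [Xs _] := ss => x /mapP[y ys ->] i ij; rewrite qtau ?normrN; last exact: Xs.
exact: lt_le_trans (sn y ys i ij) aL.
Qed.

Let evj_cob j f g : evj j (fun s => f s = g s) -> evj j (fun s => cob f s = cob g s).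
Proof.
move=> [a a0 ha]; exists a => // s ss sn; apply: eq_in_cob => t ts.
by apply: ha; [apply: small_sub ss|apply: nearq_sub sn].
Qed.

Let tauK s : (forall x, x \in s -> X x) -> map tau (map tau s) = s.
Proof.
by move=> Xs; rewrite -map_comp -[RHS]map_id; apply/eq_in_map => x /Xs /tK.
Qed.

(** One tuple is chosen from each pair of [s] and its image under [tau]. Off the tuples equal to
    their image, [half] holds for exactly one of the two; cochains need no continuity, so any choice
    works. *)
Let rep s := choose (fun t => (t == s) || (t == map tau s)) s.
Let half s := rep s == s.

Let half_tau s : (forall x, x \in s -> X x) -> map tau s != s ->
  half (map tau s) = ~~ half s.
Proof.
move=> Xs ne.
have rt : rep (map tau s) = rep s.
  rewrite /rep tauK//; set P := fun _ => _; set Q := fun _ => _.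
  have PQ : P =1 Q by move=> t; rewrite /Q orbC.
  by rewrite (eq_choose PQ); apply: choose_id; rewrite /Q eqxx ?orbT.
have : (rep s == s) || (rep s == map tau s).
  by apply: (@chooseP _ (fun t => (t == s) || (t == map tau s)) s); rewrite eqxx.
rewrite /half rt; case: eqVneq => [->|_] /=; first by rewrite eq_sym (negbTE ne).
by move=> ->.
Qed.

Let inS k := evj 0 (fun s => k (map tau s) = k s) /\ evj N (fun s => k s = false).

(** Where the first [j] coordinates of [x - tau x] are small, [k] lives only where coordinate [j] is
    not small. Its sign is then locally constant and splits [k] into two halves exchanged by [tau],
    each still a cocycle. Elsewhere an arbitrary choice of halves is enough, as nothing is claimed
    about [cob d] there. *)
Let wstep (j : 'I_N) k : inS k -> evj 0 (fun s => cob k s = false) ->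
  evj j.+1 (fun s => k s = false) ->
  exists d, [/\ evj 0 (fun s => k s = d s (+) d (map tau s)),
    evj N (fun s => d s = false) & evj j (fun s => cob d s = false)].
Proof.
move=> [k1 k2] k3 k4.
have [e e0 [E1 E2 E3 E4]] : exists2 e, 0 < e & [/\
    forall s, small X e s -> k (map tau s) = k s,
    forall s, small X e s -> nearq N e s -> k s = false,
    forall s, small X e s -> cob k s = false &
    forall s, small X e s -> nearq j.+1 e s -> k s = false].
  case: k1 k2 k3 k4 => [a a0 ha] [b b0 hb] [c c0 hc] [d d0 hd].
  exists (Num.min (Num.min a b) (Num.min c d)); first by rewrite !lt_min a0 b0 c0.
  split=> s ss.
  - by apply: ha => //; apply: small_le ss; rewrite !ge_min lexx.
  - move=> sn; apply: hb; [apply: small_le ss|apply: nearq_le sn];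
    by rewrite !ge_min lexx ?orbT.
  - by apply: hc => //; apply: small_le ss; rewrite !ge_min lexx orbT.
  - move=> sn; apply: hd; [apply: small_le ss|apply: nearq_le sn];
    by rewrite !ge_min lexx ?orbT.
pose A s := all (fun x => [forall i : 'I_N, (i < j)%N ==> (`|q i x| < e)]) s.
have AP s : reflect (nearq j e s) (A s).
  apply: (iffP allP) => [h x /h/forallP h' i ij|h x xs].
    by have := h' i; rewrite ij.
  by apply/forallP => i; apply/implyP => ij; exact: h.
have At s : (forall x, x \in s -> X x) -> A (map tau s) = A s.
  move=> Xs; rewrite /A all_map; apply: eq_in_all => x /Xs Xx /=.
  by apply: eq_forallb => i; rewrite qtau// normrN.
pose d s := if A s then (0 < q j (head 0 s)) && k s else half s && k s.
pose e1 := e / (2 * (1 + L)).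
have L10 : 0 < 1 + L by rewrite addr_gt0.
have e10 : 0 < e1 by rewrite divr_gt0// mulr_gt0.
have e1e : e1 <= e.
  rewrite ler_pdivrMr ?mulr_gt0// ler_peMr; have := L1; lra.
have e1L : (1 + L) * e1 = e / 2.
  by rewrite /e1; field; rewrite gt_eqF.
have k0 : k [::] = false by apply: E4 => //.
have dE s t : small X e1 s -> nearq j e s -> {subset t <= s} ->
    d t = (0 < q j (head 0 t)) && k t.
  by move=> ss sn ts; rewrite /d (introT (AP t))//; exact: nearq_sub sn.
have dq s x y : small X e1 s -> x \in s -> y \in s -> `|q j x - q j y| < e / 2.
  move=> [Xs ds] xs ys; rewrite (le_lt_trans (qlip j (Xs _ xs) (Xs _ ys)))//.
  by rewrite -e1L ltr_pM2l// ds.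
have k_close s x : small X e1 s -> nearq j e s -> x \in s -> `|q j x| < e / 2 ->
    forall t, {subset t <= s} -> k t = false.
  move=> ss sn xs qx t ts; apply: E4.
    by apply: small_sub ts _; apply: small_le ss.
  move=> y /ts ys i; rewrite ltnS leq_eqVlt => /orP[/eqP ij|ij]; last exact: sn.
  have -> : i = j by exact: val_inj.
  have := dq _ _ _ ss ys xs; have := ler_normD (q j y - q j x) (q j x).
  rewrite subrK; lra.
exists d; split.
- exists e1 => // s ss _.
  have ss' : small X e s by exact: small_le ss.
  have [Xs _] := ss; rewrite /d At//; case: ifPn => As.
    case: s ss ss' Xs As => [|x s] ss ss' Xs As; first by rewrite k0 andbF.
    have xs : x \in x :: s by rewrite inE eqxx.
    rewrite E1//= qtau; last exact: Xs.
    have [q0|q0|q0] := ltgtP 0 (q j x); rewrite oppr_gt0.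
    - by rewrite (lt_gtF q0)/= addbF.
    - by rewrite q0.
    - suff -> : k (x :: s) = false by rewrite !andbF.
      apply: (k_close _ _ ss _ xs) => //; first exact/AP.
      by rewrite -q0 normr0 divr_gt0.
  have [ts|ts] := eqVneq (map tau s) s.
    rewrite ts addbb; apply: E2 => // x xs i _.
    have h : {in s, tau =1 id} by apply/eq_in_map; rewrite map_id.
    have tx : tau x = x by exact: h.
    by rewrite /q tx subrr mxE normr0.
  by rewrite half_tau// E1; case: (half s); rewrite ?addbF.
- exists e => // s ss sn; rewrite /d E2//.
  by rewrite !andbF if_same.
- exists e1 => // s ss sn'.
  have sn : nearq j e s by exact: nearq_le sn'.
  have [/hasP[x xs qx]|/hasPn far] := boolP (has (fun x => `|q j x| < e / 2) s).
    rewrite -(cob_false s); apply: eq_in_cob => t ts.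
    by rewrite (dE s)// (k_close _ _ ss sn xs qx)// andbF.
  case: s ss sn sn' far => // x s ss sn _ far.
  have -> : cob d (x :: s) = cob (fun t => (0 < q j x) && k t) (x :: s).
    apply: eq_in_cob => t ts; rewrite (dE _ _ ss sn ts).
    case: t ts => [|y t] ts; first by rewrite k0 !andbF.
    have ys : y \in x :: s by apply: ts; rewrite inE eqxx.
    have xs : x \in x :: s by rewrite inE eqxx.
    have := dq _ _ _ ss xs ys; have := far _ xs; have := far _ ys.
    rewrite -!leNgt /= => H1 H2 H3; congr (_ && _).
    case: (ltP 0 (q j x)) => qx; case: (ltP 0 (q j y)) => qy //; exfalso; move: H1 H2 H3.
      rewrite (ler0_norm qy) (gtr0_norm qx) => a b c.
      have := ler_norm (q j x - q j y); lra.
    rewrite (ler0_norm qx) (gtr0_norm qy) => a b c.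
    have := ler_norm (q j y - q j x); rewrite distrC; lra.
  by rewrite cob_and E3 ?andbF//; exact: small_le ss.
Qed.

(** The map [rho] is a mere choice of a nearby fixed point; closeness to the identity is all that
    small tuples require of it. The set [S x] of candidates is the same for [x] and [tau x], which
    makes the choice invariant. *)
Let rho_exists e : 0 < e -> exists2 h, 0 < h & exists rho : V -> V,
  (forall x, F x -> rho x = x) /\
  forall x, X x -> (forall i, `|q i x| < h) ->
    [/\ F (rho x), `|x - rho x| < e & rho (tau x) = rho x].
Proof.
move=> e0; have [h h0 hh] := retr (divr_gt0 e0 L0).
exists (h / 2); first by rewrite divr_gt0.
pose S x : set V := [set y | [/\ F y, `|x - y| < e & `|tau x - y| < e]].
exists (fun x => if `[< F x >] then x else xget 0 (S x)); split=> [x Fx|x Xx qx].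
  by rewrite (introT (asboolP _)).
have St : S (tau x) = S x.
  by apply/seteqP; split=> y; rewrite /S tK// => -[].
have [Fx|nFx] := asboolP (F x).
  by have [_ tx] := Fx; rewrite tx (introT (asboolP _))// subrr normr0.
have nFt : ~ F (tau x) by move=> [_]; rewrite tK// => tx; apply: nFx.
rewrite (introF (asboolP _) nFt) St.
have [y [Xy ty yx]] : exists y, [/\ X y, tau y = y & `|x - y| < e / L].
  apply: hh => //; apply: (@le_lt_trans _ _ (h / 2)); last lra.
  by apply: mx_norm_le => [|i j]; [rewrite divr_ge0// ltW|rewrite ord1; exact/ltW/qx].
have eL : e / L <= e by rewrite ler_pdivrMr// ler_peMr// ltW.
have Sy : S x y.
  split; [by []|exact: lt_le_trans yx eL|].
  rewrite -[in X in _ - X]ty (le_lt_trans (tL Xx Xy))//.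
  by rewrite mulrC -ltr_pdivlMr.
by have [] := xgetPex 0 (ex_intro _ y Sy).
Qed.

Let F_q x i : F x -> q i x = 0.
Proof. by move=> [_ tx]; rewrite /q tx subrr mxE. Qed.

(** Write [k] as [d] plus its image by [wstep]. The coboundary of [d] is invariant and vanishes when
    the first [j] coordinates are small, so by induction it equals [cob k''], and [d + k''] is a
    cocycle on the acyclic [X], say [cob e]. As [k''] is invariant, [k] is the coboundary of [e]
    plus its image. *)
Let acyclicS j k : (j <= N)%N -> inS k -> evj 0 (fun s => cob k s = false) ->
  evj j (fun s => k s = false) -> exists k', inS k' /\ evj 0 (fun s => k s = cob k' s).
Proof.
elim: j k => [|j IH] k jN kS kc kj.
  exists (fun=> false); split; first by split; exists 1.
  by apply: evj_imp kj => s _ ->; rewrite cob_false.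
have [d [d1 d2 d3]] := wstep (j := Ordinal jN) kS kc kj.
have [k'' [k''S k''E]] : exists k', inS k' /\ evj 0 (fun s => cob d s = cob k' s).
  apply: IH => //; first exact: ltnW.
  - split.
      have c1 := evj_cob d1; apply: evj_imp (evjI c1 kc) => s _ [].
      by rewrite cobD (cob_map tau) => -> ; case: (cob d s); case: (cob d _).
    by apply: evj_imp (evj_cob d2) => s _ ->; rewrite cob_false.
  - by exists 1 => // s _ _; rewrite cob_cob.
have [e eE] : exists e, near_diag X (fun s => d s (+) k'' s = cob e s).
  apply: acX; apply/evj0P; apply: evj_imp k''E => s _ E.
  by rewrite cobD E addbb.
have /evj0P eE' := eE.
have [e0 e00 he0] : evj N (fun s => cob e s = false).
  have [_ kN] := k''S; have eN := evj_le (leq0n N) eE'.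
  by apply: evj_imp (evjI eN (evjI d2 kN)) => s _ [<- [-> ->]].
have [h h0 [rho [rhoF rhoP]]] := rho_exists (divr_gt0 e00 (ltr0Sn _ 3)).
(* The primitive must vanish near the fixed set. There [e] is a cocycle, and adding the coboundary
   of a prism replaces it by [e] evaluated on [rho]-images; this is invariant, so the sum with its
   image is zero. *)
pose e' s := e s (+) cob (prism id rho e) s.
have e'E : evj N (fun s => e' s = e (map rho s)).
  exists (Num.min h (e0 / 4)); first by rewrite lt_min h0 divr_gt0.
  move=> s ss sn; have [Xs ds] := ss.
  have rs x : x \in s -> [/\ F (rho x), `|x - rho x| < e0 / 4 & rho (tau x) = rho x].
    move=> xs; apply: rhoP; first exact: Xs.
    move=> i; apply: lt_le_trans (sn x xs i (ltn_ord i)) _.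
    by rewrite ge_min lexx.
  have := prism_homotopy id rho e s.
  rewrite [prism _ _ (cob e) s]prism_eq0 ?addbF => [E|t ts].
    by rewrite /e' E map_id addbA addbb.
  have mem y : y \in t -> exists2 x, x \in s & y = x \/ y = rho x.
    by move=> /ts; rewrite map_id mem_cat => /orP[ys|/mapP[x xs ->]]; [exists y|exists x]; auto.
  apply: he0; first split=> [y /mem[x xs [->|->]]|y z /mem[x xs yx] /mem[x' xs' zx]].
  - exact: Xs.
  - by have [[]] := rs _ xs.
  - have [_ a _] := rs _ xs; have [_ b _] := rs _ xs'.
    have := ds _ _ xs xs'; rewrite lt_min => /andP[_ c].
    have n1 := ler_normD (x - x') (x' - rho x').
    have n2 := ler_normD (rho x - x) (x - x').
    have n3 := ler_normD (rho x - x') (x' - rho x').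
    rewrite !addrA !subrK [`|rho x - x|]distrC in n1 n2 n3.
    case: yx zx => -> [] ->; lra.
  - move=> y /mem[x xs [->|->]] i iN.
      by apply: lt_le_trans (sn x xs i iN) _; rewrite ge_min; lra.
    by rewrite F_q ?normr0; have [] := rs _ xs.
exists (fun s => e' s (+) e' (map tau s)); split; first split.
- by exists 1 => // s [Xs _] _; rewrite tauK// addbC.
- have [r r0 rP] : evj N (fun s => map rho (map tau s) = map rho s).
    exists h => // s [Xs _] sn; rewrite -map_comp; apply/eq_in_map => x xs /=.
    by have [] := rhoP x (Xs _ xs) (fun i => sn x xs i (ltn_ord i)).
  have rE : evj N (fun s => map rho (map tau s) = map rho s) by exists r.
  apply: evj_imp (evjI (evjI e'E (evj_tau e'E)) rE) => s _ [[-> ->] ->].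
  by rewrite addbb.
- have [kS1 _] := k''S.
  apply: evj_imp (evjI (evjI d1 kS1) (evjI eE' (evj_tau eE'))) => s _ [[E1 E2] [E3 E4]].
  rewrite cobD (cob_map tau) !cobD !cob_cob !addbF -E3 -E4 E2 E1.
  by rewrite addbACA addbb addbF.
Qed.

(** A cocycle [z] of the fixed set is extended to [y0] through [rho] near that set and by zero
    elsewhere. Its coboundary is invariant and vanishes near the fixed set, hence is [cob k'] for
    such a [k']; a primitive of the cocycle [y0 + k'] of [X] restricts to a primitive of [z]. *)
Theorem smith_fixed_acyclic : acyclic [set x | X x /\ tau x = x].
Proof.
move=> z [e e0 ze].
have [h h0 [rho [rhoF rhoP]]] := rho_exists (divr_gt0 e0 (ltr0Sn _ 3)).
pose nF s := all (fun x => [forall i : 'I_N, `|q i x| < h]) s.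
pose y0 s := nF s && z (map rho s).
have nFP s : nearq N h s -> nF s.
  by move=> sn; apply/allP => x xs; apply/forallP => i; exact: sn.
have y0t : evj 0 (fun s => y0 (map tau s) = y0 s).
  exists 1 => // s [Xs _] _; rewrite /y0.
  have -> : nF (map tau s) = nF s.
    rewrite /nF all_map; apply: eq_in_all => x /Xs Xx /=.
    by apply: eq_forallb => i; rewrite qtau// normrN.
  case: (boolP (nF s)) => //= /allP ns; congr z; rewrite -map_comp.
  apply/eq_in_map => x xs /=.
  by have [] := rhoP x (Xs _ xs) (fun i => forallP (ns x xs) i).
have y0N : evj N (fun s => cob y0 s = false).
  exists (Num.min h (e / 4)); first by rewrite lt_min h0 divr_gt0.
  move=> s ss sn; have [Xs ds] := ss.
  have sh : nearq N h s by apply: nearq_le sn; rewrite ge_min lexx.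
  have rs x : x \in s -> [/\ F (rho x), `|x - rho x| < e / 4 & rho (tau x) = rho x].
    by move=> xs; apply: rhoP; [exact: Xs|move=> i; exact: sh].
  have -> : cob y0 s = cob (fun t => z (map rho t)) s.
    by apply: eq_in_cob => t ts; rewrite /y0 nFP//; exact: nearq_sub sh.
  rewrite cob_map; apply: ze; split=> [x /mapP[y ys ->]|x y /mapP[a sa ->] /mapP[b sb ->]].
    by have [] := rs _ ys.
  have [_ na _] := rs _ sa; have [_ nb _] := rs _ sb.
  have := ds _ _ sa sb; rewrite lt_min => /andP[_ c].
  have n1 := ler_normD (rho a - a) (a - b).
  have n2 := ler_normD (rho a - b) (b - rho b).
  rewrite !addrA !subrK [`|rho a - a|]distrC in n1 n2; lra.
have kS : inS (cob y0).
  split=> //; have := evj_cob y0t; apply: evj_imp => s _.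
  by rewrite (cob_map tau).
have [k' [[k't k'N] k'E]] : exists k', inS k' /\ evj 0 (fun s => cob y0 s = cob k' s).
  apply: (acyclicS (leqnn N)) => //.
  by exists 1 => // s _ _; rewrite cob_cob.
have [c cE] : exists c, near_diag X (fun s => y0 s (+) k' s = cob c s).
  by apply: acX; apply/evj0P; apply: evj_imp k'E => s _ E; rewrite cobD E addbb.
have /evj0P cE' := cE; have cN := evj_le (leq0n N) cE'.
have [d d0 hd] := evjI cN k'N; exists c; exists d => // s [Fs ds].
have Fq x i : x \in s -> q i x = 0 by move=> xs; apply: F_q; exact: Fs.
have sd : small X d s by split=> // x /Fs[].
have sn r : 0 < r -> nearq N r s by move=> r0 x xs i _; rewrite Fq// normr0.
have [<- k's] := hd s sd (sn _ d0); rewrite k's addbF /y0 nFP/=; last exact: sn.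
congr z; rewrite -[LHS]map_id; apply/eq_in_map => x xs.
by rewrite rhoF//; exact: Fs.
Qed.

End Smith.

(** * The counting step of Sperner's lemma *)

Section LabelCochain.

Lemma eq_cob_face (T : choiceType) (f g : seq T -> bool) s :
  (forall i, (i < size s)%N -> f (take i s ++ drop i.+1 s) = g (take i s ++ drop i.+1 s)) ->
  cob f s = cob g s.
Proof.
elim: s f g => //= x s IH f g fg; congr (_ (+) _).
  by have := fg 0 isT; rewrite drop0.
by apply: IH => i ri; exact: (fg i.+1).
Qed.

(** A face omits one vertex only, so it keeps one of the two foreign labels. *)
Lemma cob_perm_two (T : choiceType) (B s : seq T) a b : a != b -> a \notin B -> b \notin B ->
  a \in s -> b \in s -> cob (fun t => perm_eq t B) s = false.
Proof.
move=> ab aB bB as_ bs; rewrite -(cob_false s); apply: eq_cob_face => i si.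
apply/negbTE/negP => /perm_mem E.
have mem x : x \in s -> x \notin B -> x = nth a s i.
  move=> xs xB; apply/eqP; apply: contraNT xB => xi; rewrite -E.
  move: xs; rewrite -{1}(cat_take_drop i s) (drop_nth a si) !mem_cat inE (negbTE xi) /=.
  by [].
by move: ab; rewrite (mem a as_ aB) (mem b bs bB) eqxx.
Qed.

(** A tuple carrying all labels of [c :: B] once has exactly one face labelled by [B]. In any other
    tuple such faces come in pairs, by dropping either copy of a repeated label. *)
Lemma cob_perm (T : choiceType) (B u : seq T) c : uniq B -> c \notin B ->
  {subset u <= c :: B} -> cob (fun t => perm_eq t B) u = perm_eq u (c :: B).
Proof.
elim: u B c => [|x t IH] B c uB cB uc.
  by rewrite /=; apply/esym/negbTE/negP => /perm_size.
rewrite [cob _ _]/=; have := uc x; rewrite !inE eqxx => /(_ isT)/orP[/eqP->|xB].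
  rewrite perm_cons; have -> : cob (fun t => perm_eq (c :: t) B) t = cob (fun=> false) t.
    by apply: eq_in_cob => t' _; apply/negbTE/negP => /perm_mem/(_ c); rewrite inE eqxx (negbTE cB).
  by rewrite cob_false addbF.
pose B' := rem x B; have pB : perm_eq B (x :: B') := perm_to_rem xB.
have uB' : uniq B' := rem_uniq _ uB.
have xB' : x \notin B' by rewrite mem_rem_uniqF.
have xc : x != c by apply: contraNneq cB => <-.
have cB' : c \notin B' by apply: contra cB => /mem_rem.
have -> : cob (fun t => perm_eq (x :: t) B) t = cob (fun t => perm_eq t B') t.
  by apply: eq_in_cob => t' _; rewrite (permPr pB) perm_cons.
have -> : perm_eq (x :: t) (c :: B) = perm_eq t (c :: B').
  have p : perm_eq (c :: B) (x :: c :: B').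
    apply: (@perm_trans _ (c :: x :: B')); first by rewrite perm_cons.
    by apply/seq.permP => P /=; rewrite addnCA.
  by rewrite (permPr p) perm_cons.
have tB y : y \in t -> [|| y == c, y == x | y \in B'].
  move=> yt; have := uc y; rewrite !inE yt orbT => /(_ isT)/orP[->//|].
  by rewrite (perm_mem pB) inE => ->; rewrite orbT.
have [xt|xt] := boolP (x \in t); last first.
  have -> : perm_eq t B = false.
    by apply/negbTE/negP => /perm_mem/(_ x); rewrite (negbTE xt) xB.
  rewrite (IH B' c)// => y yt; have := tB y yt; rewrite inE => /or3P[->//|/eqP yx|->].
    by rewrite -yx yt in xt.
  by rewrite orbT.
have -> : perm_eq t (c :: B') = false.
  by apply/negbTE/negP => /perm_mem/(_ x); rewrite xt inE (negbTE xc) (negbTE xB').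
have [ct|ct] := boolP (c \in t).
  rewrite (@cob_perm_two _ _ _ x c)// addbF.
  by apply/negbTE/negP => /perm_mem/(_ c); rewrite ct (negbTE cB).
rewrite (IH _ x)//; first by rewrite (permPr pB) addbb.
move=> y yt; have := tB y yt; rewrite inE => /or3P[/eqP yc|->//|->].
  by rewrite -yc yt in ct.
by rewrite orbT.
Qed.

End LabelCochain.

(** * A cohomological Sperner lemma *)

Section Walls.
Variables (R : realType) (N : nat) (I : choiceType).
Local Notation V := 'rV[R]_N.
Variables (C : set V) (wall : I -> set V) (D : seq I) (lab : V -> I).

(** [B] lists the labels that remain possible on the face: the point lies on the wall of every other
    label. The whole of [C] is the case of [B] exhausting [D]. *)
Definition wall_face (B : seq I) : set V :=
  [set x | C x /\ forall c, c \in D -> c \notin B -> wall c x].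

Hypothesis labD : forall x, C x -> lab x \in D.
Hypothesis lab_wall : forall c x, C x -> wall c x -> lab x != c.
Hypothesis ac_face : forall B : seq I, B != [::] -> {subset B <= D} -> acyclic (wall_face B).

Let near_imp (X : set V) (P Q : seq V -> Prop) : (forall s, (forall x, x \in s -> X x) -> P s -> Q s) ->
  near_diag X P -> near_diag X Q.
Proof. by move=> PQ [e e0 h]; exists e => // s ss; apply: PQ (h s ss); case: ss. Qed.

Let nearI (X : set V) P Q : near_diag X P -> near_diag X Q -> near_diag X (fun s => P s /\ Q s).
Proof.
move=> [a a0 ha] [b b0 hb]; exists (Num.min a b); first by rewrite lt_min a0.
by move=> s ss; split; [apply: ha|apply: hb]; apply: small_le ss; rewrite ge_min lexx ?orbT.
Qed.

Let near_subset (X Y : set V) P : Y `<=` X -> near_diag X P -> near_diag Y P.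
Proof. by move=> YX [e e0 h]; exists e => // s [s1 s2]; apply: h; split => // x /s1/YX. Qed.

Let near_cob (X : set V) f g : near_diag X (fun s => f s = g s) -> near_diag X (fun s => cob f s = cob g s).
Proof.
move=> [e e0 h]; exists e => // s ss; apply: eq_in_cob => t ts.
by apply: h; exact: small_sub ss.
Qed.

Let wf_rem B b : wall_face (rem b B) `<=` wall_face B.
Proof. by move=> x [Cx h]; split => // c cD cB; apply: h => //; apply: contra cB; exact: mem_rem. Qed.

(** Induction on [Z]. A primitive vanishing on the faces already treated is a cocycle on the next
    face; a primitive of it there, again vanishing on the smaller faces, is extended and its
    coboundary subtracted. [Z] stays shorter than [B], so only nonempty [B] are met. *)
Lemma rel_acyclic (Z B : seq I) f : uniq B -> {subset B <= D} -> uniq Z ->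
  {subset Z <= B} -> (size Z < size B)%N ->
  near_diag (wall_face B) (fun s => cob f s = false) ->
  (forall z, z \in Z -> near_diag (wall_face (rem z B)) (fun s => f s = false)) ->
  exists g, near_diag (wall_face B) (fun s => f s = cob g s) /\
    forall z, z \in Z -> near_diag (wall_face (rem z B)) (fun s => g s = false).
Proof.
elim: Z B f => [|b Z IH] B f uB BD uZ ZB sZ fc fZ.
  have [|g gP] := ac_face (B := B) _ BD fc; first by case: (B) sZ.
  by exists g.
have [bZ uZ'] := andP uZ.
have bB : b \in B by apply: ZB; rewrite inE eqxx.
have ZB' z : z \in Z -> z \in B by move=> zZ; apply: ZB; rewrite inE zZ orbT.
have [g [g1 g2]] : exists g, near_diag (wall_face B) (fun s => f s = cob g s) /\
    forall z, z \in Z -> near_diag (wall_face (rem z B)) (fun s => g s = false).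
  apply: IH => //; first exact: ltnW.
  by move=> z zZ; apply: fZ; rewrite inE zZ orbT.
have [h [h1 h2]] : exists h, near_diag (wall_face (rem b B)) (fun s => g s = cob h s) /\
    forall z, z \in Z -> near_diag (wall_face (rem z (rem b B))) (fun s => h s = false).
  apply: IH => //.
  - exact: rem_uniq.
  - by move=> x /mem_rem/BD.
  - by move=> z zZ; rewrite mem_rem_uniq// inE ZB'// andbT; apply: contraNneq bZ => <-.
  - by rewrite size_rem// -ltnS (leq_trans sZ)// leqSpred.
  - have fb := fZ b; rewrite inE eqxx in fb.
    by apply: near_imp (nearI (fb isT) (near_subset (wf_rem (b := b)) g1)) => s _ [E1 <-].
  - move=> z zZ; apply: near_subset (g2 z zZ) => x [Cx hx]; split => // c cD cB.
    apply: hx => //; apply: contra cB.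
    by rewrite mem_rem_uniq ?rem_uniq// inE mem_rem_uniq// inE mem_rem_uniq// inE => /and3P[-> _ ->].
(* The extension of [h] off the face is by zero, which is allowed since cochains are arbitrary
   functions. *)
pose inb (s : seq V) := `[< forall x, x \in s -> wall_face (rem b B) x >].
pose h' s := inb s && h s.
have inbT (s : seq V) : (forall x, x \in s -> wall_face (rem b B) x) -> inb s by move=> H; apply/asboolP.
exists (fun s => g s (+) cob h' s); split.
  by apply: near_imp g1 => s _ ->; rewrite cobD cob_cob addbF.
move=> z; rewrite inE => /orP[/eqP->|zZ].
  have hE : near_diag (wall_face (rem b B)) (fun s => h' s = h s).
    by exists 1 => // s [sb _]; rewrite /h' inbT.
  apply: near_imp (nearI h1 (near_cob hE)) => s _ [-> ->].
  by rewrite addbb.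
have hz : near_diag (wall_face (rem z B)) (fun s => h' s = false).
  have [e e0 he] := h2 z zZ; exists e => // s [sz ds].
  rewrite /h'; case: (boolP (inb s)) => //= /asboolP sb; apply: he; split=> // x xs.
  have [Cx h3] := sz _ xs; have [_ h4] := sb _ xs; split => // c cD.
  rewrite mem_rem_uniq ?rem_uniq// inE mem_rem_uniq// !negb_and !negbK.
  move=> /orP[/eqP ->|/orP[/eqP->|cB]].
  - apply: h3 => //; first exact/BD/ZB'.
    by rewrite mem_rem_uniqF.
  - by apply: h4; rewrite ?mem_rem_uniqF//; exact: BD.
  - by apply: h3 => //; apply: contra cB; exact: mem_rem.
apply: near_imp (nearI (g2 z zZ) (near_cob hz)) => s _ [-> ->].
by rewrite cob_false.
Qed.

(** Let [chi] be the indicator of the labels [B] on a face labelled by [c :: B]. Then [f + chi] is a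
    cocycle vanishing on the faces of the labels in [B], hence [cob w] with [w] vanishing there too.
    On the face without label [c] the cochain [f] is zero, so [w] is a primitive of the label
    indicator for [B]. At the end the empty tuple gives [false = true]. *)
Lemma label_not_coboundary (B : seq I) f : uniq B -> {subset B <= D} ->
  near_diag (wall_face B) (fun s => cob f s = perm_eq (map lab s) B) ->
  (forall b, b \in B -> near_diag (wall_face (rem b B)) (fun s => f s = false)) -> False.
Proof.
elim: B f => [|c B IH] f uB BD fc fw.
  have [e e0 h] := fc; have := h [::]; rewrite /= perm_refl => H.
  by have // : false = true by apply: H.
have [cB uB'] := andP uB.
have remc : rem c (c :: B) = B by rewrite /= eqxx.
have lin x : wall_face (c :: B) x -> lab x \in c :: B.
  move=> [Cx h]; apply: contraT => lB; have := lab_wall Cx (h _ (labD Cx) lB).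
  by rewrite eqxx.
pose chi (s : seq V) := perm_eq (map lab s) B.
have chiE : near_diag (wall_face (c :: B)) (fun s => cob chi s = perm_eq (map lab s) (c :: B)).
  exists 1 => // s [sB _]; rewrite (cob_map lab (fun t => perm_eq t B)) (cob_perm (c := c))//.
  by move=> _ /mapP[x xs ->]; exact/lin/sB.
have [w [w1 w2]] : exists g, near_diag (wall_face (c :: B)) (fun s => f s (+) chi s = cob g s) /\
    forall z, z \in B -> near_diag (wall_face (rem z (c :: B))) (fun s => g s = false).
  apply: rel_acyclic => //.
  - by move=> x xB; rewrite inE xB orbT.
  - by apply: near_imp (nearI fc chiE) => s _ [E1 E2]; rewrite cobD E1 E2 addbb.
  - move=> z zB; have zcB : z \in c :: B by rewrite inE zB orbT.
    have [e e0 he] := fw z zcB; exists e => // s ss; rewrite he//=.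
    have [sz _] := ss; apply/negbTE/negP => /perm_mem/(_ z); rewrite zB.
    move=> /mapP[x xs zx]; have [Cx h] := sz _ xs.
    have := lab_wall Cx (h z (BD _ zcB) _); rewrite mem_rem_uniqF// => /(_ isT).
    by rewrite -zx eqxx.
apply: (IH w) => //.
- by move=> x xB; apply: BD; rewrite inE xB orbT.
- have := fw c; rewrite inE eqxx => /(_ isT) fw0.
  have w1' := near_subset (wf_rem (B := c :: B) (b := c)) w1; rewrite remc in w1' fw0.
  by apply: near_imp (nearI w1' fw0) => s _ [<- ->].
- move=> b bB; apply: near_subset (w2 b bB) => x [Cx h]; split=> // d dD.
  have bc : b != c by apply: contraNneq cB => <-.
  rewrite mem_rem_uniq// !inE negb_and negbK => /orP[/eqP->|].
    by apply: h; rewrite ?mem_rem_uniqF//; apply: BD; rewrite inE bB orbT.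
  rewrite negb_or => /andP[_ dB]; apply: h => //.
  by apply: contra dB; exact: mem_rem.
Qed.

End Walls.

(** * Topological tools and indistinguishable points *)

Section Topology.

Lemma cont_comp (X Y Z : topologicalType) (u : Z -> X) (f : X -> Y) :
  continuous u -> continuous f -> continuous (fun z => f (u z)).
Proof. by move=> cu cf z; apply: continuous_comp; [exact: cu | exact: cf]. Qed.

Lemma cont_fst (X Y : topologicalType) : continuous (@fst X Y).
Proof. by move=> z; exact: cvg_fst. Qed.

Lemma cont_snd (X Y : topologicalType) : continuous (@snd X Y).
Proof. by move=> z; exact: cvg_snd. Qed.

Lemma cont_pair (X Y Z : topologicalType) (u : Z -> X) (v : Z -> Y) :
  continuous u -> continuous v -> continuous (fun z => (u z, v z)).
Proof. by move=> cu cv z; exact: (cvg_pair (cu z) (cv z)). Qed.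

Lemma cont_cst (X Y : topologicalType) (y : Y) : continuous (fun _ : X => y).
Proof. by move=> x; exact: cvg_cst. Qed.

Lemma continuous_into_prod (Z : topologicalType) (I : eqType) (K : I -> topologicalType)
  (f : Z -> prod_topology K) : (forall i, continuous (fun z => f z i)) -> continuous f.
Proof.
move=> cf z; apply/cvg_sup => i; move: z.
apply/(@continuousP _ (initial_topology (@^~ i))) => A [B oB E].
rewrite -E; have -> : f @^-1` (@^~ i @^-1` B) = (fun z => f z i) @^-1` B by [].
by apply: open_comp => // z _.
Qed.

Lemma prod_coord_continuous (I : eqType) (K : I -> topologicalType) i :
  continuous (fun f : prod_topology K => f i).
Proof. exact: (@proj_continuous I K i). Qed.

Lemma set_val_continuous (X : topologicalType) (A : set X) : continuous (set_val : A -> X).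
Proof. exact: initial_continuous. Qed.

Lemma continuous_into_set_type (Z X : topologicalType) (A : set X) (f : Z -> A) :
  continuous (fun z => set_val (f z)) -> continuous f.
Proof. by move=> h; apply: (@continuous_comp_initial _ _ _ (set_val : A -> X)). Qed.

Lemma compact_set_type (X : topologicalType) (A : set X) : compact A -> compact [set: A].
Proof.
move=> cA F PF _.
have FA : (set_val @ F) A.
  change (F ((set_val : A -> X) @^-1` A)); apply: filterS filterT => x _; exact: set_valP.
have [p [Ap cl]] := cA (set_val @ F) _ FA.
exists (SigSub (mem_set Ap)); split => // B C FB.
case=> U [] [Z oZ ZU] Up UC.
have nZ : nbhs p Z.
  apply: open_nbhs_nbhs; move: Up; by rewrite -ZU.
have FB' : (set_val @ F) (set_val @` B).
  by rewrite /=; apply: filterS FB => x Bx; exists x.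
have [_ [[x Bx <-] Zx]] := cl _ _ FB' nZ.
by exists x; split=> //; apply: UC; rewrite -ZU.
Qed.

Lemma comp_within (Z X Y : topologicalType) (A : set X) (h : X -> Y) (g : Z -> X) :
  {within A, continuous h} -> continuous g -> (forall z, A (g z)) -> continuous (fun z => h (g z)).
Proof.
move=> /subspace_continuousP ch cg Ag z U /= nU.
have := cg z _ (ch _ (Ag z) U nU); rewrite /nbhs /=; apply: filterS => z' /=; exact.
Qed.

Lemma compact_pos (R : realType) (Z : topologicalType) (E : set Z) (f : Z -> R) :
  compact E -> continuous f -> (forall z, E z -> 0 < f z) ->
  exists2 d, 0 < d & forall z, E z -> d <= f z.
Proof.
move=> cE cf fE.
have cfE : closed (f @` E).
  apply: compact_closed; first exact: norm_hausdorff.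
  by apply: continuous_compact => //; exact: continuous_subspaceT.
have n0 : nbhs (0 : R) (~` (f @` E)).
  apply: open_nbhs_nbhs; split; first by rewrite openC.
  by move=> [z Ez e]; have := fE z Ez; rewrite e ltxx.
have [d /= d0 dP] := n0; exists d => // z Ez; rewrite leNgt; apply/negP => fd.
apply: (dP (f z)); last by exists z.
by rewrite /= sub0r normrN gtr0_norm// fE.
Qed.

(** Topological indistinguishability. It stands in for equality in coset spaces of subgroups that
    are not known to be closed. *)
Definition indist (X : topologicalType) (x y : X) := forall U, open U -> (U x <-> U y).

Lemma indist_map (X Y : topologicalType) (f : X -> Y) x y :
  continuous f -> indist x y -> indist (f x) (f y).
Proof. by move=> cf h U oU; apply: (h (f @^-1` U)); apply: open_comp => // z _. Qed.

Lemma indist_eq (Y : topologicalType) (x y : Y) : hausdorff_space Y -> indist x y -> x = y.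
Proof.
move=> hY h; apply: hY => A B; rewrite !nbhsE => -[U [oU Ux] UA] [V [oV Vy] VB].
by exists x; split; [exact: UA | apply: VB; apply/(h V oV)].
Qed.

Variable R : realType.

Lemma norm_sub_continuous (N : nat) (Z : topologicalType) (f g : Z -> 'rV[R]_N) :
  continuous f -> continuous g -> continuous (fun z => `|f z - g z|).
Proof. by move=> cf cg z; apply: cvg_norm; apply: cvgB; [exact: cf | exact: cg]. Qed.

Lemma cont_id (Z : topologicalType) : continuous (fun z : Z => z).
Proof. by move=> z. Qed.

(** The retraction of the line onto the unit interval, written with absolute values so that its
    continuity is immediate; it extends homotopies to all times. *)
Definition clip (t : R) : R := (`|t| - `|t - 1| + 1) / 2.

Lemma clip_itv t : 0 <= clip t <= 1.
Proof.
rewrite /clip; case: (ler0P t) => h0; case: (ler0P (t - 1)) => h1; lra.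
Qed.

Lemma clip_id t : 0 <= t <= 1 -> clip t = t.
Proof. by move=> /andP[h0 h1]; rewrite /clip ger0_norm// ler0_norm; lra. Qed.

Lemma clip_continuous : continuous clip.
Proof.
move=> t; apply: cvgM; last exact: cvg_cst.
apply: cvgD; last exact: cvg_cst.
apply: cvgB; first exact: norm_continuous.
by apply: cvg_norm; apply: cvgB; [exact: cvg_id | exact: cvg_cst].
Qed.

(** The homotopy depends only on the image point, so it descends to the image of [F] through a
    choice [b_] of preimages. This choice is not continuous; compactness of [B] provides the uniform
    continuity instead. *)
Lemma contraction_acyclic (N : nat) (B : topologicalType) (F : B -> 'rV[R]_N) (h : B * R -> 'rV[R]_N) y0 :
  compact [set: B] -> continuous F -> continuous h ->
  (forall b t, exists b', h (b, t) = F b') -> (exists b, y0 = F b) ->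
  (forall b b' t, F b = F b' -> h (b, t) = h (b', t)) ->
  (forall b, h (b, 0) = F b) -> (forall b, h (b, 1) = y0) ->
  acyclic [set y | exists b, y = F b].
Proof.
move=> cB cF ch hY y0Y hF h0 h1; have [b0 _] := y0Y.
pose b_ y := xget b0 [set b | y = F b].
have b_P y : (exists b, y = F b) -> F (b_ y) = y.
  by move=> ex; rewrite /b_; case: xgetP => [b _ ->//|no]; case: ex => b /no.
apply: (@contractible_acyclic _ _ _ (fun y t => h (b_ y, t)) y0) => //.
- by move=> y t _ _.
- move=> e e0.
  pose Z := ((B * R) * (B * R))%type.
  pose g (z : Z) : R := `|h z.1 - h z.2|.
  have cg : continuous g.
    move=> z; apply: cvg_norm; apply: cvgB; first exact: (cont_comp (@cont_fst _ _) ch).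
    exact: (cont_comp (@cont_snd _ _) ch).
  (* Pairs whose values under [h] differ by at least [e] form a compact set, on which the distance
     of image points plus that of times is positive and so has a positive minimum. *)
  pose E : set Z := (([set: B] `*` `[0, 1]) `*` ([set: B] `*` `[0, 1])) `&` [set z | e <= g z].
  have cE : compact E.
    apply: compact_closedI.
      by do ?apply: compact_setX => //; exact: segment_compact.
    have -> : [set z | e <= g z] = g @^-1` [set x | e <= x] by [].
    by apply: closed_comp.
  pose f (z : Z) : R := `|F z.1.1 - F z.2.1| + `|z.1.2 - z.2.2|.
  have cf : continuous f.
    move=> z; apply: cvgD; apply: cvg_norm; apply: cvgB.
    - exact: (cont_comp (cont_comp (@cont_fst _ _) (@cont_fst _ _)) cF).
    - exact: (cont_comp (cont_comp (@cont_snd _ _) (@cont_fst _ _)) cF).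
    - exact: (cont_comp (@cont_fst _ _) (@cont_snd _ _)).
    - exact: (cont_comp (@cont_snd _ _) (@cont_snd _ _)).
  have fE z : E z -> 0 < f z.
    case: z => [[b t] [b' t']] [_]; rewrite /g /f /= => eg; rewrite lt_neqAle addr_ge0// andbT eq_sym.
    apply/negP; rewrite paddr_eq0// !normr_eq0 !subr_eq0 => /andP[/eqP eF /eqP et].
    by move: eg; rewrite et (hF _ _ _ eF) subrr normr0 leNgt e0.
  have [d d0 dP] := compact_pos cE cf fE.
  exists (d / 2); first by rewrite divr_gt0.
  move=> x y t u Xx Xy t01 u01 xy tu; rewrite ltNge; apply/negP => le.
  have Ez : E ((b_ x, t), (b_ y, u)).
    by split.
  have := dP _ Ez; rewrite /f !b_P//; lra.
- by move=> x Xx; rewrite h0 b_P.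
Qed.

End Topology.

(** * Coordinates of the model space: a weight and a vector for each face *)

Section Coordinates.
Variables (R : realType) (P : finType) (n : nat).
Local Notation p := #|P|.
Local Notation V := 'rV[R]_n.
Local Notation V0 := 'rV[R]_(p + p * n).

Definition pl (y : V0) (J : P) : R := y 0 (lshift (p * n) (enum_rank J)).
Definition pz (y : V0) (J : P) : V :=
  \row_i y 0 (rshift p (mxvec_index (enum_rank J) i)).

(* Opaque, as unification would otherwise unfold it against arbitrary vectors. *)
Lemma mk_sig : {mk : (P -> R) -> (P -> V) -> V0 |
  (forall l z J, pl (mk l z) J = l J) /\ (forall l z J, pz (mk l z) J = z J)}.
Proof.
exists (fun (l : P -> R) (z : P -> V) => row_mx (\row_j l (enum_val j)) (mxvec (\matrix_(j, i) z (enum_val j) 0 i))).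
split=> l z J; first by rewrite /pl row_mxEl mxE enum_rankK.
by apply/rowP => i; rewrite mxE row_mxEr mxvecE mxE enum_rankK.
Qed.

Definition mk : (P -> R) -> (P -> V) -> V0 := sval mk_sig.

Lemma pl_mk l z J : pl (mk l z) J = l J. Proof. by case: (svalP mk_sig). Qed.

Lemma pz_mk l z J : pz (mk l z) J = z J. Proof. by case: (svalP mk_sig). Qed.

Lemma coord_ind (Q : 'I_(p + p * n) -> Prop) :
  (forall J, Q (lshift (p * n) (enum_rank J))) ->
  (forall J i, Q (rshift p (mxvec_index (enum_rank J) i))) -> forall k, Q k.
Proof.
move=> h1 h2 k; case: (split_ordP k) => j -> {k}; first by rewrite -(enum_valK j).
by case/mxvec_indexP: j => i j; rewrite -(enum_valK i).
Qed.

Lemma model_eq (y y' : V0) : (forall J, pl y J = pl y' J) -> (forall J, pz y J = pz y' J) -> y = y'.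
Proof.
move=> h1 h2; apply/rowP; apply: coord_ind => [J|J i]; first exact: h1.
by have /rowP/(_ i) := h2 J; rewrite !mxE.
Qed.

Lemma mk_eq l z l' z' : (forall J, l J = l' J) -> (forall J, z J = z' J) -> mk l z = mk l' z'.
Proof. by move=> h1 h2; apply: model_eq => J; rewrite ?pl_mk ?pz_mk. Qed.

Lemma plB y y' J : pl (y - y') J = pl y J - pl y' J.
Proof. by rewrite /pl !mxE. Qed.

Lemma pzB y y' J : pz (y - y') J = pz y J - pz y' J.
Proof. by apply/rowP => i; rewrite !mxE. Qed.

Lemma pl_norm y J : `|pl y J| <= `|y|. Proof. exact: mx_norm_ge. Qed.

Lemma pz_norm y J : `|pz y J| <= `|y|.
Proof. by apply: mx_norm_le => // i j; rewrite mxE; exact: mx_norm_ge. Qed.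

Lemma model_norm (y : V0) e : 0 <= e -> (forall J, `|pl y J| <= e) -> (forall J, `|pz y J| <= e) -> `|y| <= e.
Proof.
move=> e0 h1 h2; apply: mx_norm_le => // i; rewrite ord1; apply: coord_ind => [J|J j]; first exact: h1.
by apply: le_trans (h2 J); have := mx_norm_ge (pz y J) 0 j; rewrite mxE.
Qed.

Lemma mk_continuous (Z : topologicalType) (l : Z -> P -> R) (z : Z -> P -> V) :
  (forall J, continuous (fun x => l x J)) -> (forall J, continuous (fun x => z x J)) ->
  continuous (fun x => mk (l x) (z x)).
Proof.
move=> cl cz x; apply: cvg_coord; apply: coord_ind => [J|J i].
  have -> : (fun x => mk (l x) (z x) 0 (lshift (p * n) (enum_rank J))) = (fun x => l x J).
    by apply/funext => x'; exact: pl_mk.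
  exact: cl.
have -> : (fun x => mk (l x) (z x) 0 (rshift p (mxvec_index (enum_rank J) i))) = (fun x => z x J 0 i).
  by apply/funext => x'; rewrite -(pz_mk (l x') (z x') J) [in RHS]mxE.
exact: (cont_comp (cz J) (@coord_continuous _ _ _ _ i)).
Qed.

End Coordinates.

(** * Compactness of the nerve *)

Section NerveCompact.
Variables (R : realType) (P : finType) (le : rel P).

Lemma closed_forall (X : topologicalType) (I : Type) (Q : I -> set X) :
  (forall i, closed (Q i)) -> closed [set x | forall i, Q i x].
Proof.
move=> h; have -> : [set x | forall i, Q i x] = \bigcap_i Q i.
  by apply/seteqP; split=> x /= hx i //; exact: hx.
by apply: closed_bigI.
Qed.

Lemma closed_imply (X : topologicalType) (b : bool) (Q : set X) :
  closed Q -> closed [set x | b -> Q x].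
Proof.
move=> h; case: b; first by rewrite (_ : [set _ | _] = Q)//; apply/seteqP; split=> x //=; exact.
by rewrite (_ : [set _ | _] = setT); [exact: closedT | apply/seteqP; split].
Qed.

Lemma closed_preim_eq (X : topologicalType) (f : X -> R) (c : R) :
  continuous f -> closed [set x | f x = c].
Proof.
move=> cf; have -> : [set x | f x = c] = f @^-1` [set c] by [].
by apply: closed_comp.
Qed.

Lemma closed_preim_ge (X : topologicalType) (f : X -> R) (c : R) :
  continuous f -> closed [set x | c <= f x].
Proof.
move=> cf; have -> : [set x | c <= f x] = f @^-1` [set y | c <= y] by [].
by apply: closed_comp.
Qed.

Lemma compact_nerve i : compact (@nerve_above R P le i).
Proof.
have cj j : continuous (fun l : {ptws P -> R} => l j) by exact: (@prod_coord_continuous _ (fun=> R) j).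
(* The implications are rewritten as equations between continuous functions, so that each condition
   is visibly closed. *)
have E : @nerve_above R P le i = [set l : {ptws P -> R} | forall j, 0 <= l j] `&`
    [set l : {ptws P -> R} | \sum_j l j = 1] `&`
    [set l : {ptws P -> R} | forall j, ~~ le i j -> l j = 0] `&`
    [set l : {ptws P -> R} | forall j k, ~~ (le j k || le k j) -> l j * l k = 0].
  apply/seteqP; split=> [l [l0 l1 l2 l3]|l [[[/= l0 l1] l2] l3]].
    split; first split=> //=.
      by move=> j; apply: contraNeq; exact: l2.
    move=> j k; apply: contraNeq; rewrite mulf_eq0 negb_or => /andP[? ?]; exact: l3.
  split=> // j; first by apply: contraNT => /l2 ->.
  move=> k jn kn; have := l3 j k; case: (_ || _) => // /(_ isT)/eqP.
  by rewrite mulf_eq0 (negbTE jn) (negbTE kn).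
pose B : set {ptws P -> R} := [set l | forall j : P, (`[0, 1]%classic : set R) (l j)].
apply: (@subclosed_compact {ptws P -> R} _ B).
- rewrite E; apply: closedI; first apply: closedI; first apply: closedI.
  + by apply: closed_forall => j; apply: closed_preim_ge.
  + by apply: closed_preim_eq => l; apply: cvg_sum_real => j; exact: cj.
  + by apply: closed_forall => j; apply: closed_imply; apply: closed_preim_eq.
  + apply: closed_forall => j; apply: closed_forall => k; apply: closed_imply; apply: closed_preim_eq => l.
    exact: (cvgM (cj j l) (cj k l)).
- by apply: (@tychonoff P (fun=> R) (fun=> `[0, 1]%classic)) => _; exact: segment_compact.
- move=> l [l0 l1 _ _] j /=; rewrite in_itv /= l0 -l1 (bigD1 j)//= lerDl.
  by apply: sumr_ge0 => k _.
Qed.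

End NerveCompact.

(** Right translation by the involution [c] pairs the elements without fixed points; the enumeration
    order singles out one member of each pair. *)
Lemma big_addb_pair (W : finGroupType) (A : {group W}) (c : W) (f : W -> bool) :
  c \in A -> (c * c = 1)%g -> c != 1%g -> (forall v, v \in A -> f (v * c)%g = f v) ->
  \big[addb/false]_(v in A) f v = false.
Proof.
move=> cA cc c1 fc.
have cK v : (v * c * c)%g = v by rewrite -mulgA cc mulg1.
have ne v : (v * c)%g != v by apply: contra c1 => /eqP e; rewrite -(mulKg v c) e mulVg.
pose P v := (enum_rank v < enum_rank (v * c)%g)%N.
have PN v : P (v * c)%g = ~~ P v.
  rewrite /P cK -leqNgt [LHS]ltn_neqAle; case: eqVneq => //= e.
  by have := ne v; rewrite (enum_rank_inj (ord_inj e)) eqxx.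
rewrite (bigID P) /= [X in _ (+) X](reindex_inj (mulIg c)) /=.
rewrite [X in _ (+) X](eq_big (fun v => (v \in A) && P v) f); first by rewrite addbb.
  by move=> v; rewrite groupMr// PN negbK.
by move=> v /andP[vA _]; apply: fc; move: vA; rewrite groupMr.
Qed.

Lemma cob_big (T : choiceType) (I : finType) (Q : pred I) (f : I -> seq T -> bool) s :
  cob (fun t => \big[addb/false]_(i | Q i) f i t) s = \big[addb/false]_(i | Q i) cob (f i) s.
Proof.
rewrite -[in RHS]big_filter; under [X in cob X]eq_fun do rewrite -big_filter.
elim: (seq.filter _ _) => [|i l IH].
  by rewrite big_nil -[RHS](cob_false s); apply: eq_in_cob => t _; rewrite big_nil.
by rewrite big_cons -IH -cobD; apply: eq_in_cob => t _; rewrite big_cons.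
Qed.

Lemma sumr_inv_le (R : realFieldType) (I : finType) (A : {pred I}) (c : R) : (0 < c)%R ->
  (\sum_(i in A) (c * #|A|.+1%:R)^-1 <= c^-1)%R.
Proof.
move=> c0; rewrite sumr_const -[X in (X <= _)%R]mulr_natl invfM mulrCA -[X in (_ <= X)%R]mulr1.
apply: ler_wpM2l; first by rewrite invr_ge0 ltW.
by rewrite ler_pdivrMr// mul1r ler_nat.
Qed.

(** * Homotopies on quotient spaces *)

Section QuotientHomotopy.
Local Open Scope quotient_scope.
Variable R : realType.

(* The line is locally compact, so its product with a quotient map is again a quotient map. *)
Lemma quotient_prod_continuous (T : topologicalType) (Q0 : quotType T) (Y : topologicalType)
  (h : quotient_topology Q0 * R -> Y) :
  continuous (fun z : T * R => h (\pi_(quotient_topology Q0) z.1, z.2)) -> continuous h.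
Proof.
move=> ch [q t] U; rewrite {1}nbhsE => -[Q1 [oO Oq] OU].
pose H (z : T * R) := h (\pi_(quotient_topology Q0) z.1, z.2).
have HO z : Q1 (H z) -> nbhs z (H @^-1` Q1).
  by move=> Oz; apply: ch; apply: open_nbhs_nbhs.
have Hp : Q1 (H (generic_quotient.repr q, t)) by rewrite /H reprK.
have [[A B] [nA nB] AB] := HO _ Hp.
have [e /= e0 eB] := nB.
pose N := `[t - e / 2, t + e / 2]%classic.
have NB : N `<=` B.
  move=> u; rewrite /N /= in_itv /= => /andP[h1 h2]; apply: eB; rewrite /= ltr_norml.
  apply/andP; lra.
have nN : nbhs t N.
  exists (e / 2) => /=; first by rewrite divr_gt0.
  move=> u /=; rewrite ltr_norml /N /= in_itv /= => /andP[h1 h2]; lra.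
pose V : set (quotient_topology Q0) := [set q' | forall u, N u -> Q1 (h (q', u))].
have oV : open V.
  change (open (\pi_(quotient_topology Q0) @^-1` V)); rewrite openE => p Vp.
  have /compact_near_coveringP cN : compact N by exact: segment_compact.
  have := cN _ (nbhs p) (fun p' u => Q1 (H (p', u))) _; apply => u Nu.
  have [[A' B'] [nA' nB'] AB'] := HO (p, u) (Vp u Nu).
  by exists (B', A') => // -[u' p'] /= [hu hp]; apply: (AB' (p', u')).
have Vq : V q.
  move=> u Nu; have := AB (generic_quotient.repr q, u); rewrite /H /= reprK; apply; split => /=.
    exact: nbhs_singleton.
  exact: NB.
exists (V, N); first by split=> //; exact: open_nbhs_nbhs.
by move=> [q' u] [Vq' Nu]; apply: OU; exact: Vq'.
Qed.

Lemma continuous_sum_prod (I : choiceType) (X : I -> topologicalType) (Z Y : topologicalType)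
  (f : {i & X i} * Z -> Y) : (forall i, continuous (fun z : X i * Z => f (existT X i z.1, z.2))) -> continuous f.
Proof.
move=> cf [[i x] z] U nU; have [[A B] [nA nB] AB] := cf i (x, z) U nU.
exists ((existT X i) @` A, B); first by split=> //; exact: existT_nbhs.
by move=> [p z'] [[x' Ax' /= <-] Bz']; exact: (AB (x', z') (conj Ax' Bz')).
Qed.

(** Open sets cannot tell the two maps apart. This permits redefining a homotopy at its end so that
    it becomes constant there. *)
Lemma indist_continuous (X Y : topologicalType) (f g : X -> Y) :
  continuous f -> (forall x, indist (f x) (g x)) -> continuous g.
Proof.
move=> cf fg x U; rewrite {1}nbhsE => -[Q1 [oO Ox] OU].
have n : nbhs (f x) Q1 by apply: open_nbhs_nbhs; split=> //; apply/(fg x Q1 oO).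
have sub : f @^-1` Q1 `<=` g @^-1` U by move=> y Qy; apply: OU; exact: ((fg y Q1 oO).1 Qy).
exact: filterS sub (cf x _ n).
Qed.

End QuotientHomotopy.

(** * Compact Lie groups *)

Section LieTheory.
Variables (R : realType) (G : lie_group R).
Local Notation n := (Defs.dim G).
Local Notation V := 'rV[R]_n.
Local Notation coord := (@Defs.coord R G).
Local Notation param := (@Defs.param R G).
Local Notation dom := (@Defs.dom R G).

Let half01 : 0 <= (2^-1 : R) < 1. Proof. lra. Qed.
Let pow2_gt0 k : (0 : R) < 2 ^+ k. Proof. exact: exprn_gt0. Qed.

Lemma coord_cvg x y : dom x y -> {for y, continuous (coord x)}.
Proof.
move=> xy; have := @Defs.coord_continuous R G x.
rewrite (continuous_open_subspace _ (@dom_open R G x)) => H.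
by apply: H; rewrite inE.
Qed.

Lemma param_cvg x u : (coord x @` dom x) u -> {for u, continuous (param x)}.
Proof.
move=> xu; have := @param_continuous R G x.
rewrite (continuous_open_subspace _ (@coord_open R G x)) => H.
by apply: H; rewrite inE.
Qed.

Lemma paramK x y : dom x y -> param x (coord x y) = y.
Proof. by move=> xy; rewrite coordK// inE. Qed.

Lemma near_dom x y : dom x y -> \forall z \near y, dom x z.
Proof. by move=> xy; apply: open_nbhs_nbhs; split => //; exact: dom_open. Qed.

Definition mulc x y z (u : 'rV[R]_(n + n)) := coord z (param x (lsubmx u) * param y (rsubmx u))%g.

Definition mulU x y z : set 'rV[R]_(n + n) := [set u | [/\ (coord x @` dom x) (lsubmx u),
  (coord y @` dom y) (rsubmx u) & dom z (param x (lsubmx u) * param y (rsubmx u))%g]].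

Lemma mulc_smooth x y z : smooth (mulU x y z) (mulc x y z).
Proof. exact: (@mul_smooth R G x y z). Qed.

Lemma mulU_mem x y x' y' z : dom x x' -> dom y y' -> dom z (x' * y')%g ->
  mulU x y z (row_mx (coord x x') (coord y y')).
Proof. by move=> dx dy dz; rewrite /mulU /= row_mxKl row_mxKr !paramK//; split=> //; [exists x'|exists y']. Qed.

Lemma mulcE x y x' y' z : dom x x' -> dom y y' ->
  mulc x y z (row_mx (coord x x') (coord y y')) = coord z (x' * y')%g.
Proof. by move=> dx dy; rewrite /mulc row_mxKl row_mxKr !paramK. Qed.

(** The group structure is only assumed smooth in charts; continuity is recovered by going into the
    charts at the two factors and back through the chart at the product. *)
Lemma mulg_cts : continuous (fun p : G * G => p.1 * p.2)%g.
Proof.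
move=> [x y] /=; set z := (x * y)%g; pose F := mulc x y z; pose U := mulU x y z.
have [oU /(_ 0%N)[Fc _]] := mulc_smooth x y z.
have xx := dom_center x; have yy := dom_center y; have zz := dom_center z.
pose h (p : G * G) := row_mx (coord x p.1) (coord y p.2).
have hc : h @ (x, y) --> h (x, y).
  apply: cvg_row_mx.
    by apply: (cvg_comp _ _ (cvg_fst : fst @ (x, y) --> x)); exact: coord_cvg.
  by apply: (cvg_comp _ _ (cvg_snd : snd @ (x, y) --> y)); exact: coord_cvg.
have Uh : U (h (x, y)) by exact: mulU_mem.
have E : F (h (x, y)) = coord z z by exact: mulcE.
have pc : param z (F (h p)) @[p --> (x, y)] --> z.
  rewrite -{2}(paramK zz) -E.
  apply: cvg_comp; last by apply: param_cvg; exists z.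
  by apply: (cvg_comp _ _ hc); exact: Fc.
apply: cvg_trans pc; apply: near_eq_cvg.
have nU : \forall p \near (x, y), U (h p).
  by apply: hc; apply: open_nbhs_nbhs.
have n1 : \forall p \near (x, y), dom x p.1.
  by apply: (cvg_fst : fst @ (x, y) --> x); exact: near_dom.
have n2 : \forall p \near (x, y), dom y p.2.
  by apply: (cvg_snd : snd @ (x, y) --> y); exact: near_dom.
near=> p.
have [_ _] : U (h p) by near: p.
have d1 : dom x p.1 by near: p.
have d2 : dom y p.2 by near: p.
by move=> d3; rewrite /F /mulc (paramK d3) row_mxKl row_mxKr !paramK.
Unshelve. all: by end_near. Qed.

Lemma invg_cts : continuous (fun x : G => x^-1)%g.
Proof.
move=> x; set z := (x^-1)%g.
pose F (u : V) := coord z (param x u)^-1%g.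
pose U : set V := [set u | (coord x @` dom x) u /\ dom z (param x u)^-1%g].
have [oU /(_ 0%N)[Fc _]] : smooth U F := @inv_smooth R G x z.
have xx := dom_center x; have zz := dom_center z.
have Uh : U (coord x x) by rewrite /U /= paramK//; split => //; exists x.
have E : F (coord x x) = coord z z by rewrite /F paramK.
have pc : param z (F (coord x p)) @[p --> x] --> z.
  rewrite -{2}(paramK zz) -E.
  apply: cvg_comp; last by apply: param_cvg; exists z.
  exact: (@cvg_comp _ _ _ (coord x) F _ _ _ (coord_cvg xx) (Fc _ Uh)).
apply: cvg_trans pc; apply: near_eq_cvg.
have nU : \forall p \near x, U (coord x p).
  by apply: (coord_cvg xx); apply: open_nbhs_nbhs.
have n1 := near_dom xx.
near=> p.
have [_] : U (coord x p) by near: p.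
have d1 : dom x p by near: p.
by move=> d3; rewrite (paramK d3) paramK.
Unshelve. all: by end_near. Qed.

Lemma cvgMg (T : Type) (F : set_system T) {FF : Filter F} (f g : T -> G) (a b : G) :
  f @ F --> a -> g @ F --> b -> (fun t => f t * g t)%g @ F --> (a * b)%g.
Proof.
move=> fa gb; have fg : (fun t => (f t, g t)) @ F --> (a, b) by exact: cvg_pair.
exact: (@cvg_comp _ _ _ (fun t => (f t, g t)) (fun p : G * G => p.1 * p.2)%g _ _ _ fg (@mulg_cts (a, b))).
Qed.

Lemma cvgVg (T : Type) (F : set_system T) {FF : Filter F} (f : T -> G) (a : G) :
  f @ F --> a -> (fun t => (f t)^-1)%g @ F --> (a^-1)%g.
Proof. by move=> fa; exact: (@cvg_comp _ _ _ f (fun x : G => x^-1)%g _ _ _ fa (@invg_cts a)). Qed.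

Lemma cvgXg (T : Type) (F : set_system T) {FF : Filter F} (f : T -> G) (a : G) k :
  f @ F --> a -> (fun t => (f t) ^+ k)%g @ F --> (a ^+ k)%g.
Proof.
move=> fa; elim: k => [|k IH].
  by under eq_fun do rewrite expg0; exact: cvg_cst.
by under eq_fun do rewrite expgS; rewrite expgS; exact: cvgMg.
Qed.

Lemma cvg_lieg (T : Type) (F : set_system T) {FF : ProperFilter F} (f : T -> G) (a b : G) :
  f @ F --> a -> f @ F --> b -> a = b.
Proof. by move=> fa fb; apply: (cvg_unique _ fa fb); exact: lie_hausdorff. Qed.

(** The chart at the identity, translated so that the identity has coordinate [0]; [psi] is its
    inverse. *)
Definition phi (x : G) := coord 1%g x - coord 1%g 1%g.
Definition psi (u : V) := param 1%g (u + coord 1%g 1%g).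

Lemma psi0 : psi 0 = 1%g.
Proof. by rewrite /psi add0r paramK//; exact: dom_center. Qed.

Lemma phi1 : phi 1%g = 0. Proof. exact: subrr. Qed.

Lemma phiK x : dom 1%g x -> psi (phi x) = x.
Proof. by move=> x1; rewrite /psi subrK paramK. Qed.

Lemma chart_ball : exists2 r, 0 < r & forall u, `|u| < r ->
  [/\ dom 1%g (psi u), phi (psi u) = u & {for u, continuous psi}].
Proof.
have oc := @coord_open R G 1%g.
have [|r r0 h] := open_ball_rV oc (x := coord 1%g 1%g).
  by exists 1%g => //; exact: dom_center.
exists r => // u ur; have [|y dy e] := h (u + coord 1%g 1%g); first by rewrite addrK.
have py : psi u = y by rewrite /psi -e paramK.
split; [by rewrite py|by rewrite py /phi e addrK|].
have H := @cvg_comp _ _ _ (fun v => v + coord 1%g 1%g) (param 1%g) (nbhs u).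
apply: H; last by apply: param_cvg; exists y.
by apply: cvgD; [exact: cvg_id|exact: cvg_cst].
Qed.

Lemma phi_cvg x : dom 1%g x -> {for x, continuous phi}.
Proof.
move=> x1; apply: cvgB; [exact: coord_cvg|exact: cvg_cst].
Qed.

Lemma psi_cvg0 : psi @ (0 : V) --> (1%g : G).
Proof.
suff : psi @ (0 : V) --> psi 0 by rewrite psi0.
by have [r r0 /(_ 0)] := chart_ball; rewrite normr0 => /(_ r0)[].
Qed.

Definition mu (w : 'rV[R]_(n + n)) := phi (psi (lsubmx w) * psi (rsubmx w))%g.

Lemma cvg_mulVg (y : G) : (y^-1 * z)%g @[z --> y] --> (1%g : G).
Proof. by rewrite -(mulVg y); apply: cvgMg; [exact: cvg_cst|exact: cvg_id]. Qed.

Lemma cvg_phi_mulVg (y : G) : phi (y^-1 * z)%g @[z --> y] --> (0 : V).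
Proof. by rewrite -phi1; exact: (cvg_comp _ _ (cvg_mulVg y) (phi_cvg (dom_center 1%g))). Qed.

Lemma near_dom_mulVg (y : G) : \forall z \near y, dom 1%g (y^-1 * z)%g.
Proof. by apply: (cvg_mulVg y); exact: near_dom (dom_center _). Qed.

Lemma closure_subgroup (A : set G) : is_subgroup A -> is_subgroup (closure A).
Proof.
move=> [A1 AM AV]; split; first exact: subset_closure.
- move=> x y hx hy U Uxy.
  have [[U1 U2] /= [U1x U2y] sub] : nbhs (x, y) [set p : G * G | U (p.1 * p.2)%g].
    exact: (@mulg_cts (x, y) U Uxy).
  have [x' [Ax' Ux']] := hx _ U1x; have [y' [Ay' Uy']] := hy _ U2y.
  by exists (x' * y')%g; split; [exact: AM | exact: (sub (x', y'))].
- move=> x hx U Ux; have [y [Ay Uy]] := hx _ (@invg_cts x U Ux).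
  by exists y^-1%g; split; [exact: AV | exact: Uy].
Qed.

Lemma gen_le (A H : set G) : is_subgroup H -> A `<=` H -> gen A `<=` H.
Proof. by move=> sH AH x; apply. Qed.

Lemma sub_gen (A : set G) : A `<=` gen A.
Proof. by move=> x Ax H [_]; exact. Qed.

Section CosetClosure.
Variables (H : set G) (X : topologicalType) (f : G -> X).

(** An open set containing the image of one of the two points contains the images of nearby points,
    and among these is the other point up to a right factor in [H]. *)
Lemma closure_coset_indist g k : is_subgroup H -> continuous f ->
  (forall x h, H h -> f (x * h)%g = f x) -> closure H k -> indist (f g) (f (g * k)%g).
Proof.
move=> sH cf inv cl U oU.
have near x y : U (f (x * y)%g) -> nbhs y [set z | U (f (x * z)%g)].
  move=> Uxy; have c : (fun z : G => f (x * z)%g) @ y --> f (x * y)%g.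
    apply: (@cvg_comp _ _ _ (fun z : G => (x * z)%g) f _ (nbhs (x * y)%g)); last exact: cf.
    by apply: cvgMg; [exact: cvg_cst | exact: cvg_id].
  by apply: c; apply: open_nbhs_nbhs.
split=> h.
  have [_ _ cV] := closure_subgroup sH.
  have := near (g * k)%g k^-1%g; rewrite mulgK => /(_ h) nk.
  by have [x [Hx]] := cV _ cl _ nk; rewrite /= inv.
have [x [Hx]] := cl _ (near g k h); by rewrite /= inv.
Qed.
End CosetClosure.

Let o1 := coord 1%g 1%g.

Local Notation muf := (mulc 1%g 1%g 1%g).
Local Notation muU := (mulU 1%g 1%g 1%g).

Lemma muU0 : muU (row_mx o1 o1).
Proof. by apply: mulU_mem; rewrite ?mulg1; exact: dom_center. Qed.

Lemma mu_muf w : mu w = muf (w + row_mx o1 o1) + - o1.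
Proof. by rewrite /mulc -[in RHS](hsubmxK w) add_row_mx row_mxKl row_mxKr. Qed.

Lemma mu_dom : exists2 r, 0 < r & forall w, `|w| < r ->
  dom 1%g (psi (lsubmx w) * psi (rsubmx w))%g.
Proof.
have [oU _] := (mulc_smooth 1%g 1%g 1%g); have [r r0 h] := open_ball_rV oU muU0.
exists r => // w wr; have [|_ _] := h (w + row_mx o1 o1); first by rewrite addrK.
by rewrite -[in X in X -> _](hsubmxK w) add_row_mx row_mxKl row_mxKr.
Qed.

Lemma mu_psi : exists2 r, 0 < r & forall a b, `|a| < r -> `|b| < r ->
  psi (mu (row_mx a b)) = (psi a * psi b)%g.
Proof.
have [r r0 h] := mu_dom; exists r => // a b ar br; rewrite phiK row_mxKl row_mxKr//.
by have := h (row_mx a b); rewrite row_mx_norm gt_max ar row_mxKl row_mxKr; exact.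
Qed.

Lemma mu0r : exists2 r, 0 < r & forall a, `|a| < r -> mu (row_mx a 0) = a.
Proof.
have [r r0 h] := chart_ball; exists r => // a /h[_ e _].
by rewrite /mu row_mxKl row_mxKr psi0 mulg1.
Qed.

Lemma mu0l : exists2 r, 0 < r & forall a, `|a| < r -> mu (row_mx 0 a) = a.
Proof.
have [r r0 h] := chart_ball; exists r => // a /h[_ e _].
by rewrite /mu row_mxKl row_mxKr psi0 mul1g.
Qed.

Lemma strict_diff_translate m p (f g : 'rV[R]_m -> 'rV[R]_p) x0 w L b :
  (forall x, g x = f (x + x0) + b) -> strict_diff f (w + x0) L -> strict_diff g w L.
Proof.
move=> gf h e e0; have [r r0 H] := h e e0; exists r => // x y xr yr.
have := H (x + x0) (y + x0).
by rewrite !gf !addrKK => /(_ xr yr).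
Qed.

Lemma strict_diff_left m p (f : 'rV[R]_(m + m) -> 'rV[R]_p) a b L :
  strict_diff f (row_mx a b) L -> strict_diff (fun x => f (row_mx x b)) a (usubmx L).
Proof.
move=> sf; have := @strict_diff_affine R m (m + m) (row_mx 1%:M 0) (row_mx 0 b) a.
set g := fun x => _ => sg; have gE x : g x = row_mx x b.
  by rewrite /g mul_mx_row mulmx1 mulmx0 add_row_mx addr0 add0r.
have := @strict_diff_comp R _ _ _ g f a _ _ sg; rewrite gE => /(_ _ sf).
rewrite -[in X in X -> _](vsubmxK L) mul_row_col mul1mx mul0mx addr0.
by move=> H e /H[r r0 h]; exists r => // x y xr yr; have := h x y xr yr; rewrite /= !gE.
Qed.

Lemma strict_diff_right m p (f : 'rV[R]_(m + m) -> 'rV[R]_p) a b L :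
  strict_diff f (row_mx a b) L -> strict_diff (fun x => f (row_mx a x)) b (dsubmx L).
Proof.
move=> sf; have := @strict_diff_affine R m (m + m) (row_mx 0 1%:M) (row_mx a 0) b.
set g := fun x => _ => sg; have gE x : g x = row_mx a x.
  by rewrite /g mul_mx_row mulmx1 mulmx0 add_row_mx addr0 add0r.
have := @strict_diff_comp R _ _ _ g f b _ _ sg; rewrite gE => /(_ _ sf).
rewrite -[in X in X -> _](vsubmxK L) mul_row_col mul1mx mul0mx add0r.
by move=> H e /H[r r0 h]; exists r => // x y xr yr; have := h x y xr yr; rewrite /= !gE.
Qed.

Lemma strict_diff_id m (x0 : 'rV[R]_m) : strict_diff id x0 1%:M.
Proof.
by move=> e e0; exists 1 => // x y _ _; rewrite mulmx1 subrr normr0 mulr_ge0// ltW.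
Qed.

(** [mu] is the identity along both axes, which determines its derivative at the origin as the sum
    of the two arguments. *)
Lemma mu_quad : quad_diff mu 0 (col_mx 1%:M 1%:M).
Proof.
have [oU /(_ 2) c2] := (mulc_smooth 1%g 1%g 1%g).
have q := class_C2_quadratic oU c2 muU0.
have q0 : quad_diff mu 0 (jac muf (row_mx o1 o1)).
  by apply: quad_diff_shift q => x; exact: mu_muf.
suff <- : jac muf (row_mx o1 o1) = col_mx 1%:M 1%:M by [].
have := quad_diff_strict q0; rewrite -(row_mx0 R 1 n n) => s0.
rewrite -[LHS]vsubmxK; congr col_mx.
  have [r r0 h] := mu0r; apply: strict_diff_uniq (strict_diff_left s0) _.
  apply: (strict_diff_near r0) (strict_diff_id 0) => x; rewrite subr0 => xr.
  by rewrite h.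
have [r r0 h] := mu0l; apply: strict_diff_uniq (strict_diff_right s0) _.
apply: (strict_diff_near r0) (strict_diff_id 0) => x; rewrite subr0 => xr.
by rewrite h.
Qed.

Definition cj (g : G) (u : V) := phi (g * psi u * g^-1)%g.

(** Conjugation is cut into two multiplications, with the intermediate product [g * psi u] read in
    the chart at [g]; each is smooth in its charts. *)
Lemma conj_strict (g : G) : exists2 L, strict_diff (cj g) 0 L &
  exists2 r, 0 < r & forall u, `|u| < r -> psi (cj g u) = (g * psi u * g^-1)%g.
Proof.
have d1 := @dom_center R G 1%g; have dg := @dom_center R G g.
have dV := @dom_center R G (g^-1)%g.
pose A := mulc g 1%g g; pose B := mulc g (g^-1)%g 1%g.
have [oA /(_ 1%N) cA] := mulc_smooth g 1%g g.
have [oB /(_ 1%N) cB] := mulc_smooth g (g^-1)%g 1%g.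
pose a := coord g g; pose b := coord (g^-1)%g (g^-1)%g.
have UAa : mulU g 1%g g (row_mx a o1) by apply: mulU_mem; rewrite ?mulg1.
have UBa : mulU g (g^-1)%g 1%g (row_mx a b) by apply: mulU_mem; rewrite ?mulgV.
have sA := strict_diff_right (class_C1_strict oA cA UAa).
have sB := strict_diff_left (class_C1_strict oB cB UBa).
have [r1 r10 h1] := open_ball_rV oA UAa.
have AcE : mulc g 1%g g (row_mx a o1) = a by rewrite mulcE// mulg1.
have [r2 r20 h2] := open_ball_rV oB UBa.
have [r3 r30 [C C0 h3]] := strict_diff_cont sA.
have := strict_diff_comp sA; rewrite AcE => /(_ _ _ _ sB) sAB.
pose r := Num.min (Num.min r1 r3) (r2 / C).
have r0 : 0 < r by rewrite !lt_min r10 r30 divr_gt0.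
have key u : `|u| < r -> (g * psi u * g^-1)%g = (param g (A (row_mx a (u + o1))) * g^-1)%g :> G /\
    dom 1%g (g * psi u * g^-1)%g.
  rewrite !lt_min => /andP[/andP[u1 u3] u2].
  have eA : param g (A (row_mx a (u + o1))) = (g * psi u)%g.
    have [|_ _] := h1 (row_mx a (u + o1)).
      by rewrite opp_row_mx add_row_mx subrr addrK row_mx_norm normr0 gt_max r10.
    by rewrite /A /mulc row_mxKl row_mxKr (paramK dg) => /paramK.
  split; first by rewrite eA.
  have [|_ _] := h2 (row_mx (A (row_mx a (u + o1))) b).
    rewrite opp_row_mx add_row_mx subrr row_mx_norm normr0 gt_max r20 andbT.
    rewrite -[X in _ - X]AcE (le_lt_trans (h3 _ _ _ _)) ?addrK ?subrr ?normr0//.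
    by rewrite mulrC -ltr_pdivlMr.
  by rewrite row_mxKl row_mxKr eA paramK.
exists (dsubmx (jac A (row_mx a o1)) *m usubmx (jac B (row_mx a b))); last first.
  by exists r => // u /key[_ d]; rewrite phiK.
apply: (strict_diff_near r0); last first.
  apply: (@strict_diff_translate _ _ (fun x => B (row_mx (A (row_mx a x)) b)) _ o1 0 _ (- o1) (fun=> erefl)).
  by rewrite add0r; exact: sAB.
move=> u; rewrite subr0 => /key[e _].
by rewrite /cj e /= /B /mulc row_mxKl row_mxKr (paramK dV).
Qed.

Definition adj_mx (g : G) : 'M[R]_n := \matrix_i Ad g (delta_mx 0 i).

Lemma adj_mx_strict g : strict_diff (cj g) 0 (adj_mx g) /\ forall v, Ad g v = v *m adj_mx g.
Proof.
have [L sL _] := conj_strict g.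
have sc : strict_diff (fun x => coord 1%g (g * param 1%g x * g^-1)%g) o1 L.
  move=> e /sL[r r0 h]; exists r => // x y xr yr.
  have := h (x - o1) (y - o1); rewrite !subr0 => /(_ xr yr).
  by rewrite /cj /psi !subrK !addrKK.
have AdE v : Ad g v = v *m L by have [_ e] := strict_diff_derive v sc.
suff <- : L = adj_mx g by [].
by apply/row_matrixP => i; rewrite rowK AdE -rowE.
Qed.

(* The proof term is opaque so that conversion never compares the matrices of distinct elements. *)
Lemma AdM_sig : {M : G -> 'M[R]_n | forall g, strict_diff (cj g) 0 (M g) /\ forall v, Ad g v = v *m M g}.
Proof. by exists adj_mx; exact: adj_mx_strict. Qed.

Definition AdM : G -> 'M[R]_n := sval AdM_sig.

Lemma AdM_strict g : strict_diff (cj g) 0 (AdM g) /\ forall v, Ad g v = v *m AdM g.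
Proof. exact: (svalP AdM_sig). Qed.

Lemma AdE g v : Ad g v = v *m AdM g. Proof. by have [_] := AdM_strict g. Qed.

Lemma cj_strict g : strict_diff (cj g) 0 (AdM g). Proof. by have [] := AdM_strict g. Qed.

Lemma cj0 g : cj g 0 = 0. Proof. by rewrite /cj psi0 mulg1 mulgV phi1. Qed.

Lemma psi_cj g : exists2 r, 0 < r & forall u, `|u| < r ->
  psi (cj g u) = (g * psi u * g^-1)%g.
Proof. by have [L _] := conj_strict g. Qed.

Lemma AdM1 : AdM 1%g = 1%:M.
Proof.
have [r r0 h] := chart_ball.
apply: strict_diff_uniq (cj_strict _) _.
apply: (strict_diff_near r0) (strict_diff_id 0) => x; rewrite subr0 => /h[_ e _].
by rewrite /cj mul1g invg1 mulg1.
Qed.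

Lemma strict_diff_small m p (f : 'rV[R]_m -> 'rV[R]_p) x0 L e :
  strict_diff f x0 L -> 0 < e ->
  exists2 r, 0 < r & forall x, `|x - x0| < r -> `|f x - f x0| < e.
Proof.
move=> /strict_diff_cont[r r0 [C C0 h]] e0; exists (Num.min r (e / C)).
  by rewrite lt_min r0 divr_gt0.
move=> x; rewrite lt_min => /andP[xr xe].
by rewrite (le_lt_trans (h _ _ _ _)) ?subrr ?normr0// mulrC -ltr_pdivlMr.
Qed.

(** Tangent vectors are rows, so the matrices come in reversed order. *)
Lemma AdMM g h : AdM (g * h)%g = AdM h *m AdM g.
Proof.
have [r1 r10 h1] := psi_cj h.
have sh := cj_strict h; have sg := cj_strict g.
have := strict_diff_comp sh; rewrite cj0 => /(_ _ _ _ sg) sgh.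
apply: strict_diff_uniq (cj_strict _) _; apply: (strict_diff_near r10) sgh => x.
rewrite subr0 => xr; rewrite /= /cj h1//.
by rewrite invgM !mulgA.
Qed.

Lemma dirD_translate m p (f g : 'rV[R]_m -> 'rV[R]_p) x0 w b k :
  (forall x, g x = f (x + x0) + b) -> dirD g k w = dirD f k (w + x0).
Proof.
move=> gf; congr (lim (_ @ 0^')); apply/funext => h /=.
by rewrite !gf addrKK addrA.
Qed.

Lemma mu_strict : exists2 r, 0 < r & forall w, `|w| < r -> strict_diff mu w (jac mu w).
Proof.
have [oU /(_ 1%N) c1] := (mulc_smooth 1%g 1%g 1%g).
have [r r0 h] := open_ball_rV oU (muU0); exists r => // w wr.
have -> : jac mu w = jac muf (w + row_mx o1 o1).
  by apply/matrixP => i j; rewrite !mxE (dirD_translate _ _ mu_muf).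
apply: strict_diff_translate mu_muf _; apply: (class_C1_strict oU c1).
by apply: h; rewrite addrK.
Qed.

Lemma dirD_mu_strict k : exists L, strict_diff (dirD mu k) 0 L.
Proof.
have [oU /(_ 2%N)[_ /(_ k)[_ c1]]] := (mulc_smooth 1%g 1%g 1%g).
have cc : class_C 1 muU (dirD muf k) := c1.
exists (jac (dirD muf k) (0 + row_mx o1 o1)).
apply: (@strict_diff_translate _ _ (dirD muf k) _ (row_mx o1 o1) _ _ 0).
  by move=> x; rewrite addr0 (dirD_translate _ _ mu_muf).
by rewrite add0r; exact: (class_C1_strict oU cc (muU0)).
Qed.

(** The differentials at the identity of left and right translation by [psi x]. *)
Definition Lmx (x : V) : 'M[R]_n := dsubmx (jac mu (row_mx x 0)).
Definition Rmx (x : V) : 'M[R]_n := usubmx (jac mu (row_mx 0 x)).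

(** Left translation by a group element is conjugation by it followed by right translation. *)
Lemma AdM_Rmx : exists2 r, 0 < r & forall x, `|x| < r -> AdM (psi x) *m Rmx x = Lmx x.
Proof.
have [r r0 h] := mu_strict; exists r => // x xr.
have s1 := h (row_mx x 0); rewrite row_mx_norm normr0 gt_max xr r0 in s1.
have s2 := h (row_mx 0 x); rewrite row_mx_norm normr0 gt_max xr r0 in s2.
have sL := strict_diff_right (s1 isT); have sR := strict_diff_left (s2 isT).
have := strict_diff_comp (cj_strict (psi x)); rewrite cj0 => /(_ _ _ _ sR) sLR.
apply: strict_diff_uniq _ sL.
have [r1 r10 h1] := psi_cj (psi x).
apply: (strict_diff_near r10) sLR => b; rewrite subr0 => br /=.
by rewrite /mu !row_mxKl !row_mxKr h1// -mulgA mulVg mulg1.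
Qed.

Lemma strict_diff_mulmx (M : V -> 'M[R]_n) : (forall k, exists L, strict_diff (fun x => row k (M x)) 0 L) ->
  forall v, exists L, strict_diff (fun x => v *m M x) 0 L.
Proof.
move=> /choice[F FP] v; exists (\sum_k v 0 k *: F k).
have -> : (fun x => v *m M x) = fun x => \sum_k v 0 k *: row k (M x).
  by apply/funext => x; exact: mulmx_sum_row.
by apply: strict_diff_sum => k; exact: strict_diffZ.
Qed.

Lemma Lmx_strict v : exists M, strict_diff (fun x => v *m Lmx x) 0 M.
Proof.
apply: strict_diff_mulmx => k; have [L sL] := dirD_mu_strict (rshift n k); exists (usubmx L).
have -> : (fun x => row k (Lmx x)) = (fun x => dirD mu (rshift n k) (row_mx x 0)).
  by apply/funext => x; apply/rowP => j; rewrite !mxE.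
by apply: strict_diff_left; rewrite row_mx0.
Qed.

Lemma Rmx_strict v : exists M, strict_diff (fun x => v *m Rmx x) 0 M.
Proof.
apply: strict_diff_mulmx => k; have [L sL] := dirD_mu_strict (lshift n k); exists (dsubmx L).
have -> : (fun x => row k (Rmx x)) = (fun x => dirD mu (lshift n k) (row_mx 0 x)).
  by apply/funext => x; apply/rowP => j; rewrite !mxE.
by apply: strict_diff_right; rewrite row_mx0.
Qed.

Lemma jac_mu0 : jac mu 0 = col_mx 1%:M 1%:M.
Proof.
have [r r0 /(_ 0)] := mu_strict; rewrite normr0 => /(_ r0) s.
exact: strict_diff_uniq s (quad_diff_strict (mu_quad)).
Qed.

Lemma Rmx0 : Rmx 0 = 1%:M.
Proof. by rewrite /Rmx row_mx0 jac_mu0 col_mxKu. Qed.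

Lemma Lmx0 : Lmx 0 = 1%:M.
Proof. by rewrite /Lmx row_mx0 jac_mu0 col_mxKd. Qed.

Lemma Rmx_near1 e : 0 < e -> exists2 r, 0 < r & forall x, `|x| < r -> `|Rmx x - 1%:M| < e.
Proof.
move=> e0.
have [r r0 h] : exists2 r, 0 < r & forall i : 'I_n, forall x : V, `|x| < r ->
    `|row i (Rmx x) - row i 1%:M| < e.
  apply: (@small_family _ _ (fun i r => forall x : V, `|x| < r ->
    `|row i (Rmx x) - row i 1%:M| < e)) => i.
  have [M /strict_diff_small/(_ e0)[r r0 h]] := Rmx_strict (delta_mx 0 i).
  exists r => // s sr x xs; have := h x; rewrite subr0 Rmx0 -(rowE i (Rmx x)) -(rowE i 1%:M).
  by apply; exact: lt_le_trans xs sr.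
exists r => // x /h {}h.
rewrite -(@ltr_pM2r _ 2^-1)//.
case: (posnP n) => [n0|n0].
  suff -> : Rmx x - 1%:M = 0 by rewrite normr0 mul0r mulr_gt0.
  by apply/matrixP => -[i ip]; exfalso; move: ip; rewrite n0.
rewrite ltr_pM2r// -[X in X < _](_ : \big[Num.max/0]_i `|row i (Rmx x) - row i 1%:M| = _).
  by apply: bigmax_lt => // i _.
apply/eqP; rewrite eq_le; apply/andP; split.
  apply: bigmax_le => // i _; apply: mx_norm_le => // a b.
  by rewrite (le_trans _ (mx_norm_ge _ i b))// !mxE.
apply: mx_norm_le => [|i j]; first exact: bigmax_ge_id.
apply: le_trans (le_bigmax _ _ i); apply: le_trans (mx_norm_ge _ 0 j).
by rewrite !mxE.
Qed.

(** [AdM (psi x)] is a quotient of [Lmx x] by [Rmx x], whose rows are differentiable at [0]. The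
    increment [y] solves [y *m Rmx x = f x]; since [Rmx x] is close to the identity, [y] agrees with
    [f x] to first order and no matrix is inverted. *)
Lemma Ad_psi_diff (v : V) : exists M : 'M[R]_n, forall e, 0 < e ->
  exists2 r, 0 < r & forall x, `|x| < r ->
    `|v *m AdM (psi x) - v - x *m M| <= e * `|x|.
Proof.
have [ML sL] := Lmx_strict v; have [MR sR] := Rmx_strict v.
have sd := strict_diffD sL (strict_diffZ (-1) sR).
set f := (X in strict_diff X) in sd; set M := (X in strict_diff _ _ X) in sd.
have f0 : f 0 = 0 by rewrite /f Lmx0 Rmx0 scaleN1r subrr.
exists M => e e0.
have [r1 r10 [C C0 h1]] := strict_diff_cont sd.
have [r2 r20 h2] := sd (e / 2) (half_gt0 e0).
pose t := Num.min 2^-1 (e / 4 / C).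
have t0 : 0 < t by rewrite lt_min invr_gt0 ltr0Sn !divr_gt0.
have [r3 r30 h3] := Rmx_near1 (divr_gt0 t0 (ltr0Sn _ n)).
have [r4 r40 h4] := AdM_Rmx.
exists (Num.min (Num.min r1 r2) (Num.min r3 r4)); first by rewrite !lt_min r10 r20 r30.
move=> x; rewrite !lt_min => /andP[/andP[x1 x2] /andP[x3 x4]].
have := h1 x 0; have := h2 x 0; rewrite !subr0 normr0 f0 subr0 => /(_ x2 r20) H2 /(_ x1 r10) H1.
pose y := v *m AdM (psi x) - v.
have yR : y *m Rmx x = f x by rewrite mulmxBl -mulmxA h4// /f scaleN1r.
have yE : `|y - f x| <= t * `|y|.
  have -> : y - f x = - (y *m (Rmx x - 1%:M)) by rewrite -yR mulmxBr mulmx1 opprB.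
  rewrite normrN (le_trans (mulmx_norm_le _ _))// mulrCA mulrC ler_wpM2r//.
  apply: le_trans (_ : n%:R * (t / n.+1%:R) <= _).
    by rewrite ler_wpM2l// ltW// h3.
  rewrite mulrCA ler_piMr ?(ltW t0)// ler_pdivrMr// mul1r ler_nat//.
have t2 : t <= 2^-1 by rewrite ge_min lexx.
have y2 : `|y| <= 2 * (C * `|x|).
  have : `|y| <= `|f x| + t * `|y|.
    by rewrite -{1}(subrK (f x) y) (le_trans (ler_normD _ _))// addrC lerD.
  have : t * `|y| <= 2^-1 * `|y| by rewrite ler_wpM2r.
  lra.
have tC : t * (2 * (C * `|x|)) <= e / 2 * `|x|.
  have : t <= e / 4 / C by rewrite ge_min lexx orbT.
  rewrite ler_pdivlMr// => h; rewrite !mulrA ler_wpM2r//.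
  rewrite mulrAC; lra.
rewrite -/y -(subrK (f x) y) -addrA (le_trans (ler_normD _ _))//.
have ty : t * `|y| <= t * (2 * (C * `|x|)) by rewrite ler_wpM2l// ltW.
lra.
Qed.

Lemma AdM_cts (v : V) : continuous (fun g : G => v *m AdM g).
Proof.
move=> g; apply/cvgrPdist_lt => e e0.
have [M h] := Ad_psi_diff v.
pose K := n%:R * `|AdM g| + 1; have K0 : 0 < K by rewrite ltr_wpDl.
have [r r0 hr] := h 1 ltr01.
pose c := 1 + n%:R * `|M|; have c1 : 0 < c by rewrite ltr_pwDl.
have cv := cvg_phi_mulVg g; have nd := near_dom_mulVg g.
have pos : 0 < Num.min r (e / (K * c)) by rewrite lt_min r0 divr_gt0// mulr_gt0.
move/cvgrPdist_lt : cv => /(_ _ pos) cv.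
near=> x.
have dx : dom 1%g (g^-1 * x)%g by near: x.
have : `|0 - phi (g^-1 * x)%g| < Num.min r (e / (K * c)) by near: x.
rewrite sub0r normrN lt_min => /andP[xr xe].
have xE : x = (g * psi (phi (g^-1 * x)))%g by rewrite phiK// mulKVg.
set u := phi (g^-1 * x)%g in xr xe xE.
rewrite xE AdMM mulmxA -mulmxBl (le_lt_trans (mulmx_norm_le _ _))//.
have yb : `|v - v *m AdM (psi u)| <= c * `|u|.
  rewrite distrC -(subrK (u *m M) (_ - _)) (le_trans (ler_normD _ _))// mulrDl lerD//.
    by rewrite hr.
  by rewrite (le_trans (mulmx_norm_le _ _))// -mulrA [`|u| * _]mulrC.
rewrite mulrCA (@le_lt_trans _ _ (c * `|u| * K))//.
  by rewrite ler_pM// lerDl.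
by rewrite mulrC mulrA mulrC -ltr_pdivlMr// mulr_gt0.
Unshelve. all: by end_near. Qed.

(** * Construction of the exponential map *)

Section Exponential.
Definition tends (w : nat -> V) (v : V) :=
  forall e, 0 < e -> exists K, forall k, (K <= k)%N -> `|w k - v| <= e.

Lemma tendsP w v : tends w v <-> (w @ \oo --> v).
Proof.
split=> [h|/cvgrPdist_le h].
  apply/cvgrPdist_le => e e0; have [K hK] := h e e0; exists K => // k Kk.
  by rewrite distrC; exact: hK.
by move=> e e0; have [K _ hK] := h e e0; exists K => k Kk; rewrite distrC; exact: hK.
Qed.

Definition exp_in_chart (ex : V -> G) := exists Ei : V -> V,
  [/\ Ei 0 = 0, strict_diff Ei 0 1%:M & exists2 rho, 0 < rho & forall v, `|v| < rho ->
    [/\ ex v = psi (Ei v), phi (ex v) = Ei v, dom 1%g (ex v) & {for Ei v, continuous psi}]].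

(** In the chart, [sq] is squaring and [E k v] is the coordinate of the power [2^k] of
    [psi (v / 2^k)]. The exponential is the limit in [k], so no differential equation has to be
    solved. *)
Let sq (u : V) := mu (row_mx u u).
Let E := fix E (k : nat) (v : V) : V := if k is k'.+1 then sq (E k' (2^-1 *: v)) else v.

(** The bound [8^-1] makes the factor [4 * C * s] of the Lipschitz estimate for [E k] at most one
    half, for every radius [s <= r]. *)
Let params : exists C r : R, [/\ 0 < C /\ 0 < r, C * r <= 8^-1,
  (forall s, s <= 2 * r -> forall u v, `|u| < s -> `|v| < s ->
     `|sq u - sq v - (u - v) *+ 2| <= C * s * `|u - v|),
  (forall u, `|u| < 2 * r -> psi (sq u) = (psi u * psi u)%g) &
  forall u, `|u| < 2 * r ->
     [/\ dom 1%g (psi u), phi (psi u) = u & {for u, continuous psi}]].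
Proof.
have [C C0 [r1 r10 h1]] := mu_quad; have [r2 r20 h2] := mu_psi.
have [r3 r30 h3] := chart_ball.
pose m := Num.min (Num.min r1 r2) r3.
have m0 : 0 < m by rewrite !lt_min r10 r20.
exists C, (Num.min (m / 2) (8^-1 / C)).
have C8 : 0 < 8^-1 / C by rewrite divr_gt0.
have rm : 2 * Num.min (m / 2) (8^-1 / C) <= m.
  by rewrite mulrC -ler_pdivlMr// ge_min lexx.
split; first split=> //.
- by rewrite lt_min divr_gt0.
- by rewrite mulrC -ler_pdivlMr// ge_min lexx orbT.
- move=> s sr u v us vs; have := h1 s _ (row_mx u u) (row_mx v v).
  rewrite !subr0 !row_mx_norm !maxxx opp_row_mx add_row_mx row_mx_norm maxxx.
  rewrite mul_row_col mulmx1; apply => //.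
  by rewrite (le_trans sr)// (le_trans rm)// !ge_min lexx.
- move=> u um; have um' := lt_le_trans um rm.
  by apply: h2; rewrite (lt_le_trans um')// !ge_min lexx orbT.
- by move=> u um; apply: h3; rewrite (lt_le_trans um)// (le_trans rm)// ge_min lexx orbT.
Qed.

Let C := sval (cid params).
Let r := sval (cid (svalP (cid params))).
Let pP := svalP (cid (svalP (cid params))).

Let C0 : 0 < C. Proof. by have [[]] := pP. Qed.
Let r0 : 0 < r. Proof. by have [[]] := pP. Qed.
Let Cr : C * r <= 8^-1. Proof. by have [] := pP. Qed.
Let sqE s u v : s <= 2 * r -> `|u| < s -> `|v| < s ->
  `|sq u - sq v - (u - v) *+ 2| <= C * s * `|u - v|.
Proof. by have [_ _ h _ _] := pP => sr; exact: h. Qed.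
Let psi_sq u : `|u| < 2 * r -> psi (sq u) = (psi u * psi u)%g.
Proof. by have [_ _ _ h _] := pP; exact: h. Qed.
Let chart u : `|u| < 2 * r ->
  [/\ dom 1%g (psi u), phi (psi u) = u & {for u, continuous psi}].
Proof. by have [_ _ _ _ h] := pP; exact: h. Qed.

Let sq0 : sq 0 = 0.
Proof. by rewrite /sq /mu row_mxKl row_mxKr psi0 mulg1 phi1. Qed.

Let E0 k : E k 0 = 0.
Proof. by elim: k => //= k IH; rewrite scaler0 IH. Qed.

Let Cs s : 0 < s -> s <= r -> C * s <= 8^-1.
Proof. by move=> s0 sr; rewrite (le_trans _ Cr)// ler_pM2l. Qed.

Let halfn (w : V) : `|2^-1 *: w| = `|w| / 2.
Proof. by rewrite normrZ ger0_norm// mulrC. Qed.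

(** Halving the argument halves the radius as well, so the inductive error falls to a quarter before
    squaring doubles it. The remainder of [sq] adds [C * s] times the distance, and the total
    [3 * C * s] stays below [4 * C * s], uniformly in [k]. *)
Let E_lip k s u v : s <= r -> `|u| < s -> `|v| < s ->
  `|E k u - E k v - (u - v)| <= 4 * C * s * `|u - v|.
Proof.
elim: k s u v => [|k IH] s u v sr us vs.
  have s0 := le_lt_trans (normr_ge0 u) us.
  by rewrite subrr normr0 !mulr_ge0// ltW.
have s0 := le_lt_trans (normr_ge0 u) us.
have h2 (w : V) : `|w| < s -> `|2^-1 *: w| < s / 2.
  by move=> ws; rewrite halfn ltr_pM2r.
have s2 : s / 2 <= r by rewrite (le_trans _ sr); lra.
have e4 (w : V) : 4 * C * (s / 2) * (`|w| / 2) = C * s * `|w| by field.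
have c8 (w : V) : C * s * `|w| <= 8^-1 * `|w| by rewrite ler_wpM2r// Cs.
have Eb (w : V) : `|w| < s -> `|E k (2^-1 *: w)| < s.
  move=> ws; have := IH (s / 2) (2^-1 *: w) 0 s2 (h2 w ws).
  rewrite normr0 E0 !subr0 divr_gt0// => /(_ isT).
  have := ler_normD (E k (2^-1 *: w) - 2^-1 *: w) (2^-1 *: w); rewrite subrK halfn e4.
  have := c8 w; lra.
have := IH (s / 2) _ _ s2 (h2 u us) (h2 v vs).
have := sqE (le_trans sr _) (Eb u us) (Eb v vs).
have rr : r <= 2 * r by have := r0; lra.
move=> /(_ rr) /=; rewrite -scalerBr halfn e4.
set a := E k _; set b := E k _; set w := u - v => h3 h4.
have ab : `|a - b| <= `|w|.
  have := ler_normD (a - b - 2^-1 *: w) (2^-1 *: w); rewrite subrK halfn.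
  have := c8 w; have := normr_ge0 w; lra.
have h5 : C * s * `|a - b| <= C * s * `|w|.
  by rewrite ler_wpM2l// mulr_ge0 ?ltW.
have -> : sq a - sq b - w = (sq a - sq b - (a - b) *+ 2) + (a - b - 2^-1 *: w) *+ 2.
  have w2 : (2^-1 *: w) *+ 2 = w by rewrite -scaler_nat scalerA divff// scale1r.
  by rewrite [X in _ = _ + X]mulrnBl w2 addrA subrK.
rewrite (le_trans (ler_normD _ _))// normrMn.
have -> : 4 * C * s * `|w| = 4 * (C * s * `|w|) by ring.
rewrite [X in _ + X]mulr2n.
have p : 0 <= C * s * `|w| by rewrite mulr_ge0 // mulr_ge0 // ltW.
lra.
Qed.

Let E_bound k s v : s <= r -> `|v| < s -> `|E k v| <= 3 / 2 * `|v|.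
Proof.
move=> sr vs; have s0 := le_lt_trans (normr_ge0 v) vs.
have := E_lip k sr vs (v := 0); rewrite normr0 E0 !subr0 => /(_ s0).
have : 4 * C * s * `|v| <= 2^-1 * `|v|.
  by rewrite ler_wpM2r//; have := Cs s0 sr; lra.
have := ler_normD (E k v - v) v; rewrite subrK; lra.
Qed.

Let r2 : r <= 2 * r. Proof. by have := r0; lra. Qed.

Let E_half k s v : s <= r -> `|v| < s -> `|E k (2^-1 *: v)| < s.
Proof.
move=> sr vs; have s0 := le_lt_trans (normr_ge0 v) vs.
have vs2 : `|2^-1 *: v| < s by rewrite halfn; lra.
by have := E_bound k sr vs2; rewrite halfn; lra.
Qed.

Let E_cauchy k s v : s <= r -> `|v| < s -> `|E k.+1 v - E k v| <= C * s * s * (3 / 4) ^+ k.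
Proof.
elim: k s v => [|k IH] s v sr vs; have s0 := le_lt_trans (normr_ge0 v) vs.
  have vs2 : `|2^-1 *: v| < s by rewrite halfn; lra.
  have := sqE (le_trans sr r2) vs2 (v := 0); rewrite normr0 sq0 !subr0 => /(_ s0).
  have -> : (2^-1 *: v) *+ 2 = v by rewrite -scaler_nat scalerA divff// scale1r.
  move=> /le_trans; apply; rewrite mulr1 ler_wpM2l//; last by rewrite halfn; lra.
  by rewrite mulr_ge0 ?ltW.
have s2 : s / 2 <= r by rewrite (le_trans _ sr); lra.
have vs2 : `|2^-1 *: v| < s / 2 by rewrite halfn; lra.
have := IH (s / 2) _ s2 vs2.
have := sqE (le_trans sr r2) (E_half k.+1 sr vs) (E_half k sr vs).
rewrite [E k.+2 v]/= -/(E k.+1 (2^-1 *: v)) [E k.+1 v]/=.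
set a := E k.+1 _; set b := E k _ => h1 h2.
(* The constant is [2] plus the bound [1 / 8] for [C * s]. Combined with the quarter gained by
   halving [s], it stays below the ratio [3 / 4]. *)
have h3 : `|sq a - sq b| <= 17 / 8 * `|a - b|.
  have := ler_normD (sq a - sq b - (a - b) *+ 2) ((a - b) *+ 2).
  rewrite subrK normrMn -mulr_natr.
  have : C * s * `|a - b| <= 8^-1 * `|a - b| by rewrite ler_wpM2r// Cs.
  lra.
rewrite exprS; apply: (le_trans h3).
have -> : C * s * s * (3 / 4 * (3 / 4) ^+ k) = 3 * (C * (s / 2) * (s / 2) * (3 / 4) ^+ k) by field.
move: h2; have := normr_ge0 (a - b); lra.
Qed.

Let Einf_ex v : `|v| < r -> exists l, tends (E^~ v) l.
Proof.
move=> vr; apply: (@geometric_cauchy_rV R n _ (C * r * r) (3 / 4)).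
- lra.
- by rewrite !mulr_ge0 ?ltW.
- by move=> k; exact: E_cauchy.
Qed.

Let Einf v := xget 0 [set l | tends (E^~ v) l].

Let EinfP v : `|v| < r -> tends (E^~ v) (Einf v).
Proof. by move=> /Einf_ex[l hl]; exact: (xgetPex 0 (ex_intro _ l hl)). Qed.

Let Einf_lip s u v : s <= r -> `|u| < s -> `|v| < s ->
  `|Einf u - Einf v - (u - v)| <= 4 * C * s * `|u - v|.
Proof.
move=> sr us vs; apply/ler_addgt0Pr => e e0.
have [K hK] := EinfP (lt_le_trans us sr) (half_gt0 e0).
have [M hM] := EinfP (lt_le_trans vs sr) (half_gt0 e0).
pose k := maxn K M; have := hK k (leq_maxl _ _); have := hM k (leq_maxr _ _).
have := E_lip k sr us vs.
have -> : Einf u - Einf v - (u - v) = (E k u - E k v - (u - v)) +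
    ((E k v - Einf v) - (E k u - Einf u)).
  by apply/rowP => i; rewrite !mxE; ring.
have := ler_normB (E k v - Einf v) (E k u - Einf u).
have := ler_normD (E k u - E k v - (u - v)) ((E k v - Einf v) - (E k u - Einf u)).
lra.
Qed.

Let Einf0 : Einf 0 = 0.
Proof.
have h := EinfP (v := 0); rewrite normr0 in h; have {}h := h r0.
apply/eqP; rewrite -normr_le0; apply/ler_addgt0Pr => e e0; rewrite add0r.
by have [K /(_ K (leqnn _))] := h e e0; rewrite E0 sub0r normrN.
Qed.

Let Einf_bound v : `|v| < r -> `|Einf v| <= 3 / 2 * `|v|.
Proof.
move=> vr; have := Einf_lip (lexx r) vr (v := 0); rewrite normr0 Einf0 !subr0 => /(_ r0).
have : 4 * C * r * `|v| <= 2^-1 * `|v| by rewrite ler_wpM2r//; have := Cr; lra.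
have := ler_normD (Einf v - v) v; rewrite subrK; lra.
Qed.

Let psi_E k v : `|v| < r -> psi (E k v) = (psi (2 ^- k *: v) ^+ (2 ^ k))%g.
Proof.
elim: k v => [|k IH] v vr; first by rewrite invr1 scale1r.
have hv : `|2^-1 *: v| < r by rewrite halfn; have := r0; lra.
rewrite [E _ _]/= psi_sq; last by apply: lt_le_trans (E_half k (lexx r) vr) r2.
rewrite IH// -expgnDr addnn -mul2n -expnS scalerA.
by rewrite exprSr invfM.
Qed.

Let psi_cont v : `|v| < r -> {for Einf v, continuous psi}.
Proof.
move=> vr; have [] // := @chart (Einf v); have := Einf_bound vr; have := r0; lra.
Qed.

Let pow_small (w : nat -> V) v : `|v| < r -> tends (fun k => 2 ^+ k *: w k) v ->
  (fun k => psi (w k) ^+ (2 ^ k))%g @ \oo --> psi (Einf v).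
Proof.
move=> vr wv.
have cE : (fun k => E k (2 ^+ k *: w k)) @ \oo --> Einf v.
  apply/tendsP => e e0.
  have rv : 0 < (r - `|v|) / 2 by rewrite divr_gt0// subr_gt0.
  have [K1 h1] := wv _ rv; have [K2 h2] := wv (e / 4) (divr_gt0 e0 (ltr0Sn _ 3)).
  have [K3 h3] := EinfP vr (half_gt0 e0).
  exists (maxn K1 (maxn K2 K3)) => k; rewrite !geq_max => /andP[k1 /andP[k2 k3]].
  have := h1 k k1; have := h2 k k2; have := h3 k k3; move=> a1 a2 a3.
  have wr : `|2 ^+ k *: w k| < r.
    have := ler_normD (2 ^+ k *: w k - v) v; rewrite subrK; lra.
  have := E_lip k (lexx r) wr vr.
  have : 4 * C * r * `|2 ^+ k *: w k - v| <= 2^-1 * `|2 ^+ k *: w k - v|.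
    by rewrite ler_wpM2r//; have := Cr; lra.
  set x := _ *: w k in a2 a3 wr *.
  have := ler_normD (E k x - E k v - (x - v)) (x - v); rewrite subrK.
  have := ler_normD (E k x - E k v) (E k v - Einf v); rewrite addrA subrK; lra.
have H : psi (E k (2 ^+ k *: w k)) @[k --> \oo] --> psi (Einf v).
  by apply: (cvg_comp _ _ cE); exact: psi_cont.
apply: cvg_trans H; apply: near_eq_cvg.
have rv : 0 < (r - `|v|) / 2 by rewrite divr_gt0// subr_gt0.
have [K1 h1] := wv _ rv; exists K1 => // k Kk /=.
have wr : `|2 ^+ k *: w k| < r.
  have := ler_normD (2 ^+ k *: w k - v) v; rewrite subrK; have := h1 k Kk; lra.
by rewrite psi_E// scalerA mulVf ?scale1r.
Qed.

Let scale_ex (v : V) : exists m : nat, `|2 ^- m *: v| < r.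
Proof.
have r01 := half01.
have [K /(_ K (leqnn _)) h] := geometric_small r01 (normr_ge0 v) r0.
by exists K; rewrite normrZ ger0_norm ?exprn_ge0// mulrC -exprVn.
Qed.

(** Any [m] that brings [v / 2^m] into the ball would do, since [pow_ex] describes the value as a
    limit independent of [m]. *)
Let ex (v : V) : G :=
  let m := xget 0%N [set m : nat | `|2 ^- m *: v| < r] in
  (psi (Einf (2 ^- m *: v)) ^+ (2 ^ m))%g.

Let pow_ex (w : nat -> V) v : tends (fun k => 2 ^+ k *: w k) v ->
  (fun k => psi (w k) ^+ (2 ^ k))%g @ \oo --> ex v.
Proof.
move=> wv; rewrite /ex; set m := xget _ _.
have mr : `|2 ^- m *: v| < r.
  have [m0 hm] := scale_ex v.
  exact: (xgetPex 0%N (ex_intro (fun m : nat => `|2 ^- m *: v| < r) m0 hm)).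
have wm : tends (fun k => 2 ^+ k *: w (k + m)%N) (2 ^- m *: v).
  move=> e e0; have [|K hK] := wv (e * 2 ^+ m); first by rewrite mulr_gt0.
  exists K => k Kk; have := hK (k + m)%N (leq_trans Kk (leq_addr _ _)).
  have -> : 2 ^+ (k + m) *: w (k + m)%N - v = 2 ^+ m *: (2 ^+ k *: w (k + m)%N - 2 ^- m *: v).
    by rewrite scalerBr !scalerA mulfV ?scale1r ?expf_neq0// -exprD addnC.
  by rewrite normrZ ger0_norm ?exprn_ge0// mulrC ler_pM2r.
have h := @cvgXg _ \oo _ _ _ (2 ^ m)%N (pow_small mr wm).
have eE : (fun k => (psi (w (k + m)%N) ^+ (2 ^ k)) ^+ (2 ^ m))%g =
    (fun k => psi (w (k + m)%N) ^+ (2 ^ (k + m)))%g.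
  by apply/funext => k; rewrite -expgnA -expnD.
rewrite eE in h; exact: (cvg_unshift (m := m) (f := fun k => psi (w k) ^+ (2 ^ k))%g (h _)).
Qed.

Let ex_chart v : `|v| < r -> ex v = psi (Einf v).
Proof.
move=> vr.
have wv : tends (fun k => 2 ^+ k *: (2 ^- k *: v)) v.
  by move=> e e0; exists 0%N => k _; rewrite scalerA mulfV ?expf_neq0// scale1r subrr normr0 ltW.
exact: (cvg_lieg (pow_ex wv) (pow_small vr wv)).
Qed.

Let ex_chart_ex : exp_in_chart ex.
Proof.
exists Einf; split; first exact: Einf0; last first.
  exists r => // v vr; rewrite ex_chart//.
  have [|d p c] := @chart (Einf v); last by split.
  by have := Einf_bound vr; have := r0; lra.
move=> e e0; exists (Num.min r (e / (4 * C))).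
  by rewrite lt_min r0 divr_gt0// mulr_gt0.
move=> u v; rewrite !subr0 mulmx1 => us vs; apply: le_trans (Einf_lip _ us vs) _; first by rewrite ge_min lexx.
rewrite ler_wpM2r// mulrC -ler_pdivlMr ?mulr_gt0//.
by rewrite ge_min lexx orbT.
Qed.

(* The proof term is opaque so that unification never unfolds [expG]. *)
Lemma exp_sig : {ex : V -> G |
  (forall (w : nat -> V) v, tends (fun k => 2 ^+ k *: w k) v ->
    (fun k => psi (w k) ^+ (2 ^ k))%g @ \oo --> ex v) /\
  exp_in_chart ex}.
Proof. exists ex; split; [exact: pow_ex|exact: ex_chart_ex]. Qed.

Definition expG : V -> G := sval exp_sig.

Lemma exp_strict : exp_in_chart expG. Proof. exact: (svalP exp_sig).2. Qed.

(** The working characterisation of [expG]: only the first-order behaviour of the sequence matters.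
    Naturality under conjugation, multiples and the product formula all follow by exhibiting a
    suitable sequence. *)
Lemma pow_exp (w : nat -> V) v : tends (fun k => 2 ^+ k *: w k) v ->
  (fun k => psi (w k) ^+ (2 ^ k))%g @ \oo --> expG v.
Proof. by move=> h; apply: (svalP exp_sig).1. Qed.

End Exponential.

Lemma tends_half (v : V) : tends (fun k => 2 ^+ k *: (2 ^- k *: v)) v.
Proof.
by move=> e e0; exists 0%N => k _; rewrite scalerA mulfV ?expf_neq0// scale1r subrr normr0 ltW.
Qed.

Lemma tends_small (w : nat -> V) v : tends (fun k => 2 ^+ k *: w k) v -> tends w 0.
Proof.
move=> wv e e0; have [K hK] := wv 1 ltr01.
have r01 := half01.
have [M hM] := geometric_small r01 (addr_ge0 ler01 (normr_ge0 v)) e0.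
exists (maxn K M) => k; rewrite geq_max subr0 => /andP[/hK h1 /hM h2].
have k0 := pow2_gt0 k.
have h : `|2 ^+ k *: w k| <= 1 + `|v|.
  by have := ler_normD (2 ^+ k *: w k - v) v; rewrite subrK; lra.
rewrite normrZ ger0_norm ?(ltW k0)// in h.
apply: ltW; apply: le_lt_trans h2; rewrite exprVn ler_pdivlMr//.
by rewrite mulrC.
Qed.

Lemma strict_diff_tends p (f : V -> 'rV[R]_p) L (w : nat -> V) v : f 0 = 0 ->
  strict_diff f 0 L -> tends (fun k => 2 ^+ k *: w k) v ->
  forall e, 0 < e -> exists K, forall k, (K <= k)%N -> `|2 ^+ k *: f (w k) - v *m L| <= e.
Proof.
move=> f0 sf wv e e0.
pose c := `|v| + 1; have c0 : 0 < c by rewrite ltr_wpDl.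
have [r r0 hr] := sf (e / 2 / c) (divr_gt0 (half_gt0 e0) c0).
have r2 := half_gt0 r0.
have [K1 h1] := tends_small wv r2.
have [K2 h2] := wv 1 ltr01.
pose m := p.+1%:R * (n%:R * `|L| + 1).
have [|K3 h3] := wv (e / 2 / (n%:R * `|L| + 1)).
  by rewrite !divr_gt0.
exists (maxn K1 (maxn K2 K3)) => k; rewrite !geq_max => /and3P[/h1 a1 /h2 a2 /h3 a3].
have wr : `|w k| < r by rewrite subr0 in a1; lra.
have := hr (w k) 0; rewrite !subr0 normr0 f0 subr0 => /(_ wr r0) H.
have k0 := pow2_gt0 k.
have -> : 2 ^+ k *: f (w k) - v *m L =
    2 ^+ k *: (f (w k) - w k *m L) + (2 ^+ k *: w k - v) *m L.
  by rewrite scalerBr mulmxBl -scalemxAl addrA subrK.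
rewrite (le_trans (ler_normD _ _))// (splitr e) lerD//.
  rewrite normrZ (ger0_norm (ltW k0)).
  apply: le_trans (_ : 2 ^+ k * (e / 2 / c * `|w k|) <= _); first by rewrite ler_pM2l.
  have nw : 2 ^+ k * `|w k| <= c.
    have := ler_normD (2 ^+ k *: w k - v) v.
    by rewrite subrK normrZ (ger0_norm (ltW k0)) /c; lra.
  rewrite mulrCA; apply: le_trans (_ : e / 2 / c * c <= _).
    by rewrite ler_wpM2l// divr_ge0 ?(ltW c0)// divr_ge0 // ltW.
  by rewrite divfK// gt_eqF.
rewrite (le_trans (mulmx_norm_le _ _))// mulrCA mulrC.
apply: le_trans (_ : (n%:R * `|L|) * (e / 2 / (n%:R * `|L| + 1)) <= _).
  by rewrite ler_wpM2l.
rewrite mulrCA mulrA mulrAC -mulrA ler_piMr ?divr_ge0 ?(ltW e0)//.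
by rewrite mulrC ler_pdivrMr ?mul1r ?lerDl.
Qed.

(** The remainder of [mu] is quadratic in quantities of order [2^-k], so it still vanishes after
    multiplication by [2^k]. *)
Lemma tends_mu (a b : nat -> V) v w : tends (fun k => 2 ^+ k *: a k) v ->
  tends (fun k => 2 ^+ k *: b k) w ->
  tends (fun k => 2 ^+ k *: mu (row_mx (a k) (b k))) (v + w).
Proof.
move=> av bw e e0.
have [C C0 [r0 r00 h]] := mu_quad.
pose c := `|v| + `|w| + 1; have c0 : 0 < c by rewrite ltr_wpDl.
pose r := Num.min r0 (e / 3 / (C * c)).
have r1 : 0 < r by rewrite lt_min r00 divr_gt0// mulr_gt0.
have [K1 h1] := tends_small av (half_gt0 r1).
have [K2 h2] := tends_small bw (half_gt0 r1).
have pe : 0 < Num.min 1 (e / 3) by rewrite lt_min ltr01 divr_gt0.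
have [K3 h3] := av _ pe; have [K4 h4] := bw _ pe.
exists (maxn (maxn K1 K2) (maxn K3 K4)) => k; rewrite !geq_max.
move=> /andP[/andP[/h1 a1 /h2 a2] /andP[/h3 a3 /h4 a4]].
move: a1 a2 a3 a4; rewrite !subr0 !le_min => a1 a2 /andP[a3 a3'] /andP[a4 a4'].
have wr : `|row_mx (a k) (b k)| < r.
  by rewrite row_mx_norm gt_max; apply/andP; split; lra.
have rr : r <= r0 by rewrite ge_min lexx.
have := h r rr (row_mx (a k) (b k)) 0; rewrite !subr0 normr0 => /(_ wr r1).
have mu0 : mu 0 = 0 by rewrite -(row_mx0 R 1 n n) /mu row_mxKl row_mxKr psi0 mulg1 phi1.
rewrite mu0 subr0 mul_row_col !mulmx1.
set x := mu _ => H.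
have k0 := pow2_gt0 k.
have nk (u : V) : `|2 ^+ k *: u| = 2 ^+ k * `|u| by rewrite normrZ ger0_norm.
have -> : 2 ^+ k *: x - (v + w) = 2 ^+ k *: (x - (a k + b k)) +
    ((2 ^+ k *: a k - v) + (2 ^+ k *: b k - w)).
  by apply/rowP => i; rewrite !mxE; ring.
rewrite (le_trans (ler_normD _ _))//.
have t1 := ler_normD (2 ^+ k *: a k - v) (2 ^+ k *: b k - w).
suff : `|2 ^+ k *: (x - (a k + b k))| <= e / 3 by lra.
rewrite nk; apply: le_trans (_ : 2 ^+ k * (C * r * `|row_mx (a k) (b k)|) <= _).
  by rewrite ler_pM2l.
have nc : 2 ^+ k * `|row_mx (a k) (b k)| <= c.
  rewrite row_mx_norm maxr_pMr ?(ltW k0)// -!nk ge_max /c.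
  have := ler_normD (2 ^+ k *: a k - v) v; have := ler_normD (2 ^+ k *: b k - w) w.
  rewrite !subrK; have := normr_ge0 v; have := normr_ge0 w => p1 p2 p3 p4.
  apply/andP; split; lra.
rewrite mulrCA; apply: le_trans (_ : C * r * c <= _).
  by rewrite ler_wpM2l// mulr_ge0 ?ltW.
rewrite mulrAC -ler_pdivlMl ?mulr_gt0// mulrC.
by rewrite ge_min lexx orbT.
Qed.

Lemma expG_conj g v : (g * expG v * g^-1)%g = expG (v *m AdM g).
Proof.
have h := pow_exp (tends_half v).
have [r r0 hr] := psi_cj g.
have h1 : (fun k => psi (cj g (2 ^- k *: v)) ^+ (2 ^ k))%g @ \oo --> expG (v *m AdM g).
  apply: pow_exp; apply: (strict_diff_tends (cj0 g) (cj_strict g)).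
  exact: tends_half.
apply: cvg_lieg h1; have h2 : (fun k => g * psi (2 ^- k *: v) ^+ (2 ^ k) * g^-1)%g @ \oo -->
    (g * expG v * g^-1)%g.
  by apply: cvgMg; [apply: cvgMg => //; exact: cvg_cst|exact: cvg_cst].
apply: cvg_trans h2; apply: near_eq_cvg.
have [|K hK] := tends_small (tends_half v) (e := r / 2); first by rewrite divr_gt0.
exists K => // k /hK; rewrite subr0 => kr /=; rewrite hr; last lra.
have cE (x y : G) : (x * y * x^-1 = y ^ (x^-1))%g by rewrite conjgE invgK mulgA.
by rewrite !cE conjXg.
Qed.

Lemma expG0 : expG 0 = 1%g.
Proof.
have h : (fun k => psi 0 ^+ (2 ^ k))%g @ \oo --> expG 0.
  apply: pow_exp => e e0; exists 0%N => k _.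
  by rewrite scaler0 subrr normr0 ltW.
apply: cvg_lieg h _.
by under eq_fun do rewrite psi0 expg1n; exact: cvg_cst.
Qed.

Lemma near_tends_psi (w : nat -> V) : tends w 0 -> psi (w k) @[k --> \oo] --> (1%g : G).
Proof.
move=> /tendsP h; exact: (cvg_comp _ _ h psi_cvg0).
Qed.

Lemma expG_nat v k : expG (v *+ k) = (expG v ^+ k)%g.
Proof.
have [w [wv [K hK]]] : exists w : nat -> V, tends (fun j => 2 ^+ j *: w j) (v *+ k) /\
    exists K, forall j, (K <= j)%N -> psi (w j) = (psi (2 ^- j *: v) ^+ k)%g.
  elim: k => [|k [w [wv [K hK]]]].
    exists (fun=> 0); split; last by exists 0%N => j _; rewrite psi0.
    by move=> e e0; exists 0%N => j _; rewrite scaler0 subrr normr0 ltW.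
  have [r r0 hr] := mu_psi.
  have hv := tends_half v.
  have r2 := half_gt0 r0.
  have [K1 h1] := tends_small wv r2; have [K2 h2] := tends_small hv r2.
  exists (fun j => mu (row_mx (2 ^- j *: v) (w j))); split.
    rewrite (mulrS v k); exact: (@tends_mu (fun j => 2 ^- j *: v) w v (v *+ k) hv wv).
  exists (maxn K (maxn K1 K2)) => j; rewrite !geq_max => /and3P[a1 /h1 a2 /h2 a3].
  by rewrite subr0 in a2; rewrite subr0 in a3; rewrite hr ?hK ?expgS//; lra.
apply: cvg_lieg (pow_exp wv) _.
have h := @cvgXg _ \oo _ _ _ k (pow_exp (tends_half v)).
apply: cvg_trans (h _); apply: near_eq_cvg; exists K => // j Kj /=.
by rewrite hK// -!expgnA mulnC.
Qed.

Lemma expGN v : expG (- v) = ((expG v)^-1)%g.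
Proof.
have [C C0 [r0 r00 h]] := mu_quad.
have hv := tends_half v.
have pi : (psi (2 ^- j *: v))^-1%g @[j --> \oo] --> (1%g : G).
  by rewrite -invg1; apply: cvgVg; apply: near_tends_psi; exact: tends_small hv.
have d1 := @dom_center R G 1%g.
have [K0 _ hK0] : \forall j \near \oo, dom 1%g (psi (2 ^- j *: v))^-1%g.
  by apply: pi; exact: near_dom.
pose io j := phi (psi (2 ^- j *: v))^-1%g.
have ioE j : (K0 <= j)%N -> psi (io j) = ((psi (2 ^- j *: v))^-1)%g.
  by move=> kj; rewrite phiK//; exact: hK0.
have io0 : tends io 0.
  apply/tendsP; rewrite -(phi1); exact: (cvg_comp _ _ pi (phi_cvg d1)).
have wv : tends (fun j => 2 ^+ j *: io j) (- v).
  move=> e e0.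
  pose r := Num.min (Num.min r0 (2^-1 / C)) (e / (3 * C * (`|v| + 1))).
  have v1 : 0 < `|v| + 1 by rewrite ltr_wpDl.
  have r1 : 0 < r by rewrite !lt_min r00 !divr_gt0// !mulr_gt0.
  have r2 := half_gt0 r1.
  have [K1 h1] := tends_small hv r2; have [K2 h2] := io0 _ r2.
  exists (maxn K0 (maxn K1 K2)) => j; rewrite !geq_max => /and3P[k0 /h1 a1 /h2 a2].
  have k0' := pow2_gt0 j.
  have uE : 2 ^+ j *: (2 ^- j *: v) = v by rewrite scalerA mulfV ?scale1r.
  have uv : 2 ^+ j * `|2 ^- j *: v| = `|v|.
    by rewrite normrZ ger0_norm ?(ltW k0')// mulVKf.
  have pu := ioE j k0.
  rewrite !subr0 in a1 a2; move: (2 ^- j *: v : V) a1 uE uv pu => u a1 uE uv pu.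
  have rr : r <= r0 by rewrite !ge_min lexx.
  have := h r rr (row_mx u (io j)) 0; rewrite !subr0 normr0 row_mx_norm => H.
  have mm : Num.max `|u| `|io j| < r by rewrite gt_max; apply/andP; split; lra.
  have {H} := H mm r1.
  have -> : mu (row_mx u (io j)) = 0.
    by rewrite /mu row_mxKl row_mxKr pu mulgV phi1.
  have -> : mu 0 = 0 by rewrite -(row_mx0 R 1 n n) /mu row_mxKl row_mxKr psi0 mulg1 phi1.
  rewrite subrr sub0r normrN mul_row_col !mulmx1 => H.
  have Cr : C * r <= 2^-1.
    by rewrite mulrC -ler_pdivlMr// !ge_min lexx orbT.
  have Cr0 : 0 <= C * r by rewrite mulr_ge0// ltW.
  have io3 : Num.max `|u| `|io j| <= 3 * `|u|.
    have t := ler_normB (u + io j) u; rewrite addrAC subrr add0r in t.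
    have : C * r * Num.max `|u| `|io j| <= 2^-1 * Num.max `|u| `|io j|.
      by rewrite ler_wpM2r.
    have p := normr_ge0 u; move: H; rewrite ge_max.
    case: (leP `|u| `|io j|) => uio H H2; apply/andP; split; lra.
  have -> : 2 ^+ j *: io j - - v = 2 ^+ j *: (u + io j).
    by rewrite opprK (scalerDr _ u) uE addrC.
  rewrite normrZ (ger0_norm (ltW k0')).
  apply: le_trans (_ : 2 ^+ j * (C * r * (3 * `|u|)) <= _).
    rewrite ler_pM2l// (le_trans H)// ler_wpM2l//.
  have -> : 2 ^+ j * (C * r * (3 * `|u|)) = 3 * C * r * `|v| by rewrite -uv; ring.
  have : r <= e / (3 * C * (`|v| + 1)) by rewrite ge_min lexx orbT.
  rewrite ler_pdivlMr ?mulr_gt0// => H3.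
  have : 0 <= r * (3 * C) by rewrite !mulr_ge0// ltW.
  have -> : 3 * C * r * `|v| = r * (3 * C) * `|v| by ring.
  rewrite mulrDr in H3; lra.
apply: cvg_lieg (pow_exp wv) _.
have h3 := cvgVg (pow_exp hv).
apply: cvg_trans (h3 _); apply: near_eq_cvg; exists K0 => // j Kj /=.
by rewrite ioE// expVgn.
Qed.

Lemma expG_cts : continuous expG.
Proof.
move=> v.
have [Ei [_ sE [rho rho0 EiP]]] := exp_strict.
have [s s0 hs] := sE 1 ltr01.
pose t := Num.min rho s; have t0 : 0 < t by rewrite lt_min rho0.
have r01 := half01.
have [m hm] := geometric_small r01 (normr_ge0 v) t0.
have vm : `|2 ^- m *: v| < t.
  by rewrite normrZ ger0_norm ?exprn_ge0// mulrC -exprVn; exact: hm.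
have c1 : (fun u : V => 2 ^- m *: u) @ v --> 2 ^- m *: v.
  by have := @scaler_continuous R V (2 ^- m) v.
have vs : `|2 ^- m *: v| < s by move: vm; rewrite lt_min => /andP[].
have cE : Ei @ (2 ^- m *: v) --> Ei (2 ^- m *: v).
  apply: (@ball_lipschitz_continuous R _ _ Ei 2 (s - `|2 ^- m *: v|)); rewrite ?subr_gt0// => u us.
  have us' : `|u| < s by have := ler_normD (u - 2 ^- m *: v) (2 ^- m *: v); rewrite subrK; lra.
  have := hs u (2 ^- m *: v); rewrite !subr0 mulmx1 mul1r => /(_ us' vs).
  have := ler_normD (Ei u - Ei (2 ^- m *: v) - (u - 2 ^- m *: v)) (u - 2 ^- m *: v).
  rewrite subrK; lra.
have cp : psi (Ei (2 ^- m *: u)) @[u --> v] --> psi (Ei (2 ^- m *: v)).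
  have [|_ _ _ pc] := EiP (2 ^- m *: v); first by move: vm; rewrite lt_min => /andP[].
  by apply: (cvg_comp _ _ (cvg_comp _ _ c1 cE)).
have c4 := @cvgXg _ (nbhs v) _ _ _ (2 ^ m)%N cp.
have eE u : expG u = (expG (2 ^- m *: u) ^+ (2 ^ m))%g.
  by rewrite -expG_nat -scaler_nat natrX scalerA mulfV ?scale1r.
rewrite /continuous_at (eE v); have [|-> _ _ _] := EiP (2 ^- m *: v); first by move: vm; rewrite lt_min => /andP[].
have F : Filter (nbhs v) by exact: nbhs_filter.
apply: cvg_trans (c4 _); apply: near_eq_cvg.
have d0 : 0 < rho - `|2 ^- m *: v| by rewrite subr_gt0; move: vm; rewrite lt_min => /andP[].
apply: (@filterS _ (nbhs v) F _ _ _ (c1 _ (@nbhs_dist_lt R V (2 ^- m *: v) _ d0))) => u /= hu.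
rewrite (eE u); have [|-> //] := EiP (2 ^- m *: u).
by have := ler_normD (2 ^- m *: u - 2 ^- m *: v) (2 ^- m *: v); rewrite subrK distrC; lra.
Qed.

Lemma trunc_half (s : R) : 0 <= s ->
  (fun k => (Num.truncn (2 ^+ k * s))%:R / 2 ^+ k) @ \oo --> s.
Proof.
move=> s0; apply/cvgrPdist_lt => e e0.
have r01 := half01.
have [m hm] := geometric_small r01 ler01 e0; exists m => // k /hm /= h.
have k0 := pow2_gt0 k.
have := truncn_itv (mulr_ge0 (ltW k0) s0); set a := Num.truncn _ => /andP[h1 h2].
rewrite mul1r exprVn in h.
rewrite ger0_norm ?subr_ge0 ?ler_pdivrMr//; last by rewrite mulrC.
apply: le_lt_trans h; rewrite lerBlDr -[X in X + _]mul1r -mulrDl ler_pdivlMr// mulrC addrC.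
by have := @natr1 R a; lra.
Qed.

(** Both sides are limits over dyadic multiples, where the law is that of natural powers of one
    element. Truncation to naturals is the reason for the signs of [s] and [t]. *)
Lemma expG_add0 s t v : 0 <= s -> 0 <= t ->
  expG ((s + t) *: v) = (expG (s *: v) * expG (t *: v))%g.
Proof.
move=> s0 t0.
pose a k := Num.truncn (2 ^+ k * s); pose b k := Num.truncn (2 ^+ k * t).
have cs := trunc_half s0; have ct := trunc_half t0.
have cZ (c : nat -> R) (x : R) : c @ \oo --> x -> expG (c k *: v) @[k --> \oo] --> expG (x *: v).
  move=> cx; have h : c k *: v @[k --> \oo] --> x *: v by apply: cvgZl.
  by apply: (cvg_comp _ _ h); exact: expG_cts.
have h1 := cZ _ _ (cvgD cs ct) _.
have h2 := cvgMg (cZ _ _ cs) (cZ _ _ ct).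
apply: (cvg_lieg (h1 _)); apply: cvg_trans (h2 _); apply: near_eq_cvg; exists 0%N => // k _ /=.
have E (m : nat) : expG ((m%:R / 2 ^+ k) *: v) = (expG (2 ^- k *: v) ^+ m)%g.
  by rewrite -expG_nat -(scaler_nat m (2 ^- k *: v)) scalerA.
rewrite (_ : (_ + _) k = (a k + b k)%N%:R / 2 ^+ k); last by rewrite natrD mulrDl.
by rewrite !E expgnDr.
Qed.

Lemma expG_comm0 s t v : 0 <= s -> 0 <= t ->
  (expG (s *: v) * expG (t *: v) = expG (t *: v) * expG (s *: v))%g.
Proof. by move=> s0 t0; rewrite -(expG_add0 v s0 t0) -(expG_add0 v t0 s0) addrC. Qed.

Lemma expG_diff a b v : 0 <= a -> 0 <= b ->
  expG ((a - b) *: v) = (expG (a *: v) * (expG (b *: v))^-1)%g.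
Proof.
have H (x y : R) : 0 <= y -> y <= x -> expG (x *: v) = (expG ((x - y) *: v) * expG (y *: v))%g.
  by move=> y0 yx; rewrite -expG_add0 ?subr_ge0// subrK.
move=> a0 b0; have [ab|/ltW ab] := leP b a; first by rewrite (H _ _ b0 ab) mulgK.
rewrite -opprB scaleNr expGN (H _ _ a0 ab).
by rewrite invgM mulVKg.
Qed.

Lemma expG_add s t v : expG ((s + t) *: v) = (expG (s *: v) * expG (t *: v))%g.
Proof.
have pn (x : R) : exists a b, [/\ 0 <= a, 0 <= b & x = a - b].
  have [x0|x0] := leP 0 x; first by exists x, 0; rewrite subr0.
  exists (0 : R), (- x); split; lra.
have [a [b [a0 b0 ->]]] := pn s; have [c [d [c0 d0 ->]]] := pn t.
have -> : a - b + (c - d) = (a + c) - (b + d) by ring.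
rewrite (expG_diff v (addr_ge0 a0 c0) (addr_ge0 b0 d0)) (expG_diff v a0 b0).
rewrite (expG_diff v c0 d0) (expG_add0 v a0 c0) (expG_add0 v b0 d0).
have cm : commute (expG (b *: v)) (expG (c *: v)) by exact: expG_comm0.
have cd : commute (expG (d *: v)) (expG (b *: v)) by exact: expG_comm0.
have cV : (expG (c *: v) * (expG (b *: v))^-1 = (expG (b *: v))^-1 * expG (c *: v))%g.
  by apply: (@mulgI _ (expG (b *: v))); rewrite mulVKg mulgA (cm : (_ * _ = _ * _)%g) mulgK.
rewrite (_ : (expG (b *: v) * expG (d *: v))%g = (expG (d *: v) * expG (b *: v))%g)//.
by rewrite invgM !mulgA; congr (_ * _)%g; rewrite -!mulgA cV.
Qed.

Lemma div_succ_le (a b : R) : 0 <= a -> 0 <= b -> a / (b + 1) * b <= a.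
Proof.
move=> a0 b0; have b1 : 0 < b + 1 by rewrite ltr_wpDl.
by rewrite mulrAC ler_pdivrMr// ler_wpM2l// lerDl.
Qed.

(** The iteration [u + (y - f u)] from [0] halves its increments, so it converges without leaving
    the ball of radius [2 * |y|]. *)
Lemma local_surj (m : nat) (f : 'rV[R]_m -> 'rV[R]_m) (s : R) (y : 'rV[R]_m) : f 0 = 0 ->
  (forall u v, `|u| < s -> `|v| < s -> `|f u - f v - (u - v)| <= 2^-1 * `|u - v|) ->
  `|y| < s / 4 -> exists2 u, `|u| <= 2 * `|y| & f u = y.
Proof.
move=> f0 fL ys.
pose u := fix u (k : nat) := if k is k'.+1 then u k' + (y - f (u k')) else (0 : 'rV[R]_m).
have y0 := normr_ge0 y.
have p (k : nat) : 0 < (2^-1 : R) ^+ k by rewrite exprn_gt0.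
have H k : `|u k| <= 2 * `|y| * (1 - 2^-1 ^+ k) /\ `|u k.+1 - u k| <= `|y| * 2^-1 ^+ k.
  elim: k => [|k [IH1 IH2]].
    by rewrite /= f0 subr0 add0r subrr mulr1 subr0 normr0.
  have le1 : `|u k.+1| <= 2 * `|y| * (1 - 2^-1 ^+ k.+1).
    have := ler_normD (u k.+1 - u k) (u k); rewrite subrK exprS.
    move: IH1 IH2; lra.
  split=> //.
  have b j : `|u j| <= 2 * `|y| * (1 - 2^-1 ^+ j) -> `|u j| < s.
    have : 0 <= `|y| * 2^-1 ^+ j by rewrite mulr_ge0.
    rewrite mulrBr; lra.
  have := fL _ _ (b _ le1) (b _ IH1).
  have E : u k.+2 - u k.+1 = - (f (u k.+1) - f (u k) - (u k.+1 - u k)).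
    by rewrite /=; apply/rowP => j; rewrite !mxE; ring.
  rewrite E normrN exprS => h; lra.
have h01 := half01.
have [l hl] := geometric_cauchy_rV h01 y0 (fun k => (H k).2).
have l2 : `|l| <= 2 * `|y|.
  apply/ler_addgt0Pr => e e0; have [K /(_ K (leqnn _)) hK] := hl e e0.
  have := ler_normB (u K) (u K - l); rewrite opprB addrC subrK.
  have [+ _] := H K; have : 0 <= `|y| * 2^-1 ^+ K by rewrite mulr_ge0.
  rewrite mulrBr; lra.
have us k : `|u k| < s.
  have [+ _] := H k; have : 0 <= `|y| * 2^-1 ^+ k by rewrite mulr_ge0.
  rewrite mulrBr; lra.
have ls : `|l| < s by lra.
exists l => //; apply/eqP; rewrite -subr_eq0 -normr_le0; apply/ler_addgt0Pr => e e0; rewrite add0r.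
have e3 : 0 < e / 3 by rewrite divr_gt0.
have [K hK] := hl _ e3; have [M hM] := geometric_small h01 y0 e3.
pose k := maxn K M; have h1 := hK k (leq_maxl _ _); have h2 := hM k (leq_maxr _ _).
have [_ h3] := H k.
have h4 := fL _ _ ls (us k).
have E : f l - y = (f l - f (u k) - (l - u k)) + (l - u k) - (u k.+1 - u k).
  by rewrite /=; apply/rowP => j; rewrite !mxE; ring.
rewrite E; have := ler_normB (f l - f (u k) - (l - u k) + (l - u k)) (u k.+1 - u k).
have := ler_normD (f l - f (u k) - (l - u k)) (l - u k).
rewrite [`|l - u k|]distrC in h4 *; lra.
Qed.

(** Composing with the right inverse [B] of the derivative reduces to a map between equal dimensions
    with derivative one. *)
Lemma strict_surj (m p : nat) (f : 'rV[R]_m -> 'rV[R]_p) L (B : 'M[R]_(p, m)) :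
  f 0 = 0 -> strict_diff f 0 L -> B *m L = 1%:M ->
  forall e, 0 < e -> exists2 d, 0 < d & forall y, `|y| < d -> exists2 u, `|u| < e & f u = y.
Proof.
move=> f0 sf BL e e0.
have sg : strict_diff (fun y => f (y *m B)) 0 1%:M.
  rewrite -BL; have sB := @strict_diff_affine R p m B 0 0.
  have h : (0 : 'rV[R]_p) *m B + 0 = 0 by rewrite mul0mx addr0.
  have := @strict_diff_comp R p m p (fun x => x *m B + 0) f 0 B L sB.
  rewrite h => /(_ sf); apply: strict_diff_near ltr01 _ => x _ /=.
  by rewrite addr0.
have [s s0 hs] := sg 2^-1 ltac:(lra).
have c0 : 0 < p%:R * `|B| + 1 :> R by rewrite ltr_wpDl.
exists (Num.min (s / 4) (e / 2 / (p%:R * `|B| + 1))); first by rewrite lt_min !divr_gt0.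
move=> y; rewrite lt_min => /andP[y1 y2].
have hf u v : `|u| < s -> `|v| < s -> `|f (u *m B) - f (v *m B) - (u - v)| <= 2^-1 * `|u - v|.
  by move=> us vs; have := hs u v; rewrite !subr0 mulmx1; apply.
have g0 : f (0 *m B) = 0 by rewrite mul0mx.
have [u u2 fu] := local_surj (f := fun y => f (y *m B)) g0 hf y1.
exists (u *m B) => //; apply: le_lt_trans (mulmx_norm_le _ _) _.
rewrite mulrCA; rewrite ltr_pdivlMr// mulrDr mulr1 in y2.
have : `|u| * (p%:R * `|B|) <= 2 * `|y| * (p%:R * `|B|) by rewrite ler_wpM2r.
have := normr_ge0 y; lra.
Qed.

Lemma exp_psi_seq v : exists2 w : nat -> V, tends (fun k => 2 ^+ k *: w k) v &
  exists K, forall k, (K <= k)%N -> expG (2 ^- k *: v) = psi (w k).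
Proof.
have [Ei [Ei0 sE [rho rho0 EP]]] := exp_strict.
exists (fun k => Ei (2 ^- k *: v)).
  by have h := strict_diff_tends Ei0 sE (tends_half v); rewrite mulmx1 in h.
have rho2 := half_gt0 rho0.
have [K hK] := tends_small (tends_half v) rho2.
by exists K => k /hK; rewrite subr0 => h; have [|-> //] := EP (2 ^- k *: v); lra.
Qed.

(** The product [exp (v / 2^k) exp (w / 2^k)] has chart coordinates with first-order term
    [(v + w) / 2^k], so its powers converge by [pow_exp]. *)
Lemma trotter v w :
  (fun k => (expG (2 ^- k *: v) * expG (2 ^- k *: w)) ^+ (2 ^ k))%g @ \oo --> expG (v + w).
Proof.
have [a av [K1 h1]] := exp_psi_seq v; have [b bw [K2 h2]] := exp_psi_seq w.
have h := pow_exp (tends_mu av bw).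
apply: cvg_trans h; apply: near_eq_cvg.
have [r r0 hr] := mu_psi; have r2 := half_gt0 r0.
have [K3 h3] := tends_small av r2; have [K4 h4] := tends_small bw r2.
exists (maxn (maxn K1 K2) (maxn K3 K4)) => // k /=; rewrite !geq_max.
move=> /andP[/andP[/h1 e1 /h2 e2] /andP[/h3 e3 /h4 e4]].
by rewrite !subr0 in e3 e4; rewrite e1 e2 hr//; lra.
Qed.

Lemma expgMn_comm (H : groupType) (x y : H) k : (x * y = y * x)%g -> ((x * y) ^+ k = x ^+ k * y ^+ k)%g.
Proof. by move=> xy; exact: expgMn. Qed.

Lemma expG_half v k : (expG (2 ^- k *: v) ^+ (2 ^ k))%g = expG v.
Proof.
by rewrite -expG_nat -(scaler_nat _ (2 ^- k *: v)) natrX scalerA mulfV ?scale1r.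
Qed.

Lemma expG_addC v w :
  (forall k : nat, (expG (2 ^- k *: v) * expG (2 ^- k *: w) =
     expG (2 ^- k *: w) * expG (2 ^- k *: v))%g) ->
  expG (v + w) = (expG v * expG w)%g.
Proof.
move=> h; have H := @trotter v w; apply: (cvg_lieg H).
under eq_fun => k do rewrite (expgMn_comm _ (h k)) !expG_half.
exact: cvg_cst.
Qed.

Lemma exp_near1 e : 0 < e -> nbhs (1%g : G) [set x | exists2 v, `|v| < e & expG v = x].
Proof.
move=> e0; have [Ei [Ei0 sE [rho rho0 EP]]] := exp_strict.
have m0 : 0 < Num.min e rho by rewrite lt_min e0.
have [d d0 hd] := strict_surj Ei0 sE (mul1mx 1%:M) m0.
have d1 := @dom_center R G 1%g.
have F : Filter (nbhs (1%g : G)) by exact: nbhs_filter.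
have h1 : nbhs (1%g : G) [set x | `|phi x| < d].
  have := phi_cvg d1 => /cvgrPdist_lt/(_ d d0); apply: filterS => x.
  by rewrite phi1 sub0r normrN.
apply: filterS (filterI h1 (near_dom d1)) => x [xd xdom].
have [u um uE] := hd _ xd; move: um; rewrite lt_min => /andP[ue ur].
by exists u => //; have [-> _ _ _] := EP u ur; rewrite uE phiK.
Qed.

Lemma exp_inj : exists2 r, 0 < r & forall u v, `|u| < r -> `|v| < r -> expG u = expG v -> u = v.
Proof.
have [Ei [Ei0 sE [rho rho0 EP]]] := exp_strict.
have [s s0 hs] := sE 2^-1 ltac:(lra).
exists (Num.min s rho); first by rewrite lt_min s0.
move=> u v; rewrite !lt_min => /andP[us ur] /andP[vs vr] uv.
have [_ pu _ _] := EP u ur; have [_ pv _ _] := EP v vr.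
have := hs u v; rewrite !subr0 mulmx1 -pu -pv uv subrr sub0r normrN => /(_ us vs) h.
by apply/eqP; rewrite -subr_eq0 -normr_le0; lra.
Qed.

Lemma small_half (v : V) r : 0 < r -> exists K, forall k, (K <= k)%N -> `|2 ^- k *: v| < r.
Proof.
move=> r0; have r2 := half_gt0 r0.
have [K hK] := tends_small (tends_half v) r2; exists K => k /hK; rewrite subr0; lra.
Qed.

Lemma expG_gen_inj u v : (forall k : nat, expG (2 ^- k *: u) = expG (2 ^- k *: v)) -> u = v.
Proof.
move=> h; have [r r0 hr] := exp_inj.
have [K hK] := small_half u r0; have [M hM] := small_half v r0.
pose k := maxn K M.
have := hr _ _ (hK k (leq_maxl _ _)) (hM k (leq_maxr _ _)) (h k) => /(congr1 (fun z => 2 ^+ k *: z)).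
by rewrite !scalerA mulfV ?scale1r.
Qed.

Lemma AdM_fix_commute g v :
  v *m AdM g = v <-> forall s, (g * expG (s *: v) = expG (s *: v) * g)%g.
Proof.
split=> [gv s|h].
  by apply: (@mulIg _ (g^-1)%g); rewrite expG_conj mulgK -scalemxAl gv.
apply: expG_gen_inj => k; rewrite scalemxAl -expG_conj h mulgK//.
Qed.

Lemma AdM_V g : AdM g *m AdM (g^-1)%g = 1%:M.
Proof. by rewrite -AdMM mulVg AdM1. Qed.

Lemma AdM_VK g (v : V) : v *m AdM g *m AdM (g^-1)%g = v.
Proof. by rewrite -mulmxA AdM_V mulmx1. Qed.

(** The resulting [bk Y B] is the Lie bracket of [Y] and [B], as the first-order term of [Ad] at the
    identity in the direction [Y]. *)
Lemma bk_sig (B : V) : {M : 'M[R]_n | forall e, 0 < e -> exists2 r, 0 < r &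
  forall x, `|x| < r -> `|B *m AdM (psi x) - B - x *m M| <= e * `|x|}.
Proof. by have [M h] := cid (@Ad_psi_diff B); exists M. Qed.

Definition bkM (B : V) : 'M[R]_n := sval (bk_sig B).
Definition bk (Y B : V) : V := Y *m bkM B.

Lemma bk_exp B e : 0 < e -> exists2 r, 0 < r & forall x, `|x| < r ->
  `|B *m AdM (expG x) - B - bk x B| <= e * `|x|.
Proof.
move=> e0; rewrite /bk; have := svalP (bk_sig B); rewrite -/(bkM B).
set M := bkM B => H.
have [Ei [Ei0 sE [rho rho0 EP]]] := exp_strict.
have e4 : 0 < e / 4 by rewrite divr_gt0.
have c0 : 0 < n%:R * `|M| + 1 :> R by rewrite ltr_wpDl.
have [r1 r10 h1] := H _ e4.
have d0 : 0 < Num.min 1 (e / 2 / (n%:R * `|M| + 1)) by rewrite lt_min ltr01 !divr_gt0.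
have [r2 r20 h2] := sE _ d0.
exists (Num.min (Num.min rho r2) (r1 / 2)); first by rewrite !lt_min rho0 r20 divr_gt0.
move=> x; rewrite !lt_min => /andP[/andP[xr x2] x1].
have := h2 x 0; rewrite !subr0 normr0 Ei0 subr0 mulmx1 => /(_ x2 r20) h.
have x0 := normr_ge0 x.
have ha : `|Ei x - x| <= `|x|.
  by apply: le_trans h _; rewrite ler_piMl// ge_min lexx.
have hb : `|Ei x - x| * (n%:R * `|M| + 1) <= e / 2 * `|x|.
  have h3 : `|Ei x - x| <= e / 2 / (n%:R * `|M| + 1) * `|x|.
    by apply: (le_trans h); rewrite ler_wpM2r// ge_min lexx orbT.
  apply: le_trans (ler_wpM2r (ltW c0) h3) _.
  by rewrite mulrAC divfK.
have Ex : `|Ei x| <= 2 * `|x|.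
  by have := ler_normD (Ei x - x) x; rewrite subrK; lra.
have [-> _ _ _] := EP x xr.
have := h1 (Ei x) ltac:(lra) => h3.
have -> : B *m AdM (psi (Ei x)) - B - x *m M =
    (B *m AdM (psi (Ei x)) - B - Ei x *m M) + (Ei x - x) *m M.
  by rewrite mulmxBl addrA subrK.
rewrite (le_trans (ler_normD _ _))//.
have := mulmx_norm_le (Ei x - x) M; rewrite mulrCA.
rewrite mulrDr mulr1 in hb; have := normr_ge0 (Ei x - x).
have : e / 4 * `|Ei x| <= e / 4 * (2 * `|x|) by rewrite ler_wpM2l// ltW.
lra.
Qed.

(** Linearity in the second argument, the vanishing of [bk Y Y] and compatibility with [Ad] are read
    off from this uniqueness. *)
Lemma bk_uniq Y B Z : (forall e, 0 < e -> exists2 d, 0 < d & forall h, 0 < h -> h < d ->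
    `|B *m AdM (expG (h *: Y)) - B - h *: Z| <= e * h) -> Z = bk Y B.
Proof.
move=> H; apply/eqP; rewrite -subr_eq0 -normr_le0; apply/ler_addgt0Pr => e e0; rewrite add0r.
have e2 := half_gt0 e0.
have [d d0 hd] := H _ e2.
have Y1 : 0 < `|Y| + 1 by rewrite ltr_wpDl.
have [r r0 hr] := bk_exp B (divr_gt0 e2 Y1).
pose h := Num.min (d / 2) (r / 2 / (`|Y| + 1)).
have h0 : 0 < h by rewrite lt_min !divr_gt0.
have hY : h * (`|Y| + 1) <= r / 2 by rewrite -ler_pdivlMr// ge_min lexx orbT.
have hd2 : h < d by rewrite gt_min; lra.
have := hd h h0 hd2; have := hr (h *: Y); rewrite normrZ (gtr0_norm h0).
rewrite mulrDr mulr1 in hY => /(_ ltac:(have := h0; lra)).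
rewrite /bk -scalemxAl -/(bk Y B).
have : e / 2 / (`|Y| + 1) * (h * `|Y|) <= e / 2 * h.
  by rewrite mulrCA [leRHS]mulrC ler_wpM2l ?div_succ_le ?(ltW h0)// ltW.
move=> h1 h2 h3.
have : `|h *: (Z - bk Y B)| <= e * h.
  have -> : h *: (Z - bk Y B) = (B *m AdM (expG (h *: Y)) - B - h *: bk Y B) -
      (B *m AdM (expG (h *: Y)) - B - h *: Z).
    by apply/rowP => i; rewrite !mxE; ring.
  rewrite (le_trans (ler_normB _ _)); lra.
by rewrite normrZ (gtr0_norm h0) mulrC ler_pM2r.
Qed.

Lemma bk_line Y B e : 0 < e -> exists2 d, 0 < d & forall h, `|h| < d ->
  `|B *m AdM (expG (h *: Y)) - B - h *: bk Y B| <= e * `|h|.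
Proof.
move=> e0; have Y1 : 0 < `|Y| + 1 by rewrite ltr_wpDl.
have [r r0 hr] := bk_exp B (divr_gt0 e0 Y1).
exists (r / (`|Y| + 1)); first by rewrite divr_gt0.
move=> h; rewrite ltr_pdivlMr// mulrDr mulr1 => hh.
have := hr (h *: Y); rewrite normrZ /bk -scalemxAl => H.
apply: le_trans (H _) _; first by have := normr_ge0 h; lra.
by rewrite mulrCA [leRHS]mulrC ler_wpM2l// div_succ_le// ltW.
Qed.

Lemma bkDl X Y B : bk (X + Y) B = bk X B + bk Y B.
Proof. exact: mulmxDl. Qed.

Lemma bkZl c Y B : bk (c *: Y) B = c *: bk Y B.
Proof. by rewrite scalemxAl. Qed.

Lemma bkDr Y A B : bk Y (A + B) = bk Y A + bk Y B.
Proof.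
apply/esym/bk_uniq => e e0; have e2 := half_gt0 e0.
have [r1 r10 h1] := bk_line Y A e2; have [r2 r20 h2] := bk_line Y B e2.
exists (Num.min r1 r2); first by rewrite lt_min r10.
move=> h h0; rewrite lt_min => /andP[hr1 hr2].
have := h1 h; have := h2 h; rewrite (gtr0_norm h0) => /(_ hr2) a /(_ hr1) b.
have -> : (A + B) *m AdM (expG (h *: Y)) - (A + B) - h *: (bk Y A + bk Y B) =
   (A *m AdM (expG (h *: Y)) - A - h *: bk Y A) + (B *m AdM (expG (h *: Y)) - B - h *: bk Y B).
  by rewrite mulmxDl scalerDr !opprD (addrACA (A *m _)) (addrACA (A *m _ - A)).
by apply: le_trans (ler_normD _ _) _; apply: le_trans (lerD b a) _; rewrite -mulrDl -splitr.
Qed.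

Lemma bkZr Y c B : bk Y (c *: B) = c *: bk Y B.
Proof.
apply/esym/bk_uniq => e e0; have c1 : 0 < `|c| + 1 by rewrite ltr_wpDl.
have [r r0 hr] := bk_line Y B (divr_gt0 e0 c1); exists r => // h h0 h1.
have := hr h; rewrite (gtr0_norm h0) => /(_ h1) H.
have -> : (c *: B) *m AdM (expG (h *: Y)) - c *: B - h *: (c *: bk Y B) =
    c *: (B *m AdM (expG (h *: Y)) - B - h *: bk Y B).
  by rewrite -scalemxAl !scalerBr !scalerA [h * c]mulrC.
rewrite normrZ; apply: le_trans (ler_wpM2l _ H) _ => //.
by rewrite mulrA ler_wpM2r ?(ltW h0)// mulrC div_succ_le// ltW.
Qed.

Lemma bkNr Y B : bk Y (- B) = - bk Y B.
Proof. by rewrite -scaleN1r bkZr scaleN1r. Qed.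

Lemma bkvv Y : bk Y Y = 0.
Proof.
apply/esym/bk_uniq => e e0; exists 1 => // h h0 _.
have -> : Y *m AdM (expG (h *: Y)) = Y.
  by apply/AdM_fix_commute => s; rewrite -!expG_add addrC.
by rewrite subrr scaler0 subrr normr0 mulr_ge0// ltW.
Qed.

Lemma bkC Y B : bk Y B = - bk B Y.
Proof.
have := bkvv (Y + B); rewrite bkDl !bkDr !bkvv add0r addr0 => h.
by apply/eqP; rewrite -addr_eq0 h.
Qed.

Lemma bk_inter Y Y' (N : 'M[R]_n) B : (forall h : R, N *m AdM (expG (h *: Y')) = AdM (expG (h *: Y)) *m N) ->
  bk Y' (B *m N) = bk Y B *m N.
Proof.
move=> cN; apply/esym/bk_uniq => e e0.
have c0 : 0 < n%:R * `|N| + 1 :> R by rewrite ltr_wpDl.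
have [r r0 hr] := bk_line Y B (divr_gt0 e0 c0); exists r => // h h0 h1.
have := hr h; rewrite (gtr0_norm h0) => /(_ h1).
rewrite -[B *m N *m _]mulmxA cN mulmxA; move: (B *m AdM (expG (h *: Y))) (bk Y B) => X Z H.
rewrite (scalemxAl h Z) -mulmxBl -mulmxBl; apply: le_trans (mulmx_norm_le _ _) _; rewrite mulrCA.
apply: le_trans (_ : e / (n%:R * `|N| + 1) * h * (n%:R * `|N|) <= _).
  by rewrite ler_wpM2r.
by rewrite mulrAC ler_wpM2r ?(ltW h0)// div_succ_le ?mulr_ge0// ltW.
Qed.

Lemma bk_Ad g Y B : bk (Y *m AdM g) (B *m AdM g) = bk Y B *m AdM g.
Proof.
by apply: bk_inter => h; rewrite scalemxAl -expG_conj !AdMM mulmxA AdM_V mul1mx.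
Qed.

Hypothesis cG : compact [set: G].

(** * An invariant inner product *)

Section InvariantProduct.
Local Notation V2 := 'rV[R]_(n * n).

Lemma AdM_coef_cts i j : continuous (fun g : G => AdM g i j).
Proof.
have -> : (fun g : G => AdM g i j) = (fun g : G => (delta_mx 0 i *m AdM g : V) 0 j).
  by apply/funext => g; rewrite -rowE [in RHS]mxE.
move=> g; exact: (cvg_comp _ _ (@AdM_cts (delta_mx 0 i) g) (@coord_continuous R 1 n 0 j _)).
Qed.

Lemma AdM_bound : exists2 b, 0 <= b & forall (g : G) , `|AdM g| <= b.
Proof.
have h i j : exists c : R, forall g : G, `|AdM g i j| <= c.
  have [|c hc] := @evt_max_all R G (fun g : G => `|AdM g i j|) 1%g cG.
    move=> g; exact: (cvg_comp _ _ (@AdM_coef_cts i j g) (@norm_continuous _ R^o _)).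
  by exists `|AdM c i j|.
pose c i j := sval (cid (h i j)).
have cP i j g : `|AdM g i j| <= c i j := svalP (cid (h i j)) g.
exists (\sum_i \sum_j c i j).
  by apply: sumr_ge0 => i _; apply: sumr_ge0 => j _; apply: le_trans (cP i j 1%g).
have c0 i j : 0 <= c i j by apply: le_trans (cP i j 1%g).
move=> g; apply: mx_norm_le => [|i j].
  by apply: sumr_ge0 => i _; apply: sumr_ge0 => j _.
apply: le_trans (cP i j g) _; rewrite (bigD1 i)//= (bigD1 j)//= -addrA lerDl addr_ge0//.
  by apply: sumr_ge0.
by apply: sumr_ge0 => k _; apply: sumr_ge0.
Qed.

Let qf (q : 'M[R]_n) (v : V) : R := (v *m q *m v^T) 0 0.

Lemma sqnormE (v : V) : sqnorm v = (v *m v^T) 0 0.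
Proof. by rewrite mxE; apply: eq_bigr => i _; rewrite mxE. Qed.

Lemma mxvec_norm (M : 'M[R]_n) : `|mxvec M| <= `|M|.
Proof.
apply: mx_norm_le => // i j; rewrite ord1; case/mxvec_indexP: j => k l.
by rewrite mxvecE mx_norm_ge.
Qed.

Lemma vec_mx_norm (x : V2) : `|vec_mx x : 'M[R]_n| <= `|x|.
Proof. by apply: mx_norm_le => // i j; rewrite mxE mx_norm_ge. Qed.

Let act (g : G) (x : V2) : V2 := mxvec (AdM g *m vec_mx x *m (AdM g)^T).

(** No integration over the group: the symmetric forms bounded below by [c], the minimum of the
    Euclidean square along each orbit, form a closed, convex and invariant set containing the
    Euclidean form, so it has a fixed point. The bound [c] keeps that form positive definite. *)
Lemma invariant_form : exists Q : 'M[R]_n, [/\ Q^T = Q,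
  forall v, v != 0 -> 0 < qf Q v & forall g, AdM g *m Q *m (AdM g)^T = Q].
Proof.
have [b b0 hb] := AdM_bound.
have e_cts v : continuous (fun g : G => - sqnorm (v *m AdM g)).
  move=> g; apply: (@cvgN R R^o).
  exact: (cvg_comp _ _ (@AdM_cts v g) (@sqnorm_cts R n _)).
pose c (v : V) := let g := sval (cid (evt_max_all 1%g cG (e_cts v))) in sqnorm (v *m AdM g).
have cP v g : c v <= sqnorm (v *m AdM g).
  by have := svalP (cid (evt_max_all 1%g cG (e_cts v))) g; rewrite lerN2.
have c0 v : v != 0 -> 0 < c v.
  move=> v0; rewrite lt_neqAle sqnorm_ge0 andbT eq_sym; apply: contra v0 => /eqP h.
  have /sqnorm_eq0/(congr1 (mulmxr (AdM (sval (cid (evt_max_all 1%g cG (e_cts v))))^-1%g))) :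
    sqnorm (v *m AdM (sval (cid (evt_max_all 1%g cG (e_cts v))))) <= 0 by rewrite -/(c v) h.
  by rewrite /= AdM_VK mul0mx => ->.
pose C : set V2 := [set x | (vec_mx x)^T = vec_mx x :> 'M[R]_n /\
   forall v, c v <= qf (vec_mx x) v].
have coefc i : continuous (fun x : V2 => x 0 i) by exact: coord_continuous.
have vE (x : V2) i j : (vec_mx x : 'M[R]_n) i j = x 0 (mxvec_index i j) by rewrite mxE.
have qf_cts v : continuous (fun x : V2 => qf (vec_mx x) v).
  have -> : (fun x : V2 => qf (vec_mx x) v) =
    (fun x => \sum_j \sum_i x 0 (mxvec_index i j) * (v 0 i * v 0 j)).
    apply/funext => x; rewrite /qf mxE; apply: eq_bigr => j _.
    rewrite !mxE mulr_suml; apply: eq_bigr => i _; rewrite vE; ring.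
  move=> x; apply: cvg_sum_real => j; apply: cvg_sum_real => i.
  apply: (@cvgM R _ (nbhs x) _ (fun x1 : V2 => x1 0 (mxvec_index i j))
    (fun=> v 0 i * v 0 j)); [exact: (coefc (mxvec_index i j) x)|exact: cvg_cst].
have [x [xs xc] xT] : exists2 x, C x & forall g, act g x = x.
  apply: (@invariant_vector R G _ act cG _ _ _ _ _ _ (n%:R * b * (n%:R * b))) => //.
  - by move=> g x y; rewrite /act linearD/= mulmxDr mulmxDl linearD.
  - by move=> g a x; rewrite /act linearZ/= -scalemxAr -scalemxAl linearZ.
  - by move=> g h; exists (h * g)%g => x; rewrite /act mxvecK AdMM trmx_mul !mulmxA.
  - by move=> x; rewrite /act AdM1 trmx1 mul1mx mulmx1 vec_mxK.
  - move=> g x /(congr1 vec_mx); rewrite mxvecK linear0.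
    move=> /(congr1 (fun y => AdM (g^-1)%g *m y *m (AdM (g^-1)%g)^T)).
    rewrite mulmx0 mul0mx !mulmxA -AdMM mulgV AdM1 mul1mx -!mulmxA -trmx_mul -AdMM.
    by rewrite mulgV AdM1 trmx1 mulmx1 => /(congr1 mxvec); rewrite vec_mxK linear0.
  - move=> x g; apply: cvg_coord => k; case/mxvec_indexP: k => i j.
    have -> : (fun h : G => act h x 0 (mxvec_index i j)) = (fun h : G =>
        \sum_k \sum_l AdM h i l * (vec_mx x : 'M[R]_n) l k * AdM h j k).
      apply/funext => h; rewrite mxvecE mxE; apply: eq_bigr => k _.
      by rewrite !mxE mulr_suml.
    apply: cvg_sum_real => k; apply: cvg_sum_real => l.
    apply: (@cvgM R _ (nbhs g) _ (fun h => AdM h i l * (vec_mx x : 'M[R]_n) l k) (fun h => AdM h j k)).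
      apply: (@cvgM R _ (nbhs g) _ (fun h => AdM h i l) (fun=> (vec_mx x : 'M[R]_n) l k)).
        exact: AdM_coef_cts.
      exact: cvg_cst.
    exact: AdM_coef_cts.
  - by rewrite !mulr_ge0.
  - move=> g x; apply: le_trans (mxvec_norm _) _.
    apply: le_trans (mulmx_norm_le _ _) _.
    have h1 := mulmx_norm_le (AdM g) (vec_mx x); have h2 := vec_mx_norm x.
    have h3 := hb g; have h4 : `|(AdM g)^T| <= b.
      by apply: mx_norm_le => // i j; rewrite mxE; apply: le_trans (mx_norm_ge _ _ _) h3.
    have -> : n%:R * b * (n%:R * b) * `|x| = n%:R * (n%:R * (b * `|x|) * b) by ring.
    rewrite ler_wpM2l// ler_pM//.
    by apply: (le_trans h1); rewrite ler_wpM2l// ler_pM.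
  - have -> : C = (\bigcap_(p in [set: 'I_n * 'I_n])
        [set x : V2 | x 0 (mxvec_index p.1 p.2) - x 0 (mxvec_index p.2 p.1) = 0]) `&`
        \bigcap_(v in [set: V]) [set x : V2 | c v <= qf (vec_mx x) v].
      apply/seteqP; split=> x [h1 h2]; split => //.
      - by move=> [i j] _ /=; apply/eqP; rewrite subr_eq0 -!vE -{1}h1 mxE.
      - by move=> v _; exact: h2.
      - by apply/matrixP => i j; rewrite mxE !vE; apply/eqP; rewrite -subr_eq0; apply/eqP/(h1 (j, i)).
      - by move=> v; exact: (h2 v I).
    apply: closedI; apply: closed_bigI => p _.
      apply: (@closed_comp _ _ (fun x : V2 => x 0 (mxvec_index p.1 p.2) - x 0 (mxvec_index p.2 p.1))
        [set 0]); last exact: closed_eq.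
      by move=> x _; exact: (@cvgB R R^o _ (nbhs x) _ _ _ _ _ (coefc (mxvec_index p.1 p.2) x) (coefc (mxvec_index p.2 p.1) x)).
    apply: (@closed_comp _ _ (fun x : V2 => qf (vec_mx x) p) [set y | c p <= y]).
      by move=> x _.
    exact: closed_ge.
  - exists (mxvec 1%:M); split; first by rewrite mxvecK trmx1.
    move=> v; rewrite mxvecK.
    by rewrite /qf mulmx1 -sqnormE; have := cP v 1%g; rewrite AdM1 mulmx1.
  - move=> x y [x1 x2] [y1 y2]; split; first by rewrite linearZ linearD/= linearZ linearD/= x1 y1.
    move=> v; have := x2 v; have := y2 v; rewrite /qf linearZ linearD/=.
    rewrite -scalemxAr -scalemxAl mulmxDr mulmxDl [X in _ -> _ -> _ <= X]mxE [X in _ -> _ -> _ <= _ * X]mxE.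
    by rewrite mulrC; lra.
  - move=> g x [x1 x2]; split; first by rewrite mxvecK !trmx_mul trmxK x1 mulmxA.
    move=> v; rewrite mxvecK.
    have -> : qf (AdM g *m vec_mx x *m (AdM g)^T) v = qf (vec_mx x) (v *m AdM g).
      by rewrite /qf trmx_mul !mulmxA.
    apply: le_trans (x2 _); rewrite {2}/c; set k := sval _.
    by rewrite -mulmxA -AdMM.
exists (vec_mx x); split=> //.
  by move=> v /c0 h; apply: lt_le_trans h (xc v).
by move=> g; rewrite -[in RHS](xT g) mxvecK.
Qed.
End InvariantProduct.

(** * One-parameter orbits, Lie algebras of subgroups and Hunt's lemma *)

Section Hunt.
Lemma lin_small_eq0 (S A B : R) : 0 <= A -> 0 <= B ->
  (forall e, 0 < e -> exists2 d, 0 < d & forall h, 0 < h -> h < d -> h * `|S| <= A * e * h + B * h ^+ 2) ->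
  S = 0.
Proof.
move=> A0 B0 H; apply/eqP; rewrite -normr_le0; apply/ler_addgt0Pr => e e0; rewrite add0r.
have A1 : 0 < A + 1 by rewrite ltr_wpDl.
have B1 : 0 < B + 1 by rewrite ltr_wpDl.
have e2 := half_gt0 e0.
have [d d0 hd] := H (e / 2 / (A + 1)) (divr_gt0 e2 A1).
pose h := Num.min (d / 2) (e / 2 / (B + 1)).
have h0 : 0 < h by rewrite lt_min !divr_gt0.
have hd2 : h < d by rewrite gt_min; lra.
have := hd h h0 hd2; have -> : B * h ^+ 2 = B * h * h by ring.
rewrite -mulrDl [h * _]mulrC ler_pM2r// => h1.
have : A * (e / 2 / (A + 1)) <= e / 2 by rewrite mulrC div_succ_le// ltW.
have : B * h <= e / 2.
  apply: le_trans (_ : B * (e / 2 / (B + 1)) <= _); last by rewrite mulrC div_succ_le// ltW.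
  by rewrite ler_wpM2l// ge_min lexx orbT.
lra.
Qed.

Lemma bk_fix0 Y B : (forall s, B *m AdM (expG (s *: Y)) = B) -> bk Y B = 0.
Proof.
move=> h; apply/esym/bk_uniq => e e0; exists 1 => // s s0 _.
by rewrite h subrr scaler0 subrr normr0 mulr_ge0// ltW.
Qed.

(** Uniqueness for the linear equation of the orbit. The interval is cut into [N] steps and
    everything is moved back to time [0]; each step contributes an error proportional to [e] and to
    its length, since the matrices [AdM] are uniformly bounded. *)
Lemma exp_curve Y (c : R -> V) :
  (forall e, 0 < e -> exists2 d, 0 < d & forall h s, `|h| < d ->
     `|c s *m AdM (expG (h *: Y)) - c (s + h)| <= e * `|h|) ->
  forall s, c 0 *m AdM (expG (s *: Y)) = c s.
Proof.
move=> H s; have [b b0 hb] := AdM_bound.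
apply/eqP; rewrite -subr_eq0 -normr_le0; apply/ler_addgt0Pr => e e0; rewrite add0r.
pose K := n%:R * b * (n%:R * b) * `|s|; have K0 : 0 <= K by rewrite !mulr_ge0.
have K1 : 0 < K + 1 by rewrite ltr_wpDl.
have [d d0 hd] := H (e / (K + 1)) (divr_gt0 e0 K1).
pose N := (Num.truncn (`|s| / d)).+1; have N0 : (0 : R) < N%:R by rewrite ltr0n.
pose h := s / N%:R.
have hd2 : `|h| < d.
  rewrite normrM normfV (ger0_norm (ltW N0)) ltr_pdivrMr// mulrC -ltr_pdivrMr//.
  by have /andP[] := truncn_itv (divr_ge0 (normr_ge0 s) (ltW d0)).
have bx (x : V) g : `|x *m AdM g| <= n%:R * b * `|x|.
  apply: le_trans (mulmx_norm_le _ _) _; rewrite -mulrA ler_wpM2l// mulrC ler_wpM2r//.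
have comp (x : V) (t u : R) : x *m AdM (expG (t *: Y)) *m AdM (expG (u *: Y)) = x *m AdM (expG ((t + u) *: Y)).
  by rewrite -mulmxA -AdMM addrC expG_add.
have step k : `|c (k%:R * h) *m AdM (expG ((- (k%:R * h)) *: Y)) - c 0| <=
    k%:R * (n%:R * b * (e / (K + 1) * `|h|)).
  elim: k => [|k IH].
    by rewrite !mul0r oppr0 scale0r expG0 AdM1 mulmx1 subrr normr0.
  set a := k%:R * h in IH *; have -> : k.+1%:R * h = a + h by rewrite -natr1 mulrDl mul1r.
  have -> : c (a + h) *m AdM (expG (- (a + h) *: Y)) - c 0 =
      - ((c a *m AdM (expG (h *: Y)) - c (a + h)) *m AdM (expG (- (a + h) *: Y))) +
      (c a *m AdM (expG (- a *: Y)) - c 0).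
    rewrite mulmxBl comp (_ : h + - (a + h) = - a); last by rewrite opprD addrCA subrr addr0.
    by rewrite opprB addrA subrK.
  rewrite (le_trans (ler_normD _ _))// normrN -natr1 mulrDl mul1r addrC lerD//.
  apply: le_trans (bx _ _) _; rewrite ler_wpM2l ?mulr_ge0//; exact: hd.
have := step N; rewrite mulrC divfK ?gt_eqF// => h1.
have -> : c 0 *m AdM (expG (s *: Y)) - c s = - ((c s *m AdM (expG (- s *: Y)) - c 0) *m AdM (expG (s *: Y))).
  by rewrite mulmxBl comp addNr scale0r expG0 AdM1 mulmx1 opprB.
rewrite normrN; apply: le_trans (bx _ _) _.
apply: le_trans (ler_wpM2l _ h1) _; first by rewrite mulr_ge0.
have -> : n%:R * b * (N%:R * (n%:R * b * (e / (K + 1) * `|h|))) = e / (K + 1) * K.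
  rewrite normrM normfV (ger0_norm (ltW N0)) {3}/K; field.
  by rewrite gt_eqF// gt_eqF.
by rewrite div_succ_le// ltW.
Qed.

Lemma bk0_fix Y B : bk Y B = 0 -> forall s, B *m AdM (expG (s *: Y)) = B.
Proof.
move=> h; apply: (exp_curve (c := fun=> B)) => e e0.
have [d d0 hd] := bk_line Y B e0; exists d => // x _ xd.
by have := hd x xd; rewrite h scaler0 subr0.
Qed.

(** The bracket with [Y] generates a rotation of speed [c] in [p] and [q]. By [exp_curve] it is
    enough that the rotating curve obeys the equation to first order, uniformly in time. *)
Lemma exp_rotation Y p q c : bk Y p = c *: q -> bk Y q = - c *: p ->
  forall s, p *m AdM (expG (s *: Y)) = cos (c * s) *: p + sin (c * s) *: q.
Proof.
move=> bp bq s.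
have := @exp_curve Y (fun s => cos (c * s) *: p + sin (c * s) *: q).
rewrite /= mulr0 cos0 sin0 scale1r scale0r addr0; apply => e e0.
pose D := `|p| + `|q| + 1; have D0 : 0 < D by rewrite ltr_wpDl.
pose C := `|c| + 1; have C0 : 0 < C by rewrite ltr_wpDl.
have e2 : 0 < e / 8 by rewrite divr_gt0.
pose e1 := e / 8 / D / C; have e10 : 0 < e1 by rewrite !divr_gt0.
have [d1 d10 h1] := bk_line Y p e2; have [d2 d20 h2] := bk_line Y q e2.
have [d3 d30 h3] := @trig_small R e1 e10.
exists (Num.min (Num.min d1 d2) (d3 / C)); first by rewrite !lt_min d10 d20 divr_gt0.
move=> h t; rewrite !lt_min => /andP[/andP[hd1 hd2]]; rewrite ltr_pdivlMr// => hd3.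
have ch : `|c * h| <= C * `|h| by rewrite normrM ler_wpM2r// lerDl.
have [c3 s3] := h3 (c * h) ltac:(by apply: le_lt_trans hd3; rewrite [leRHS]mulrC).
have a1 := h1 h hd1; have a2 := h2 h hd2; rewrite bp bq in a1 a2.
set P := p *m AdM (expG (h *: Y)) in a1 *; set P' := q *m AdM (expG (h *: Y)) in a2 *.
rewrite mulmxDl -!scalemxAl -/P -/P' mulrDr cosD sinD.
have -> : cos (c * t) *: P + sin (c * t) *: P' -
  ((cos (c * t) * cos (c * h) - sin (c * t) * sin (c * h)) *: p +
   (sin (c * t) * cos (c * h) + cos (c * t) * sin (c * h)) *: q) =
  cos (c * t) *: (P - p - h *: (c *: q)) + sin (c * t) *: (P' - q - h *: (- c *: p)) -
  ((cos (c * h) - 1) * cos (c * t) - (sin (c * h) - c * h) * sin (c * t)) *: p -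
  ((cos (c * h) - 1) * sin (c * t) + (sin (c * h) - c * h) * cos (c * t)) *: q.
  clear a1 a2; move: (cos (c * t)) (sin (c * t)) (cos (c * h)) (sin (c * h)) => x y z w.
  by clearbody P P'; apply/rowP => i; rewrite !mxE; ring.
have lc (x : R) : `|cos x| <= 1 by rewrite ler_norml cos_geN1 cos_le1.
have ls (x : R) : `|sin x| <= 1 by rewrite ler_norml sin_geN1 sin_le1.
have e1h : e1 * `|c * h| * D <= e / 8 * `|h|.
  apply: le_trans (_ : e1 * (C * `|h|) * D <= _); first by rewrite ler_pM2r// ler_pM2l.
  rewrite /e1 le_eqVlt; apply/orP; left; apply/eqP; field; by rewrite !gt_eqF.
have m (x : V) (a b u v : R) : `|x| <= D -> `|u| <= 1 -> `|v| <= 1 ->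
    `|a| <= e1 * `|c * h| -> `|b| <= e1 * `|c * h| -> `|(a * u + b * v) *: x| <= e / 8 * `|h| *+ 2.
  move=> xD u1 v1 ha hb; rewrite normrZ.
  apply: le_trans (_ : (e1 * `|c * h|) *+ 2 * D <= _); last by rewrite mulrnAl lerMn2r.
  rewrite ler_pM// (le_trans (ler_normD _ _))// (normrM a) (normrM b) lerD//.
    by rewrite (le_trans (ler_wpM2l _ u1))// mulr1.
  by rewrite (le_trans (ler_wpM2l _ v1))// mulr1.
have pD : `|p| <= D by rewrite /D -addrA lerDl.
have qD : `|q| <= D by rewrite /D addrAC lerDr.
have m1 := m p (cos (c * h) - 1) (- (sin (c * h) - c * h)) (cos (c * t)) (sin (c * t)) pD (lc _) (ls _) c3.
rewrite normrN mulNr in m1; have {}m1 := m1 s3.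
have m2 := m q (cos (c * h) - 1) (sin (c * h) - c * h) (sin (c * t)) (cos (c * t)) qD (ls _) (lc _) c3 s3.
have m3 : `|cos (c * t) *: (P - p - h *: (c *: q))| <= e / 8 * `|h|.
  by rewrite normrZ (le_trans (ler_wpM2r _ (lc _)))// mul1r.
have m4 : `|sin (c * t) *: (P' - q - h *: (- c *: p))| <= e / 8 * `|h|.
  by rewrite normrZ (le_trans (ler_wpM2r _ (ls _)))// mul1r.
move: m1 m2 m3 m4; set x1 := _ *: p; set x2 := _ *: q; set x3 := _ *: (P - _ - _); set x4 := _ *: (P' - _ - _).
clear -e0; move=> m1 m2 m3 m4.
apply: le_trans (ler_normB _ _) _; apply: le_trans (lerD (le_trans (ler_normB _ _) (lerD (ler_normD _ _) (lexx _))) (lexx _)) _.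
have : 0 <= e * `|h| by rewrite mulr_ge0// ltW.
move: m1 m2; lra.
Qed.

Variable Q : 'M[R]_n.
Hypothesis Qs : Q^T = Q.
Local Notation ip := (ip Q).
Hypothesis Qp : forall v, v != 0 -> 0 < ip v v.
Hypothesis Qi : forall g, AdM g *m Q *m (AdM g)^T = Q.

Lemma ip_Ad g u v : ip (u *m AdM g) (v *m AdM g) = ip u v.
Proof. by rewrite /ip trmx_mul mulmxA -(mulmxA u) -(mulmxA u) Qi. Qed.

Lemma ip_bk Y u v : ip (bk Y u) v = - ip u (bk Y v).
Proof.
apply/eqP; rewrite -addr_eq0; apply/eqP.
have [K K0 hK] := ip_bound Q.
set p := bk Y u; set q := bk Y v.
apply: (@lin_small_eq0 _ (K * (`|u| + `|v|)) (K * ((`|p| + 1) * (`|q| + 1)))).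
- by rewrite mulr_ge0.
- by rewrite mulr_ge0.
move=> e e0; pose e1 := Num.min e 1; have e10 : 0 < e1 by rewrite lt_min e0 ltr01.
have [d1 d10 h1] := bk_line Y u e10; have [d2 d20 h2] := bk_line Y v e10.
exists (Num.min d1 d2); first by rewrite lt_min d10.
move=> h h0; rewrite lt_min => /andP[hd1 hd2].
have := h1 h; have := h2 h; rewrite (gtr0_norm h0) => /(_ hd2) b /(_ hd1) a.
have hV : 0 < h^-1 by rewrite invr_gt0.
have nV (D : V) : `|D| <= e1 * h -> `|h^-1 *: D| <= e1.
  by move=> HD; rewrite normrZ (gtr0_norm hV) mulrC ler_pdivrMr.
have := ip_Ad (expG (h *: Y)) u v.
have dec w : `|w *m AdM (expG (h *: Y)) - w - h *: bk Y w| <= e1 * h ->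
    exists2 c : V, w *m AdM (expG (h *: Y)) = w + h *: (bk Y w + c) & `|c| <= e1.
  move=> D; exists (h^-1 *: (w *m AdM (expG (h *: Y)) - w - h *: bk Y w)); last exact: nV.
  by rewrite scalerDr scalerA mulfV ?scale1r ?gt_eqF//; exact: sub_split3.
have [a' -> ab] := dec u a; have [b' -> bb] := dec v b.
rewrite ipDl !ipDr !ipZl !ipZr ipDl ipDr => H.
have E : ip p v + ip u q = - ip a' v - ip u b' - h * ip (p + a') (q + b').
  have h0' : h != 0 by rewrite gt_eqF.
  apply: (mulfI h0'); move: H; move: (ip (p + a') (q + b')) => Z H.
  clear -H; lra.
have ee : e1 <= e by rewrite ge_min lexx.
have e11 : e1 <= 1 by rewrite ge_min lexx orbT.
have n1 : `|ip a' v| <= K * (`|v| * e).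
  by apply: le_trans (hK _ _) _; rewrite ler_wpM2l// mulrC ler_wpM2l// (le_trans ab).
have n2 : `|ip u b'| <= K * (`|u| * e).
  by apply: le_trans (hK _ _) _; rewrite ler_wpM2l// ler_wpM2l// (le_trans bb).
have n3 : `|ip (p + a') (q + b')| <= K * ((`|p| + 1) * (`|q| + 1)).
  apply: le_trans (hK _ _) _; rewrite ler_wpM2l// ler_pM//.
    by rewrite (le_trans (ler_normD _ _))// lerD2l (le_trans ab).
  by rewrite (le_trans (ler_normD _ _))// lerD2l (le_trans bb).
have : `|ip p v + ip u q| <= `|ip a' v| + `|ip u b'| + h * `|ip (p + a') (q + b')|.
  rewrite E (le_trans (ler_normB _ _))// normrM (gtr0_norm h0) lerD2r.
  by rewrite (le_trans (ler_normB _ _))// normrN.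
have : h * `|ip (p + a') (q + b')| <= h * (K * ((`|p| + 1) * (`|q| + 1))).
  by rewrite ler_wpM2l// ltW.
move: n1 n2 => n1 n2 n4 n5.
have -> : K * (`|u| + `|v|) * e * h + K * ((`|p| + 1) * (`|q| + 1)) * h ^+ 2 =
  h * (K * (`|v| * e) + K * (`|u| * e) + h * (K * ((`|p| + 1) * (`|q| + 1)))) by ring.
rewrite ler_pM2l//; move: (K * (_ * e)) (K * (_ * e)) n1 n2 n4 n5 => X1 X2; clear -K0; lra.
Qed.

(** The Lie algebra of a closed subgroup, through its one-parameter groups; sums stay inside by the
    product formula. *)
Definition LieS (H : set G) (Y : V) := forall s, H (expG (s *: Y)).

Lemma closed_seq (T : topologicalType) (H : set T) (f : nat -> T) l : closed H ->
  (forall k, H (f k)) -> f @ \oo --> l -> H l.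
Proof. by move=> cH hf fl; apply: (@closed_cvg _ _ _ _ f H cH _ _ fl); exists 0%N => // k _. Qed.

Lemma LieS_subspace H : is_subgroup H -> closed H -> is_subspace (LieS H).
Proof.
move=> [H1 HM HV] cH; split.
- by move=> s; rewrite scaler0 expG0.
- move=> u v hu hv s; rewrite scalerDr.
  apply: (closed_seq cH _ (@trotter (s *: u) (s *: v))) => k.
  have hX x m : H x -> H (x ^+ m)%g.
    by move=> hx; elim: m => [|m IH]; [rewrite expg0|rewrite expgS; exact: HM].
  by apply: hX; apply: HM; rewrite scalerA.
- by move=> c u hu s; rewrite scalerA.
Qed.

Lemma LieS_lim H (w : nat -> V) v : closed H -> (forall k, LieS H (w k)) -> tends w v -> LieS H v.
Proof.
move=> cH hw /tendsP wv s.
have h : expG (s *: w k) @[k --> \oo] --> expG (s *: v).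
  have h1 : s *: w k @[k --> \oo] --> s *: v by apply: cvgZr.
  by apply: (cvg_comp _ _ h1); exact: expG_cts.
by apply: (closed_seq cH _ h) => k; exact: hw.
Qed.

Lemma LieS_Ad H g Y : is_subgroup H -> H g -> LieS H Y -> LieS H (Y *m AdM g).
Proof.
move=> [H1 HM HV] Hg HY s; rewrite scalemxAl -expG_conj.
by apply: (HM); [apply: (HM)|exact: (HV)].
Qed.

Lemma bk_tends Y B : tends (fun k => 2 ^+ k *: (B *m AdM (expG (2 ^- k *: Y)) - B)) (bk Y B).
Proof.
move=> e e0; have [d d0 hd] := bk_line Y B e0.
have h01 := half01.
have [K hK] := geometric_small h01 ler01 d0; exists K => k /hK; rewrite mul1r exprVn => kd.
have k0 := pow2_gt0 k.
have kn : `|2 ^- k| = 2 ^- k :> R by rewrite gtr0_norm.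
have := hd (2 ^- k); rewrite kn => /(_ kd) h.
have -> : 2 ^+ k *: (B *m AdM (expG (2 ^- k *: Y)) - B) - bk Y B =
    2 ^+ k *: (B *m AdM (expG (2 ^- k *: Y)) - B - 2 ^- k *: bk Y B).
  by rewrite [in RHS]scalerBr scalerA mulfV ?scale1r.
by rewrite normrZ gtr0_norm// mulrC -ler_pdivlMr.
Qed.

Lemma LieS_bk H X Y : is_subgroup H -> closed H -> LieS H X -> LieS H Y -> LieS H (bk X Y).
Proof.
move=> sH cH HX HY; apply: (LieS_lim cH _ (@bk_tends X Y)) => k.
have sp := LieS_subspace sH cH; have [_ _ PZ] := sp; apply: (PZ).
apply: (subspaceB sp) => //; apply: LieS_Ad => //.
Qed.

(* Hunt's argument: [m] maximises [<Ad m A, X>] on the compact group [H]. *)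
Lemma hunt H A X : is_subgroup H -> closed H ->
  exists2 m, H m & forall Y, LieS H Y -> ip (bk Y (A *m AdM m)) X = 0.
Proof.
move=> sH cH; have [H1 HM HV] := sH.
have cpH : compact H by apply: subclosed_compact cH cG _.
pose f g := ip (A *m AdM g) X.
have fc : continuous f.
  move=> g; apply: (@continuous_comp G V R (fun g => A *m AdM g) (fun x : V => ip x X)).
    exact: AdM_cts.
  have [K K0 hK] := ip_bound Q.
  apply: (@ball_lipschitz_continuous R _ R^o _ (K * `|X|) 1) => // x _.
  by rewrite -mulrA (mulrC `|X|) -ipNl -ipDl.
have [||m /set_mem Hm max] := @compact_EVT_max G R f H _ cpH.
- by exists 1%g.
- exact: continuous_subspaceT.
exists m => // Y HY; set A' := A *m AdM m; set S := ip _ _.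
have [K K0 hK] := ip_bound Q.
apply: (@lin_small_eq0 _ (K * `|X|) 0) => //; first by rewrite mulr_ge0.
move=> e e0; have [d d0 hd] := bk_line Y A' e0; exists d => // h h0 hd1.
rewrite mul0r addr0.
have up (k : R) : `|k| < d -> k * S <= K * `|X| * e * `|k|.
  move=> kd; have := hd k kd.
  have : f (expG (k *: Y) * m)%g <= f m by apply: max; rewrite inE; apply: HM.
  rewrite /f AdMM mulmxA -/A' => h1 h2.
  set D := A' *m AdM (expG (k *: Y)) - A' - k *: bk Y A' in h2.
  have E : A' *m AdM (expG (k *: Y)) = A' + k *: bk Y A' + D.
    by rewrite -addrA; exact: sub_split3.
  clearbody D; rewrite E !ipDl ipZl -/S in h1; clear E.
  have := hK D X; rewrite ler_norml => /andP[h3 _].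
  have : K * (`|D| * `|X|) <= K * `|X| * e * `|k|.
    by rewrite -!mulrA ler_wpM2l// mulrC ler_wpM2l.
  lra.
have u1 := up h; have u2 := up (- h); rewrite normrN gtr0_norm// in u1 u2.
have {}u1 := u1 hd1; have {}u2 := u2 hd1.
by have [S0|S0] := lerP 0 S; [rewrite ger0_norm|rewrite ltr0_norm]; lra.
Qed.

(** With [Y] the bracket of [X] and the moved vector, invariance of the product turns the critical
    point condition of [hunt] into the vanishing of minus the square length of that bracket. *)
Lemma hunt_commute H A X : is_subgroup H -> closed H -> LieS H A -> LieS H X ->
  exists2 m, H m & bk X (A *m AdM m) = 0.
Proof.
move=> sH cH HA HX; have [m Hm h] := hunt A X sH cH; exists m => //.
set A' := A *m AdM m in h *.
have HA' : LieS H A' by exact: LieS_Ad.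
have HZ : LieS H (bk X A') by exact: LieS_bk.
apply: (ip_eq0 Qp); have := h _ HZ.
rewrite bkC ipNl ip_bk opprK (bkC A') ipNr => /eqP.
by rewrite oppr_eq0 => /eqP.
Qed.
End Hunt.

Lemma half_pow_small (d : R) : 0 < d -> exists m, forall k, (m <= k)%N -> 2 ^- k < d.
Proof.
move=> d0; have h01 := half01.
by have [m h] := geometric_small h01 ler01 d0; exists m => k /h; rewrite mul1r exprVn.
Qed.

(** Within the ball where [expG] is injective, square roots are unique, so the values at [2^-k] are
    exponentials of successive halves of one vector. Dyadic times and then all times follow by
    continuity. *)
Lemma one_param_exp (p : R -> G) : continuous p -> (forall s t, p (s + t) = (p s * p t)%g) ->
  exists v, forall s, p s = expG (s *: v).
Proof.
move=> cp pD.
have p0 : p 0 = 1%g by apply: (@mulgI _ (p 0)); rewrite -pD addr0 mulg1.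
have pN s : p (- s) = (p s)^-1%g by apply: (@mulgI _ (p s)); rewrite -pD subrr mulgV.
have pX s m : p (s *+ m) = (p s ^+ m)%g.
  by elim: m => [|m IH]; rewrite ?expg0// mulrS pD IH expgS.
have [r r0 inj] := exp_inj.
have r2 := half_gt0 r0.
have nb : nbhs (p 0) [set x | exists2 v, `|v| < r / 2 & expG v = x].
  by rewrite p0; exact: exp_near1.
have /nbhs_ballP[d /= d0 hd] := cp 0 _ nb.
have [m hm] := half_pow_small d0.
have ball0 k : (m <= k)%N -> exists2 v, `|v| < r / 2 & expG v = p (2 ^- k).
  move=> mk; apply: (hd (2 ^- k)); rewrite -ball_normE /= sub0r normrN.
  by rewrite ger0_norm ?exprn_ge0//; exact: hm.
have [u0 u0r u0E] := ball0 m (leqnn _).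
have dy j : expG (2 ^- j *: u0) = p (2 ^- (m + j)) /\ `|2 ^- j *: u0| < r / 2.
  elim: j => [|j [IH1 IH2]]; first by rewrite addn0 invr1 scale1r.
  have [u ur uE] := ball0 (m + j.+1)%N (leq_addr _ _).
  suff -> : 2 ^- j.+1 *: u0 = u by [].
  have E : u *+ 2 = 2 ^- j *: u0.
    apply: inj; rewrite ?(lt_trans IH2)//; first by rewrite normrMn; lra.
      by lra.
    rewrite expG_nat uE IH1 -pX addnS exprS invfM -mulrnAl -[2^-1 *+ 2]mulr_natr.
    by rewrite mulVf// mul1r.
  by rewrite exprS invfM -scalerA -E -(scaler_nat 2 u) scalerA mulVf// scale1r.
exists (2 ^+ m *: u0) => s; set v := 2 ^+ m *: u0.
have dyv k : (m <= k)%N -> expG (2 ^- k *: v) = p (2 ^- k).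
  move=> mk; have [+ _] := dy (k - m)%N; rewrite subnKC// => <-.
  by rewrite scalerA -{1}(subnK mk) exprD invfM -mulrA mulVf ?mulr1.
have pos (t : R) : 0 <= t -> p t = expG (t *: v).
  move=> t0; have ct := trunc_half t0.
  have h1 : p ((Num.truncn (2 ^+ k * t))%:R / 2 ^+ k) @[k --> \oo] --> p t.
    by apply: (cvg_comp _ _ ct); exact: cp.
  have h2 : expG (((Num.truncn (2 ^+ k * t))%:R / 2 ^+ k) *: v) @[k --> \oo] --> expG (t *: v).
    have h3 : ((Num.truncn (2 ^+ k * t))%:R / 2 ^+ k) *: v @[k --> \oo] --> t *: v by apply: cvgZl.
    by apply: (cvg_comp _ _ h3); exact: expG_cts.
  apply: (cvg_lieg h1); apply: cvg_trans h2; apply: near_eq_cvg; exists m => // k /= mk.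
  rewrite mulr_natl pX -dyv// -expG_nat; congr (expG _).
  by rewrite scalerMnl.
have [s0|s0] := lerP 0 s; first exact: pos.
by have := pos (- s); rewrite oppr_ge0 (ltW s0) pN scaleNr expGN => /(_ isT) /invg_inj.
Qed.

(** The powers of [x] accumulate by compactness; the quotient of two powers close to the same
    cluster point is close to the identity. *)
Lemma recurrence (x : G) (U : set G) : nbhs (1%g : G) U ->
  exists2 m, (0 < m)%N & U (x ^+ m)%g.
Proof.
move=> U1.
have [p [_ clp]] : [set: G] `&` cluster ((fun i => x ^+ i)%g @ \oo) !=set0.
  by apply: cG; exact: filterT.
have c : (fun q : G * G => (q.1^-1 * q.2)%g) @ (p, p) --> (1%g : G).
  rewrite -(mulVg p); apply: (@cvgMg _ (nbhs (p, p)) _ (fun q : G * G => q.1^-1%g) (fun q => q.2)).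
    by apply: (@cvgVg _ (nbhs (p, p)) _ (fun q : G * G => q.1)); exact: cvg_fst.
  exact: cvg_snd.
have [[A B] /= [Ap Bp] AB] := c _ U1.
have AA : nbhs p (A `&` B) by apply: filterI.
have [|y [[i _ iy] [Ay _]]] := clp (range (fun i => x ^+ i)%g) _ _ AA.
  by exists 0%N => // i _; exists i.
have [|z [[j /= ij jz] [_ Bz]]] := clp [set z | exists2 j, (i < j)%N & (x ^+ j)%g = z] _ _ AA.
  by exists i.+1 => // j /= ij; exists j.
exists (j - i)%N; first by rewrite subn_gt0.
have := AB (y, z) (conj Ay Bz); rewrite /= -iy -jz -(subnKC (ltnW ij)) expgnDr mulKg.
by rewrite addKn.
Qed.

(** Either the group has arbitrarily small positive elements, and being closed it is the whole line,
    or it has a least positive element, found in a compact interval ending at the member [1]. *)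
Lemma closed_subgroup_real (Y : R -> Prop) : closed (Y : set R) -> Y 1 ->
  (forall x y, Y x -> Y y -> Y (x - y)) -> (forall y, Y y) \/
  exists2 c, 0 < c & Y c /\ forall y, Y y -> exists k : int, y = k%:~R * c.
Proof.
move=> cY Y1 YB.
have Y0 : Y 0 by rewrite -(subrr 1); exact: YB.
have YN y : Y y -> Y (- y) by rewrite -sub0r; exact: YB.
have YD x y : Y x -> Y y -> Y (x + y) by move=> hx hy; rewrite -[y]opprK; apply: YB => //; exact: YN.
have Yn y (k : nat) : Y y -> Y (k%:R * y).
  by move=> hy; elim: k => [|k IH]; rewrite ?mul0r// -natr1 mulrDl mul1r; exact: YD.
have Yz y (k : int) : Y y -> Y (k%:~R * y).
  by move=> hy; case: k => k; rewrite ?NegzE ?mulrNz ?mulNr; [|apply: YN]; exact: Yn.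
have [H|] := pselect (forall e, 0 < e -> exists2 y, 0 < y < e & Y y).
  left=> y; have := cY y; apply; move=> B /nbhs_ballP[e /= e0 hB].
  have [c /andP[c0 ce] Yc] := H e e0.
  exists ((Num.floor (y / c))%:~R * c); split; first exact: Yz.
  apply: hB; rewrite -ball_normE /=.
  have /andP[] := floor_bounds (y / c).
  rewrite ler_pdivlMr// => h1; rewrite ltr_pdivrMr// mulrDl mul1r => h2.
  by rewrite ger0_norm; lra.
move=> /existsNP[d /not_implyP[d0 dY]].
have dP y : 0 < y -> y < d -> ~ Y y by move=> y0 yd hy; apply: dY; exists y => //; rewrite y0.
have d1 : d <= 1 by rewrite leNgt; apply/negP => /(dP 1 ltr01).
right; have [|||c /set_mem[Yc /=]] := @compact_EVT_min R R id (Y `&` `[d, 1]).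
- by exists 1; rewrite /= in_itv /= d1 lexx.
- by apply: (@subclosed_compact _ _ `[d, 1]%classic); [apply: closedI => //; exact: itv_closed|exact: segment_compact|move=> x []].
- by apply: continuous_subspaceT => x.
rewrite in_itv /= => /andP[dc c1] cmin.
have c0 : 0 < c by exact: lt_le_trans dc.
exists c => //; split=> // y Yy; exists (Num.floor (y / c)).
have /andP[] := floor_bounds (y / c).
rewrite ler_pdivlMr// => h1; rewrite ltr_pdivrMr// mulrDl mul1r => h2.
have Yz' : Y (y - (Num.floor (y / c))%:~R * c) by apply: YB => //; exact: Yz.
apply/eqP; rewrite -subr_eq0; apply/eqP; set z := _ - _ in Yz' *.
have z0 : 0 <= z by rewrite subr_ge0.
have zc : z < c by rewrite /z; lra.
apply/eqP; rewrite eq_le z0 andbT leNgt; apply/negP => z1.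
have dz : d <= z by rewrite leNgt; apply/negP => /(dP z z1).
have : c <= z by apply: cmin; rewrite inE; split => //=; rewrite in_itv /=; lra.
by rewrite leNgt zc.
Qed.

Lemma mulmx_cts p q (M : 'M[R]_(p, q)) : continuous (fun x : 'rV[R]_p => x *m M).
Proof.
move=> x; apply: (@ball_lipschitz_continuous R _ _ _ (p%:R * `|M|) 1) => // y _.
by rewrite -mulmxBl; apply: le_trans (mulmx_norm_le _ _) _; rewrite mulrCA mulrC.
Qed.

(** * Tori and their Lie algebras *)

Section Torus.
Section OneTorus.
Variables (k : nat) (f : 'rV[R]_k -> G).
Hypotheses (fc : continuous f) (fD : {morph f : x y / x + y >-> (x * y)%g}).
Hypothesis fK : forall x, f x = 1%g <-> forall i, x 0 i \is a Num.int.

Lemma torus_rho_ex : {rho : 'rV[R]_k -> V | forall x s, f (s *: x) = expG (s *: rho x)}.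
Proof.
suff /(_ _)/cid h x : exists v, forall s, f (s *: x) = expG (s *: v).
  by exists (fun x => sval (h x)) => x s; rewrite (svalP (h x)).
have [|s t|v hv] := @one_param_exp (fun s => f (s *: x)); last by exists v.
  move=> s; apply: (@continuous_comp R 'rV[R]_k G (fun s : R => s *: x) f); last exact: fc.
  by apply: cvgZl; exact: cvg_id.
by rewrite scalerDl.
Qed.

(** The differential of the parametrisation [f] at the origin. *)
Definition torus_rho := sval torus_rho_ex.

Lemma torus_rhoE x s : f (s *: x) = expG (s *: torus_rho x).
Proof. exact: (svalP torus_rho_ex). Qed.

Lemma torus_exp x : f x = expG (torus_rho x).
Proof. by rewrite -[x in LHS]scale1r torus_rhoE scale1r. Qed.

Lemma torus_fC x y : (f x * f y = f y * f x)%g.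
Proof. by rewrite -!fD addrC. Qed.

Lemma torus_rhoD x y : torus_rho (x + y) = torus_rho x + torus_rho y.
Proof.
apply: expG_gen_inj => j; rewrite -torus_rhoE scalerDr fD !torus_rhoE scalerDr expG_addC// => i.
by rewrite !scalerA -!torus_rhoE torus_fC.
Qed.

Lemma torus_rhoZ c x : torus_rho (c *: x) = c *: torus_rho x.
Proof. by apply: expG_gen_inj => j; rewrite -torus_rhoE !scalerA torus_rhoE. Qed.

Lemma torus_frac x : exists2 y : 'rV[R]_k, (forall i, 0 <= y 0 i <= 1) & f y = f x.
Proof.
pose z : 'rV[R]_k := \row_i (Num.floor (x 0 i))%:~R.
exists (x - z) => [i|].
  rewrite !mxE; have /andP[h1 h2] := floor_bounds (x 0 i).
  by rewrite /=; lra.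
have z1 : f z = 1%g by apply/fK => i; rewrite mxE.
by rewrite -[in RHS](subrK z x) (fD (x - z)) z1 mulg1.
Qed.

Lemma torus_compact : compact (f @` [set: 'rV[R]_k]).
Proof.
have -> : f @` [set: 'rV[R]_k] = f @` [set x : 'rV[R]_k | forall i, `[0, 1]%classic (x ord0 i)].
  apply/seteqP; split=> _ [x _ <-]; last by exists x.
  by have [y hy <-] := torus_frac x.
apply: continuous_compact; first exact: continuous_subspaceT.
by apply: (@rV_compact R k (fun=> `[0, 1]%classic)) => i; exact: segment_compact.
Qed.

Lemma torus_f0 : f 0 = 1%g.
Proof. by apply: (@mulgI _ (f 0)); rewrite -fD addr0 mulg1. Qed.

Lemma torus_fN x : f (- x) = (f x)^-1%g.
Proof. by apply: (@mulgI _ (f x)); rewrite -fD subrr torus_f0 mulgV. Qed.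

Lemma torus_subgroup : is_subgroup (f @` [set: 'rV[R]_k]).
Proof.
split; first by exists 0; rewrite ?torus_f0.
  by move=> _ _ [x _ <-] [y _ <-]; exists (x + y) => //.
by move=> _ [x _ <-]; exists (- x) => //; exact: torus_fN.
Qed.

End OneTorus.

Lemma torus_sub (T : set G) : is_torus T -> is_subgroup T.
Proof. by move=> [k [f [fc fD fK <-]]]; exact: torus_subgroup. Qed.

Lemma torus_cpt (T : set G) : is_torus T -> compact T.
Proof. by move=> [k [f [fc fD fK <-]]]; exact: torus_compact. Qed.

Lemma torus_closed (T : set G) : is_torus T -> closed T.
Proof. by move=> /torus_cpt; apply: compact_closed; exact: lie_hausdorff. Qed.

Lemma torus_comm (T : set G) : is_torus T -> forall x y, T x -> T y -> (x * y = y * x)%g.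
Proof. by move=> [k [f [fc fD fK <-]]] _ _ [x _ <-] [y _ <-]; exact: torus_fC. Qed.

Lemma torus_expE (T : set G) x : is_torus T -> T x -> exists2 v, LieS T v & expG v = x.
Proof.
move=> [k [f [fc fD fK <-]]] [y _ <-]; exists (torus_rho fc fD y); last by rewrite -torus_exp.
by move=> s; rewrite -torus_rhoE.
Qed.

Lemma torus_fix (T : set G) v y : is_torus T -> LieS T v -> T y -> v *m AdM y = v.
Proof.
move=> tT hv hy; apply/AdM_fix_commute => s; exact: (torus_comm tT hy (hv s)).
Qed.

(** The one-parameter group of [l] commutes with [T] and meets it at the times in [Y], the multiples
    of some [c]. Adding a coordinate with direction [c *: l], sheared by a preimage [x0] in [T] of
    [expG (c *: l)], makes the kernel exactly the integer lattice. *)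
Lemma torus_extend (T : set G) l : is_torus T -> expG l = 1%g -> (forall x, T x -> l *m AdM x = l) ->
  ~ LieS T l -> exists2 T', is_torus T' & T `<=` T' /\ LieS T' l.
Proof.
move=> tT l1 lT lnT; have cT := torus_closed tT; have [T1 TM TV] := torus_sub tT.
pose Y (y : R) := T (expG (y *: l)).
have cY : closed (Y : set R).
  apply: (@closed_comp R G (fun y : R => expG (y *: l)) T) => // y _.
  apply: (@continuous_comp R V G (fun y : R => y *: l) expG); last exact: expG_cts.
  by apply: cvgZl; exact: cvg_id.
have Y1 : Y 1 by rewrite /Y scale1r l1.
have YB x y : Y x -> Y y -> Y (x - y).
  by move=> hx hy; rewrite /Y expG_add scaleNr expGN; apply: TM => //; exact: TV.
have [//|[c c0 [Yc cP]]] := closed_subgroup_real cY Y1 YB.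
have [k [f [fc fD fK fT]]] := tT.
have [x0 _ fx0] : (f @` [set: 'rV[R]_k]) (expG (c *: l)) by rewrite fT.
have rE := torus_rhoE fc fD.
pose A : 'M[R]_(k + 1, k) := col_mx 1%:M (- x0).
pose B : 'M[R]_(k + 1, n) := col_mx 0 (c *: l).
pose g (z : 'rV[R]_(k + 1)) := (f (z *m A) * expG (z *m B))%g.
have zE (z : 'rV[R]_(k + 1)) : z = row_mx (lsubmx z) ((rsubmx z 0 0)%:M).
  by rewrite -mx11_scalar hsubmxK.
have gE x (y : R) : g (row_mx x y%:M) = (f (x - y *: x0) * expG (y *: (c *: l)))%g.
  by rewrite /g !mul_row_col mulmx1 mulmx0 add0r !mul_scalar_mx scalerN.
have comm x (y : R) : (f x * expG (y *: l) = expG (y *: l) * f x)%g.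
  by apply: (AdM_fix_commute _ _).1; apply: lT; rewrite -fT.
have gD : {morph g : x y / x + y >-> (x * y)%g}.
  move=> x y; have E : (rsubmx x 0 0)%:M + (rsubmx y 0 0)%:M = (rsubmx x 0 0 + rsubmx y 0 0)%:M :> 'M[R]_1.
    by rewrite raddfD.
  rewrite (zE x) (zE y) add_row_mx E !gE scalerDl expG_add opprD addrACA.
  move: (lsubmx x - _) (lsubmx y - _) => X Z; rewrite fD.
  by rewrite !mulgA; congr (_ * _)%g; rewrite -!mulgA; congr (_ * _)%g; rewrite scalerA comm.
have fcl x (y : R) : f x = expG (y *: (c *: l)) -> exists m : int, y = m%:~R.
  rewrite scalerA => h; have : Y (y * c) by rewrite /Y -h -fT.
  by move=> /cP[m]; move=> /(mulIf (lt0r_neq0 c0)) ->; exists m.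
have f0 := torus_f0 fD; have fN := torus_fN fD.
have fz (m : int) : f (m%:~R *: x0) = expG (m%:~R *: (c *: l)).
  have fn (i : nat) : f (i%:R *: x0) = expG (i%:R *: (c *: l)).
    rewrite !scaler_nat expG_nat -fx0; elim: i => [|i IH]; rewrite ?expg0//.
    by rewrite mulrS fD IH expgS.
  by case: m => m; rewrite ?NegzE ?mulrNz ?scaleNr ?fN ?expGN fn.
have gc : continuous g.
  move=> z; apply: (@cvgMg _ (nbhs z) _ (fun z => f (z *m A)) (fun z => expG (z *m B))).
    by apply: (@continuous_comp 'rV[R]_(k + 1) 'rV[R]_k G (fun z => z *m A) f); [exact: mulmx_cts|exact: fc].
  by apply: (@continuous_comp 'rV[R]_(k + 1) V G (fun z => z *m B) expG); [exact: mulmx_cts|exact: expG_cts].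
have gK x : g x = 1%g <-> forall i, x 0 i \is a Num.int.
  rewrite (zE x) gE; set y := rsubmx x 0 0; set x' := lsubmx x; split.
    move=> h; have h' : f (- (x' - y *: x0)) = expG (y *: (c *: l)).
      by rewrite fN; apply: (@mulgI _ (f (x' - y *: x0))); rewrite mulgV.
    have [m ym] := fcl _ _ h'; move: h; rewrite ym -fz -fD subrK => /fK h i.
    case: (split_ordP i) => j ->; first by rewrite row_mxEl.
    by rewrite row_mxEr ord1 mxE mulr1n.
  move=> h; have /intrP[m ym] : y \is a Num.int.
    by have := h (rshift k 0); rewrite row_mxEr mxE.
  rewrite ym -fz -fD subrK; apply/fK => i.
  by have := h (lshift 1 i); rewrite row_mxEl.
exists (g @` [set: 'rV[R]_(k + 1)]); first by exists (k + 1)%N, g.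
split.
  move=> y; rewrite -fT => -[x _ <-]; exists (row_mx x 0%:M) => //.
  by rewrite gE !scale0r expG0 subr0 mulg1.
move=> s; exists (row_mx ((s / c) *: x0) (s / c)%:M) => //.
by rewrite gE subrr f0 mul1g scalerA divfK// gt_eqF.
Qed.

Variable T : set G.
Hypothesis mT : maximal_torus T.

(** The one-parameter group of [B] need not close up. Recurrence gives a power of [expG B] equal to
    [expG e] with [e] small; then [B *+ m - e] has trivial exponential, is fixed by [T], and avoids
    the Lie algebra since [B] has positive distance from it. Enlarging [T] by its circle contradicts
    maximality. *)
Lemma fixed_LieS B : (forall x, T x -> B *m AdM x = B) <-> LieS T B.
Proof.
have [tT max] := mT; split; last by move=> hB x; exact: torus_fix.
move=> hB; apply: contrapT => nB.
have cT := torus_closed tT; have sT := torus_sub tT.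
have [Tz TD TZ] := LieS_subspace sT cT.
have [d d0 hd] : exists2 d, 0 < d & forall e : V, `|e| < d -> ~ LieS T (B - e).
  apply: contrapT => H; apply: nB.
  have hk k : {w : V | LieS T w & `|w - B| < 2 ^- k}.
    apply: cid2; apply: contrapT => H2; apply: H.
    exists (2 ^- k); first by rewrite invr_gt0.
    move=> e ek hBe; apply: H2; exists (B - e) => //.
    by rewrite addrAC subrr add0r normrN.
  apply: (@LieS_lim T (fun k => s2val (hk k)) B cT) => [k|e e0]; first exact: (s2valP (hk k)).
  have [m hm] := half_pow_small e0; exists m => k /hm mk.
  exact: le_trans (ltW (s2valP' (hk k))) (ltW mk).
have [b b0 hb] := AdM_bound.
have [r r0 inj] := exp_inj.
have nb0 : 0 < n%:R * b + 1 :> R by rewrite ltr_wpDl// mulr_ge0.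
pose e0 := Num.min d (r / (n%:R * b + 1)).
have e00 : 0 < e0 by rewrite lt_min d0 divr_gt0.
have [m m0 [e ee eE]] := @recurrence (expG B) _ (exp_near1 e00).
have [ed er] : `|e| < d /\ `|e| * (n%:R * b + 1) < r.
  by move: ee; rewrite lt_min ltr_pdivlMr// => /andP[].
have eAd g : (g * (expG B ^+ m) * g^-1 = expG B ^+ m)%g -> e *m AdM g = e.
  move=> h; apply: inj.
  - apply: le_lt_trans (mulmx_norm_le _ _) _; apply: le_lt_trans er.
    rewrite mulrCA ler_wpM2l//; have := ler_wpM2l (ler0n R n) (hb g); lra.
  - apply: le_lt_trans er; rewrite ler_peMr// lerDr mulr_ge0//.
  by rewrite -expG_conj eE.
have eT x : T x -> e *m AdM x = e.
  move=> Tx; apply: eAd; rewrite -expG_nat expG_conj.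
  by rewrite -(scaler_nat m B) -scalemxAl hB.
have eB s : e *m AdM (expG (s *: B)) = e.
  apply: eAd; rewrite -expG_nat expG_conj; congr expG.
  apply/AdM_fix_commute => t; rewrite -(scaler_nat m B) scalerA -!expG_add; congr expG.
  by rewrite addrC.
have l1 : expG (B *+ m - e) = 1%g.
  rewrite expG_addC; first by rewrite expG_nat -eE expGN mulgV.
  move=> j; rewrite scalerN expGN; apply: (@mulgI _ (expG (2 ^- j *: e))).
  rewrite mulVKg mulgA -(scaler_nat m B) scalerA.
  by rewrite -((AdM_fix_commute _ _).1 (eB _)) mulgK.
have lT x : T x -> (B *+ m - e) *m AdM x = B *+ m - e.
  by move=> Tx; rewrite mulmxBl eT// -(scaler_nat m B) -scalemxAl hB.
have ln : ~ LieS T (B *+ m - e).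
  move=> /(TZ m%:R^-1); rewrite scalerBr -(scaler_nat m B) scalerA mulVf ?scale1r; last first.
    by rewrite pnatr_eq0 -lt0n.
  apply: hd; rewrite normrZ normfV normr_nat.
  apply: le_lt_trans ed; rewrite ler_piMl// invf_le1 ?ltr0n// ler1n//.
have [T' tT' [TT' lT']] := torus_extend tT l1 lT ln.
by apply: ln; rewrite -(max _ tT' TT').
Qed.
End Torus.

Definition invQ : 'M[R]_n := sval (cid (invariant_form)).
Local Notation ip := (ip invQ).

Lemma invQs : invQ^T = invQ.
Proof. by have [] := svalP (cid (invariant_form)). Qed.

Lemma invQp (v : V) : v != 0 -> 0 < ip v v.
Proof. by have [_ h _] := svalP (cid (invariant_form)); exact: h. Qed.

Lemma invQi g : AdM g *m invQ *m (AdM g)^T = invQ.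
Proof. by have [_ _] := svalP (cid (invariant_form)). Qed.

Lemma iC (u v : V) : ip u v = ip v u. Proof. exact: ipC invQs _ _. Qed.
Lemma iAd g (u v : V) : ip (u *m AdM g) (v *m AdM g) = ip u v. Proof. exact: ip_Ad invQi _ _ _. Qed.
Lemma ibk Y (u v : V) : ip (bk Y u) v = - ip u (bk Y v). Proof. exact: (ip_bk invQi). Qed.
Lemma ieq0 (v : V) : ip v v = 0 -> v = 0. Proof. exact: (ip_eq0 invQp). Qed.

Lemma igt0 (v : V) : v <> 0 -> 0 < ip v v.
Proof. by move=> /eqP; exact: invQp. Qed.

Lemma quad_cts (N : 'M[R]_n) : continuous (fun u : V => (u *m N *m u^T) 0 0).
Proof.
move=> u; have -> : (fun u : V => (u *m N *m u^T) 0 0) = (fun u : V => \sum_j (u *m N) 0 j * u 0 j).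
  by apply/funext => x; rewrite mxE; apply: eq_bigr => j _; rewrite [X in _ * X]mxE.
apply: cvg_sum_real => j.
apply: (@cvgM R _ (nbhs u) _ (fun u : V => (u *m N) 0 j) (fun u : V => u 0 j)).
  apply: (@continuous_comp V V R (fun u => u *m N) (fun u => u 0 j)); first exact: mulmx_cts.
  exact: coord_continuous.
exact: coord_continuous.
Qed.

Lemma ip_cts (w : V) : continuous (fun u : V => ip u w).
Proof.
move=> u; have [K K0 hK] := ip_bound invQ.
apply: (@ball_lipschitz_continuous R _ R^o _ (K * `|w|) 1) => // x _.
by rewrite -mulrA (mulrC `|w|) -ipNl -ipDl.
Qed.

Lemma subspace_closed (P : V -> Prop) : is_subspace P -> closed (P : set V).
Proof.
move=> /subspace_mx[M hM].
have -> : (P : set V) = (fun u : V => u *m cokermx M) @^-1` [set 0].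
  by apply/seteqP; split => u /=; rewrite hM submxE => /eqP.
apply: closed_comp; first by move=> u _; exact: mulmx_cts.
by apply: accessible_closed_set1; apply: hausdorff_accessible; exact: norm_hausdorff.
Qed.

(** The Rayleigh quotient has a maximum on the unit sphere, and by homogeneity the sphere of the
    maximum norm serves as well. Varying the maximiser in the direction of its own residual [z]
    shows that [z] vanishes. *)
Lemma sym_eigen (P : V -> Prop) (M : 'M[R]_n) : is_subspace P -> (exists2 u, P u & u <> 0) ->
  (forall u, P u -> P (u *m M)) -> (forall u v, P u -> P v -> ip (u *m M) v = ip u (v *m M)) ->
  exists m u, [/\ P u, u <> 0 & u *m M = m *: u].
Proof.
move=> sP [u1 Pu1 u10] PM sym; have [P0 PD PZ] := sP.
pose q (u : V) := ip (u *m M) u; pose f (u : V) := q u / ip u u.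
pose B : set V := (P : set V) `&` [set u | `|u| = 1].
have n10 : `|u1| != 0 by rewrite normr_eq0; exact/eqP.
have cB : compact B.
  apply: bounded_closed_compact.
    by exists 1; split; [exact: num_real|move=> r r1 x [_ /= ->]; exact: ltW].
  apply: closedI; first exact: subspace_closed.
  have -> : [set u : V | `|u| = 1] = (fun x : V => `|x|) @^-1` [set 1] by [].
  apply: closed_comp; first by move=> x _; exact: norm_continuous.
  by apply: accessible_closed_set1; apply: hausdorff_accessible; exact: norm_hausdorff.
have ne (u : V) : `|u| = 1 -> ip u u != 0.
  move=> un; rewrite gt_eqF// invQp// -normr_eq0 un oner_eq0//.
have [||u0 /set_mem[Pu0 /= nu0] mx] := @compact_EVT_max _ R f B _ cB.
- exists (`|u1|^-1 *: u1); split; first exact: PZ.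
  by rewrite /= normrZ normfV normr_id mulVf.
- apply: continuous_in_subspaceT => u /set_mem[_ /= /ne nu].
  apply: (@cvgM R _ (nbhs u) _ q (fun u => (ip u u)^-1)).
    have -> : q = (fun u : V => (u *m (M *m invQ) *m u^T) 0 0) by apply/funext => x; rewrite mulmxA.
    exact: quad_cts.
  by apply: (@cvgV R _ (nbhs u) _ (fun u : V => ip u u) (ip u u)) => //; exact: (@quad_cts invQ u).
set m := f u0 in mx.
have qm w : P w -> q w <= m * ip w w.
  move=> Pw; have [->|w0] := eqVneq w 0; first by rewrite /q mul0mx ip0l mulr0.
  have nw : `|w| != 0 by rewrite normr_eq0.
  have := mx (`|w|^-1 *: w); rewrite inE => /(_ (conj (PZ _ _ Pw) _)) H.
  have {H} := H ltac:(by rewrite /= normrZ normfV normr_id mulVf).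
  rewrite /f /q -scalemxAl !ipZl !ipZr !mulrA -invfM => H.
  have wp := invQp w0; rewrite -ler_pdivrMr//; apply: le_trans H.
  rewrite le_eqVlt; apply/orP; left; apply/eqP; field.
  by rewrite nw gt_eqF.
have qu0 : q u0 = m * ip u0 u0 by rewrite divfK// ne.
exists m, u0; split=> //; first by move=> z; move: nu0; rewrite z normr0 => /esym/eqP; rewrite oner_eq0.
have [z zE] : exists z, u0 *m M = m *: u0 - z.
  by exists (m *: u0 - u0 *m M); rewrite opprB addrC subrK.
have Pz : P z.
  have -> : z = m *: u0 - u0 *m M by rewrite zE opprB addrC subrK.
  by apply: subspaceB => //; [exact: PZ|exact: PM].
suff /ieq0 z0 : ip z z = 0 by rewrite zE z0 subr0.
have H (s : R) : 0 <= 2 * s * ip z z + s ^+ 2 * (m * ip z z - q z).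
  have := qm _ (PD _ _ Pu0 (PZ s _ Pz)); rewrite /q mulmxDl -scalemxAl !ipDl !ipDr !ipZl !ipZr.
  have -> : ip (z *m M) u0 = ip (u0 *m M) z by rewrite sym// iC.
  have E : ip (u0 *m M) z = m * ip u0 z - ip z z by rewrite zE ipDl ipNl ipZl.
  rewrite E -/(q u0) qu0 -/(q z) (iC z u0) -subr_ge0.
  by move=> h; apply: le_trans h _; rewrite le_eqVlt; apply/orP; left; apply/eqP; ring.
set A := ip z z in H *; set B' := m * A - q z in H.
have A0 : 0 <= A.
  by rewrite /A; have [->|/invQp/ltW //] := eqVneq z 0; rewrite ip0l.
have b1 : 0 < `|B'| + 1 by rewrite ltr_wpDl.
have [//|An0] := eqVneq A 0; have Ap : 0 < A by rewrite lt_neqAle eq_sym An0.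
have := H (- (A / (`|B'| + 1))).
have : (- (A / (`|B'| + 1))) ^+ 2 * B' <= A / (`|B'| + 1) * A.
  have -> : (- (A / (`|B'| + 1))) ^+ 2 * B' = A / (`|B'| + 1) * (A / (`|B'| + 1) * B') by ring.
  rewrite ler_wpM2l ?divr_ge0 ?(ltW b1)//; apply: le_trans (div_succ_le A0 (normr_ge0 B')).
  by rewrite ler_wpM2l ?divr_ge0 ?(ltW b1)// ler_norm.
have : 0 < A / (`|B'| + 1) * A by rewrite mulr_gt0// divr_gt0.
set X := A / _; nra.
Qed.

Lemma bk0r Y : bk Y 0 = 0.
Proof. by have := bkZr Y 0 0; rewrite !scale0r. Qed.

Definition adm (Y : V) : 'M[R]_n := \matrix_i bk Y (delta_mx 0 i).

Lemma bk_adm Y B : bk Y B = B *m adm Y.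
Proof.
rewrite mulmx_sum_row {1}(row_sum_delta B).
have H (s : seq 'I_n) : bk Y (\sum_(i <- s) B 0 i *: delta_mx 0 i) = \sum_(i <- s) B 0 i *: bk Y (delta_mx 0 i).
  elim: s => [|i s IH]; first by rewrite !big_nil bk0r.
  by rewrite !big_cons bkDr bkZr IH.
by rewrite H; apply: eq_bigr => i _; rewrite rowK.
Qed.

Lemma strict_row_mx m p q (f : 'rV[R]_m -> 'rV[R]_p) (g : 'rV[R]_m -> 'rV[R]_q) x0 L M :
  strict_diff f x0 L -> strict_diff g x0 M ->
  strict_diff (fun x => row_mx (f x) (g x)) x0 (row_mx L M).
Proof.
move=> hf hg.
have h1 : strict_diff (fun x : 'rV[R]_p => x *m row_mx 1%:M (0 : 'M[R]_(p, q)) + 0) (f x0) (row_mx 1%:M 0).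
  exact: strict_diff_affine.
have h2 : strict_diff (fun x : 'rV[R]_q => x *m row_mx (0 : 'M[R]_(q, p)) 1%:M + 0) (g x0) (row_mx 0 1%:M).
  exact: strict_diff_affine.
have := strict_diffD (strict_diff_comp hf h1) (strict_diff_comp hg h2).
rewrite !mul_mx_row !mulmx1 !mulmx0 add_row_mx addr0 add0r.
apply: (@strict_diff_near _ _ _ _ _ _ _ 1) => // x _ /=.
by rewrite !mul_mx_row !mulmx1 !mulmx0 !addr0 add_row_mx addr0 add0r.
Qed.

Lemma strict_mu m (f g : 'rV[R]_m -> V) L M : f 0 = 0 -> g 0 = 0 ->
  strict_diff f 0 L -> strict_diff g 0 M ->
  strict_diff (fun w => mu (row_mx (f w) (g w))) 0 (L + M).
Proof.
move=> f0 g0 hf hg; have := strict_row_mx hf hg => hr.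
have hm : strict_diff mu (row_mx (f 0) (g 0)) (col_mx 1%:M 1%:M).
  by rewrite f0 g0 row_mx0; exact: quad_diff_strict (mu_quad).
by have := strict_diff_comp hr hm; rewrite mul_row_col !mulmx1.
Qed.

Lemma closed_Ad_eq (v w : V) : closed [set g : G | v *m AdM g = w].
Proof.
have -> : [set g : G | v *m AdM g = w] = (fun g : G => v *m AdM g) @^-1` [set w] by [].
apply: closed_comp; first by move=> g _; exact: AdM_cts.
by apply: accessible_closed_set1; apply: hausdorff_accessible; exact: norm_hausdorff.
Qed.

Lemma closed_cent (x : G) : closed [set g : G | (g * x = x * g)%g].
Proof.
have -> : [set g : G | (g * x = x * g)%g] = (fun g : G => g^-1 * (x * g))%g @^-1` [set x].
  apply/seteqP; split => g /=; first by move=> <-; rewrite mulKg.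
  by move=> h; rewrite -{1}h mulVKg.
apply: closed_comp.
  move=> g _; apply: cvgMg; first by apply: cvgVg; exact: cvg_id.
  by apply: cvgMg; [exact: cvg_cst | exact: cvg_id].
by apply: accessible_closed_set1; apply: hausdorff_accessible; exact: lie_hausdorff.
Qed.

Lemma cent_subgroup (x : G) : is_subgroup [set g : G | (g * x = x * g)%g].
Proof.
split=> /=; first by rewrite mul1g mulg1.
- by move=> a b ha hb; rewrite -mulgA hb mulgA ha mulgA.
- by move=> a ha; apply: (mulgI a); rewrite !mulgA mulgV mul1g ha -mulgA mulgV mulg1.
Qed.

(** * Roots and the conjugacy theorem for a maximal torus *)

Section MaximalTorus.
Variable T : set G.
Hypothesis mT : maximal_torus T.
Local Notation t := (LieS T).
Let tT : is_torus T. Proof. by case: mT. Qed.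
Let cT : closed T. Proof. exact: torus_closed. Qed.
Let sT : is_subgroup T. Proof. exact: torus_sub. Qed.

Let st : is_subspace t. Proof. exact: LieS_subspace. Qed.

Lemma adm_Ad H x : t H -> T x -> adm H *m AdM x = AdM x *m adm H.
Proof.
move=> tH Tx; apply/row_matrixP => i.
have hx : H *m AdM x = H by exact: (torus_fix tT).
by rewrite !row_mul rowK -[row i _ *m adm H]bk_adm rowE -[in RHS]hx bk_Ad.
Qed.

Lemma bk_commt H H' u : t H -> t H' -> bk H (bk H' u) = bk H' (bk H u).
Proof.
move=> tH tH'; rewrite !(bk_adm H') (@bk_inter H)// => h; apply: adm_Ad => //; exact: tH.
Qed.

Definition Tstable (P : V -> Prop) := forall x u, T x -> P u -> P (u *m AdM x).

Lemma Tstable_bk P H u : is_subspace P -> Tstable P -> t H -> P u -> P (bk H u).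
Proof.
move=> sP TP tH Pu; have cP := subspace_closed sP; have [_ _ PZ] := sP.
have /tendsP h := bk_tends H u; apply: (closed_seq cP _ h) => k.
by apply: PZ; apply: (subspaceB sP) => //; apply: TP => //.
Qed.

Lemma bk_t0 u : (forall H, t H -> bk H u = 0) -> t u.
Proof.
move=> h; apply/(fixed_LieS mT) => x /(torus_expE tT)[H tH <-].
by have /(bk0_fix) := h H tH => /(_ 1); rewrite scale1r.
Qed.

Lemma bk_tt H u : t H -> t u -> bk H u = 0.
Proof. by move=> tH tu; apply: bk_fix0 => s; apply: (torus_fix tT) => //. Qed.

(* In a minimal stable subspace, symmetric operators commuting with [T] are scalar by [sym_eigen]. *)
Lemma weight_exists P : is_subspace P -> Tstable P -> (exists2 u, P u & u <> 0) ->
  (forall u, P u -> t u -> u = 0) ->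
  exists u v, [/\ P u, P v, u <> 0, ip u v = 0 & ip u u = ip v v] /\
   exists2 c : V -> R, (forall H, t H -> bk H u = - c H *: v /\ bk H v = c H *: u) &
     exists2 H, t H & c H <> 0.
Proof.
move=> sP TP [w0 Pw0 w00] Pt.
pose good (M : 'M[R]_n) := [/\ (forall u, (u <= M)%MS -> P u), (forall x, T x -> (M *m AdM x <= M)%MS) & (M != 0)].
have [d [M [gM rM] dmin]] : exists d, exists2 M, good M /\ \rank M = d & forall M', good M' -> (d <= \rank M')%N.
  have [M0 hM0] := subspace_mx sP.
  have ex : exists d, `[< exists M, good M /\ \rank M = d >].
    exists (\rank M0); apply/asboolP; exists M0; split=> //; split.
    - by move=> u /hM0.
    - move=> x Tx; apply/rV_subP => _ /submxP[D ->]; rewrite mulmxA; apply/hM0/TP => //.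
      by apply/hM0; exact: submxMl.
    - apply/eqP => M00; move/hM0: Pw0; rewrite M00 submx0 => /eqP//.
  case: (ex_minnP ex) => d /asboolP[M gM] dmin; exists d; exists M => // M' gM'.
  by apply: dmin; apply/asboolP; exists M'.
have [MP Mst Mn0] := gM.
pose P0 (u : V) : Prop := (u <= M)%MS.
have sP0 : is_subspace P0.
  split; [exact: sub0mx|by move=> u v; exact: addmx_sub|by move=> c u; exact: scalemx_sub].
have TP0 : Tstable P0.
  by move=> x u Tx /submxP[D ->]; rewrite /P0 -mulmxA mulmx_sub// Mst.
have [u0 P0u0 u00] : exists2 u, P0 u & u <> 0.
  apply: contrapT => h; move/eqP: Mn0; apply; apply/eqP; rewrite -submx0; apply/rV_subP => v vM.
  by apply: contrapT => v0; apply: h; exists v => // z; apply: v0; rewrite z sub0mx.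
(* An eigenspace of an operator commuting with [T] is again stable, so in a subspace of minimal rank
   it is everything. *)
have full (N : 'M[R]_n) c u1 : P0 u1 -> u1 <> 0 -> u1 *m N = c *: u1 ->
    (forall x, T x -> N *m AdM x = AdM x *m N) -> forall u, P0 u -> u *m N = c *: u.
  move=> Pu1 u10 u1N cN u Pu.
  have kE m (X : 'M[R]_(m, n)) : (X <= kermx (N - c%:M))%MS = (X *m N == c *: X).
    by rewrite sub_kermx mulmxBr mul_mx_scalar subr_eq0.
  pose E := (M :&: kermx (N - c%:M))%MS.
  have gE : good E.
    split.
    - by move=> v; rewrite sub_capmx => /andP[/MP].
    - move=> x Tx; rewrite sub_capmx; apply/andP; split.
        by apply: submx_trans (Mst x Tx); apply: submxMr; exact: capmxSl.
      have : (E <= kermx (N - c%:M))%MS by exact: capmxSr.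
      by rewrite !kE -mulmxA -cN// mulmxA => /eqP ->; rewrite scalemxAl.
    - apply/eqP => E0; apply: u10; apply/eqP; rewrite -submx0 -E0 sub_capmx.
      by rewrite kE u1N eqxx andbT.
  have EM : (E <= M)%MS by exact: capmxSl.
  have : (M <= E)%MS by rewrite -(mxrank_leqif_sup EM) eqn_leq mxrankS// rM dmin.
  by move=> ME; apply/eqP; rewrite -kE; apply: submx_trans Pu (submx_trans ME (capmxSr _ _)).
have bkP0 H u : t H -> P0 u -> P0 (bk H u) by move=> tH; exact: Tstable_bk.
have [H0 tH0 [u2 P0u2 hu2]] : exists2 H0, t H0 & exists2 u, P0 u & bk H0 u <> 0.
  apply: contrapT => h; apply: u00; apply: Pt; first exact: MP.
  apply: bk_t0 => H tH; apply: contrapT => h1; apply: h; exists H => //; by exists u0.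
have admP H u : u *m adm H = bk H u by rewrite bk_adm.
have [m [u3 [P0u3 u30 u3m]]] : exists m u, [/\ P0 u, u <> 0 & u *m (adm H0 *m adm H0) = m *: u].
  apply: sym_eigen => //; first by exists u0.
    by move=> u Pu; rewrite mulmxA !admP; apply: (bkP0) => //; apply: (bkP0).
  by move=> u v _ _; rewrite !mulmxA !admP ibk ibk opprK.
have HH u : P0 u -> bk H0 (bk H0 u) = m *: u.
  rewrite -2!admP -mulmxA => Pu; apply: (full _ _ u3) => // x Tx.
  by rewrite -mulmxA (adm_Ad tH0 Tx) !mulmxA (adm_Ad tH0 Tx).
have m0 : m < 0.
  have h1 := igt0 hu2; have u20 : u2 <> 0 by move=> z; apply: hu2; rewrite z bk0r.
  have := igt0 u20; rewrite ibk HH// ipZr in h1 => h2; nra.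
(* The square of the bracket with [H0] is the negative scalar [m], so dividing by [l] gives a
   complex structure [J]. For every [H] in [t] the bracket composed with [J] is symmetric, hence
   scalar. *)
pose l := Num.sqrt (- m); have l0 : 0 < l by rewrite sqrtr_gt0 oppr_gt0.
have ll : l ^+ 2 = - m by rewrite sqr_sqrtr// oppr_ge0 ltW.
have ln0 : l != 0 by rewrite gt_eqF.
pose J (u : V) := l^-1 *: bk H0 u.
have JJ u : P0 u -> J (J u) = - u.
  move=> Pu; have E : l^-1 * l^-1 * m = -1 by rewrite -[m]opprK -ll; field.
  by rewrite /J bkZr HH// !scalerA mulrA E scaleN1r.
have JP u : P0 u -> P0 (J u) by move=> Pu; have [_ _ Z] := sP0; apply: Z; exact: bkP0.
have Js u v : ip (J u) v = - ip u (J v) by rewrite ipZl ipZr ibk mulrN.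
have Jbk H u : t H -> bk H (J u) = J (bk H u) by move=> tH; rewrite bkZr bk_commt.
have cex H : t H -> exists c, forall u, P0 u -> bk H (J u) = c *: u.
  move=> tH; pose N := l^-1 *: (adm H0 *m adm H).
  have NE u : u *m N = bk H (J u) by rewrite -scalemxAr mulmxA !admP bkZr.
  have [c [u4 [P0u4 u40 u4c]]] : exists c u, [/\ P0 u, u <> 0 & u *m N = c *: u].
    apply: sym_eigen => //; first by exists u0.
      by move=> u Pu; rewrite NE; apply: bkP0 => //; exact: JP.
    by move=> u v _ _; rewrite !NE ibk Js opprK Jbk.
  exists c => u Pu; rewrite -NE; apply: (full _ _ u4) => // x Tx.
  rewrite -scalemxAl -scalemxAr; congr (_ *: _).
  by rewrite -mulmxA (adm_Ad tH Tx) !mulmxA (adm_Ad tH0 Tx).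
pose u := u0; pose v := J u0; have uu : ip u u != 0 by rewrite gt_eqF// igt0.
have vv : ip u u = ip v v by rewrite Js JJ// ipNr opprK.
have cP H : t H -> bk H v = (ip (bk H v) u / ip u u) *: u.
  by move=> tH; have [c hc] := cex H tH; rewrite /v hc// ipZl mulfK.
exists u, v; split.
  split=> //; [exact: MP|by apply: MP; exact: JP|].
  rewrite /v /J ipZr; have /eqP := ibk H0 u u; rewrite iC -addr_eq0 -mulr2n mulrn_eq0 /= => /eqP ->.
  by rewrite mulr0.
exists (fun H => ip (bk H v) u / ip u u).
  move=> H tH; split; last exact: cP.
  have [c hc] := cex H tH; have := hc _ P0u0; rewrite -/v => e; rewrite e ipZl mulfK//.
  by have := hc _ (JP _ P0u0); rewrite JJ// bkNr => /eqP; rewrite eqr_oppLR => /eqP ->; rewrite scaleNr.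
exists H0 => // z; have := cP H0 tH0; rewrite z scale0r /v /J bkZr HH// scalerA => /eqP.
rewrite scaler_eq0 mulf_eq0 invr_eq0 (negbTE ln0) (lt_eqF m0) /= => /eqP; exact: u00.
Qed.
Let tZ c H : t H -> t (c *: H). Proof. by have [_ _] := st; apply. Qed.

(** A root in real form: [t] rotates the plane of [u] and [v] with speed [ip b H], and the root is
    represented by the vector [b] of [t] through the invariant product. *)
Definition wt (b u v : V) := [/\ t b, u <> 0, ip u u = ip v v &
  forall H, t H -> bk H u = - ip b H *: v /\ bk H v = ip b H *: u].
Definition isrt b := b <> 0 /\ exists u v, wt b u v.

Lemma wt_exp b u v H : wt b u v -> t H ->
  u *m AdM (expG H) = cos (ip b H) *: u - sin (ip b H) *: v /\
  v *m AdM (expG H) = sin (ip b H) *: u + cos (ip b H) *: v.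
Proof.
move=> [tb _ _ h] tH; have [h1 h2] := h H tH.
have e1 : bk H v = - - ip b H *: u by rewrite opprK.
have := exp_rotation h1 e1 1; have := exp_rotation h2 h1 1.
by rewrite !mulr1 scale1r cosN sinN scaleNr addrC [in X in _ -> _ -> _ /\ X]addrC => -> ->; rewrite addrC.
Qed.

Lemma wt_orth b u v : b <> 0 -> wt b u v -> ip u v = 0.
Proof.
move=> b0 [tb _ _ h]; have [h1 _] := h b tb.
have /eqP := ibk b u u; rewrite iC -addr_eq0 -mulr2n mulrn_eq0 /= h1 ipZr mulf_eq0 oppr_eq0.
by rewrite gt_eqF ?(igt0 b0)//= => /eqP.
Qed.

Lemma wt_v b u v : wt b u v -> v <> 0.
Proof. by move=> [_ u0 uv _] v0; have := igt0 u0; rewrite uv v0 ip0l ltxx. Qed.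

Lemma wt_of_form u v (c : V -> R) : u <> 0 ->
  (forall H, t H -> bk H u = - c H *: v /\ bk H v = c H *: u) -> (exists2 H, t H & c H <> 0) ->
  exists2 b, b <> 0 & wt b u v /\ forall H, t H -> c H = ip b H.
Proof.
move=> u0 h [H0 tH0 c0].
have uv : ip u u = ip v v.
  have [h1 h2] := h H0 tH0; have := ibk H0 u v; rewrite h1 h2 ipZl ipZr mulNr => /eqP.
  by move/eqP : c0 => c0; rewrite eqr_opp => /eqP /(mulfI c0) ->.
have vv : ip v v != 0 by rewrite -uv gt_eqF// igt0.
(* Invariance of the product makes this multiple of [bk u v] represent [c]. Rotating the plane does
   not change [bk u v], so it is fixed by [T] and lies in [t]. *)
pose b := - (ip v v)^-1 *: bk u v.
have bH H : t H -> c H = ip b H.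
  move=> tH; have [h1 h2] := h H tH; rewrite /b ipZl ibk (bkC u) h1 ipNr ipZr.
  by field.
have tb : t b.
  apply: tZ; apply/(fixed_LieS mT) => x Tx.
  have [H tH <-] := torus_expE tT Tx; have [h1 h2] := h H tH.
  have e1 : bk H v = - - c H *: u by rewrite opprK.
  have := exp_rotation h1 e1 1; have := exp_rotation h2 h1 1.
  rewrite !mulr1 scale1r cosN sinN => r1 r2; rewrite -bk_Ad r1 r2.
  rewrite !bkDl !bkDr !bkZl !bkZr !bkvv !scaler0 addr0 add0r (bkC v u) scalerN !scalerA.
  by rewrite scalerN scaleNr opprK scalerA -scalerDl -!expr2 cos2Dsin2 scale1r.
exists b; first by move=> b0; apply: c0; rewrite bH// b0 ip0l.
by split=> //; split=> // H tH; rewrite -bH//; exact: h.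
Qed.

Lemma weight_wt P : is_subspace P -> Tstable P -> (exists2 u, P u & u <> 0) ->
  (forall u, P u -> t u -> u = 0) -> exists b u v, [/\ P u, P v, b <> 0 & wt b u v].
Proof.
move=> sP TP ne Pt; have [u [v [[Pu Pv u0 _ _] [c hc nc]]]] := weight_exists sP TP ne Pt.
by have [b b0 [w _]] := wt_of_form u0 hc nc; exists b, u, v.
Qed.

(** The orthogonal complement of [P'] in [P] is stable and meets [t] trivially; if it were nonzero
    it would contain a weight vector, which lies in [P'] and would be orthogonal to itself. *)
Lemma weight_span (P P' : V -> Prop) : is_subspace P -> Tstable P -> is_subspace P' -> Tstable P' ->
  (forall H, t H -> P' H) ->
  (forall b u v, P u -> P v -> b <> 0 -> wt b u v -> P' u) ->
  (forall u, P' u -> P u) -> forall u, P u -> P' u.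
Proof.
move=> sP TP sP' TP' tP' wP P'P u Pu.
have [a [b [P'a borth uE]]] := orth_decomp invQs invQp sP' u.
suff b0 : b = 0 by rewrite uE b0 addr0.
pose N x := P x /\ forall w, P' w -> ip w x = 0.
have [P0 PD PZ] := sP.
have sN : is_subspace N.
  split; first by split=> // w _; rewrite ip0r.
    by move=> x y [Px hx] [Py hy]; split; [exact: PD|move=> w P'w; rewrite ipDr hx// hy// addr0].
  by move=> c x [Px hx]; split; [exact: PZ|move=> w P'w; rewrite ipZr hx// mulr0].
have TN : Tstable N.
  move=> x y Tx [Py hy]; split; first exact: TP.
  move=> w P'w; have TxV : T x^-1%g by case: sT => _ _; apply.
  by rewrite -(iAd x^-1%g) AdM_VK hy//; exact: TP'.
have Nb : N b.
  split=> //; have -> : b = u - a by rewrite uE addrC addKr.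
  by apply: (subspaceB sP) => //; exact: P'P.
apply: contrapT => b0; have [||b' [u' [v' [[Pu' ou'] [Pv' _] b'0 w']]]] := weight_wt sN TN.
- by exists b.
- by move=> x [_ hx] tx; apply: (ieq0); apply: hx; exact: tP'.
- by have [_ u'0 _ _] := w'; apply: u'0; apply: (ieq0); apply: ou'; exact: (wP b' u' v').
Qed.

Let Te H : t H -> T (expG H). Proof. by move=> tH; have := tH 1; rewrite scale1r. Qed.

Lemma exp_tD H H' : t H -> t H' -> expG (H + H') = (expG H * expG H')%g.
Proof.
by move=> tH tH'; rewrite expG_addC// => k; apply: (torus_comm tT); [exact: tH|exact: tH'].
Qed.

Lemma root_char b : isrt b -> exists2 a, is_root T a & forall H, t H -> a (expG H) = expi (ip b H).
Proof.
move=> [b0 [u [v w]]]; have [tb u0 uv hw] := w.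
have uu : ip u u != 0 by rewrite gt_eqF// igt0.
have ort := wt_orth b0 w.
pose a (x : G) : R[i] := ((ip (u *m AdM x) u / ip u u) +i* (ip (v *m AdM x) u / ip u u))%C.
have aE H : t H -> a (expG H) = expi (ip b H).
  move=> tH; have [e1 e2] := wt_exp w tH; rewrite /a e1 e2 /expi ipDl ipNl !ipZl ipDl !ipZl.
  by rewrite (iC v u) ort !mulr0 subr0 addr0 !mulfK.
exists a => //; split.
- apply: continuous_subspaceT => x.
  have c (y : V) : {for x, continuous (fun x : G => ip (y *m AdM x) u / ip u u)}.
    apply: (@cvgM R _ (nbhs x) _ (fun x : G => ip (y *m AdM x) u) (fun=> (ip u u)^-1)); last exact: cvg_cst.
    by apply: (@continuous_comp G V R (fun x : G => y *m AdM x) (fun y => ip y u)); [exact: AdM_cts|exact: ip_cts].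
  exact: (cvg_pair (c u) (c v)).
- by move=> x /(torus_expE tT)[H tH <-]; rewrite aE// expi_norm.
- move=> x y /(torus_expE tT)[H tH <-] /(torus_expE tT)[H' tH' <-].
  have [_ tD _] := st; rewrite -exp_tD// !aE ?ipDr ?expiD//; exact: tD.
- exists (expG ((pi / ip b b) *: b)); first by apply: Te; exact: tZ.
  rewrite aE; last exact: tZ.
  rewrite ipZr divfK; last by rewrite gt_eqF ?igt0.
  by apply/eqP; rewrite /expi cospi => -[] /eqP; rewrite eqNr oner_eq0.
- exists u, v; split; first by apply/eqP => -[].
  move=> x /(torus_expE tT)[H tH <-]; have [e1 e2] := wt_exp w tH.
  by rewrite !AdE aE.
Qed.

Lemma rot_eq0 (x y : R) (u v : V) : (u, v) != (0, 0) -> x *: u = y *: v -> x *: v = - y *: u -> x = 0 /\ y = 0.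
Proof.
move=> uv e1 e2.
have h1 : (x ^+ 2 + y ^+ 2) *: u = 0.
  by rewrite scalerDl !expr2 -!scalerA e1 (scalerA x) [x * y]mulrC -scalerA e2 scaleNr scalerN addNr.
have h2 : (x ^+ 2 + y ^+ 2) *: v = 0.
  by rewrite scalerDl !expr2 -!scalerA e2 scaleNr scalerN scalerA mulrC -scalerA e1 addNr.
suff : x ^+ 2 + y ^+ 2 = 0.
  have := sqr_ge0 x; have := sqr_ge0 y => p1 p2 p3.
  by split; apply/eqP; rewrite -sqrf_eq0; apply/eqP; lra.
apply: contrapT => /eqP n0; move/eqP: h1; move/eqP: h2; rewrite !scaler_eq0 (negbTE n0) /= => /eqP v0 /eqP u0.
by move: uv; rewrite u0 v0 eqxx.
Qed.

Lemma char_root a : is_root T a -> exists2 b, isrt b & forall H, t H -> a (expG H) = expi (ip b H).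
Proof.
move=> [_ _ _ [x Tx ax] [u [v [uv0 hAd]]]].
have p0 : ip u u + ip v v != 0.
  have h (y : V) : 0 <= ip y y by have [->|/invQp/ltW//] := eqVneq y 0; rewrite ip0l.
  apply/eqP => e; have := h u; have := h v => h1 h2.
  have /ieq0 u0 : ip u u = 0 by lra.
  have /ieq0 v0 : ip v v = 0 by lra.
  by move: uv0; rewrite u0 v0 eqxx.
(* The derivative of the character, isolated by pairing with [u] and [v]: the difference quotients
   of its imaginary part converge to [c H], while those of its real part tend to [0] because the
   bracket is skew. *)
pose c H := (ip (bk H v) u - ip (bk H u) v) / (ip u u + ip v v).
have uE y : T y -> u *m AdM y = complex.Re (a y) *: u - complex.Im (a y) *: v by move=> /hAd[]; rewrite AdE.
have vE y : T y -> v *m AdM y = complex.Im (a y) *: u + complex.Re (a y) *: v by move=> /hAd[_]; rewrite AdE.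
have rel H : t H -> bk H u = - c H *: v /\ bk H v = c H *: u.
  move=> tH; pose y k := expG (2 ^- k *: H); have Ty k : T (y k) by exact: tH.
  pose X (k : nat) : R := 2 ^+ k * (complex.Re (a (y k)) - 1); pose Y (k : nat) : R := 2 ^+ k * complex.Im (a (y k)).
  have Du : (fun k => X k *: u - Y k *: v) @ \oo --> bk H u.
    have /tendsP := bk_tends H u; apply: cvg_trans; apply: near_eq_cvg; exists 0%N => // k _ /=.
    by rewrite uE//; apply/rowP => i; rewrite !mxE /X /Y; ring.
  have Dv : (fun k => Y k *: u + X k *: v) @ \oo --> bk H v.
    have /tendsP := bk_tends H v; apply: cvg_trans; apply: near_eq_cvg; exists 0%N => // k _ /=.
    by rewrite vE//; apply/rowP => i; rewrite !mxE /X /Y; ring.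
  have I (w z : V) (f : nat -> V) : f @ \oo --> w -> (fun k => ip (f k) z) @ \oo --> ip w z.
    by move=> fw; exact: (cvg_comp _ _ fw (@ip_cts z w)).
  have cX : X @ \oo --> (0 : R).
    have zz z : ip (bk H z) z = 0.
      by have /eqP := ibk H z z; rewrite iC -addr_eq0 -mulr2n mulrn_eq0 /= => /eqP.
    have -> : (0 : R) = (ip (bk H u) u + ip (bk H v) v) / (ip u u + ip v v) by rewrite !zz addr0 mul0r.
    apply: (@cvg_nat_eq _ _ (fun k => (ip (X k *: u - Y k *: v) u + ip (Y k *: u + X k *: v) v) / (ip u u + ip v v))).
      by move=> k; rewrite !ipDl ipNl !ipZl (iC v u); field.
    by apply: cvgM; [apply: cvgD; exact: I|exact: cvg_cst].
  have cY : Y @ \oo --> c H.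
    apply: (@cvg_nat_eq _ _ (fun k => (ip (Y k *: u + X k *: v) u - ip (X k *: u - Y k *: v) v) / (ip u u + ip v v))).
      by move=> k; rewrite !ipDl ipNl !ipZl (iC v u); field.
    by apply: cvgM; [apply: cvgB; exact: I|exact: cvg_cst].
  split.
    have h : (fun k => X k *: u - Y k *: v) @ \oo --> 0 *: u - c H *: v by apply: cvgB; apply: cvgZl.
    by have := cvg_unique _ Du h; rewrite scale0r sub0r scaleNr; apply; exact: norm_hausdorff.
  have h : (fun k => Y k *: u + X k *: v) @ \oo --> c H *: u + 0 *: v by apply: cvgD; apply: cvgZl.
  by have := cvg_unique _ Dv h; rewrite scale0r addr0; apply; exact: norm_hausdorff.
have nz : exists2 H, t H & c H <> 0.
  apply: contrapT => h; move/eqP: ax; apply.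
  have c0 H : t H -> c H = 0 by move=> tH; apply: contrapT => h1; apply: h; exists H.
  have tu : t u by apply: bk_t0 => H tH; rewrite (rel H tH).1 c0// oppr0 scale0r.
  have tv : t v by apply: bk_t0 => H tH; rewrite (rel H tH).2 c0// scale0r.
  have := uE x Tx; have := vE x Tx; rewrite !(torus_fix tT)//.
  case: (a x) => r i /= e2 e1.
  have [/eqP r1 i0] : r - 1 = 0 /\ i = 0.
    apply: (rot_eq0 uv0).
      by rewrite scalerBl scale1r {2}e1 opprB addrC subrK.
    by rewrite scalerBl scale1r {2}e2 opprD addrC subrK scaleNr.
  by rewrite i0; move: r1; rewrite subr_eq0 => /eqP ->.
have u0 : u <> 0.
  move=> u0; have [H tH /eqP cH] := nz; have [h1 h2] := rel H tH.
  move: h1; rewrite u0 bk0r => /esym/eqP; rewrite scaler_eq0 oppr_eq0 (negbTE cH) /= => /eqP v0.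
  by move: uv0; rewrite u0 v0 eqxx.
have [b b0 [w cb]] := wt_of_form u0 rel nz.
exists b; first by split=> //; exists u, v.
move=> H tH; have [e1 e2] := wt_exp w tH; have ort := wt_orth b0 w.
have := uE _ (Te tH); rewrite e1; case: (a (expG H)) => r i /= e3.
have uu := igt0 u0; have vv := igt0 (wt_v w).
have h1 := congr1 (fun z => ip z u) e3; have h2 := congr1 (fun z => ip z v) e3.
move: h1 h2; rewrite /= !ipDl !ipNl !ipZl (iC v u) ort !mulr0 !subr0 !sub0r => h1 /oppr_inj h2.
have uu' : ip u u != 0 by rewrite gt_eqF.
have vv' : ip v v != 0 by rewrite gt_eqF.
by rewrite /expi (mulIf uu' h1) (mulIf vv' h2).
Qed.

Lemma expi_inj b b' : t b -> t b' -> (forall H, t H -> expi (ip b H) = expi (ip b' H)) -> b = b'.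
Proof.
move=> tb tb' h; apply/eqP; rewrite -subr_eq0; apply/eqP; apply: contrapT => d0.
set d := b - b' in d0; have td : t d by exact: (subspaceB st).
have dd := igt0 d0; have := h _ (tZ (pi / ip d d) td) => e.
have : expi (ip d ((pi / ip d d) *: d)) = 1.
  by rewrite /d ipDl ipNl expiD expiN e mulfV// expi_neq0.
rewrite ipZr divfK ?gt_eqF// expi_pi => /eqP; rewrite eqNr oner_eq0//.
Qed.

(** * Simple roots and fundamental vectors *)

Section Base.
Variables (W : finType) (S : {set W}) (a : W -> G -> R[i]).
Hypothesis bs : is_base T S a.

Definition sroot (s : W) : V :=
  xget 0 [set b | isrt b /\ forall H, t H -> a s (expG H) = expi (ip b H)].

Lemma srootP s : s \in S -> isrt (sroot s) /\ forall H, t H -> a s (expG H) = expi (ip (sroot s) H).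
Proof.
move=> Ss; have [/(_ s Ss)/char_root[b rb hb] _ _] := bs.
exact: (xgetPex 0 (ex_intro (fun b => isrt b /\ _) b (conj rb hb))).
Qed.

Lemma sroot_t s : s \in S -> t (sroot s).
Proof. by case/srootP => -[_ [u [v []]]]. Qed.

Lemma t_sum (I : Type) (r : seq I) (P : pred I) (F : I -> V) : (forall i, P i -> t (F i)) ->
  t (\sum_(i <- r | P i) F i).
Proof.
have [t0 tD _] := st; move=> h; by elim/big_ind: _.
Qed.

Lemma ip_suml (I : Type) (r : seq I) (P : pred I) (F : I -> V) H :
  ip (\sum_(i <- r | P i) F i) H = \sum_(i <- r | P i) ip (F i) H.
Proof. by apply: (big_morph (fun x => ip x H)) => [x y|]; [exact: ipDl|exact: ip0l]. Qed.

Lemma prod_a (m : W -> int) H : t H ->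
  \prod_(s in S) a s (expG H) ^ m s = expi (ip (\sum_(s in S) (m s)%:~R *: sroot s) H).
Proof.
move=> tH; rewrite ip_suml (big_morph _ (@expiD R) (expi0 R)).
by apply: eq_bigr => s Ss; rewrite ipZl expiZ (srootP Ss).2.
Qed.

Lemma prod_aN (m : W -> nat) H : t H ->
  \prod_(s in S) a s (expG H) ^+ m s = expi (ip (\sum_(s in S) (m s)%:R *: sroot s) H).
Proof. exact: (@prod_a (fun s => (m s)%:Z)). Qed.

Lemma roots_comb b : isrt b -> exists m : W -> nat,
  b = \sum_(s in S) (m s)%:R *: sroot s \/ b = - \sum_(s in S) (m s)%:R *: sroot s.
Proof.
move=> rb; have tb : t b by case: rb => _ [u [v []]].
have [c rc hc] := root_char rb; have [_ /(_ c rc)[m hm] _] := bs; exists m.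
have tS : t (\sum_(s in S) (m s)%:R *: sroot s) by apply: t_sum => s Ss; apply: tZ; exact: sroot_t.
case: hm => hm; [left|right]; apply: expi_inj => //.
- move=> H tH; by rewrite -hc// (hm _ (Te tH)) prod_aN.
- by rewrite -scaleN1r; exact: tZ.
- move=> H tH; by rewrite -hc// (hm _ (Te tH)) ipNl expiN -prod_aN// -prodfV.
Qed.

(** A base is independent only for integral exponents. On the lattice of the torus the roots take
    values in the multiples of [2 pi], which gives an integral matrix; a rational relation among its
    rows clears to an integral one, so the rows are independent over the rationals, hence over the
    reals. *)
Lemma fundamental s : s \in S ->
  exists2 w, t w & forall s', s' \in S -> ip (sroot s') w = (s' == s)%:R.
Proof.
move=> Ss; have [k [f [fc fD fK fT]]] := tT.
pose rho := torus_rho fc fD.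
have rhoE x : f x = expG (rho x) := torus_exp fc fD x.
have trho x : t (rho x) by move=> c; rewrite -torus_rhoE -fT; exists (c *: x).
pose m := #|S|; pose e (i : 'I_m) := enum_val i.
have eS i : e i \in S by exact: enum_valP.
have intg i j : exists z : int, ip (sroot (e i)) (rho (delta_mx 0 j)) = z%:~R * (pi *+ 2).
  apply: expi_eq1; rewrite -(srootP (eS i)).2// -rhoE.
  have -> : f (delta_mx 0 j) = 1%g by apply/fK => l; rewrite mxE rpred_nat.
  have [/(_ _ (eS i))[_ _ aM [x Tx ax1] _] _ _] := bs.
  have n0 : a (e i) x != 0.
    by apply/eqP => z; have := torus_sub tT; case: bs => /(_ _ (eS i))[_ an _ _ _] _ _ _; have := an _ Tx; rewrite z normr0 => /esym/eqP; rewrite oner_eq0.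
  by apply: (mulfI n0); rewrite -aM ?mulg1 ?mulr1//; case: sT.
pose M : 'M[int]_(m, k) := \matrix_(i, j) sval (cid (intg i j)).
have ME i j : ip (sroot (e i)) (rho (delta_mx 0 j)) = (M i j)%:~R * (pi *+ 2).
  by rewrite mxE; exact: (svalP (cid (intg i j))).
have ipr (b : V) x : ip b (rho x) = \sum_j x 0 j * ip b (rho (delta_mx 0 j)).
  rewrite {1}(row_sum_delta x).
  have rh0 : rho 0 = 0 by rewrite /rho -(scale0r 0) torus_rhoZ scale0r.
  have H (r : seq 'I_k) : rho (\sum_(j <- r) x 0 j *: delta_mx 0 j) = \sum_(j <- r) x 0 j *: rho (delta_mx 0 j).
    elim: r => [|j r IH]; first by rewrite !big_nil.
    by rewrite !big_cons /rho torus_rhoD torus_rhoZ -/rho IH.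
  by rewrite H iC ip_suml; apply: eq_bigr => j _; rewrite ipZl iC.
have free : row_free (map_mx (intr : int -> rat) M).
  apply: inj_row_free => q qM.
  pose D : int := \prod_i denq (q 0 i).
  have D0 : D != 0 by apply/prodf_neq0 => i _; exact: denq_neq0.
  (* These are the entries of [q] multiplied by the common denominator [D]. *)
  pose z i : int := numq (q 0 i) * \prod_(j | j != i) denq (q 0 j).
  have zE i : (z i)%:~R = D%:~R * q 0 i :> rat.
    rewrite /z /D intrM numqE [X in _ = X%:~R * _](bigD1 i)//= intrM; ring.
  pose zs (s : W) : int := if pick [pred i | e i == s] is Some i then z i else 0.
  have zse i : zs (e i) = z i.
    rewrite /zs; case: pickP => [j /= /eqP /enum_val_inj -> //|/(_ i)].
    by rewrite /= eqxx.
  have zM j : \sum_i z i * M i j = 0.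
    have /matrixP/(_ 0 j) := qM; rewrite mxE [RHS]mxE => h.
    apply/eqP; rewrite -(intr_eq0 rat) rmorph_sum /=.
    have := congr1 (fun x => D%:~R * x) h; rewrite mulr0 mulr_sumr => h'.
    apply/eqP; rewrite -[RHS]h'; apply: eq_bigr => i _.
    by rewrite [X in _ = _ * (_ * X)]mxE intrM zE mulrA.
  have z0 s' : s' \in S -> zs s' = 0.
    have [_ _ indep] := bs; move=> Ss'; apply: (indep zs _ s' Ss') => x.
    rewrite -fT => -[y _ <-]; rewrite rhoE prod_a// ipr.
    rewrite (_ : \sum_j _ = 0) ?expi0//; apply: big1 => j _.
    rewrite ip_suml (_ : \sum_(s in S) _ = 0) ?mulr0//.
    transitivity (\sum_(i < m) (zs (e i))%:~R * ((M i j)%:~R * (pi *+ 2)) : R).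
      rewrite big_enum_val /=; apply: eq_bigr => i _; by rewrite ipZl ME.
    transitivity ((\sum_i z i * M i j)%:~R * (pi *+ 2) : R); last by rewrite zM mul0r.
    rewrite rmorph_sum mulr_suml; apply: eq_bigr => i _ /=.
    by rewrite zse intrM mulrA.
  apply/rowP => i; rewrite [RHS]mxE; apply/eqP.
  have := zE i; rewrite -zse z0 ?eS// => /esym/eqP; rewrite mulf_eq0 intr_eq0 (negbTE D0).
  done.
have /row_freeP[B MB] : row_free (map_mx (ratr : rat -> R) (map_mx (intr : int -> rat) M)).
  by rewrite row_free_map.
have p2 : pi *+ 2 != 0 :> R by rewrite mulrn_eq0 /= gt_eqF// pi_gt0.
have [i0 e0] : exists i0, e i0 = s by exists (enum_rank_in Ss s); rewrite /e enum_rankK_in.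
exists (rho ((pi *+ 2)^-1 *: (col i0 B)^T)) => // s' Ss'.
have [i e1] : exists i, e i = s' by exists (enum_rank_in Ss' s'); rewrite /e enum_rankK_in.
rewrite ipr -e1 -e0 (inj_eq enum_val_inj).
have := congr1 (fun X : 'M[R]_m => X i i0) MB; rewrite !mxE => <-.
apply: eq_bigr => j _; rewrite ME.
have -> : map_mx (ratr : rat -> R) (map_mx (intr : int -> rat) M) i j = (M i j)%:~R.
  by rewrite [LHS]mxE [X in ratr X]mxE ratr_int.
have -> : ((pi *+ 2)^-1 *: (col i0 B)^T) 0 j = (pi *+ 2)^-1 * B j i0 by rewrite !mxE.
move: (pi *+ 2) p2 (M i j)%:~R (B j i0) => x x0 y z; by field.
Qed.

Definition fund (s : W) : V := xget 0 [set w | t w /\ forall s', s' \in S -> ip (sroot s') w = (s' == s)%:R].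

Lemma fundP s : s \in S -> t (fund s) /\ forall s', s' \in S -> ip (sroot s') (fund s) = (s' == s)%:R.
Proof.
move=> /fundamental[w tw hw].
exact: (xgetPex 0 (ex_intro (fun w => t w /\ _) w (conj tw hw))).
Qed.

(* [rho J] lies on exactly the walls indexed by [J]. *)
Definition rhoJ (J : {set W}) : V := \sum_(s in S | s \notin J) fund s.

Lemma rhoJ_t J : t (rhoJ J).
Proof. by apply: t_sum => s /andP[Ss _]; have [] := fundP Ss. Qed.

Lemma rhoJ_ip J s : s \in S -> ip (sroot s) (rhoJ J) = (s \notin J)%:R.
Proof.
move=> Ss; rewrite iC /rhoJ ip_suml; case: (boolP (s \in J)) => sJ /=.
  apply: big1 => s' /andP[Ss' s'J]; rewrite iC (fundP Ss').2//.
  by case: eqP => // e; move: s'J; rewrite -e sJ.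
rewrite (bigD1 s) ?Ss ?sJ//= iC (fundP Ss).2// eqxx big1 ?addr0// => s' /andP[/andP[Ss' _] s's].
by rewrite iC (fundP Ss').2// eq_sym (negbTE s's).
Qed.

Lemma comb_rhoJ (m : W -> nat) J : ip (\sum_(s in S) (m s)%:R *: sroot s) (rhoJ J) = \sum_(s in S | s \notin J) (m s)%:R.
Proof.
rewrite ip_suml [RHS]big_mkcondr; apply: eq_bigr => s Ss; rewrite ipZl rhoJ_ip//.
by case: ifP; rewrite ?mulr1 ?mulr0.
Qed.

(** The pairing is, up to sign, the sum of the nonnegative coefficients of the root. *)
Lemma rho0_regular b : isrt b -> ip b (rhoJ finset.set0) <> 0.
Proof.
move=> rb; have [b0 _] := rb; have [m hm] := roots_comb rb => h; apply: b0.
have : \sum_(s in S | s \notin finset.set0) (m s)%:R = 0 :> R.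
  rewrite -(comb_rhoJ m finset.set0); case: hm => E; rewrite E ?ipNl in h => //.
  by apply/eqP; rewrite -oppr_eq0 h.
move/eqP; rewrite psumr_eq0// => /allP h0.
suff E0 : \sum_(s in S) (m s)%:R *: sroot s = 0 by case: hm => ->; rewrite E0 ?oppr0.
apply: big1 => s Ss; have := h0 s (mem_index_enum _); rewrite Ss inE /= => /eqP ->.
by rewrite scale0r.
Qed.

Lemma centralizer_subspace X : is_subspace (fun B => bk X B = 0).
Proof.
split; first exact: bk0r.
  by move=> x y hx hy; rewrite bkDr hx hy addr0.
by move=> k x hx; rewrite bkZr hx scaler0.
Qed.

Lemma centralizer_Tstable X : t X -> Tstable (fun B => bk X B = 0).
Proof.
move=> tX x y Tx hy; have <- : X *m AdM x = X by exact: (torus_fix tT).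
by rewrite bk_Ad hy mul0mx.
Qed.

Lemma regular_t B : bk (rhoJ finset.set0) B = 0 -> t B.
Proof.
apply: (@weight_span (fun B => bk (rhoJ finset.set0) B = 0) t) => //.
- exact: centralizer_subspace.
- by apply: centralizer_Tstable; exact: rhoJ_t.
- by move=> x y Tx ty; rewrite (torus_fix tT).
- move=> b u v hu _ b0 w; have [tb u0 uv hw] := w; exfalso.
  apply: (@rho0_regular b); first by split=> //; exists u, v.
  have [h1 _] := hw _ (rhoJ_t finset.set0); move: hu; rewrite h1 => /eqP.
  rewrite scaler_eq0 oppr_eq0 => /orP[/eqP//|/eqP v0]; by case: (wt_v w v0).
- by move=> H tH; apply: bk_tt => //; exact: rhoJ_t.
Qed.

End Base.
Lemma AdMv (v : V) g h : v *m AdM (g * h)%g = v *m AdM h *m AdM g.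
Proof. by rewrite AdMM mulmxA. Qed.

Lemma LieS_mono (H K : set G) v : H `<=` K -> LieS H v -> LieS K v.
Proof. by move=> HK h s; exact: HK. Qed.

Lemma LieS_exp H v : LieS H v -> H (expG v).
Proof. by move=> /(_ 1); rewrite scale1r. Qed.

Lemma norm_t g H : normalizer T g -> t H -> t (H *m AdM g).
Proof.
move=> ng tH s; apply/ng; rewrite scalemxAl -expG_conj conjgE.
by rewrite !mulgA mulVg mul1g mulgKV; exact: tH.
Qed.

Lemma normV g : normalizer T g -> normalizer T g^-1%g.
Proof. by move=> ng x; apply: iff_sym; rewrite -{2}(conjgKV g x); exact: ng. Qed.

Variable X : V.
Hypothesis tX : t X.
Hypothesis Xreg : forall B, bk X B = 0 -> t B.

(** As [t] contains the centralizer of [X], vectors of [t] transported back by [g] commute with [X]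
    and so lie in [t]; equality of ranks gives the converse inclusion. *)
Lemma reg_norm g : t (X *m AdM g) -> normalizer T g.
Proof.
move=> tXg.
have sub H : t H -> t (H *m AdM g^-1%g).
  move=> tH; apply: Xreg; rewrite -(AdM_VK g X) bk_Ad.
  by rewrite (bk_tt tXg tH) mul0mx.
have [M MP] := subspace_mx st.
have le1 : (M *m AdM g^-1%g <= M)%MS.
  apply/row_subP => i; rewrite row_mul; apply/MP/sub/MP; exact: row_sub.
have un : AdM g^-1%g \in unitmx.
  by have := mulmx1_unit (AdM_V g) => -[].
have le2 : (M <= M *m AdM g^-1%g)%MS.
  by rewrite -(geq_leqif (mxrank_leqif_sup le1)) mxrankMfree ?row_free_unit.
have sup H : t H -> t (H *m AdM g).
  move=> /MP tH; apply/MP; have := submx_trans tH le2 => /submxP[D ->].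
  by rewrite -!mulmxA -{2}(invgK g) AdM_V mulmx1; exact: submxMl.
move=> y; split=> [/(torus_expE tT)[v tv <-]|].
  have -> : (expG v ^ g = expG (v *m AdM g^-1))%g by rewrite -expG_conj invgK conjgE mulgA.
  by apply: LieS_exp; exact: sub.
move=> /(torus_expE tT)[v tv e].
have -> : y = expG (v *m AdM g) by rewrite -expG_conj e conjgE !mulgA mulgV mul1g mulgK.
by apply: LieS_exp; exact: sup.
Qed.

(** Hunt's lemma moves [X *m AdM g] inside [Q] to a vector commuting with the regular [X], hence
    into [t]. *)
Lemma hunt_norm Q g : is_subgroup Q -> closed Q -> T `<=` Q -> LieS Q (X *m AdM g) ->
  exists2 m, Q m & normalizer T (m * g)%g.
Proof.
move=> sQ cQ TQ Xg.
have [m Qm h] := hunt_commute invQp invQi sQ cQ Xg (LieS_mono TQ tX).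
exists m => //; apply: reg_norm; apply: Xreg; by rewrite AdMM mulmxA.
Qed.

(* If [Ad g] maps a family in [t] into [t], Hunt's lemma in the common stabilizer of the images
   corrects [g] to an element of the normalizer. *)
Lemma conj_family (I : Type) (u : I -> V) g : (forall i, t (u i)) -> (forall i, t (u i *m AdM g)) ->
  exists2 h, normalizer T h & forall i, u i *m AdM h = u i *m AdM g.
Proof.
move=> tu tug; pose Q : set G := \bigcap_i [set q | u i *m AdM g *m AdM q = u i *m AdM g].
have cQ : closed Q by apply: closed_bigI => i _; exact: closed_Ad_eq.
have sQ : is_subgroup Q.
  split=> [i I0|x y hx hy i I0|x hx i I0] /=; first by rewrite AdM1 mulmx1.
    by rewrite AdMv; rewrite (hy i I0) (hx i I0).
  by rewrite -{1}(hx i I0); rewrite AdM_VK.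
have TQ : T `<=` Q by move=> x Tx i _ /=; exact: (torus_fix tT (tug i) Tx).
have XQ : LieS Q (X *m AdM g).
  move=> s i _ /=; apply: (bk0_fix); by rewrite bk_Ad (bk_tt tX (tu i)) mul0mx.
have [m Qm nm] := hunt_norm sQ cQ TQ XQ.
exists (m * g)%g => [|i]; [exact: nm | by rewrite AdMv; exact: (Qm i Logic.I)].
Qed.

Definition Tconj : set G := [set x | exists g y, T y /\ x = (g * y * g^-1)%g].

Lemma Tconj_conj g x : Tconj x -> Tconj (g * x * g^-1)%g.
Proof.
by move=> [h [y [Ty ->]]]; exists (g * h)%g, y; rewrite invgM !mulgA.
Qed.

(** The vector [v] is moved into [t] by Hunt's lemma inside the centralizer of [y], which leaves [y]
    in place. *)
Lemma Tconj_mul_exp y v : T y -> v *m AdM y = v -> Tconj (y * expG v)%g.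
Proof.
move=> Ty yv; pose Q := [set g : G | (g * y = y * g)%g].
have sQ := cent_subgroup y; have cQ := @closed_cent y.
have TQ : T `<=` Q by move=> x Tx; rewrite /Q /=; exact: (torus_comm tT Tx Ty).
have vQ : LieS Q v by move=> s; rewrite /Q /=; apply/esym; move: s; apply/AdM_fix_commute.
have [m Qm h] := hunt_commute invQp invQi sQ cQ vQ (LieS_mono TQ tX).
exists m^-1%g, (y * expG (v *m AdM m))%g; split.
  have [_ TM _] := sT; apply: TM => //; apply: LieS_exp; exact: Xreg.
rewrite -expG_conj invgK !mulgA mulgKV; rewrite /= in Qm.
by rewrite -(mulgA m^-1%g y m) -Qm mulKg.
Qed.

Lemma Tconj_closed : closed Tconj.
Proof.
have -> : Tconj = (fun p : G * G => p.1 * p.2 * p.1^-1)%g @` ([set: G] `*` T).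
  apply/seteqP; split=> [x [g [y [Ty ->]]]|_ [[g y] [_ /= Ty] <-]]; last by exists g, y.
  by exists (g, y).
apply: compact_closed; first exact: lie_hausdorff.
apply: continuous_compact; last by apply: compact_setX => //; exact: torus_cpt tT.
apply: continuous_subspaceT => p; apply: cvgMg; first apply: cvgMg.
- exact: cvg_fst.
- exact: cvg_snd.
- by apply: cvgVg; exact: cvg_fst.
Qed.

(** The products [exp Y * (y * exp U) * exp (- Y)], with [U] fixed by [y], are conjugate into [T],
    and they fill a neighbourhood of [y] because the derivative [Y (A - 1) + U] is onto. *)
Lemma Tconj_near y : T y -> nbhs y Tconj.
Proof.
move=> Ty; have [Ei [Ei0 Eis [rho rho0 EiP]]] := exp_strict.
pose A := AdM y^-1%g; have AA : A *m AdM y = 1%:M by rewrite /A -{2}(invgK y) AdM_V.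
have [Z ZP] : exists Z : 'M[R]_n, forall v : V, v *m AdM y = v <-> (v <= Z)%MS.
  apply: subspace_mx; split; first by rewrite mul0mx.
    by move=> u v hu hv; rewrite mulmxDl hu hv.
  by move=> c u hu; rewrite -scalemxAl hu.
pose L := col_mx (A - 1%:M) Z.
(* By invariance of the product, a vector orthogonal to the image of [A - 1] is fixed by [y], so the
   image and the fixed space together span everything. *)
have [B BL] : exists B, B *m L = 1%:M.
  apply/row_fullP; rewrite -sub1mx; apply/row_subP => i.
  move: (row i 1%:M) => v.
  have sI : is_subspace (fun w : V => (w <= A - 1%:M)%MS).
    split; first exact: sub0mx.
      by move=> ? ?; exact: addmx_sub.
    by move=> ? ?; exact: scalemx_sub.
  have [p [b [pP bP ->]]] := orth_decomp invQs invQp sI v.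
  rewrite -addsmxE; apply: addmx_sub; first exact: submx_trans pP (addsmxSl _ _).
  apply: submx_trans (addsmxSr _ _); apply/ZP/eqP; rewrite -subr_eq0; apply/eqP.
  apply: (ieq0); set w := _ - _.
  have := bP (w *m (A - 1%:M)) (submxMl _ _); rewrite mulmxBr mulmx1 ipDl ipNl.
  rewrite -(iAd y (w *m A) b) -mulmxA.
  by rewrite AA mulmx1 -ipNr -ipDr.
pose f (w : 'rV[R]_(n + n)) := Ei (w *m col_mx A 0).
pose f2 (w : 'rV[R]_(n + n)) := Ei (w *m col_mx 0 Z).
pose f3 (w : 'rV[R]_(n + n)) := Ei (w *m col_mx (- 1%:M) 0).
have lin (M : 'M[R]_(n + n, n)) : Ei (0 *m M) = 0 /\ strict_diff (fun w => Ei (w *m M)) 0 M.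
  split; first by rewrite mul0mx.
  have h := strict_diff_affine M 0 0.
  have hE : strict_diff Ei (0 *m M + 0) 1%:M by rewrite mul0mx addr0.
  have := strict_diff_comp h hE; rewrite mulmx1; apply: (@strict_diff_near _ _ _ _ _ _ _ 1) => // x _ /=.
  by rewrite addr0.
have [f0 fs] := lin (col_mx A 0); have [f20 f2s] := lin (col_mx 0 Z).
have [f30 f3s] := lin (col_mx (- 1%:M) 0).
have gs := strict_mu f0 f20 fs f2s.
have mu0 : mu (row_mx (f 0) (f2 0)) = 0.
  by rewrite /f /f2 f0 f20 /mu !(row_mxKl, row_mxKr) psi0 mulg1 phi1.
have Fs := strict_mu mu0 f30 gs f3s.
have eL : col_mx A 0 + col_mx 0 Z + col_mx (- 1%:M) 0 = L.
  by rewrite !add_col_mx addr0 add0r addr0.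
rewrite eL in Fs; move: Fs; set F := fun w => _ => Fs.
have F0 : F 0 = 0 by rewrite /F -/(f 0) -/(f2 0) mu0 f30 /mu !(row_mxKl, row_mxKr) psi0 mulg1 phi1.
have [r1 r10 muP] := mu_psi.
have [e1 e10 h1] := strict_diff_small fs r10.
have [e2 e20 h2] := strict_diff_small f2s r10.
have [e3 e30 h3] := strict_diff_small f3s r10.
have [e4 e40 h4] := strict_diff_small gs r10.
have sm (M : 'M[R]_(n + n, n)) : exists2 e, 0 < e & forall w : 'rV[R]_(n + n), `|w| < e -> `|w *m M| < rho.
  have [e e0 he] := strict_diff_small (strict_diff_affine M 0 0) rho0.
  by exists e => // w we; have := he w; rewrite mul0mx !addr0 !subr0; exact.
have [e5 e50 h5] := sm (col_mx A 0); have [e6 e60 h6] := sm (col_mx 0 Z).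
have [e7 e70 h7] := sm (col_mx (- 1%:M) 0).
pose e := \big[Num.min/e1]_(i <- [:: e2; e3; e4; e5; e6; e7]) i.
have e0 : 0 < e by rewrite /e !big_cons big_nil !lt_min e10 e20 e30 e40 e50 e60 e70.
have eP w : `|w| < e -> Tconj (y * psi (F w))%g.
  rewrite /e !big_cons big_nil !lt_min => /andP[w2 /andP[w3 /andP[w4 /andP[w5 /andP[w6 /andP[w7 w1]]]]]].
  have g1 : `|f w| < r1 by have := h1 w; rewrite subr0 => /(_ w1); rewrite [X in _ - X]f0 subr0.
  have g2 : `|f2 w| < r1 by have := h2 w; rewrite subr0 => /(_ w2); rewrite [X in _ - X]f20 subr0.
  have g3 : `|f3 w| < r1 by have := h3 w; rewrite subr0 => /(_ w3); rewrite [X in _ - X]f30 subr0.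
  have g4 : `|mu (row_mx (f w) (f2 w))| < r1.
    by have := h4 w; rewrite subr0 => /(_ w4); rewrite [X in _ - X]mu0 subr0.
  rewrite /F muP ?g4 ?g3// muP ?g1 ?g2//.
  have [<- _ _ _] := EiP _ (h5 w w5); have [<- _ _ _] := EiP _ (h6 w w6).
  have [<- _ _ _] := EiP _ (h7 w w7).
  rewrite -(hsubmxK w) !mul_row_col !mulmx0 addr0 add0r addr0 mulmxN mulmx1 expGN.
  move: (lsubmx w) (rsubmx w) => Y U.
  have -> : (y * (expG (Y *m A) * expG (U *m Z) * (expG Y)^-1) =
      expG Y * (y * expG (U *m Z)) * (expG Y)^-1)%g.
    rewrite !mulgA; congr (_ * _ * _)%g; apply: (mulIg y^-1%g); rewrite expG_conj -mulmxA.
    by rewrite AA mulmx1 mulgK.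
  by apply/Tconj_conj/Tconj_mul_exp => //; apply/ZP; exact: submxMl.
have [d d0 dP] := strict_surj F0 Fs BL e0.
have c3 := @cvg_phi_mulVg y _ (nbhs_dist_lt (0 : V) d0).
apply: filterS2 (near_dom_mulVg y) c3 => z dz; rewrite /= sub0r normrN => hz.
have [w we Fw] := dP _ hz; have := eP w we; by rewrite Fw phiK// mulVKg.
Qed.

Lemma Tconj_open : open Tconj.
Proof.
rewrite openE => x [g [y [Ty ->]]] /=.
have c : (fun z => g^-1 * z * g)%g @ (g * y * g^-1)%g --> y.
  have e : (g^-1 * (g * y * g^-1) * g = y)%g by rewrite !mulgA mulVg mul1g mulgKV.
  rewrite -{2}e; apply: cvgMg; last exact: cvg_cst.
  by apply: cvgMg; [exact: cvg_cst | exact: cvg_id].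
suff : nbhs (g * y * g^-1)%g Tconj by [].
have := c _ (Tconj_near Ty); apply: (@filterS _ _ (nbhs_filter _)) => z /= h.
by have := Tconj_conj g h; rewrite !mulgA mulgV mul1g mulgK.
Qed.

Hypothesis con : connected [set: G].

(** The maximal torus theorem: the union of the conjugates is nonempty, open and closed in a
    connected group. *)
Lemma Tconj_all x : Tconj x.
Proof.
have -> // : Tconj = [set: G].
apply: con.
- by exists 1%g; exists 1%g, 1%g; have [T1 _ _] := sT; split; [exact: T1 | rewrite mul1g mulgV].
- by exists Tconj; [exact: Tconj_open | rewrite setTI].
- by exists Tconj; [exact: Tconj_closed | rewrite setTI].
Qed.

(** Write [k] as a conjugate by [g] of an element of [T]. The centralizer of [k] contains both [T]
    and its conjugate, so Hunt's lemma there corrects [g] to a normalizing element without moving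
    [k]. *)
Lemma torus_self_centralizing k : (forall x, T x -> (k * x = x * k)%g) -> T k.
Proof.
move=> kT; have [g [y [Ty ky]]] := Tconj_all k.
pose Q := [set h : G | (h * k = k * h)%g].
have TQ : T `<=` Q by move=> x Tx; rewrite /Q /= kT.
have XQ : LieS Q (X *m AdM g).
  move=> s; rewrite /Q /= scalemxAl -expG_conj ky !mulgA !mulgKV; congr (_ * _)%g.
  by rewrite -!mulgA; congr (_ * _)%g; apply: (torus_comm tT) => //; exact: tX.
have [m Qm nm] := hunt_norm (cent_subgroup k) (@closed_cent k) TQ XQ.
apply/nm; rewrite conjgM; rewrite /= in Qm.
have -> : (k ^ m = k)%g by rewrite conjgE -Qm mulKg.
by rewrite ky conjgE !mulgA mulVg mul1g mulgKV.
Qed.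
End MaximalTorus.

(** * Fixed points of the torus by iterated involutions *)

Section TorusFixed.
Lemma nat_seq_min (u : nat -> nat) : exists m, forall k, (u m <= u k)%N.
Proof.
have ex : exists r, `[< exists m, u m = r >] by exists (u 0%N); apply/asboolP; exists 0%N.
case: (ex_minnP ex) => x /asboolP[m <-] xmin; exists m => k; apply: xmin.
by apply/asboolP; exists k.
Qed.

Lemma half_pow m : 2 ^- m = 2 ^- m.+1 + 2 ^- m.+1 :> R.
Proof. by rewrite exprS invfM; move: ((2 ^+ m)^-1) => x; field. Qed.

(* The subspaces fixed by [exp (2^-m v)] decrease, hence are eventually constant. *)
Lemma fix_exp_stable (v : V) : exists m : nat, forall u : V,
  u *m AdM (expG (2 ^- m *: v)) = u -> forall s, u *m AdM (expG (s *: v)) = u.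
Proof.
pose M m := kermx (AdM (expG (2 ^- m *: v)) - 1%:M).
have MP m (u : V) : (u <= M m)%MS <-> u *m AdM (expG (2 ^- m *: v)) = u.
  split=> [/sub_kermxP/eqP|h]; first by rewrite mulmxBr mulmx1 subr_eq0 => /eqP.
  by apply/sub_kermxP; rewrite mulmxBr mulmx1 h subrr.
have dec m : (M m.+1 <= M m)%MS.
  apply/row_subP => i; apply/MP; have /MP := row_sub i (M m.+1); move: (row i _) => u h.
  have -> : expG (2 ^- m *: v) = (expG (2 ^- m.+1 *: v) * expG (2 ^- m.+1 *: v))%g.
    rewrite -expG_add; congr (expG (_ *: v)); exact: half_pow.
  by rewrite AdMv h h.
have dec' m k : (M (m + k)%N <= M m)%MS.
  elim: k => [|k IH]; first by rewrite addn0; exact: submx_refl.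
  by rewrite addnS; exact: submx_trans (dec _) IH.
have [m mP] := nat_seq_min (fun m => \rank (M m)).
have eqM k : (M m <= M (m + k)%N)%MS.
  by rewrite -(geq_leqif (mxrank_leqif_sup (dec' m k))).
exists m => u /MP um; apply: (bk0_fix).
have all k : (m <= k)%N -> u *m AdM (expG (2 ^- k *: v)) - u = 0.
  by move=> mk; apply/eqP; rewrite subr_eq0; apply/eqP/MP; rewrite -(subnKC mk); exact: submx_trans um (eqM _).
apply/eqP; rewrite -normr_le0; apply/ler_addgt0Pr => e e0; rewrite add0r.
have [k0 hk] := bk_tends v u e0; have := hk (maxn k0 m) (leq_maxl _ _).
by rewrite all ?leq_maxr// scaler0 sub0r normrN.
Qed.

Variables (P : finType).
Local Notation V0 := 'rV[R]_(#|P| + #|P| * n).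
Lemma tau_sig : {tau : G -> V0 -> V0 | (forall g y J, pl (tau g y) J = pl y J) /\
  forall g y J, pz (tau g y) J = pz y J *m AdM g}.
Proof.
by exists (fun g y => mk (pl y) (fun J => pz y J *m AdM g)); split=> *; [exact: pl_mk | exact: pz_mk].
Qed.

Definition tau : G -> V0 -> V0 := sval tau_sig.

Lemma pl_tau g y J : pl (tau g y) J = pl y J. Proof. by case: (svalP tau_sig). Qed.
Lemma pz_tau g y J : pz (tau g y) J = pz y J *m AdM g. Proof. by case: (svalP tau_sig). Qed.

Lemma tauM g h y : tau (g * h)%g y = tau g (tau h y).
Proof. by apply: model_eq => J; [rewrite !pl_tau | rewrite !pz_tau AdMv]. Qed.

Lemma tau1 y : tau 1%g y = y.
Proof. by apply: model_eq => J; [rewrite pl_tau | rewrite pz_tau AdM1 mulmx1]. Qed.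

Lemma tau_fixP g y : tau g y = y <-> forall J, pz y J *m AdM g = pz y J.
Proof.
split=> [h J|h]; first by rewrite -{2}h pz_tau.
by apply: model_eq => J; [rewrite pl_tau | rewrite pz_tau h].
Qed.

Lemma tau_lip g : exists2 L, 1 <= L & forall x y, `|tau g x - tau g y| <= L * `|x - y|.
Proof.
exists (1 + n%:R * `|AdM g|); first by rewrite lerDl mulr_ge0.
move=> x y; have L1 : 1 <= 1 + n%:R * `|AdM g| by rewrite lerDl mulr_ge0.
have nonneg := mulr_ge0 (le_trans ler01 L1) (normr_ge0 (x - y)).
apply: model_norm => // J.
  rewrite plB !pl_tau -plB; apply: le_trans (pl_norm _ _) _; exact: ler_peMl.
rewrite pzB !pz_tau -mulmxBl -pzB; apply: le_trans (mulmx_norm_le _ _) _.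
apply: (@le_trans _ _ (n%:R * `|AdM g| * `|x - y|)).
  rewrite -mulrA ler_wpM2l// mulrC ler_wpM2l//; exact: pz_norm.
by rewrite ler_wpM2r// lerDr.
Qed.

Lemma tau_continuous g : continuous (tau g).
Proof.
have [L L1 tL] := tau_lip g.
by move=> x; apply: (@ball_lipschitz_continuous _ _ _ _ L 1 x) => // y _; exact: tL.
Qed.

Lemma closed_tau_fix g : closed [set y | tau g y = y].
Proof.
have -> : [set y | tau g y = y] = [set y : V0 | `|tau g y - y| = 0].
  by apply/seteqP; split=> y /= => [->|/normr0_eq0/eqP]; rewrite ?subrr ?normr0// subr_eq0 => /eqP.
apply: closed_preim_eq; exact: (norm_sub_continuous (@tau_continuous g) (@cont_id _)).
Qed.

Variable T : set G.
Hypothesis tT : is_torus T.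

Definition good (Z : set V0) := [/\ compact Z, (forall y x, Z y -> T x -> Z (tau x y)) & acyclic Z].

Lemma tauC x x' y : T x -> T x' -> tau x (tau x' y) = tau x' (tau x y).
Proof. by move=> Tx Tx'; rewrite -!tauM (torus_comm tT Tx Tx'). Qed.

(** Only on [Z] need [x] act as an involution: in the iteration [Z] is already the fixed set of the
    square of [x]. *)
Lemma good_fix Z x : good Z -> T x -> (forall y, Z y -> tau x (tau x y) = y) ->
  good [set y | Z y /\ tau x y = y].
Proof.
move=> [cZ sZ aZ] Tx inv.
have cF : compact [set y | Z y /\ tau x y = y].
  have -> : [set y | Z y /\ tau x y = y] = Z `&` [set y | tau x y = y] by [].
  by apply: compact_closedI => //; exact: closed_tau_fix.
split; first exact: cF.
  by move=> y x' /= [Zy xy] Tx'; split; [exact: sZ | rewrite (tauC y Tx Tx') xy].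
have [L L1 tL] := tau_lip x.
apply: (@smith_fixed_acyclic _ _ Z (tau x) L) => //; first by move=> y Zy; exact: sZ.
move=> e e0.
(* Points of [Z] at distance at least [e] from the fixed set form a compact set, on which the
   displacement is bounded below; this is the retraction hypothesis of Smith theory. *)
pose E := Z `&` [set y : V0 | forall z, `[< Z z /\ tau x z = z >] -> e <= `|y - z| ].
have cE : compact E.
  apply: compact_closedI => //; apply: closed_forall => z; apply: closed_imply; apply: closed_preim_ge.
  exact: (norm_sub_continuous (@cont_id _) (@cont_cst _ _ _)).
have cf : continuous (fun y : V0 => `|y - tau x y|).
  exact: (norm_sub_continuous (@cont_id _) (@tau_continuous x)).
have pE y : E y -> 0 < `|y - tau x y|.
  move=> [Zy hy]; rewrite lt_neqAle normr_ge0 andbT eq_sym normr_eq0 subr_eq0; apply/eqP => yx.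
  have fy : `[< Z y /\ tau x y = y >] by apply/asboolP.
  by have := hy y fy; rewrite subrr normr0 leNgt e0.
have [d d0 dP] := compact_pos cE cf pE.
exists d => // y Zy yd; apply: contrapT => no.
have : E y.
  split=> //= z /asboolP[Zz xz]; rewrite leNgt; apply/negP => yz; apply: no; by exists z.
by move=> /dP; rewrite leNgt yd.
Qed.

Lemma good_eq Z Z' : (forall y, Z y <-> Z' y) -> good Z -> good Z'.
Proof. by move=> h; have -> : Z = Z' by apply/seteqP; split=> y /h. Qed.

Variables (k : nat) (f : 'rV[R]_k -> G).
Hypotheses (fc : continuous f) (fD : {morph f : x y / x + y >-> (x * y)%g}).
Hypothesis fK : forall x, f x = 1%g <-> forall i, x 0 i \is a Num.int.
Hypothesis fT : f @` [set: 'rV[R]_k] = T.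

Lemma torus_mem x : T (f x). Proof. by rewrite -fT; exists x. Qed.

Lemma good_root Z (i : 'I_k) m : good Z ->
  good [set y | Z y /\ tau (f (2 ^- m *: delta_mx 0 i)) y = y].
Proof.
move=> gZ; elim: m => [|m IH].
  apply: good_eq gZ => y; rewrite expr0 invr1 scale1r /=.
  have -> : f (delta_mx 0 i) = 1%g by apply/fK => j; rewrite !mxE; case: eqP => // _; rewrite ?rpred1 ?rpred0; case: eqP.
  by rewrite tau1; split=> [|[]].
have sq : f (2 ^- m *: delta_mx 0 i) = (f (2 ^- m.+1 *: delta_mx 0 i) * f (2 ^- m.+1 *: delta_mx 0 i))%g.
  rewrite -fD -scalerDl; congr (f (_ *: _)); exact: half_pow.
apply: good_eq (good_fix IH (torus_mem (2 ^- m.+1 *: delta_mx 0 i)) _) => [y /=|y [Zy h]].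
  rewrite sq tauM; split=> [[[Zy _] h]|[Zy h]]; first by split.
  by split=> //; split=> //; rewrite h h.
by rewrite -tauM -sq.
Qed.

(** Being fixed is a linear condition on each vector coordinate, so for a root of sufficiently high
    2-power order it amounts to being fixed by the whole circle; finitely many involutions
    suffice. *)
Lemma good_circle Z (i : 'I_k) : good Z ->
  good [set y | Z y /\ forall s, tau (f (s *: delta_mx 0 i)) y = y].
Proof.
move=> gZ; have [m hm] := fix_exp_stable (torus_rho fc fD (delta_mx 0 i)).
apply: good_eq (good_root i m gZ) => y /=; split=> [[Zy h]|[Zy h]]; (split; first exact: Zy); last exact: h.
move=> s.
rewrite (torus_rhoE fc fD); apply/tau_fixP => J; apply: hm.
by rewrite -(torus_rhoE fc fD); move: J; apply/tau_fixP.
Qed.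

Lemma good_torus Z : good Z -> good [set y | Z y /\ forall x, T x -> tau x y = y].
Proof.
move=> gZ.
have h (s : seq 'I_k) : good [set y | Z y /\ forall i, i \in s -> forall c, tau (f (c *: delta_mx 0 i)) y = y].
  elim: s => [|i s IH]; first by apply: good_eq gZ => y /=; split=> [|[]].
  apply: good_eq (good_circle i IH) => y /=; split=> [[[Zy h1] h2]|[Zy h]].
    by split; [exact: Zy | move=> j; rewrite inE => /orP[/eqP ->|/h1]; [exact: h2|]].
  split; last by apply: h; rewrite mem_head.
  by split; [exact: Zy | move=> j js; apply: h; rewrite inE js orbT].
apply: good_eq (h (enum 'I_k)) => y /=; split=> [[Zy hy]|[Zy hy]]; (split; first exact: Zy); last first.
  by move=> i _ c; apply: hy; exact: torus_mem.
move=> x; rewrite -fT => -[v _ <-]; rewrite (row_sum_delta v).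
apply: (big_ind (fun u => tau (f u) y = y)).
- by rewrite (torus_f0 fD) tau1.
- by move=> u u' hu hu'; rewrite fD tauM hu' hu.
- by move=> i _; apply: hy; rewrite mem_enum.
Qed.
End TorusFixed.

End LieTheory.

(** * The Weyl complex *)

Section WeylGroup.
Local Notation repr := generic_quotient.repr.
Local Notation subsetP := fintype.subsetP.
Local Notation sub0set := finset.sub0set.
Variables (R : realType) (G : lie_group R).
Hypothesis cG : compact [set: G].
Hypothesis con : connected [set: G].
Local Notation n := (Defs.dim G).
Local Notation V := 'rV[R]_n.
Local Notation AdM := (@AdM R G).
Local Notation expG := (@expG R G).
Local Notation bk := (@bk R G).
Local Notation ip := (ip (invQ cG)).
Variables (W : finGroupType) (S : {set W}) (T : set G) (a : W -> G -> R[i]) (r : W -> G).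
Hypothesis cox : coxeter_system S.
Hypothesis wey : is_weyl_system S T a r.
Local Notation t := (LieS T).
Local Notation sroot := (sroot cG T a).
Local Notation fund := (fund cG T S a).
Local Notation rhoJ := (rhoJ cG T S a).
Local Notation wt := (wt cG T).
Local Notation isrt := (isrt cG T).

Let mT : maximal_torus T. Proof. by case: wey. Qed.
Let bs : is_base T S a. Proof. by case: wey. Qed.
Let rN w : normalizer T (r w). Proof. by case: wey => _ _ []. Qed.
Let rM v w : T ((r v * r w)^-1 * r (v * w))%g. Proof. by case: wey => _ _ []. Qed.
Let r_inj w : T (r w) -> w = 1%g. Proof. by case: wey => _ _ [_ _ h _] _; exact: h. Qed.
Let rsurj g : normalizer T g -> exists w, T ((r w)^-1 * g)%g. Proof. by case: wey => _ _ [_ _ _ h] _; exact: h. Qed.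
Let rs s : s \in S -> root_centralizer T (a s) (r s). Proof. by case: wey => _ _ _; exact. Qed.
Let genW : <<S>>%g = [set: W]%SET. Proof. by case: cox. Qed.
Let invS : {in S, forall s, #[s]%g = 2}. Proof. by case: cox. Qed.
Let tT : is_torus T. Proof. by case: mT. Qed.
Let cT : closed T. Proof. exact: torus_closed tT. Qed.
Let sT : is_subgroup T. Proof. exact: torus_sub tT. Qed.
Let st : is_subspace t. Proof. exact: LieS_subspace. Qed.
Let tZ c H : t H -> t (c *: H). Proof. by have [_ _ h] := st; exact: h. Qed.
Let tB H H' : t H -> t H' -> t (H - H'). Proof. exact: subspaceB. Qed.

Let Tr1 : T (r 1%g).
Proof.
have [_ _ TV] := sT; rewrite -[r 1%g]invgK; apply: TV.
by have := rM 1%g 1%g; rewrite mulg1 invgM -mulgA mulVg mulg1.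
Qed.

Let rt J : t (rhoJ J). Proof. exact: rhoJ_t. Qed.
Let reg := @regular_t _ _ cG _ mT _ _ _ bs.
Let srt s : s \in S -> isrt (sroot s). Proof. by move=> /(srootP cG mT bs)[]. Qed.

(** * The Weyl group acting on the Lie algebra of the torus *)

Section WeylAction.
Definition act (w : W) (H : V) : V := H *m AdM (r w).

Lemma act_t w H : t H -> t (act w H). Proof. exact: norm_t (rN w). Qed.

(** Representatives multiply up to an element of [T], and [T] acts trivially on [t]. *)
Lemma actM v w H : t H -> act (v * w)%g H = act v (act w H).
Proof.
move=> tH; rewrite /act; have -> : r (v * w)%g = ((r v * r w) * ((r v * r w)^-1 * r (v * w)))%g.
  by rewrite mulVKg.
by rewrite AdMv (torus_fix tT tH (rM v w)) AdMv.
Qed.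

Lemma act1 H : t H -> act 1%g H = H.
Proof. by move=> tH; exact: (torus_fix tT tH). Qed.

Lemma actK w H : t H -> act w^-1%g (act w H) = H.
Proof. by move=> tH; rewrite -actM// mulVg act1. Qed.

Lemma act_ip w H H' : ip (act w H) (act w H') = ip H H'. Proof. exact: iAd. Qed.

Lemma actB w H H' : act w (H - H') = act w H - act w H'. Proof. exact: mulmxBl. Qed.
Lemma actD w H H' : act w (H + H') = act w H + act w H'. Proof. exact: mulmxDl. Qed.
Lemma actZ w c H : act w (c *: H) = c *: act w H. Proof. by rewrite /act -scalemxAl. Qed.
Lemma actN w H : act w (- H) = - act w H. Proof. exact: mulNmx. Qed.

(** Such a [g] commutes with [T], which is its own centralizer in the connected group [G]. *)
Lemma centT g : (forall H, t H -> H *m AdM g = H) -> T g.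
Proof.
move=> h; apply: (torus_self_centralizing cG mT (rt finset.set0) reg con).
move=> x /(torus_expE tT)[v tv <-]; have := (AdM_fix_commute g v).1 (h v tv) 1.
by rewrite scale1r.
Qed.

Lemma act_faithful w : (forall H, t H -> act w H = H) -> w = 1%g.
Proof. by move=> h; apply: r_inj; exact: centT. Qed.

Lemma act_inj v w : (forall H, t H -> act v H = act w H) -> v = w.
Proof.
move=> h; apply: (mulgI w^-1%g); rewrite mulVg; apply: act_faithful => H tH.
by rewrite actM// h// actK.
Qed.

Definition refl (b H : V) : V := H - (2 * ip b H / ip b b) *: b.

Lemma refl_act w b H : refl (act w b) (act w H) = act w (refl b H).
Proof. by rewrite /refl !act_ip actB actZ. Qed.

Lemma refl_scale c b H : c != 0 -> ip b b != 0 -> refl (c *: b) H = refl b H.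
Proof.
move=> c0 b0; rewrite /refl scalerA; congr (_ - _ *: _).
by rewrite !(ipZl, ipZr); move: (ip b H) (ip b b) b0 => x y y0; field; rewrite y0.
Qed.

Lemma isrt_t b : isrt b -> t b. Proof. by move=> [_ [u [v []]]]. Qed.

Lemma isrt_ip b : isrt b -> ip b b != 0.
Proof. by move=> [b0 _]; rewrite gt_eqF// (igt0 cG). Qed.

Lemma ker_sroot s H c : s \in S -> t H -> ip (sroot s) H = 0 -> a s (expG (c *: H)) = 1.
Proof.
move=> sS tH h; have [_ ->] := srootP cG mT bs sS; last exact: tZ.
by rewrite ipZr h mulr0 expi0.
Qed.

Lemma orth_part b H : ip b b != 0 -> ip b (H - (ip b H / ip b b) *: b) = 0.
Proof.
by move=> b0; rewrite ipDr ipNr ipZr; field.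
Qed.

(** The representative centralizes the kernel of the character, so it fixes the hyperplane
    orthogonal to the root; the root itself is multiplied by [1] or [-1], and [1] would make [s] act
    trivially. *)
Lemma act_s s H : s \in S -> t H -> act s H = refl (sroot s) H.
Proof.
move=> sS; have b0 := isrt_ip (srt sS); have tb := isrt_t (srt sS).
have fix0 p : t p -> ip (sroot s) p = 0 -> act s p = p.
  move=> tp bp; apply/AdM_fix_commute => c; apply: (rs sS); first exact: tp.
  exact: ker_sroot.
move: (sroot s) b0 tb fix0 => b b0 tb fix0 tH.
pose d := act s b; pose c := ip b d / ip b b.
have dc : d = c *: b.
  apply/eqP; rewrite -subr_eq0; apply/eqP; apply: (ieq0 (cG := cG)).
  set p := d - c *: b.
  have bp : ip b p = 0 by exact: orth_part.
  have tp : t p by apply: tB; [exact: act_t | exact: tZ].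
  have dp : ip d p = 0 by rewrite -(fix0 p tp bp) act_ip.
  by rewrite ipDl ipNl ipZl bp mulr0 subr0.
have c2 : c ^+ 2 = 1.
  have : ip d d = ip b b by exact: act_ip.
  by rewrite dc ipZl ipZr mulrA => /(canRL (mulfK b0)); rewrite divff.
have split_H H' : t H' -> act s H' = H' - (ip b H' / ip b b) *: b + ((ip b H' / ip b b) * c) *: b.
  move=> tH'; set k := ip b H' / ip b b.
  have tp : t (H' - k *: b) by apply: tB => //; exact: tZ.
  have := fix0 _ tp (orth_part H' b0); rewrite -/k => e.
  by rewrite -{1}(subrK (k *: b) H') actD e actZ -/d dc scalerA.
have : c = -1.
  move/eqP: c2; rewrite sqrf_eq1 => /orP[/eqP c1|/eqP //]; exfalso.
  have := S_neq1 invS sS; rewrite (_ : s = 1%g) ?eqxx//; apply: act_faithful => H' tH'.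
  by rewrite split_H// c1 mulr1 subrK.
rewrite split_H// /refl => ->; set k := ip b H / ip b b.
have -> : 2 * ip b H / ip b b = k + k by rewrite -mulrA mulr_natl.
by rewrite mulrN1 scaleNr scalerDl opprD addrA.
Qed.

Lemma wt_norm g b u v : normalizer T g -> wt b u v -> wt (b *m AdM g) (u *m AdM g) (v *m AdM g).
Proof.
move=> ng [tb u0 uv h]; split.
- exact: norm_t.
- by move=> e; apply: u0; rewrite -(AdM_VK g u) e mul0mx.
- by rewrite !iAd.
move=> H tH; have tH' := norm_t (normV ng) tH.
have eH : H = H *m AdM g^-1%g *m AdM g by rewrite -{2}(invgK g) AdM_VK.
have [h1 h2] := h _ tH'; rewrite {1 3}eH !bk_Ad h1 h2 -!scalemxAl.
by rewrite -(iAd cG g b (H *m AdM g^-1%g)) -eH.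
Qed.

Lemma isrt_act w b : isrt b -> isrt (act w b).
Proof.
move=> [b0 [u [v h]]]; split; last by exists (u *m AdM (r w)), (v *m AdM (r w)); exact: wt_norm.
by move=> e; apply: b0; rewrite -(AdM_VK (r w) b); rewrite /act in e; rewrite e mul0mx.
Qed.

Lemma actE w H : act w H = H *m AdM (r w). Proof. by []. Qed.

Opaque act.

Lemma wtN b u v : wt b u v -> wt (- b) v u.
Proof.
move=> h; have [tb u0 uv hH] := h; split; [|exact: wt_v h|by []|].
  by rewrite -scaleN1r; exact: tZ.
by move=> H tH; have [h1 h2] := hH H tH; rewrite ipNl opprK.
Qed.

Lemma wtR b u v : wt b u v -> wt b v (- u).
Proof.
move=> h; have [tb u0 uv hH] := h; split; [by []|exact: wt_v h| |].
  by rewrite ipNl ipNr opprK.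
by move=> H tH; have [h1 h2] := hH H tH; rewrite bkNr h1 scalerN !scaleNr !opprK.
Qed.

Definition comb (m : W -> nat) : V := \sum_(s in S) (m s)%:R *: sroot s.

Lemma comb_fund m s : s \in S -> ip (comb m) (fund s) = (m s)%:R.
Proof.
move=> sS; have [_ h] := fundP cG mT bs sS; rewrite ip_suml (bigD1 s)//= ipZl h// eqxx mulr1.
rewrite big1 ?addr0// => s' /andP[s'S ne]; by rewrite ipZl h// (negbTE ne) mulr0.
Qed.

Lemma comb_eq0 m : (forall s, s \in S -> m s = 0%N) -> comb m = 0.
Proof. by move=> h; rewrite /comb big1// => s sS; rewrite h// scale0r. Qed.

Lemma comb_single m x : x \in S -> (forall s, s \in S -> s != x -> m s = 0%N) -> comb m = (m x)%:R *: sroot x.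
Proof.
by move=> xS h; rewrite /comb (bigD1 x)//= big1 ?addr0// => s /andP[sS ne]; rewrite h// scale0r.
Qed.

Definition pos (b : V) := isrt b /\ exists m, b = comb m.

Lemma isrtN b : isrt b -> isrt (- b).
Proof.
move=> [b0 [u [v h]]]; split; last by exists v, u; exact: wtN.
by move=> /eqP; rewrite oppr_eq0 => /eqP.
Qed.

Lemma pos_or b : isrt b -> pos b \/ pos (- b).
Proof.
move=> hb; have [m [e|e]] := roots_comb mT bs hb; [left|right].
  by split=> //; exists m.
by split; [exact: isrtN | exists m; rewrite e opprK].
Qed.

Lemma pos_opp b : pos b -> pos (- b) -> False.
Proof.
move=> [[b0 _] [m e]] [_ [m' e']]; apply: b0; rewrite e; apply: comb_eq0 => s sS.
have := comb_fund m' sS; rewrite -e' ipNl e comb_fund// => h; apply/eqP; rewrite -(eqr_nat R) eq_le ler0n.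
by rewrite -oppr_ge0 h ler0n.
Qed.

Lemma pos_sroot s : s \in S -> pos (sroot s).
Proof.
move=> sS; split; first exact: srt.
exists (fun s' => (s' == s) : nat); rewrite (comb_single sS) ?eqxx ?scale1r//.
by move=> s' _ /negbTE ->.
Qed.

(** Reflection in a simple root changes only the coefficient of that root, so a change of sign
    forces all the other coefficients to vanish. *)
Lemma refl_pos x b : x \in S -> pos b -> pos (- act x b) -> exists k : nat, b = k%:R *: sroot x.
Proof.
move=> xS [rb [m e]] [_ [m' e']]; exists (m x); rewrite e; apply: comb_single => // s sS ne.
have := comb_fund m' sS; rewrite -e' act_s//; last exact: isrt_t.
have [_ h] := fundP cG mT bs sS.
rewrite ipNl ipDl ipNl ipZl h// [x == s]eq_sym (negbTE ne) mulr0 subr0 e comb_fund// => h'.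
by apply/eqP; rewrite -(eqr_nat R) eq_le ler0n -oppr_ge0 h' ler0n.
Qed.

(** At the letter [x] where the image of the simple root turns negative it is a multiple of the root
    of [x]. The two reflections then agree, so [x] can be moved past the rest of the word and
    becomes [s] at its end. *)
Lemma neg_shorter l s : {subset l <= S} -> s \in S -> pos (- act (wprod l) (sroot s)) ->
  (len S (wprod l * s)%g < size l)%N.
Proof.
move=> + sS; have ts := isrt_t (srt sS); elim: l => [_|x l IH lS].
  rewrite wprod_nil act1// => h; case: (pos_opp (pos_sroot sS) h).
have xS : x \in S by apply: lS; rewrite mem_head.
have lS' : {subset l <= S} by move=> z zl; apply: lS; rewrite inE zl orbT.
rewrite wprod_cons actM// => h.
have rb : isrt (act (wprod l) (sroot s)) by apply: isrt_act; exact: srt.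
case: (pos_or rb) => pb.
  have [k ek] := refl_pos xS pb h.
  have k0 : k%:R != 0 :> R.
    by apply/eqP => k0; case: rb => + _; rewrite ek k0 scale0r.
  have e : (x * wprod l = wprod l * s)%g.
    apply: act_inj => H tH; rewrite (actM _ _ tH) (actM _ _ tH) (act_s xS (act_t _ tH)) (act_s sS tH).
    by rewrite -refl_act ek (refl_scale _ k0 (isrt_ip (srt xS))).
  by rewrite e -mulgA (ss1 invS sS) mulg1; apply: (len_le genW).
have h0 := IH lS' pb; have [l0 [l0S e0 s0]] := len_word genW (wprod l * s)%g.
rewrite -mulgA -e0 -wprod_cons; apply: leq_ltn_trans (len_le genW _) _; last by rewrite /= s0.
by move=> z; rewrite inE => /orP[/eqP ->//|]; exact: l0S.
Qed.

Lemma descent_neg w s : s \in S -> (len S (w * s)%g < len S w)%N -> pos (- act w (sroot s)).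
Proof.
move=> sS lt; have ts := isrt_t (srt sS).
case: (pos_or (isrt_act w (srt sS))) => // pw; exfalso.
have e : act (w * s)%g (sroot s) = - act w (sroot s).
  rewrite (actM _ _ ts) (act_s sS ts) -actN /refl; congr (act w _).
  rewrite -mulrA divff ?mulr1; last exact: isrt_ip (srt sS).
  by rewrite scaler_nat opprD addrA subrr sub0r.
have [l [lS e0 s0]] := len_word genW (w * s)%g.
have := neg_shorter lS sS; rewrite e0 e opprK => /(_ pw).
by rewrite -mulgA (ss1 invS sS) mulg1 s0 ltnNge ltnW.
Qed.

Lemma refl_fix b H : ip b H = 0 -> refl b H = H.
Proof. by move=> h; rewrite /refl h mulr0 mul0r scale0r subr0. Qed.

Lemma act_rho (J : {set W}) s : J \subset S -> s \in J -> act s (rhoJ J) = rhoJ J.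
Proof.
move=> JS sJ; have sS := subsetP JS s sJ.
by rewrite (act_s sS (rt J)) refl_fix// rhoJ_ip// sJ.
Qed.

Lemma parabolic_rho (J : {set W}) w : J \subset S -> w \in <<J>>%g -> act w (rhoJ J) = rhoJ J.
Proof.
move=> JS /gen_word[l lJ <-]; elim: l lJ => [|s l IH] lJ; first by rewrite wprod_nil act1.
rewrite wprod_cons (actM _ _ (rt J)) IH; last by move=> z zl; apply: lJ; rewrite inE zl orbT.
by apply: act_rho => //; apply: lJ; rewrite mem_head.
Qed.

(* A descent [s] outside [J] would give [0 < (sroot s, rhoJ J) = (w (sroot s), rhoJ J) <= 0]. *)
Lemma stab_rho (J : {set W}) w : J \subset S -> act w (rhoJ J) = rhoJ J -> w \in <<J>>%g.
Proof.
move=> JS; have [k] := ubnP (len S w); elim: k w => // k IH w; rewrite ltnS => lk wr.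
have [l [lS lw ls]] := len_word genW w.
case/lastP: l lS lw ls => [|l s] lS lw ls; first by rewrite -lw wprod_nil.
have sS : s \in S by apply: lS; rewrite mem_rcons mem_head.
have lt : (len S (w * s)%g < len S w)%N.
  rewrite -ls -lw -cats1 wprod_cat wprod1 -mulgA (ss1 invS sS) mulg1 size_cat addn1 ltnS.
  by apply: (len_le genW) => z zl; apply: lS; rewrite mem_rcons inE zl orbT.
case: (boolP (s \in J)) => sJ.
  have : (w * s)%g \in <<J>>%g.
    by apply: IH; [exact: leq_trans lt lk | rewrite (actM _ _ (rt J)) act_rho].
  by rewrite groupMr// mem_gen.
exfalso; have [_ [m e]] := descent_neg sS lt.
have h1 : ip (act w (sroot s)) (rhoJ J) = 1 by rewrite -{1}wr act_ip rhoJ_ip// sJ.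
have h2 : ip (- act w (sroot s)) (rhoJ J) = \sum_(s in S | s \notin J) (m s)%:R by rewrite e comb_rhoJ.
have : 0 <= \sum_(s in S | s \notin J) (m s)%:R :> R by apply: sumr_ge0 => *.
by rewrite -h2 ipNl h1 oppr_ge0 ler10.
Qed.

Lemma rhoJ_setD (D : {set W}) : D \subset S -> rhoJ D + rhoJ (S :\: D) = rhoJ finset.set0.
Proof.
move=> DS; rewrite [RHS](bigID (fun s => s \in D)) /= addrC; congr (_ + _); apply: eq_bigl => s.
  by rewrite inE; case: (s \in S).
by rewrite !inE; case: (s \in S); case: (s \in D).
Qed.

(** An element of both parabolic subgroups fixes [rhoJ D] and [rhoJ (S :\: D)], hence their sum,
    which is regular. *)
Lemma parabolic_disjoint (D : {set W}) w : D \subset S -> w \in <<D>>%g -> w \in <<S :\: D>>%g -> w = 1%g.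
Proof.
move=> DS wD wD'; have : w \in <<finset.set0 : {set W}>>%g.
  apply: stab_rho; first exact: sub0set.
  by rewrite -(rhoJ_setD DS) actD !parabolic_rho// finset.subsetDl.
by rewrite gen0 => /set1gP.
Qed.
End WeylAction.

Lemma torus_root_centralizer s : T `<=` root_centralizer T (a s).
Proof. by move=> x Tx y Ty _; exact: (torus_comm tT Tx Ty). Qed.

Lemma wt_root_centralizer s (z : int) b u v c : s \in S -> wt b u v -> b = z%:~R *: sroot s ->
  root_centralizer T (a s) (expG (c *: v)).
Proof.
move=> sS h e _ /(torus_expE tT)[H tH <-]; have [_ ->//] := srootP cG mT bs sS.
move=> /expi_eq1[m em]; have : expi (ip b H) = 1.
  by rewrite e ipZl em mulrA -intrM expi_2pi.
move=> eb; have cb : cos (ip b H) = 1 by have := congr1 (@complex.Re R) eb.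
have sb : sin (ip b H) = 0 by have := congr1 (@complex.Im R) eb.
have [_ hv] := wt_exp h tH; rewrite cb sb scale0r scale1r add0r in hv.
by apply/esym; apply: (AdM_fix_commute _ _).1 hv c.
Qed.

(* [exp (c v) = [exp (- c/2 v), y^-1]] for an element [y] of the torus acting by [-1] on [v]. *)
Lemma wt_root_subgroup s (z : int) b u v c : s \in S -> b <> 0 -> wt b u v -> b = z%:~R *: sroot s ->
  root_subgroup T (a s) (expG (c *: v)).
Proof.
move=> sS b0 h e; have [tb _ _ _] := h; apply: sub_gen => /=.
have tH0 : t ((pi / ip b b) *: b) by exact: tZ.
have [_ hv] := wt_exp h tH0; move: hv; rewrite ipZr divfK ?gt_eqF ?(igt0 cG)//.
rewrite sinpi cospi scale0r add0r scaleN1r; set y := expG _ => hv.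
have Ty : T y by apply: LieS_exp.
have [_ _ TV] := sT.
exists (expG ((- c / 2) *: v)); first exact: wt_root_centralizer h e.
exists (y^-1)%g; first by apply: torus_root_centralizer; exact: TV.
rewrite commgEl conjgE invgK (mulgA y) expG_conj -scalemxAl hv -expGN scalerN -scaleNr -expG_add.
by congr (expG (_ *: _)); field.
Qed.

Lemma bk_uv b u v : b <> 0 -> wt b u v -> bk u v = - (ip u u) *: b.
Proof.
move=> b0 h; have [tb _ uv hH] := h.
have tuv : t (bk u v).
  apply/(fixed_LieS cG mT) => x /(torus_expE tT)[H tH <-].
  have [hu hv] := wt_exp h tH; rewrite -bk_Ad hu hv.
  move: (ip b H) => z; rewrite bkDr -scaleNr !bkDl !bkZr !bkZl !bkvv !scaler0 add0r addr0.
  rewrite (bkC v u) scalerN -!scaleNr !scalerA -scalerDl.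
  have -> : sin z * - (- sin z) + cos z * cos z = 1 :> R.
    by rewrite opprK addrC cos2Dsin2.
  by rewrite scale1r.
apply/eqP; rewrite scaleNr -subr_eq0 opprK; apply/eqP; apply: (ieq0 (cG := cG)).
set X := _ + _; have tX : t X by have [_ hD _] := st; apply: hD => //; exact: tZ.
have [hXu _] := hH X tX.
have -> : ip X X = ip (bk u v) X + ip u u * ip b X by rewrite ipDl ipZl.
by rewrite (ibk cG) (bkC u X) ipNr opprK hXu ipZr uv mulNr mulrC addNr.
Qed.

(** The candidate is an exponential in the root plane that acts on [t] as the reflection of [s];
    agreeing with [r s] on [t], it differs from it by an element of [T]. *)
Lemma rs_exp s : s \in S -> exists g, T ((r s)^-1 * g)%g /\ root_subgroup T (a s) g.
Proof.
move=> sS; have [b0 [u [v h]]] := srt sS; have [tb u0 uv hH] := h.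
set b := sroot s in b0 h tb hH.
have bb : 0 < ip b b by apply: igt0.
have uu : 0 < ip u u by apply: igt0.
(* The factor [m] gives [m *: u] the length of [b], so that bracketing with [v] rotates their plane
   with speed [c]; at time [pi / c] it sends [b] to [- b]. *)
pose m := Num.sqrt (ip b b / ip u u).
have m2 : m * m * ip u u = ip b b.
  by rewrite -expr2 sqr_sqrtr ?divfK ?gt_eqF// divr_ge0// ltW.
have m0 : m != 0 by apply/eqP => e; move: m2 bb; rewrite e !mul0r => <-; rewrite ltxx.
pose c := - m * ip u u.
have c0 : c != 0 by rewrite mulf_neq0 ?oppr_eq0// gt_eqF.
have h1 : bk v b = c *: (m *: u).
  have [_ hbv] := hH b tb; rewrite bkC hbv scalerA -scaleNr; congr (_ *: _).
  by rewrite -m2 /c; ring.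
have h2 : bk v (m *: u) = - c *: b.
  by rewrite bkZr bkC (bk_uv b0 h) -scaleNr opprK scalerA /c mulNr opprK.
pose g := expG ((pi / c) *: v).
have gb : b *m AdM g = - b.
  by rewrite (exp_rotation cG h1 h2) mulrC divfK// cospi sinpi scale0r addr0 scaleN1r.
have gf H : t H -> ip b H = 0 -> H *m AdM g = H.
  move=> tH bH; apply: (bk0_fix cG); have [_ hv] := hH H tH.
  by rewrite bkC hv bH scale0r oppr0.
have gH H : t H -> H *m AdM g = act s H.
  move=> tH; rewrite (act_s sS tH) /refl -/b.
  set k := ip b H / ip b b; have tp : t (H - k *: b) by exact: (subspaceB st tH (tZ _ tb)).
  have := gf _ tp (orth_part H (lt0r_neq0 bb)).
  rewrite mulmxBl -scalemxAl gb scalerN opprK => e.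
  have -> : 2 * ip b H / ip b b = k + k by rewrite -mulrA mulr_natl.
  by rewrite scalerDl opprD addrA -e addrK.
exists g; split; last by apply: (@wt_root_subgroup s 1 b u v) => //; rewrite scale1r.
apply: centT => H tH; rewrite AdMv gH//.
exact: AdM_VK.
Qed.

(** * The closure of a standard subgroup as a stabiliser *)

Section OneParabolic.
Variables (J : {set W}) (JS : J \subset S).
Local Notation GJ := (standard_subgroup T a J).

Lemma torus_standard : T `<=` GJ.
Proof. by move=> x Tx; apply: sub_gen; left. Qed.

Lemma root_standard s : s \in J -> root_subgroup T (a s) `<=` GJ.
Proof. by move=> sJ x xs; apply: sub_gen; right; exists s. Qed.

Let sGJ : is_subgroup GJ. Proof. exact: standard_is_subgroup. Qed.

Lemma r_standard w : w \in <<J>>%g -> GJ (r w).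
Proof.
have [G1 GM GV] := sGJ.
have rJ s : s \in J -> GJ (r s).
  move=> sJ; have [g [Tg gs]] := rs_exp (subsetP JS s sJ).
  have -> : r s = (g * ((r s)^-1 * g)^-1)%g by rewrite invgM invgK mulVKg.
  by apply: GM; [exact: root_standard gs | apply: GV; exact: torus_standard].
move=> /gen_word[l lJ <-]; elim: l lJ => [|s l IH] lJ.
  by rewrite wprod_nil; apply: torus_standard.
rewrite wprod_cons -[r _](mulVKg (r s * r (wprod l))%g); apply: (GM _ _ _ (torus_standard (rM _ _))).
apply: GM; first by apply: rJ; apply: lJ; rewrite mem_head.
by apply: IH => z zl; apply: lJ; rewrite inE zl orbT.
Qed.

Lemma standard_fix g : GJ g -> rhoJ J *m AdM g = rhoJ J.
Proof.
pose H := [set g : G | rhoJ J *m AdM g = rhoJ J].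
have sH : is_subgroup H.
  split=> [|x y hx hy|x hx]; rewrite /H /=; first by rewrite AdM1 mulmx1.
    by rewrite AdMv hy.
  by rewrite -{1}hx AdM_VK.
apply: (@gen_le _ _ _ H) => // x [Tx|[s /= sJ]].
  exact: torus_fix tT (rt J) Tx.
have sS := subsetP JS s sJ.
have cs y : root_centralizer T (a s) y -> H y.
  move=> yc; apply/AdM_fix_commute => c; apply: yc; first exact: rt.
  by apply: ker_sroot => //; rewrite rhoJ_ip// sJ.
apply: (gen_le sH) => _ [y /cs hy [z /cs hz <-]]; have [_ HM HV] := sH.
by rewrite commgEl; exact: (HM _ _ (HV _ hy) (HM _ _ (HV _ hz) (HM _ _ hy hz))).
Qed.

(* Reflecting in a simple root with positive pairing lowers the height. *)
Lemma conj_simple b m : isrt b -> b = comb m -> (forall s, s \in S -> s \notin J -> m s = 0%N) ->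
  exists w s k, [/\ w \in <<J>>%g, s \in J & act w b = k%:~R *: sroot s :> V].
Proof.
have [N] := ubnP (\sum_(s in S) m s)%N; elim: N b m => // N IH b m; rewrite ltnS => leN rb eb mJ.
have [s sJ sb] : exists2 s, s \in J & 0 < ip (sroot s) b.
  apply: contrapT => no; have : 0 < ip b b by apply: igt0; case: rb.
  rewrite {1}eb ip_suml ltNge => /negP; apply; apply: sumr_le0 => s sS; rewrite ipZl.
  have [sJ|sJ] := boolP (s \in J); last by rewrite mJ// mul0r.
  by rewrite mulr_ge0_le0// leNgt; apply/negP => h; apply: no; exists s.
have sS := subsetP JS s sJ.
have rb' := isrt_act s rb.
have bf s' : s' \in S -> ip b (fund s') = (m s')%:R by rewrite eb; exact: comb_fund _ _.
have [k k0 e] : exists2 k, 0 < k & act s b = b - k *: sroot s.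
  exists (2 * ip (sroot s) b / ip (sroot s) (sroot s)); last exact: (act_s sS (isrt_t rb)).
  by rewrite divr_gt0 ?mulr_gt0// igt0; case: (srt sS).
have bf' s' : s' \in S -> ip (act s b) (fund s') = (m s')%:R - k * (s == s')%:R.
  by move=> s'S; rewrite e ipDl ipNl ipZl bf//; have [_ ->] := fundP cG mT bs s'S.
have [m' [em|em]] := roots_comb mT bs rb'.
  have mm s' : s' \in S -> (m' s')%:R = (m s')%:R - k * (s == s')%:R :> R.
    by move=> s'S; rewrite -bf'// em comb_fund.
  have ms : (m' s < m s)%N.
    by rewrite -(ltr_nat R) mm// eqxx mulr1 ltrBlDr ltrDl.
  have mo s' : s' \in S -> s' != s -> m' s' = m s'.
    by move=> s'S ne; apply/eqP; rewrite -(eqr_nat R) mm// [s == s']eq_sym (negbTE ne) mulr0 subr0.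
  have [||w [s0 [k1 [wJ s0J ew]]]] := IH (act s b) m' _ rb' em.
  - apply: leq_trans leN; rewrite (bigD1 s)//= [X in (_ < X)%N](bigD1 s)//= -addSn leq_add//.
    by apply/eq_leq/eq_bigr => s' /andP[s'S ne]; rewrite mo.
  - move=> s' s'S s'J; rewrite mo ?mJ//; by apply: contraNneq s'J => ->.
  exists (w * s)%g, s0, k1; split=> //; first by rewrite groupM// mem_gen.
  by rewrite (actM)//; exact: isrt_t rb.
exists 1%g, s, (m s); split=> //; rewrite act1; last exact: isrt_t rb.
rewrite eb (comb_single sS)// => s' s'S ne; apply/eqP; rewrite -(eqr_nat R) eq_le ler0n.
have := bf' s' s'S; rewrite em ipNl (comb_fund)// [s == s']eq_sym (negbTE ne) mulr0 subr0.
by move=> <-; rewrite oppr_le0 ler0n.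
Qed.

Let M := closure GJ.
Let sM : is_subgroup M. Proof. exact: closure_subgroup. Qed.
Let cM : closed M. Proof. exact: closed_closure. Qed.
Let GM : GJ `<=` M. Proof. exact: subset_closure. Qed.
Let TM : T `<=` M. Proof. by move=> x Tx; apply: GM; exact: torus_standard. Qed.

Let M_fix g : M g -> rhoJ J *m AdM g = rhoJ J.
Proof.
move=> Mg; have := @closed_Ad_eq R G (rhoJ J) (rhoJ J); rewrite closure_id => e.
by move: Mg; rewrite /M => /(@closureS _ _ _ standard_fix); rewrite -e.
Qed.

(** Nonnegativity makes a root orthogonal to [rhoJ J] a combination of the simple roots of [J]. It
    is conjugate under the parabolic subgroup to a multiple of one of them, whose rank-one subgroup
    lies in [G_J]. *)
Lemma wt_LieS b u v : b <> 0 -> wt b u v -> ip b (rhoJ J) = 0 -> LieS M u.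
Proof.
move=> b0 h br; have rb : isrt b by split=> //; exists u, v.
have [m [e hb]] : exists m, (b = comb m \/ b = - comb m) /\ forall s, s \in S -> s \notin J -> m s = 0%N.
  have [m e] := roots_comb mT bs rb; exists m; split=> // s sS sJ.
  have : \sum_(s in S | s \notin J) (m s)%:R = 0 :> R.
    rewrite -(comb_rhoJ cG mT bs); case: e br => ->; rewrite ?ipNl => /eqP; rewrite ?oppr_eq0 => /eqP ->//.
  move=> /eqP; rewrite psumr_eq0 => [/allP /(_ s)|*]; last exact: ler0n.
  by rewrite mem_index_enum sS sJ pnatr_eq0 => /(_ isT)/eqP.
have [w [s [k [wJ sJ ew]]]] : exists w s k, [/\ w \in <<J>>%g, s \in J & act w b = k%:~R *: sroot s :> V].
  case: e => e; first exact: conj_simple rb e hb.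
  have e' : - b = comb m by rewrite e opprK.
  have [w [s [k [wJ sJ ew]]]] := conj_simple (isrtN rb) e' hb.
  exists w, s, (- k); by rewrite -[b]opprK actN ew rmorphN scaleNr.
have sS := subsetP JS s sJ.
have hw := wtR (wt_norm (rN w) h).
have b0' : b *m AdM (r w) <> 0 by have [] := isrt_act w rb.
have Mu : LieS M (u *m AdM (r w)).
  move=> c; rewrite -[c *: _]opprK -scaleNr -scalerN; apply: GM; apply: (root_standard sJ).
  by rewrite actE in ew; exact: (wt_root_subgroup _ sS b0' hw ew).
rewrite -(AdM_VK (r w) u); apply: LieS_Ad => //; have [_ _ MV] := sM; apply: MV; apply: GM.
exact: r_standard.
Qed.

(** By [weight_span] it is enough to treat [t] and the weight vectors commuting with [rhoJ J]; the
    latter belong to roots orthogonal to [rhoJ J]. *)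
Lemma centralizer_LieS B : bk (rhoJ J) B = 0 -> LieS M B.
Proof.
have trho := rt J.
apply: (@weight_span _ _ cG _ mT (fun B => bk (rhoJ J) B = 0) (LieS M)) => //.
- exact: centralizer_subspace.
- exact: centralizer_Tstable.
- exact: LieS_subspace.
- by move=> x u Tx Mu; apply: LieS_Ad => //; exact: TM.
- by move=> H; exact: LieS_mono.
- move=> b u v Pu Pv b0 h; apply: (wt_LieS b0 h); have [_ _ _ hH] := h.
  have [hu _] := hH _ trho; move: hu; rewrite Pu => /esym/eqP; rewrite scaler_eq0 oppr_eq0.
  by move=> /orP[/eqP //|/eqP v0]; case: (wt_v h v0).
- move=> u Mu; rewrite bkC; apply/eqP; rewrite oppr_eq0; apply/eqP; apply: bk_fix0 => s.
  by apply: M_fix.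
Qed.

(** Hunt's lemma inside the closure of [G_J] corrects [g] to a normalizing element. The Weyl group
    element it represents still fixes [rhoJ J], so it lies in the parabolic subgroup of [J]. *)
Lemma stab_closure g : rhoJ J *m AdM g = rhoJ J -> closure GJ g.
Proof.
move=> fg; have tX := rt finset.set0.
have Xg : LieS M (rhoJ finset.set0 *m AdM g).
  apply: centralizer_LieS; rewrite -{1}fg bk_Ad (bk_tt mT (rt J) tX) mul0mx//.
have [m Mm nm] := hunt_norm cG mT tX reg sM cM TM Xg.
have [w Tw] := rsurj nm.
have fw : act w (rhoJ J) = rhoJ J.
  have e : r w = ((m * g) * ((r w)^-1 * (m * g))^-1)%g by rewrite invgM invgK mulVKg.
  have [_ _ TV] := sT.
  rewrite actE e AdMv (torus_fix tT (rt J) (TV _ Tw)) AdMv fg; exact: M_fix.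
have wJ := stab_rho JS fw.
have [_ MM MV] := sM.
have -> : g = (m^-1 * (r w * ((r w)^-1 * (m * g))))%g by rewrite mulVKg mulKg.
exact: (MM _ _ (MV _ Mm) (MM _ _ (GM (r_standard wJ)) (TM Tw))).
Qed.

End OneParabolic.

(** For [J = S] the vector [rhoJ S] is an empty sum, stabilised by everything. *)
Lemma standard_dense g : closure (standard_subgroup T a S) g.
Proof.
apply: stab_closure => //; have -> : rhoJ S = 0; last by rewrite mul0mx.
by apply: big_pred0 => s; rewrite andbN.
Qed.

Variable K : {set {set W}}.
Hypothesis cplx : simplicial_complex S K.
Local Notation P := (faces K).
Local Notation V0 := 'rV[R]_(#|P| + #|P| * n).
Local Notation leP := (fun I J : P => val I \subset val J).
Local Notation nerve I := (@nerve_above R P leP I).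
Let IS (I : P) : val I \subset S.
Proof. by case: cplx => _ /subsetP h _; have := h _ (valP I); rewrite inE. Qed.
Definition empty_face : P := exist _ finset.set0 (let: And3 h _ _ := cplx in h).
Local Notation f0 := empty_face.
Local Notation L0 := (nerve f0).
Definition rho (J : P) : V := rhoJ (val J).
Let trho J : t (rho J). Proof. exact: rt. Qed.

Lemma nerveP (I : P) (l : nerve I) : nerve_above leP I (set_val l).
Proof. exact: set_valP. Qed.

Lemma nerve_neq0 (I : P) (l : nerve I) : exists J, set_val l J != 0.
Proof.
have [_ l1 _ _] := nerveP l; apply: contrapT => no.
move: l1; rewrite big1 => [/esym/eqP|J _]; first by rewrite oner_eq0.
by apply/eqP; apply: contrapT => /negP h; apply: no; exists J.
Qed.

Lemma nerve_vertex (I E : P) : val I \subset val E -> nerve_above leP I (fun J => (J == E)%:R : R).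
Proof.
move=> IE; split=> [J||J|J J'] //=.
- by rewrite (bigD1 E)//= eqxx big1 ?addr0// => J /negbTE ->.
- by case: (eqVneq J E) => [->|_ /eqP].
- case: (eqVneq J E) => [-> _|_ /eqP//]; case: (eqVneq J' E) => [-> _|_ /eqP//].
  by rewrite fintype.subxx.
Qed.

Lemma nerve_join (I E : P) (l : nerve I) (u : R) : val I \subset val E -> 0 <= u <= 1 ->
  (forall J, set_val l J != 0 -> leP E J || leP J E) ->
  nerve_above leP I (fun J => (1 - u) * set_val l J + u * (J == E)%:R).
Proof.
move=> IE /andP[u0 u1] hE; have [l0 l1 l2 l3] := nerveP l.
have mE J : (1 - u) * set_val l J + u * (J == E)%:R != 0 -> J = E \/ set_val l J != 0.
  case: (eqVneq J E) => [-> _|_]; first by left.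
  by rewrite mulr0 addr0 mulf_eq0 negb_or => /andP[_ ?]; right.
split=> [J||J /mE[->|/l2]|J J' /mE hJ /mE hJ'] //.
- by rewrite addr_ge0// mulr_ge0// subr_ge0.
- rewrite big_split -!mulr_sumr l1 (bigD1 E)//= eqxx big1 ?addr0 ?mulr1 ?subrK//.
  by move=> J /negbTE ->.
- case: hJ hJ' => [->|lJ] [->|lJ']; last exact: l3.
  + by rewrite fintype.subxx.
  + exact: hE.
  + by rewrite orbC; exact: hE.
Qed.

(** * The map from the homotopy colimit to the model space *)

Section FlagModel.
Local Notation X := (parabolic_hocolim T a K).
Local Open Scope quotient_scope.
Local Notation GI I := (standard_subgroup T a (val I)).
Let sGI (I : P) : is_subgroup (GI I). Proof. exact: standard_is_subgroup. Qed.

Lemma standard_le (I J : P) : val I \subset val J -> GI I `<=` GI J.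
Proof.
move=> /subsetP IJ; apply: gen_le; first exact: sGI.
move=> x [Tx|[s /= sI xs]]; apply: sub_gen; [by left | right].
by exists s => //; exact: IJ.
Qed.

Definition cpi (I : P) (x : G) : flag_space T a I :=
  \pi_({eq_quot coset_equiv (standard_is_subgroup T a (val I))}) x.

Lemma cpi_continuous I : continuous (cpi I).
Proof. exact: pi_continuous. Qed.

Lemma cpiP I x y : cpi I x = cpi I y <-> GI I (x^-1 * y)%g.
Proof.
split=> [h|h].
  by apply/asboolP; have /eqmodP := h.
by apply/eqmodP/asboolP.
Qed.

Lemma cpi_repr I (u : flag_space T a I) : cpi I (repr u) = u.
Proof. exact: reprK. Qed.

Lemma repr_cpi I x : GI I (x^-1 * repr (cpi I x))%g.
Proof. by apply/cpiP; rewrite cpi_repr. Qed.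

Lemma cpi_mulr I x h : GI I h -> cpi I (x * h)%g = cpi I x.
Proof.
move=> hI; apply/esym/cpiP; by rewrite mulKg.
Qed.

Lemma flag_proj_cpi (I J : P) x : val I \subset val J -> flag_proj J (cpi I x) = cpi J x.
Proof.
move=> IJ; change (cpi J (repr (cpi I x)) = cpi J x).
by apply/esym/cpiP; apply: (standard_le IJ); exact: repr_cpi.
Qed.

Definition hpre := @hocolim_pre R P leP (flag_space T a (K:=K)).
Definition hpt (I : P) (u : flag_space T a I) (l : nerve I) : hpre :=
  existT (@hocolim_piece R P leP (flag_space T a (K:=K))) I (u, l).
Definition hpi (q : hpre) : X :=
  \pi_({eq_quot @hocolim_equiv R P leP (flag_space T a (K:=K)) (@flag_proj R G W T a K)}) q.

Lemma hpi_continuous : continuous hpi.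
Proof. exact: pi_continuous. Qed.

Lemma hpi_repr x : hpi (repr x) = x.
Proof. exact: reprK. Qed.

Lemma hpiP p q : hpi p = hpi q <->
  Relation_Operators.clos_refl_sym_trans _
    (@hocolim_step R P leP (flag_space T a (K:=K)) (@flag_proj R G W T a K)) p q.
Proof.
split=> [h|h]; first by apply/asboolP; have /eqmodP := h.
by apply/eqmodP/asboolP.
Qed.

Lemma hpi_step (I J : P) x (l : nerve I) (m : nerve J) :
  val I \subset val J -> set_val l = set_val m -> hpi (hpt (cpi I x) l) = hpi (hpt (cpi J x) m).
Proof.
move=> IJ lm; apply/hpiP; apply: Relation_Operators.rst_step.
by rewrite -(flag_proj_cpi x IJ).
Qed.

Lemma hpt_continuous (Z : topologicalType) (I : P) (u : Z -> flag_space T a I)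
  (l : Z -> nerve I) : continuous u -> continuous l -> continuous (fun z => hpt (u z) (l z)).
Proof.
move=> cu cl z; apply: (@continuous_comp _ _ _ (fun z => (u z, l z)) (existT (@hocolim_piece R P leP _) I)).
  exact: (cont_pair cu cl).
exact: existT_continuous.
Qed.

Lemma rho_fix (J : P) x h : GI J h -> rho J *m AdM (x * h)%g = rho J *m AdM x.
Proof. by move=> hJ; rewrite AdMv (standard_fix (IS J) hJ). Qed.

(** The value [0] when [I] is not contained in [J] is harmless: the weight of [J] over [I] then
    vanishes. Otherwise the vector does not depend on the representative. *)
Definition flag_vec (I J : P) (u : flag_space T a I) : V :=
  if val I \subset val J then rho J *m AdM (repr u) else 0.

Lemma flag_vec_cpi (I J : P) x : val I \subset val J -> flag_vec J (cpi I x) = rho J *m AdM x.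
Proof.
move=> IJ; rewrite /flag_vec IJ -{1}(mulVKg x (repr _)) rho_fix//.
by apply: (standard_le IJ); exact: repr_cpi.
Qed.

Lemma flag_vec_continuous (I J : P) : continuous (@flag_vec I J).
Proof.
have [IJ|IJ] := boolP (val I \subset val J); last first.
  have -> : @flag_vec I J = fun=> 0 by apply/funext => u; rewrite /flag_vec (negbTE IJ).
  exact: cont_cst.
have -> : @flag_vec I J = (fun u : flag_space T a I => rho J *m AdM (repr u)).
  by apply/funext => u; rewrite /flag_vec IJ.
apply: (@repr_comp_continuous _ _ _ (fun x : G => rho J *m AdM x)) => [|x y /eqP h]; first exact: AdM_cts.
have {}h : cpi I x = cpi I y by exact: h.
by rewrite -(flag_vec_cpi x IJ) -(flag_vec_cpi y IJ) h.
Qed.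

Definition model_pre (q : hpre) : V0 :=
  let: existT _ ul := q in mk (set_val ul.2) (fun J => set_val ul.2 J *: flag_vec J ul.1).

Lemma model_pre_cpi I x l : model_pre (hpt (cpi I x) l) = mk (set_val l) (fun J => set_val l J *: (rho J *m AdM x)).
Proof.
apply: mk_eq => //= J; have [-> | lJ] := eqVneq (set_val l J) 0; first by rewrite !scale0r.
by rewrite flag_vec_cpi//; case: (nerveP l) => _ _ h _; exact: h.
Qed.

Lemma set_val_coord_continuous (I J : P) : continuous (fun l : nerve I => set_val l J).
Proof.
exact: (cont_comp (@set_val_continuous _ _) (@prod_coord_continuous P (fun=> R) J)).
Qed.

Lemma model_pre_continuous : continuous model_pre.
Proof.
pose f (I : P) (ul : @hocolim_piece R P leP (flag_space T a (K:=K)) I) : V0 :=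
  mk (set_val ul.2) (fun J => set_val ul.2 J *: flag_vec J ul.1).
suff cf I : continuous (f I).
  apply/continuousP => A oA; apply/sigT_openP => I; have /continuousP h := cf I; exact: (h A oA).
apply: mk_continuous => J.
  exact: (cont_comp (@cont_snd _ _) (@set_val_coord_continuous I J)).
move=> z; apply: cvgZ.
  exact: (cont_comp (@cont_snd _ _) (@set_val_coord_continuous I J)).
exact: (cont_comp (@cont_fst _ _) (@flag_vec_continuous I J)).
Qed.

Lemma model_pre_hpi p q : hpi p = hpi q -> model_pre p = model_pre q.
Proof.
move/hpiP; elim=> {p q} [p q h|//|p q _ -> //|p q s _ -> _ ->//].
case: h => I J u l m IJ lm; change (model_pre (hpt u l) = model_pre (hpt (flag_proj J u) m)).
have := cpi_repr u; move: (repr u) => x <-.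
by rewrite (flag_proj_cpi x IJ) !model_pre_cpi lm.
Qed.

Definition model (x : X) : V0 := model_pre (repr x).

Lemma model_hpi q : model (hpi q) = model_pre q.
Proof. by apply: model_pre_hpi; rewrite hpi_repr. Qed.

Lemma model_continuous : continuous model.
Proof.
apply: (@repr_comp_continuous _ _ _ model_pre model_pre_continuous) => p q /eqP h.
by apply/eqP; apply: model_pre_hpi.
Qed.

Local Notation B := (G * L0)%type.

Lemma compact_B : compact [set: B].
Proof. by rewrite -setXTT; apply: compact_setX => //; apply: compact_set_type; exact: compact_nerve. Qed.

Lemma flag_pt_sig : {F : B -> V0 | forall b,
  F b = mk (set_val b.2) (fun J => set_val b.2 J *: (rho J *m AdM b.1))}.
Proof. by eexists => b. Qed.

Definition flag_pt : B -> V0 := sval flag_pt_sig.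

Lemma flag_ptE b : flag_pt b = mk (set_val b.2) (fun J => set_val b.2 J *: (rho J *m AdM b.1)).
Proof. exact: (svalP flag_pt_sig). Qed.

Definition hocolim_pt (b : B) : X := hpi (hpt (cpi f0 b.1) b.2).

Lemma pl_flag_pt b J : pl (flag_pt b) J = set_val b.2 J.
Proof. by rewrite flag_ptE pl_mk. Qed.

Lemma pz_flag_pt b J : pz (flag_pt b) J = set_val b.2 J *: (rho J *m AdM b.1).
Proof. by rewrite flag_ptE pz_mk. Qed.

Lemma model_hocolim_pt b : model (hocolim_pt b) = flag_pt b.
Proof. by rewrite model_hpi model_pre_cpi flag_ptE. Qed.

Lemma hocolim_pt_continuous : continuous hocolim_pt.
Proof.
apply: (@cont_comp _ _ _ (fun b : B => hpt (cpi f0 b.1) b.2) hpi); last exact: hpi_continuous.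
apply: hpt_continuous; last exact: cont_snd.
exact: (cont_comp (@cont_fst _ _) (@cpi_continuous f0)).
Qed.

Lemma flag_pt_continuous : continuous flag_pt.
Proof.
have -> : flag_pt = (fun b => model (hocolim_pt b)) by apply/funext => b; rewrite model_hocolim_pt.
exact: (cont_comp hocolim_pt_continuous model_continuous).
Qed.

(** Weights over [I] are also weights over the empty face, which is how the compact space [G * L0]
    reaches every point of the model. *)
Lemma nerve_to0 (I : P) (l : nerve I) : exists m : L0, set_val m = set_val l.
Proof.
have h : nerve_above leP f0 (set_val l).
  by have [l0 l1 _ l3] := nerveP l; split=> // J _; exact: sub0set.
by exists (SigSub (mem_set h)).
Qed.

Lemma model_range x : exists b, model x = flag_pt b.
Proof.
rewrite -(hpi_repr x); case: (repr x) => I [u l].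
have [m lm] := nerve_to0 l; exists (repr u, m).
rewrite model_hpi -(cpi_repr u) model_pre_cpi cpi_repr flag_ptE /=.
by rewrite lm.
Qed.

Lemma hocolim_ptE g l : hocolim_pt (g, l) = hpi (hpt (cpi f0 g) l).
Proof. by []. Qed.

Lemma nerve_bottom (l : L0) : exists (I : P) (m : nerve I),
  set_val m = set_val l /\ set_val l I != 0.
Proof.
have [l0 l1 l2 l3] := nerveP l.
suff [I [h In]] : exists I : P, nerve_above leP I (set_val l) /\ set_val l I != 0.
  by exists I, (SigSub (mem_set h)).
have [I0 I00] := nerve_neq0 l.
case: (@arg_minnP _ I0 (fun I : P => set_val l I != 0) (fun I : P => #|val I|) I00) => I In Imin.
exists I; split; [split|] => // J Jn.
have := l3 I J In Jn => /orP[//|JI]; have := Imin J Jn => h.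
by have /eqP -> : val J == val I by rewrite eqEcard JI.
Qed.

Opaque hpi hpt cpi model flag_pt hocolim_pt.

(** Equal images have equal weights, and the group elements differ by the stabiliser of [rho I],
    with [I] the smallest face in the support. That stabiliser lies in the closure of [G_I], whence
    indistinguishable points rather than equal ones. *)
Lemma flag_pt_indist b b' : flag_pt b = flag_pt b' -> indist (hocolim_pt b) (hocolim_pt b').
Proof.
case: b b' => [g l] [g' l'] e.
have el J : set_val l J = set_val l' J by rewrite -(pl_flag_pt (g, l)) e pl_flag_pt.
have {}el : l = l' by apply: val_inj; apply/funext => J; exact: el.
subst l'; have [I [m [lm In]]] := nerve_bottom l.
have fix0 : rho I *m AdM (g^-1 * g')%g = rho I.
  have := pz_flag_pt (g, l) I; rewrite e pz_flag_pt => /(scalerI In) h.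
  by rewrite AdMv h AdM_VK.
have cl := stab_closure (IS I) fix0.
have ptE x : hocolim_pt (x, l) = hpi (hpt (cpi I x) m).
  by rewrite hocolim_ptE; apply: hpi_step; [exact: sub0set | rewrite lm].
rewrite !ptE -(mulVKg g g').
apply: (@closure_coset_indist R G (GI I) X (fun x => hpi (hpt (cpi I x) m))); last exact: cl.
- exact: sGI.
- apply: (@cont_comp _ _ _ (fun x => hpt (cpi I x) m) hpi); last exact: hpi_continuous.
  by apply: hpt_continuous; [exact: cpi_continuous | exact: cont_cst].
- by move=> x h hI; rewrite cpi_mulr.
Qed.

Lemma hocolim_contractible_acyclic : contractible R X -> acyclic [set y | exists b, y = flag_pt b].
Proof.
move=> [x0 [h [ch h0 h1]]].
pose H (z : B * R) := model (h (hocolim_pt z.1, clip z.2)).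
have Ht t : continuous (fun x => model (h (x, clip t))).
  apply: (@cont_comp _ _ _ (fun x => h (x, clip t)) model); last exact: model_continuous.
  apply: (comp_within (g := fun x => (x, clip t)) ch); last by move=> x; split=> //=; exact: clip_itv.
  by apply: cont_pair; [move=> x; exact: cvg_id | exact: cont_cst].
have c01 : clip (0 : R) = 0 /\ clip (1 : R) = 1 by rewrite !clip_id ?lexx ?ler01.
apply: (@contraction_acyclic R _ B flag_pt H (model x0)).
- exact: compact_B.
- exact: flag_pt_continuous.
- apply: (@cont_comp _ _ _ (fun z : B * R => h (hocolim_pt z.1, clip z.2)) model); last exact: model_continuous.
  apply: (comp_within (g := fun z : B * R => (hocolim_pt z.1, clip z.2)) ch).
    apply: cont_pair; first exact: (cont_comp (@cont_fst _ _) hocolim_pt_continuous).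
    exact: (cont_comp (@cont_snd _ _) (@clip_continuous R)).
  by move=> z; split=> //=; exact: clip_itv.
- by move=> b t; exact: model_range.
- exact: model_range.
- move=> b b' t e; have ib := flag_pt_indist e; apply: indist_eq; first exact: norm_hausdorff.
  exact: (indist_map (Ht t) ib).
- by move=> b; rewrite /H c01.1 h0 model_hocolim_pt.
- by move=> b; rewrite /H c01.2 h1.
Qed.
End FlagModel.

(** * The torus-fixed points as translates of a chamber *)

Section WeylComplex.
Lemma weyl_pt_sig : {F : W -> L0 -> V0 | (forall w l J, pl (F w l) J = set_val l J) /\
  forall w l J, pz (F w l) J = set_val l J *: act w (rho J)}.
Proof.
exists (fun w l => mk (set_val l) (fun J => set_val l J *: act w (rho J))).
by split=> *; [exact: pl_mk | exact: pz_mk].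
Qed.

Definition weyl_pt : W -> L0 -> V0 := sval weyl_pt_sig.

Lemma pl_weyl_pt w l J : pl (weyl_pt w l) J = set_val l J.
Proof. by case: (svalP weyl_pt_sig). Qed.

Lemma pz_weyl_pt w l J : pz (weyl_pt w l) J = set_val l J *: act w (rho J).
Proof. by case: (svalP weyl_pt_sig). Qed.

Lemma tau_flag_pt g b : tau g (flag_pt b) = flag_pt ((g * b.1)%g, b.2).
Proof.
apply: model_eq => J; first by rewrite pl_tau !pl_flag_pt.
by rewrite pz_tau !pz_flag_pt AdMv -scalemxAl.
Qed.

(** At a fixed point all the vectors of the support lie in [t]. By [conj_family] a single element of
    the normalizer produces them simultaneously, so one Weyl group element serves for all faces of
    the support. *)
Lemma weyl_acyclic : contractible R (parabolic_hocolim T a K) ->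
  acyclic [set y | exists w l, y = weyl_pt w l].
Proof.
move=> ctr; have ac := @hocolim_contractible_acyclic ctr.
pose Y0 := [set y | exists b, y = flag_pt b].
have [k [f [fc fD fK fT]]] := tT.
have gY : good T Y0.
  split; [|  | exact: ac]; last first.
    by move=> y x [b ->] _; exists ((x * b.1)%g, b.2); exact: tau_flag_pt.
  have -> : Y0 = flag_pt @` [set: G * L0].
    by apply/seteqP; split=> [y [b ->]|y [b _ <-]]; exists b.
  apply: continuous_compact; first by apply: continuous_subspaceT; exact: flag_pt_continuous.
  exact: compact_B.
have [_ _] := good_torus cG tT fc fD fK fT gY.
congr (acyclic _); apply/seteqP; split=> [y [[[g l] ->] fy]|y [w [l ->]]].
  pose I := {J : P | set_val l J != 0}.
  have tg (J : I) : t (rho (val J) *m AdM g).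
    apply/(fixed_LieS cG mT) => x Tx; have := fy x Tx; rewrite tau_flag_pt => h.
    have := pz_flag_pt (g, l) (val J).
    by rewrite -h pz_flag_pt => /(scalerI (valP J)) /=; rewrite AdMv.
  have tX := rt finset.set0.
  have [h nh hP] := conj_family cG mT tX reg (fun J : I => trho (val J)) tg.
  have [w Tw] : exists w, T ((r w)^-1 * h)%g by case: wey => _ _ [_ _ _ sur] _; exact: sur.
  exists w, l; apply: model_eq => J; first by rewrite pl_flag_pt pl_weyl_pt.
  rewrite pz_flag_pt pz_weyl_pt /=; have [->|lJ] := eqVneq (set_val l J) 0; first by rewrite !scale0r.
  congr (_ *: _); have := hP (exist _ J lJ); rewrite /= => <-.
  rewrite -{1}(mulVKg (r w) h) AdMv (torus_fix tT (trho J) Tw) actE//.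
split.
  exists (r w, l); apply: model_eq => J; first by rewrite pl_weyl_pt pl_flag_pt.
  by rewrite pz_weyl_pt pz_flag_pt.
move=> x Tx; apply/tau_fixP => J; rewrite pz_weyl_pt -scalemxAl (torus_fix tT _ Tx)//.
exact: act_t _ _ (trho J).
Qed.
End WeylComplex.

(** * A minimal nonface obstructs acyclicity *)

Section Contradiction.
Local Notation p := #|P|.
Local Notation F := [set y | exists w l, y = weyl_pt w l].
Implicit Types (l : L0) (J : P) (w : W) (x y : V0).

Let l_ge0 l J : 0 <= set_val l J. Proof. by have [h _ _ _] := nerveP l. Qed.
Let l_sum l : \sum_J set_val l J = 1. Proof. by have [_ h _ _] := nerveP l. Qed.

Lemma tau_weyl_pt v w l : tau (r v) (weyl_pt w l) = weyl_pt (v * w)%g l.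
Proof.
apply: model_eq => J; first by rewrite pl_tau !pl_weyl_pt.
rewrite pz_tau !pz_weyl_pt -scalemxAl; congr (_ *: _).
by rewrite (actM v w (trho J)).
Qed.

(** The total weight of the faces containing [c]. It equals [1] exactly on the wall of [c], while a
    point labelled [c] has value [0]. *)
Definition lam (c : W) (y : V0) : R := \sum_(J : P | c \in val J) pl y J.

Lemma lam_weyl_pt c w l : lam c (weyl_pt w l) = \sum_(J : P | c \in val J) set_val l J.
Proof. by apply: eq_bigr => J _; rewrite pl_weyl_pt. Qed.

Lemma lam_tau c g y : lam c (tau g y) = lam c y.
Proof. by apply: eq_bigr => J _; rewrite pl_tau. Qed.

Lemma lam1P c w l : lam c (weyl_pt w l) = 1 <-> forall J, set_val l J != 0 -> c \in val J.
Proof.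
rewrite lam_weyl_pt; have := l_sum l; rewrite (bigID (fun J : P => c \in val J)) /=.
set A := \sum_(_ | c \in _) _; set B := \sum_(_ | _) _ => e.
split=> [A1 J|h]; last first.
  have B0 : B = 0 by apply: big1 => J cJ; apply/eqP; apply: contraNT cJ; exact: h.
  by move: e; rewrite B0 addr0.
have B0 : B = 0 by move: e; lra.
move: B0 => /eqP; rewrite psumr_eq0 => [/allP /(_ J (mem_index_enum J))|? _]; last exact: l_ge0.
by case: (c \in val J) => //= ->.
Qed.

Lemma lam_lip c x y : `|lam c x - lam c y| <= p%:R * `|x - y|.
Proof.
rewrite -sumrB; apply: le_trans (ler_norm_sum _ _ _) _.
rewrite mulr_natl -sumr_const.
apply: (@le_trans _ _ (\sum_(J : P | c \in val J) `|x - y|)).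
  by apply: ler_sum => J _; rewrite -plB; exact: pl_norm.
rewrite big_mkcond /= [X in _ <= X](_ : _ = \sum_(J : P) `|x - y|); last by apply: eq_bigl.
by apply: ler_sum => J _; case: ifP.
Qed.

Lemma nerve_top l : exists2 J0, set_val l J0 != 0 & forall J, set_val l J != 0 -> val J \subset val J0.
Proof.
have [I0 I00] := nerve_neq0 l.
case: (@arg_maxnP _ I0 (fun I : P => set_val l I != 0) (fun I : P => #|val I|) I00) => I In Imax.
exists I => // J Jn; have [_ _ _ ch] := nerveP l; have := ch I J In Jn => /orP[IJ|//].
have := Imax J Jn => h; by have /eqP -> : val I == val J by rewrite eqEcard IJ.
Qed.

Variable D : {set W}.
Hypotheses (DS : D \subset S) (DK : D \notin K).
Hypothesis Dmin : forall D' : {set W}, D' \proper D -> D' \in K.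

Let D1 c : c \in D -> c != 1%g.
Proof. by move=> cD; apply: (S_neq1 invS); exact: (subsetP DS). Qed.

Let D_neq0 : D != finset.set0.
Proof. by apply: contra DK => /eqP ->; case: cplx. Qed.

(** The support has a largest face, which cannot contain the nonface [D]. *)
Lemma lam_zero w l : exists2 c, c \in D & lam c (weyl_pt w l) = 0.
Proof.
have [J0 J0n top] := nerve_top l.
have : ~~ (D \subset val J0).
  by apply: contra DK => DJ; case: cplx => _ _ h; exact: h (valP J0) DJ.
move=> /fintype.subsetPn[c cD cJ]; exists c => //; rewrite lam_weyl_pt; apply: big1 => J cJ'.
by apply/eqP; apply: contraNT cJ => /top /subsetP; exact.
Qed.

(** The default [1] is not in [D] and is never taken on the Weyl complex. *)
Definition lab (y : V0) : W := odflt 1%g [pick c in D | lam c y == 0].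

Lemma labP w l : lab (weyl_pt w l) \in D /\ lam (lab (weyl_pt w l)) (weyl_pt w l) = 0.
Proof.
rewrite /lab; case: pickP => [c /= /andP[cD /eqP h] //|no]; exfalso.
by have [c cD h] := lam_zero w l; have := no c; rewrite cD h eqxx.
Qed.

Lemma lab_tau g y : lab (tau g y) = lab y.
Proof. by rewrite /lab; congr odflt; apply: eq_pick => c; rewrite lam_tau. Qed.

Let H := <<S :\: D>>%g.

Local Notation off J := [disjoint val J & D]%B.

Lemma parabolic_sub J : off J -> <<val J>>%g \subset H.
Proof. by move=> JD; apply: genS; rewrite finset.subsetD IS. Qed.

Lemma act_eq w w' J : act w (rho J) = act w' (rho J) -> (w^-1 * w')%g \in <<val J>>%g.
Proof.
move=> e; apply: (stab_rho (IS J)).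
by have := actM w^-1%g w' (trho J); rewrite -e (actK w (trho J)).
Qed.

(** A face [J] of positive weight determines [w] up to the parabolic subgroup of [J]. If [J] misses
    [D] that subgroup lies in [H], so membership of [w] in [H] is a property of the point. *)
Definition chi (y : V0) : bool := `[< exists w l J,
  [/\ w \in H, y = weyl_pt w l, set_val l J != 0 & off J] >].

Lemma chi_weyl_pt w l J : set_val l J != 0 -> off J -> chi (weyl_pt w l) = (w \in H).
Proof.
move=> lJ JD; apply/asboolP/idP => [[w' [l' [J' [wH e l'J' J'D]]]]|wH]; last by exists w, l, J.
have el : set_val l J' = set_val l' J' by rewrite -(pl_weyl_pt w) e pl_weyl_pt.
have ez := pz_weyl_pt w l J'.
move: ez; rewrite e pz_weyl_pt el => /(scalerI l'J') /act_eq h.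
have := subsetP (parabolic_sub J'D) _ h; by rewrite groupMl ?groupV.
Qed.

Let kap : R := (4 * p.+1%:R)^-1.
Let eta : R := (2 * #|D|.+1%:R)^-1.
Let kap0 : 0 < kap. Proof. by rewrite invr_gt0. Qed.
Let eta0 : 0 < eta. Proof. by rewrite invr_gt0. Qed.

(** The bound [eta] leaves at most one half of the weight to the faces meeting [D], and faces of
    weight below [kap] together carry at most a quarter; so some face off [D] has weight at least
    [kap]. *)
Lemma big_weight w l : (forall c, c \in D -> lam c (weyl_pt w l) <= eta) ->
  exists2 J, kap <= set_val l J & off J.
Proof.
move=> hl; apply: contrapT => no; have := l_sum l.
rewrite (bigID (fun J : P => off J)) /=.
have h1 : \sum_(J : P | off J) set_val l J <= 1 / 4.
  apply: (@le_trans _ _ (\sum_(J : P) kap)).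
    rewrite big_mkcond; apply: ler_sum => J _; case: ifP => JD; last exact: ltW.
    by rewrite leNgt; apply/negP => h; apply: no; exists J => //; exact: ltW.
  by rewrite mul1r; have := @sumr_inv_le R P P 4 _; apply.
have h2 : \sum_(J : P | ~~ off J) set_val l J <= 1 / 2.
  apply: (@le_trans _ _ (\sum_(c in D) lam c (weyl_pt w l))).
    rewrite (eq_bigr _ (fun c _ => lam_weyl_pt c w l)).
    rewrite (exchange_big_dep predT) //= big_mkcond; apply: ler_sum => J _.
    case: ifP => [|_]; last by apply: sumr_ge0.
    move=> /pred0Pn[c /= /andP[cJ cD]].
    by rewrite (bigD1 c) ?cD//= lerDl; apply: sumr_ge0.
  apply: (@le_trans _ _ (\sum_(c in D) eta)); first exact: ler_sum.
  by rewrite mul1r; have := @sumr_inv_le R W (mem D) 2 _; apply.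
move=> e; lra.
Qed.

Lemma rho_sep : exists2 d, 0 < d & forall w w' J, act w (rho J) <> act w' (rho J) ->
  d <= `|act w (rho J) - act w' (rho J)|.
Proof.
have [|d d0 dP] := @small_family R (W * W * P)%type (fun i s =>
   act i.1.1 (rho i.2) <> act i.1.2 (rho i.2) -> s <= `|act i.1.1 (rho i.2) - act i.1.2 (rho i.2)|).
  move=> [[w w'] J] /=; case: (pselect (act w (rho J) = act w' (rho J))) => [e|ne].
    by exists 1 => // s _.
  exists `|act w (rho J) - act w' (rho J)| => //.
  by rewrite normr_gt0 subr_eq0; apply/eqP.
by exists d => // w w' J; exact: (dP (w, w', J)).
Qed.

(** A face off [D] of weight at least [kap] keeps positive weight at the nearby point, and its two
    vectors are closer than the finitely many distinct translates can be; hence they coincide and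
    both group elements have the same class. *)
Lemma chi_near : exists2 d, 0 < d & forall w l w' l', `|weyl_pt w l - weyl_pt w' l'| < d ->
  (forall c, c \in D -> lam c (weyl_pt w l) <= eta) -> chi (weyl_pt w l) = chi (weyl_pt w' l').
Proof.
have [de de0 deP] := rho_sep.
pose M := \sum_(i : W * P) `|act i.1 (rho i.2)|.
have M0 : 0 <= M by apply: sumr_ge0.
have MP w J : `|act w (rho J)| <= M.
  by rewrite /M (bigD1 (w, J))//= lerDl; apply: sumr_ge0.
(* The first bound keeps the weight at the second point positive. The second makes [d * (1 + M)],
   the error in the weighted vectors, smaller than the weighted separation [kap * de]. *)
clearbody M; pose d := Num.min (kap / 2) (kap * de / (2 * (1 + M))).
have d0 : 0 < d.
  have k0 := kap0; have := mulr_gt0 kap0 de0; move: (kap * de) => kd kd0.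
  by rewrite lt_min !divr_gt0// mulr_gt0// ltr_pwDl.
have d1 : d <= kap / 2 by rewrite ge_min lexx.
have d2 : d * (1 + M) <= kap * de / 2.
  have : d <= kap * de / (2 * (1 + M)) by rewrite ge_min lexx orbT.
  have M1 : 0 < 1 + M by rewrite ltr_pwDl.
  by rewrite invfM mulrA ler_pdivlMr.
exists d => // w l w' l' lt hl; have [J lJ JD] := big_weight hl.
have hpl : `|set_val l J - set_val l' J| <= d.
  apply: ltW; apply: le_lt_trans lt; rewrite -(pl_weyl_pt w l J) -(pl_weyl_pt w' l' J) -plB.
  exact: pl_norm.
have hpz : `|set_val l J *: act w (rho J) - set_val l' J *: act w' (rho J)| <= d.
  by apply: ltW; apply: le_lt_trans lt; rewrite -!pz_weyl_pt -pzB; exact: pz_norm.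
have k0 := kap0.
have l'J : 0 < set_val l' J.
  move: hpl lJ d1 k0; move: (set_val l J) (set_val l' J) => u v; rewrite ler_norml => /andP[]; lra.
have e : act w (rho J) = act w' (rho J).
  apply: contrapT => /deP; move: (act w (rho J)) (act w' (rho J)) (MP w' J) hpz => A A' MA' hpz dA.
  have id : set_val l J *: (A - A') = (set_val l J *: A - set_val l' J *: A') - (set_val l J - set_val l' J) *: A'.
    by rewrite scalerBr scalerBl opprB addrA subrK.
  have h1 : kap * de <= `|set_val l J *: (A - A')|.
    by rewrite normrZ ger0_norm//; apply: ler_pM => //; exact: ltW.
  have h2 : `|set_val l J *: (A - A')| <= d + d * M.
    rewrite id; apply: le_trans (ler_normB _ _) _; apply: lerD => //; rewrite normrZ.
    by apply: ler_pM.
  have := mulr_gt0 k0 de0; move: h1 h2 d2; move: (kap * de) => kd; lra.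
have lJ0 : set_val l J != 0 by rewrite gt_eqF// (lt_le_trans k0).
rewrite (chi_weyl_pt w lJ0 JD) (chi_weyl_pt w' _ JD); last by rewrite gt_eqF.
have := subsetP (parabolic_sub JD) _ (act_eq e) => h.
by apply/idP/idP => wH; [rewrite -(mulKVg w w') groupM | move: h; rewrite groupMr// groupV].
Qed.

(** Reading [chi] at the first vertex is enough, since it is constant on small tuples that carry all
    labels. *)
Definition phi_lab (s : seq V0) : bool := perm_eq (map lab s) (enum D) && chi (head 0 s).

Let F_lab x : F x -> lab x \in D. Proof. by move=> [w [l ->]]; have [] := labP w l. Qed.

(* A small tuple carrying every label of [D] is near the points with [lam c = 0] for all [c] in [D],
   where [chi] is locally constant. *)
Lemma lam_small : exists2 d, 0 < d & forall s, small F d s -> (forall c, c \in D -> c \in map lab s) ->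
  forall x c, x \in s -> c \in D -> lam c x <= eta.
Proof.
exists (eta / p.+1%:R); first by rewrite divr_gt0.
move=> s [sF sd] sD x c xs cD; have /mapP[y ys cy] := sD c cD.
have [w [l ey]] := sF y ys; have [_ ly] := labP w l; rewrite -ey -cy in ly.
have := lam_lip c x y; rewrite ly subr0 => h; apply: le_trans (ler_norm _) (le_trans h _).
have hz := ltW (sd x y xs ys); have z0 := normr_ge0 (x - y); move: `|x - y| hz z0 => z hz z0.
apply: (@le_trans _ _ (p.+1%:R * (eta / p.+1%:R))); last by rewrite mulrC divfK.
by apply: ler_pM => //; rewrite ler_nat.
Qed.

(** If some label is missing from the tuple, every face gives zero. Otherwise [chi] is constant on
    the tuple and factors out, leaving the coboundary of the label indicator. *)
Lemma phi_lab_cocycle : near_diag F (fun s => cob phi_lab s = false).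
Proof.
have [d1 d10 h1] := lam_small; have [d2 d20 h2] := chi_near.
exists (Num.min d1 d2); first by rewrite lt_min d10.
move=> s sm; have s1 : small F d1 s by apply: small_le sm; rewrite ge_min lexx.
have s2 : small F d2 s by apply: small_le sm; rewrite ge_min lexx orbT.
have [sD|] := boolP [forall c in D, c \in map lab s]; last first.
  move=> /forall_inPn[c cD cs]; rewrite -[RHS](cob_false s); apply: eq_in_cob => t ts.
  rewrite /phi_lab; apply/negbTE; apply: contra cs => /andP[/perm_mem e _].
  have : c \in map lab t by rewrite e mem_enum.
  by move=> /mapP[x /ts xs ->]; exact: map_f.
have {}sD c : c \in D -> c \in map lab s by move=> cD; exact: (forall_inP sD).
have chiE x y : x \in s -> y \in s -> chi x = chi y.
  move=> xs ys; have [w [l ex]] := s1.1 x xs; have [w' [l' ey]] := s1.1 y ys.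
  rewrite ex ey; apply: h2; first by rewrite -ex -ey; exact: s2.2.
  by move=> c cD; rewrite -ex; exact: (h1 s s1 sD).
rewrite (@eq_in_cob _ _ (fun t => chi (head 0 s) && perm_eq (map lab t) (enum D))); last first.
  move=> [|x t] ts; rewrite /phi_lab /=.
    have -> : perm_eq [::] (enum D) = false.
      by apply/negbTE; apply: contra D_neq0 => /perm_size /= e; rewrite -cards_eq0 cardE -e.
    by rewrite andbF.
  rewrite andbC; congr (_ && _); apply: chiE; first by apply: ts; rewrite mem_head.
  case: s ts {sm s1 s2 sD} => [/(_ x)|y s _ ]; first by rewrite mem_head => /(_ isT).
  exact: mem_head.
rewrite cob_and (cob_map lab (fun u => perm_eq u (enum D))).
(* The extra label needed for the count is [1]; labels lie in [D], so no tuple is labelled by [1]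
   together with all of [D]. *)
rewrite (@cob_perm _ (enum D) _ 1%g) ?enum_uniq ?mem_enum//.
- rewrite andbC; case: (boolP (perm_eq _ _)) => // /perm_mem /(_ 1%g); rewrite mem_head.
  by move=> /mapP[x xs e]; have := F_lab (s1.1 x xs); rewrite -e => /D1; rewrite eqxx.
- by apply/negP => /D1; rewrite eqxx.
- by move=> c /mapP[x xs ->]; rewrite inE mem_enum F_lab ?orbT//; exact: s1.1.
Qed.

Definition chamber : set V0 := [set y | exists l, y = weyl_pt 1%g l].
Definition wall (c : W) : set V0 := [set y | lam c y = 1].

Let chF : chamber `<=` F. Proof. by move=> y [l ->]; exists 1%g, l. Qed.

Lemma wall_fix v c y : chamber y -> c \in D -> wall c y -> tau (r (v * c)%g) y = tau (r v) y.
Proof.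
move=> [l ->] cD /lam1P h; rewrite !tau_weyl_pt !mulg1.
apply: model_eq => J; first by rewrite !pl_weyl_pt.
rewrite !pz_weyl_pt; have [->|lJ] := eqVneq (set_val l J) 0; first by rewrite !scale0r.
by rewrite (actM v c (trho J)) (act_rho (IS J) (h J lJ)).
Qed.

Lemma tau_small e : 0 < e -> exists2 d, 0 < d & forall v s, small chamber d s -> small F e (map (tau (r v)) s).
Proof.
move=> e0; have [|d d0 dP] := @small_family R W (fun v d => forall x y : V0, `|x - y| < d -> `|tau (r v) x - tau (r v) y| < e).
  move=> v; have [L L1 tL] := tau_lip P (r v); have L0 : 0 < L by exact: lt_le_trans L1.
  exists (e / L); first by rewrite divr_gt0.
  move=> s se x y xy; apply: le_lt_trans (tL x y) _.
  by rewrite mulrC -ltr_pdivlMr//; exact: lt_le_trans se.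
exists d => // v s [sC sd]; split=> [_ /mapP[x xs ->]|_ _ /mapP[x xs ->] /mapP[y ys ->]].
  by have [l ->] := sC x xs; exists (v * 1)%g, l; rewrite tau_weyl_pt.
by apply: dP; exact: sd.
Qed.

(* The faces of the chamber are star-shaped: the centre is the vertex indexed by the face of [K]
   consisting of the walls containing it. *)
Lemma face_acyclic (B : seq W) : B != [::] -> {subset B <= enum D} ->
  acyclic (wall_face chamber wall (enum D) B).
Proof.
move=> B0 BD; pose E := [set c in D | c \notin B].
have EK : E \in K.
  apply: Dmin; apply/fintype.properP; split; first by apply/subsetP => c; rewrite inE => /andP[].
  case: B B0 BD @E => // b B _ BD E; exists b; first by rewrite -mem_enum; apply: BD; rewrite mem_head.
  by rewrite inE mem_head andbF.
pose EP : P := exist _ E EK.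
have nE : nerve_above leP f0 (fun J => (J == EP)%:R : R) by apply: nerve_vertex; exact: sub0set.
pose lE : L0 := SigSub (mem_set nE); pose x0 := weyl_pt 1%g lE.
have fE l : wall_face chamber wall (enum D) B (weyl_pt 1%g l) -> forall J, set_val l J != 0 -> E \subset val J.
  move=> [_ h] J lJ; apply/subsetP => c; rewrite inE => /andP[cD cB].
  have hc : lam c (weyl_pt 1%g l) = 1 by apply: h; rewrite ?mem_enum.
  exact: ((lam1P c 1%g l).1 hc J lJ).
have lEE J : set_val lE J = (J == EP)%:R by [].
have x0f : wall_face chamber wall (enum D) B x0.
  split; first by exists lE.
  move=> c; rewrite mem_enum => cD cB; apply/lam1P => J; rewrite lEE.
  by case: (eqVneq J EP) => [-> _|_ /eqP//]; rewrite inE cD.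
pose M := 1 + \sum_(J : P) `|rho J|.
have M1 : 1 <= M by rewrite lerDl; apply: sumr_ge0.
have Cb x : chamber x -> `|x| <= M.
  have l1 l J : `|set_val l J| <= 1.
    by rewrite ger0_norm// -(l_sum l) (bigD1 J)//= lerDl; apply: sumr_ge0.
  move=> [l ->]; apply: model_norm => [|J|J]; first exact: le_trans M1.
    by rewrite pl_weyl_pt; exact: le_trans (l1 l J) M1.
  rewrite pz_weyl_pt normrZ (act1 (trho J)).
  apply: (@le_trans _ _ (1 * `|rho J|)); first by rewrite ler_wpM2r.
  by rewrite mul1r /M (bigD1 J)//= addrCA lerDl; apply: addr_ge0 => //; apply: sumr_ge0.
apply: (@contractible_acyclic _ _ _ (fun x t => x + t *: (x0 - x)) x0) => //.
- move=> x t [[l ex] hx] /andP[t0 t1].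
  pose m : {ptws P -> R} := fun J => (1 - t) * set_val l J + t * (J == EP)%:R.
  have lE0 : forall J, set_val l J != 0 -> E \subset val J by apply: fE; rewrite -ex; split=> //; exists l.
  have nm : nerve_above leP f0 m.
    apply: nerve_join => [||J lJ]; [exact: sub0set|by rewrite t0|by rewrite /= (lE0 J lJ)].
  pose lm : L0 := SigSub (mem_set nm).
  have -> : x + t *: (x0 - x) = weyl_pt 1%g lm.
    have lmE J : set_val lm J = m J by [].
    rewrite ex; apply: model_eq => J.
      have plD (y y' : V0) : pl (y + t *: (y' - y)) J = pl y J + t * (pl y' J - pl y J) by rewrite /pl !mxE.
      rewrite plD !pl_weyl_pt lmE /m; ring.
    have pzD (y y' : V0) : pz (y + t *: (y' - y)) J = pz y J + t *: (pz y' J - pz y J).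
      by apply/rowP => i; rewrite !mxE.
    rewrite pzD !pz_weyl_pt -scalerBl scalerA -scalerDl; congr (_ *: _).
    by rewrite lmE /m; ring.
  split; first by exists lm.
  move=> c; rewrite mem_enum => cD cB; apply/lam1P => J; change (m J != 0 -> c \in val J); rewrite /m.
  case: (eqVneq J EP) => [-> _|_]; first by rewrite inE cD.
  rewrite mulr0 addr0 mulf_eq0 negb_or => /andP[_ lJ].
  have hc : lam c (weyl_pt 1%g l) = 1 by rewrite -ex; apply: hx; rewrite ?mem_enum.
  exact: ((lam1P c 1%g l).1 hc J lJ).
- move=> e e0; pose d := e / (2 * (2 + 2 * M)).
  have M2 : 0 < 2 + 2 * M by have := M1; lra.
  have d0 : 0 < d by rewrite divr_gt0// mulr_gt0.
  exists d => // x y t u [Cx _] [Cy _] /andP[t0 t1] /andP[u0 u1] xy tu.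
  have e1 : x + t *: (x0 - x) - (y + u *: (x0 - y)) = (1 - t) *: (x - y) + (t - u) *: (x0 - y).
    by rewrite !scalerBr !scalerBl !scale1r; apply/rowP => i; rewrite !mxE; ring.
  rewrite e1; apply: le_lt_trans (ler_normD _ _) _; rewrite !normrZ.
  have h1 : `|1 - t| * `|x - y| <= d.
    rewrite -[d]mul1r; apply: ler_pM => //; last exact: ltW.
    by rewrite ger0_norm; lra.
  have h2 : `|t - u| * `|x0 - y| <= d * (2 * M).
    apply: ler_pM => //; first exact: ltW.
    by apply: le_trans (ler_normB _ _) _; have := Cb _ x0f.1; have := Cb _ Cy; lra.
  have h3 : d * (2 + 2 * M) = e / 2.
    by rewrite /d invfM mulrA divfK ?gt_eqF.
  move: h1 h2 h3 d0; move: (`|1 - t| * `|x - y|) (`|t - u| * `|x0 - y|) => z1 z2; nra.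
- by move=> x _; rewrite scale0r addr0.
- by move=> x _; rewrite scale1r addrC subrK.
Qed.

(** A primitive [psi] is pulled back to the chamber along all elements of the parabolic subgroup of
    [D] and summed. Only the identity also lies in [H], so the coboundary of the sum is the label
    indicator. On the wall of [c] the terms of [v] and [v * c] agree and cancel modulo 2, so the sum
    vanishes on every wall, against the Sperner argument. *)
Lemma weyl_complex_not_acyclic : acyclic F -> False.
Proof.
move=> acF; have [psi hpsi] := acF phi_lab phi_lab_cocycle.
have [e e0 eP] := hpsi; have [d1 d10 d1P] := tau_small e0; have [d2 d20 d2P] := lam_small.
pose psi' s := \big[addb/false]_(v in <<D>>%g) psi (map (tau (r v)) s).
apply: (@label_not_coboundary R _ W chamber wall (enum D) lab _ _ face_acyclic (enum D) psi').
- by move=> x /chF Fx; rewrite mem_enum; exact: F_lab.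
- move=> c x [l ->] wc; have [_ h] := labP 1%g l; apply/eqP => ec; move: wc; rewrite /wall /= -ec h.
  by move/esym/eqP; rewrite oner_eq0.
- exact: enum_uniq.
- by [].
- exists (Num.min d1 d2); first by rewrite lt_min d10.
  move=> s [sC' sd]; have sm : small chamber (Num.min d1 d2) s by split=> // x /sC'[].
  have s1 : small chamber d1 s by apply: small_le sm; rewrite ge_min lexx.
  have s2 : small F d2 s.
    have : small chamber d2 s by apply: small_le sm; rewrite ge_min lexx orbT.
    by move=> [h h']; split=> // x /h /chF.
  rewrite cob_big; under eq_bigr => v _ do rewrite (cob_map (tau (r v)) psi) -(eP _ (d1P v s s1)) /phi_lab.
  have labE v : map lab (map (tau (r v)) s) = map lab s.
    by rewrite -map_comp; apply: eq_map => x /=; rewrite lab_tau.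
  under eq_bigr => v _ do rewrite labE.
  have [pe|] := boolP (perm_eq (map lab s) (enum D)); last by move=> _; rewrite big1.
  have sD c : c \in D -> c \in map lab s by move=> cD; rewrite (perm_mem pe) mem_enum.
  case: s sC' sd sm s1 s2 labE pe sD => [|x s] sC' sd sm s1 s2 labE pe sD.
    by exfalso; have := perm_size pe; move/esym/eqP; rewrite size_eq0 => /eqP en; move: D_neq0; rewrite -cards_eq0 cardE en.
  have [l ex] := s1.1 x (mem_head _ _).
  have [J lJ JD] : exists2 J, kap <= set_val l J & off J.
    by apply: (@big_weight 1%g) => c cD; rewrite -ex; apply: (d2P (x :: s)) => //; exact: mem_head.
  have lJ0 : set_val l J != 0 by rewrite gt_eqF// (lt_le_trans kap0).
  rewrite (bigD1 1%g) ?group1//= big1 => [|v /andP[vD v1]].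
    by rewrite ex tau_weyl_pt mulg1 (chi_weyl_pt _ lJ0 JD) group1.
  rewrite ex tau_weyl_pt mulg1 (chi_weyl_pt _ lJ0 JD); apply/negbTE; apply: contra v1 => vH.
  by apply/eqP; exact: (parabolic_disjoint DS vD vH).
- move=> c; rewrite mem_enum => cD; exists 1 => // s [sC _].
  apply: (@big_addb_pair _ _ c); [exact: mem_gen | apply: (ss1 invS); exact: (subsetP DS) | exact: D1 |].
  move=> v vD; congr (psi _); apply/eq_in_map => x /sC[Cx h]; apply: wall_fix => //.
  by apply: h; rewrite ?mem_enum// mem_rem_uniq ?enum_uniq// inE eqxx.
Qed.
End Contradiction.

(** * Contractibility for the full simplex *)

Section FullComplex.
Local Notation X := (parabolic_hocolim T a K).
Hypothesis KE : K = finset.powerset S.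

Lemma top_face_mem : S \in K. Proof. by rewrite KE finset.powersetE fintype.subxx. Qed.

Definition top_face : P := exist _ S top_face_mem.

Lemma top_faceP (I : P) : val I \subset val top_face.
Proof. have : val I \in finset.powerset S by rewrite -KE; exact: valP.
by rewrite finset.powersetE. Qed.

Lemma join_nerve (I : P) (l : nerve I) (u : R) :
  nerve_above leP I (fun J => (1 - clip u) * set_val l J + clip u * (J == top_face)%:R).
Proof.
by apply: nerve_join => [||J _]; [exact: top_faceP | exact: clip_itv | apply/orP; right; exact: top_faceP].
Qed.

(** The straight path of weights towards the top vertex, which is comparable with every face;
    clipping the time makes it available for all real times. *)
Definition join (I : P) (l : nerve I) (t : R) : nerve I := SigSub (mem_set (join_nerve l t)).

Lemma joinE I (l : nerve I) t J :
  set_val (join l t) J = (1 - clip t) * set_val l J + clip t * (J == top_face)%:R.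
Proof. by []. Qed.

Lemma join_continuous I : continuous (fun z : nerve I * R => join z.1 z.2).
Proof.
apply: continuous_into_set_type; apply: (@continuous_into_prod _ P (fun=> R)) => J z.
have cc : continuous (fun z : nerve I * R => clip z.2) := cont_comp (@cont_snd _ _) (@clip_continuous R).
have cs : continuous (fun z : nerve I * R => set_val z.1 J).
  exact: (cont_comp (@cont_fst (nerve I) R) (@set_val_coord_continuous I J)).
apply: cvgD; apply: cvgM.
- by apply: cvgB; [exact: cvg_cst | exact: cc].
- exact: cs.
- exact: cc.
- exact: cvg_cst.
Qed.

Definition join_pre (p : hpre) (t : R) : hpre := let: existT J ul := p in hpt (I := J) ul.1 (join ul.2 t).

Lemma join_hpi p q t : hpi p = hpi q -> hpi (join_pre p t) = hpi (join_pre q t).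
Proof.
move/hpiP; elim=> {p q} [p q h|//|p q _ -> //|p q s _ -> _ ->//].
case: h => I J u l m IJ lm.
change (hpi (hpt u (join l t)) = hpi (hpt (flag_proj J u) (join m t))).
have := cpi_repr u; move: (repr u) => x <-.
rewrite (flag_proj_cpi x IJ); apply: hpi_step => //; apply/funext => J'.
by rewrite !joinE lm.
Qed.

Definition shrink (z : X * R) : X := hpi (join_pre (repr z.1) z.2).

Lemma shrink_continuous : continuous shrink.
Proof.
apply: quotient_prod_continuous.
have -> : (fun z : hpre * R => shrink (hpi z.1, z.2)) = (fun z => hpi (join_pre z.1 z.2)).
  by apply/funext => z; apply: join_hpi; rewrite hpi_repr.
apply: continuous_sum_prod => I.
apply: (@cont_comp _ _ _ (fun z => hpt (I := I) z.1.1 (join z.1.2 z.2)) hpi); last exact: hpi_continuous.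
apply: hpt_continuous; first exact: (cont_comp (@cont_fst _ _) (@cont_fst _ _)).
apply: (@cont_comp _ _ _ (fun z => (z.1.2, z.2)) (fun z => join z.1 z.2)); last exact: join_continuous.
by apply: cont_pair; [exact: (cont_comp (@cont_fst _ _) (@cont_snd _ _)) | exact: cont_snd].
Qed.

Let top_nerve := nerve_vertex (fintype.subxx (val top_face)).

Definition top_point (g : G) : X := hpi (hpt (cpi top_face g) (SigSub (mem_set top_nerve))).

Lemma top_point_indist g h : indist (top_point g) (top_point h).
Proof.
have := @closure_coset_indist R G (standard_subgroup T a S) X top_point g (g^-1 * h)%g.
rewrite mulKVg; apply.
- exact: standard_is_subgroup.
- apply: (@cont_comp _ _ _ (fun x => hpt (cpi top_face x) (SigSub (mem_set top_nerve))) hpi).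
    by apply: hpt_continuous; [exact: cpi_continuous | exact: cont_cst].
  exact: hpi_continuous.
- by move=> x k kS; rewrite /top_point cpi_mulr.
- exact: standard_dense.
Qed.

Lemma shrink1 x : exists g, shrink (x, 1) = top_point g.
Proof.
rewrite /shrink /=; case: (repr x) => I [u l]; exists (repr u).
change (hpi (hpt u (join l 1)) = top_point (repr u)).
rewrite -{1}(cpi_repr u); apply: hpi_step; first exact: top_faceP.
by apply/funext => J; rewrite joinE clip_id ?lexx ?ler01// subrr mul0r add0r mul1r.
Qed.

(** At time [1] the deformation ends in cosets of [G_S], which are mutually indistinguishable by
    density but possibly distinct. The final stage is therefore redefined to be one point, at no
    cost to continuity. *)
Lemma full_contractible : contractible R X.
Proof.
pose h (z : X * R) := if z.2 == 1 then top_point 1%g else shrink z.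
exists (top_point 1%g), h; split=> [|x|x]; last by rewrite /h eqxx.
  apply: continuous_subspaceT; apply: (indist_continuous shrink_continuous) => z.
  rewrite /h; have [z1|_] := eqVneq z.2 1; last by move=> U _.
  by have [g] := shrink1 z.1; rewrite -z1 -surjective_pairing => ->; exact: top_point_indist.
rewrite /h /= eq_sym oner_eq0 /shrink /= -[RHS]hpi_repr.
case: (repr x) => I [u l].
change (hpi (hpt u (join l 0)) = hpi (hpt u l)); congr (hpi (hpt u _)).
apply: val_inj; apply/funext => J.
change (set_val (join l 0) J = set_val l J).
by rewrite joinE clip_id ?lexx ?ler01// subr0 mul1r mul0r addr0.
Qed.
End FullComplex.

End WeylGroup.

Theorem corollary7p3 (W : finGroupType) (S : {set W}) (K : {set {set W}})
    (coxS : coxeter_system S) (cplxK : simplicial_complex S K) :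
  [/\ forall (D : {set W}) (wD : W), D \subset S -> longest_in S D wD ->
        forall j : int,
          direct_summand (reduced_homology (induced_subcomplex K D) j)
            (homology (bar_complex S K) ((2 * len S wD)%N%:Z + j + 1)%R),
      (forall n : int, torsion_free (homology (bar_complex S K) n)) <->
      (forall D : {set W}, D \subset S -> forall j : int,
         torsion_free (reduced_homology (induced_subcomplex K D) j)) &
      forall (R : realType) (G : lie_group R) (T : set G)
        (a : W -> G -> R[i]) (r : W -> G),
        compact [set: G]%classic -> connected [set: G]%classic ->
        simply_connected R G -> semisimple G ->
        is_weyl_system S T a r ->
        (forall s : W, s \in S -> [set s]%SET \in K) ->
        contractible R (parabolic_hocolim T a K) <-> K = finset.powerset S].
Proof.
split.
- by move=> D wD DS hD j; exact: reduced_homology_summand.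
- exact: bar_torsion_free.
move=> R G T a r cG con _ _ wey _; split=> [ctr|KE]; last exact: (full_contractible cG con coxS wey KE).
have [_ KS down] := cplxK; apply/eqP; rewrite finset.eqEsubset KS /=; apply: contraT => no.
have [D0 D0S D0K] := fintype.subsetPn no.
have D00 : (D0 \subset S) && (D0 \notin K) by rewrite -finset.powersetE D0S D0K.
(* A nonface inside [S] of least cardinality has all its proper subsets in [K], which is the form
   the chamber argument requires. *)
case: (@arg_minnP _ D0 (fun D : {set W} => (D \subset S) && (D \notin K)) (fun D : {set W} => #|D|) D00).
move=> D /andP[DS DK] Dmin; exfalso.
have Dproper (D' : {set W}) : D' \proper D -> D' \in K.
  move=> D'D; apply: contraT => nK; have := Dmin D'.
  rewrite nK (fintype.subset_trans (fintype.proper_sub D'D) DS) => /(_ isT).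
  by rewrite leqNgt proper_card.
have ac := @weyl_acyclic R G cG con W S T a r coxS wey K cplxK ctr.
exact: (weyl_complex_not_acyclic con coxS wey DS DK Dproper ac).
Qed.
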